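(* Let $\mathcal J:D[0,1]\times D[0,1]\to\mathbb R$ be a functional that is continuous on the closed subset $C[0,1]\times\overline{\{\mathcal V^\theta:\theta\in\Theta_0\}}$ (that is, continuous at every point of this subset) with respect to the uniform topology, i.e. the topology generated by the norm $\|(f_1,f_2)\|=\max\{\|f_1\|_\infty,\|f_2\|_\infty\}$. Define $$\hat D_n^\theta=\mathcal J\big(\sqrt{|J_n|}\,\hat\gamma^{(n),\theta},\ \hat{\mathcal V}_n^\theta\big).$$ Assume the following. (Boundedness) There exist constants $C,C'>0$ such that for every $\theta\in\Theta$: the $\mathcal G_t^\theta$-intensity $\boldsymbol\lambda^\theta$ of $N^\theta$ is càglàd with $\sup_{0\le t\le 1}\boldsymbol\lambda_t^\theta\le C$ almost surely; the residual process $G^\theta$ is càglàd with $\sup_{0\le t\le 1}|G_t^\theta|\le C'$ almost surely; and the estimators satisfy the same bounds, $\sup_t|\hat\lambda_t^{(n),\theta}|\le C$ and $\sup_t|\hat G_t^{(n),\theta}|\le C'$ almost surely. (Rates) $|J_n|\to\infty$ as $n\to\infty$, and with $g^\theta(n)=\||G^\theta-\hat G^{(n),\theta}\||_2$ and $h^\theta(n)=\||\lambda^\theta-\hat\lambda^{(n),\theta}\||_2$, $$\lim_{n\to\infty}\sup_{\theta\in\Theta}\max\{g^\theta(n),\,h^\theta(n),\,\sqrt{|J_n|}\,g^\theta(n)h^\theta(n)\}=0 .$$ Then $\hat D_n^\theta\xrightarrow{\mathcal D/\Theta_0}\mathcal J(U^\theta,\mathcal V^\theta)$ as $n\to\infty$,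 where $U^\theta$ is a mean zero continuous Gaussian martingale on $[0,1]$ with variance function $\mathcal V^\theta$.
   Context: Setting. $\Theta$ is an arbitrary set indexing sampling distributions; every object below depends on $\theta\in\Theta$, with the superscript $\theta$ often suppressed. Time is $[0,1]$. $N$ is a counting process adapted to a right-continuous complete filtration $\mathcal F_t$; $X$ is a real-valued càglàd process; $\mathcal G_t$ is the right-continuous complete filtration generated by $\mathcal F_t$ and $X_t$. $N$ has an $\mathcal F_t$-intensity $\lambda$ (i.e. $\lambda$ is $\mathcal F_t$-predictable and $M_t=N_t-\int_0^t\lambda_s\,ds$ is a local $\mathcal F_t$-martingale) and a $\mathcal G_t$-intensity $\boldsymbol\lambda$. The hypothesis $H_0$ (conditional local independence of $N$ from $X$ given $\mathcal F_t$) is: $M$ is also a local $\mathcal G_t$-martingale. $\Theta_0=\{\theta\in\Theta: H_0\text{ is valid}\}$. A residual process $G$ of $X$ given $\mathcal F_t$ is a càglàd $\mathcal G_t$-adapted process with $E(G_t\mid\mathcal F_{t-})=0$ for all $t\in[0,1]$; one is fixed for each $\theta$. The variance function is $\mathcal V(t)=E\int_0^tG_s^2\,dN_s$. Data and estimators. $(N_j,X_j,\mathcal F_j)$, $j=1,\dots,n$, are i.i.d. replications of $(N,X,\mathcal F)$. $J_n\cup J_n^c=\{1,\dots,n\}$ is a partition into two disjoint sets. The estimates $\hat\lambda^{(n)}$ and $\hat G^{(n)}$ are fitted on data indexed by $J_n^c$ only; given those data they are fixed maps, evaluated on the $\mathcal F$-history resp. $\mathcal G$-history of a new observation, yielding (conditionally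 on the training data) an $\mathcal F_t$-predictable process resp. a $\mathcal G_t$-predictable process. $\hat\lambda_j^{(n)},\hat G_j^{(n)}$ are their evaluations on observation $j\in J_n$; $\hat\lambda_t^{(n)},\hat G_t^{(n)}$ are their evaluations on one additional copy $(N,X,\mathcal F)$ independent of the data. With $\hat M_{j,t}^{(n)}=N_{j,t}-\int_0^t\hat\lambda_{j,s}^{(n)}ds$, set $$\hat\gamma_t^{(n)}=\frac1{|J_n|}\sum_{j\in J_n}\int_0^t\hat G_{j,s}^{(n)}\,d\hat M_{j,s}^{(n)},\qquad \hat{\mathcal V}_n(t)=\frac1{|J_n|}\sum_{j\in J_n}\int_0^t(\hat G_{j,s}^{(n)})^2\,dN_{j,s}.$$ For a process $W$ on $[0,1]$, $\||W\||_2^2=E\int_0^1W_s^2\,ds$. $D[0,1]$ is the space of càdlàg functions $[0,1]\to\mathbb R$, $C[0,1]$ the continuous ones, and closures are in the supremum norm $\|\cdot\|_\infty$. Uniform convergence. For real random variables, $Y_n^\theta\xrightarrow{\mathcal D/\Theta_0}Y^\theta$ means $\sup_{\theta\in\Theta_0}\sup_f|E f(Y_n^\theta)-E f(Y^\theta)|\to0$, the inner supremum over $f:\mathbb R\to\mathbb R$ with $\|f\|_\infty\le1$ and Lipschitz constant at most $1$. The test statistics $\hat D_n^\theta$ and $\mathcal J(U^\theta,\mathcal V^\theta)$ are understood to be random variables. *)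

(* Defs.v *)
From HB Require Import structures.
From mathcomp Require Import all_boot all_order all_algebra.
From mathcomp Require Import all_classical all_reals all_analysis.

Set Implicit Arguments.
Unset Strict Implicit.
Unset Printing Implicit Defensive.

Import Order.TTheory GRing.Theory Num.Theory.
Import numFieldNormedType.Exports.

Local Open Scope classical_set_scope.
Local Open Scope ring_scope.

(* Processes are indexed by R, but only times in [0, 1] are ever constrained
   or used. A process is written H : R -> S -> R, with H t y its value at time
   t and outcome y. *)

Section paths.
Context {R : realType}.
Implicit Types f : R -> R.

Definition caglad f :=
  (forall t, t \in `]0, 1] -> f s @[s --> t^'-] --> f t) /\
  (forall t, t \in `[0, 1[ -> cvg (f s @[s --> t^'+])).

Definition cadlag f :=
  (forall t, t \in `[0, 1[ -> f s @[s --> t^'+] --> f t) /\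
  (forall t, t \in `]0, 1] -> cvg (f s @[s --> t^'-])).

(* Monotonicity and right-continuity are carried by the type. *)
Definition counting_path (f : cumulative R R) :=
  [/\ f 0 = 0,
      forall t, t \in `[0, 1] -> f t \is a Num.nat
    & forall t, t \in `]0, 1] -> f t - lim (f s @[s --> t^'-]) <= 1].

(* int_(0,t] h dN, for a single path of N *)
Definition int_dN (N : cumulative R R) (h : R -> R) (t : R) : R :=
  \int[lebesgue_stieltjes_measure N]_(s in `]0, t]) h s.

Definition int_ds (h : R -> R) (t : R) : R :=
  \int[lebesgue_measure]_(s in `[0, t]) h s.

(* int_(0,t] h d(N - int_0^. l ds), for a single path *)
Definition int_dM (N : cumulative R R) (l h : R -> R) (t : R) : R :=
  int_dN N h t - int_ds (fun s => h s * l s) t.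

Definition unitI : Type := `[(0 : R), 1]%classic.

Definition res01 f : {uniform unitI -> R} := f \o set_val.

Definition D01 : set {uniform unitI -> R} := res01 @` cadlag.

Definition C01 : set {uniform unitI -> R} :=
  res01 @` [set f : R -> R | {within `[(0:R), 1], continuous f}].

End paths.

Section processes.
Context {R : realType} {d : measure_display} {S : measurableType d}.
Variable Q : probability S R.
Implicit Types (F : R -> set (set S)) (H : R -> S -> R) (Z : S -> R).

Definition measurable_wrt (A : set (set S)) Z :=
  forall B : set R, measurable B -> A (Z @^-1` B).

Definition adapted F H := forall t, t \in `[0, 1] -> measurable_wrt (F t) (H t).

(* [usual_right] is vacuous at the terminal time 1. Since Q.-negligible sets
   are arbitrary subsets of measurable null sets, [usual_sub] and
   [usual_complete] together force Q itself to be complete. *)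
Record usual_filtration F : Prop := UsualFiltration {
  usual_sigma : forall t, t \in `[0, 1] -> sigma_algebra setT (F t) ;
  usual_sub : forall t, t \in `[0, 1] -> F t `<=` measurable ;
  usual_mono : forall s t, 0 <= s -> s <= t -> t <= 1 -> F s `<=` F t ;
  usual_right : forall t, t \in `[0, 1[ -> \bigcap_(s in `]t, 1]) F s `<=` F t ;
  usual_complete : Q.-negligible `<=` F 0 }.

(* F_{t-}, with the convention F_{0-} = F_0 *)
Definition left_sigma F (t : R) : set (set S) :=
  if t == 0 then F 0 else <<s \bigcup_(s in `[0, t[) F s >>.

Definition join_raw F H (t : R) : set (set S) :=
  <<s F t `|` \bigcup_(s in `[0, t]) preimage_set_system setT (H s) measurable >>.

(* The right-continuous filtration generated by F and H (join_raw itself at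
   the terminal time 1); it is complete as soon as F is. *)
Definition join_filtration F H (t : R) : set (set S) :=
  \bigcap_(s in [set s | t <= s <= 1 /\ (t < s \/ s = 1)]) join_raw F H s.

Definition predictable_sets F : set (set (R * S)) :=
  <<s `[0, 1] `*` setT,
    [set [set 0] `*` A | A in F 0] `|`
    [set B | exists s t A,
      [/\ 0 <= s < t, t <= 1, F s A & B = `]s, t]%classic `*` A]] >>.

Definition predictable F H :=
  forall B : set R, measurable B ->
    predictable_sets F
      ((`[0, 1] `*` setT) `&` (fun z : R * S => H z.1 z.2) @^-1` B).

(* Y is a version of E(Z | A) *)
Definition is_condexp (A : set (set S)) Z (Y : S -> R) :=
  [/\ Q.-integrable setT (EFin \o Z), Q.-integrable setT (EFin \o Y),
      measurable_wrt A Y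
    & forall B, A B ->
        (\int[Q]_(y in B) (Y y)%:E = \int[Q]_(y in B) (Z y)%:E)%E].

Definition martingale F H :=
  forall s t, 0 <= s -> s <= t -> t <= 1 -> is_condexp (F s) (H t) (H s).

Definition stopping_time F (tau : S -> R) :=
  (forall y, 0 <= tau y) /\
  forall t, t \in `[0, 1] -> F t [set y | tau y <= t].

(* As the time horizon [0, 1] is closed, a localizing sequence has to reach
   the terminal time. *)
Definition local_martingale F H :=
  exists tau : nat -> S -> R,
  [/\ forall k, stopping_time F (tau k),
      forall k y, tau k y <= tau k.+1 y,
      {ae Q, forall y, \forall k \near \oo, 1 <= tau k y}
    & forall k, martingale F (fun t y => H (Num.min t (tau k y)) y)].

Definition compensated (N : S -> cumulative R R) H : R -> S -> R :=
  fun t y => N y t - int_ds (H ^~ y) t.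

Definition intensity F (N : S -> cumulative R R) H :=
  [/\ predictable F H,
      {ae Q, forall y,
        lebesgue_measure.-integrable `[0, 1] (EFin \o (H ^~ y))}
    & local_martingale F (compensated N H)].

(* The observable (N, X, F). A counting process on [0, 1] is given by paths
   on R; their values outside [0, 1] play no role. *)
Definition observable F (N : S -> cumulative R R) (X : R -> S -> R) :=
  [/\ usual_filtration F,
      forall y, counting_path (N y),
      adapted F (fun t y => N y t),
      forall y, caglad (X ^~ y)
    & forall t, t \in `[0, 1] -> measurable_fun setT (X t)].

(* Conditional local independence of N from X given F; H is the F-intensity
   of N. *)
Definition H0 F (N : S -> cumulative R R) (X : R -> S -> R) H :=
  local_martingale (join_filtration F X) (compensated N H).

Definition residual_process F (X G : R -> S -> R) :=
  [/\ forall y, caglad (G ^~ y),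
      adapted (join_filtration F X) G
    & forall t, t \in `[0, 1] -> is_condexp (left_sigma F t) (G t) (cst 0)].

Definition variance_function (N : S -> cumulative R R) (G : R -> S -> R)
    (t : R) : R :=
  fine (\int[Q]_y (int_dN (N y) (fun s => G s y ^+ 2) t)%:E)%E.

Definition sup_bounded (C : R) H :=
  {ae Q, forall y, forall t, t \in `[0, 1] -> `|H t y| <= C}.

Definition norm2 H : \bar R :=
  ((\int[Q]_y \int[lebesgue_measure]_(t in `[0%R, 1%R]) (H t y ^+ 2)%:E)
    `^ (2^-1)%R)%E.

(* The normal law is allowed to be degenerate; normal_prob m 0 is not the
   Dirac mass at m. *)
Definition gaussian_rv Z :=
  measurable_fun setT Z /\
  exists m s : R, forall B : set R, measurable B ->
    Q (Z @^-1` B) = if s == 0 then dirac m B else normal_prob m s B.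

Definition gaussian_process H :=
  forall (k : nat) (a t : 'I_k -> R), (forall i, t i \in `[0, 1]) ->
    gaussian_rv (fun y => \sum_(i < k) a i * H (t i) y).

Definition natural_filtration H (t : R) : set (set S) :=
  <<s \bigcup_(s in `[0, t]) preimage_set_system setT (H s) measurable >>.

Definition continuous_gaussian_martingale (V : R -> R) H :=
  [/\ forall y, {within `[(0:R), 1], continuous (H ^~ y)},
      gaussian_process H,
      martingale (natural_filtration H) H
    & forall t, t \in `[0, 1] ->
        ('E_Q[H t] = 0)%E /\ 'V_Q[H t] = (V t)%:E].

End processes.

Section sampling.
Context {R : realType} {d d' : measure_display}.
Context {S : measurableType d} {Om : measurableType d'}.
Variables (Q : probability S R) (P : probability Om R).

Definition iid (I : eqType) (Y : I -> Om -> S) :=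
  [/\ forall i, measurable_fun setT (Y i),
      forall i A, measurable A -> P (Y i @^-1` A) = Q A
    & forall (r : seq I) (A : I -> set S), uniq r ->
        (forall i, measurable (A i)) ->
        P (\bigcap_(i in [set` r]) Y i @^-1` A i)
        = (\prod_(i <- r) P (Y i @^-1` A i))%E].

Variables (n : nat) (J : {set 'I_n}).

(* A fitted process: for every training sample, indexed by the complement of
   J, a process evaluated on new observations. *)
Definition estimator : Type := #|~: J|.-tuple S -> R -> S -> R.

Definition training (Y : nat -> Om -> S) (w : Om) : #|~: J|.-tuple S :=
  [tuple Y (enum_val i : 'I_n) w | i < #|~: J|].

Definition predictable_estimator (F : R -> set (set S)) (e : estimator) :=
  (forall x, predictable F (e x)) /\
  measurable_fun [set z : #|~: J|.-tuple S * (R * S) | z.2.1 \in `[0, 1]]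
    (fun z => e z.1 z.2.1 z.2.2).

(* Evaluation of e, fitted on the training part of Y, on the observation y. *)
Definition evaluate (e : estimator) (Y : nat -> Om -> S) (y : Om -> S) :
    R -> Om -> R :=
  fun t w => e (training Y w) t (y w).

Variables (N : S -> cumulative R R) (lamhat Ghat : estimator).
Variable Y : nat -> Om -> S.

Definition gamma_hat (w : Om) (t : R) : R :=
  (#|J|%:R)^-1 * \sum_(j in J)
    int_dM (N (Y j w)) (fun s => evaluate lamhat Y (Y j) s w)
      (fun s => evaluate Ghat Y (Y j) s w) t.

Definition V_hat (w : Om) (t : R) : R :=
  (#|J|%:R)^-1 * \sum_(j in J)
    int_dN (N (Y j w)) (fun s => evaluate Ghat Y (Y j) s w ^+ 2) t.

Definition test_statistic
    (T : {uniform (@unitI R) -> R} -> {uniform (@unitI R) -> R} -> R)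
    (w : Om) : R :=
  T (res01 (fun t => Num.sqrt #|J|%:R * gamma_hat w t)) (res01 (V_hat w)).

End sampling.

Section uniform_convergence.
Context {R : realType}.

(* Supremum of a family of nonnegative extended reals, 0 when A is empty. *)
Definition sup_nneg (I : Type) (A : set I) (f : I -> \bar R) : \bar R :=
  ereal_sup (0%E |` f @` A).

Definition BL1 : set (R -> R) :=
  [set f | (forall x, `|f x| <= 1) /\ 1.-lipschitz f].

Definition bl_dist {d d' : measure_display}
    {T : measurableType d} {T' : measurableType d'}
    (P : probability T R) (Y : T -> R) (P' : probability T' R) (Y' : T' -> R) :
    \bar R :=
  ereal_sup [set (`| 'E_P[f \o Y] - 'E_P'[f \o Y'] |)%E | f in BL1].

Definition jointly_continuous_at
    (T : {uniform (@unitI R) -> R} -> {uniform (@unitI R) -> R} -> R)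
    (p : {uniform (@unitI R) -> R} * {uniform (@unitI R) -> R}) :=
  T q.1 q.2 @[q --> within (D01 `*` D01) (nbhs p)] --> T p.1 p.2.

End uniform_convergence.

(* Main.v *)
Require Import Defs.
From HB Require Import structures.
From mathcomp Require Import all_boot all_order all_algebra.
From mathcomp Require Import all_classical all_reals all_analysis.
From mathcomp Require Import measurable_realfun ring lra zify.

(* Boundedness of the compensator makes N(1) integrable, and under H_0 the two
   intensities agree almost everywhere, so every stochastic integral reduces to
   bounded predictable integrands and the compensation formula.  Up to an error
   vanishing uniformly over [0,1] and theta, sqrt|J| gamma-hat is the normalized
   sum of the i.i.d. martingales int G dM: the error from G-hat - G is a
   martingale (Doob), the one from lambda-hat - lambda is conditionally centred
   given the training data because E(G_t | F_t-) = 0, and the product of the two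
   is bounded by sqrt|J| g h.  Uniform convergence in law is obtained through a
   Bernstein partition of unity made of trigonometric polynomials of the path on
   a finite grid: the cell probabilities converge by explicit estimates of
   characteristic functions, and fourth moments control the modulus of
   continuity, so that both paths are near a fixed compact set, in a uniform
   neighbourhood of which the functional varies little on each cell. *)

Set Implicit Arguments.
Unset Strict Implicit.
Unset Printing Implicit Defensive.

Import Order.TTheory GRing.Theory Num.Theory.
Import numFieldNormedType.Exports.

Local Open Scope classical_set_scope.
Local Open Scope ring_scope.

(** Uniformity over the parameter forces every error to be an explicit function of [C], [C'], the
    size of the test set and the two L2 errors. Exceptional events are exhibited as sets with a
    bound on their probability; suprema over [0, 1] are never measured. The bounds of the statement
    hold almost surely and on [0, 1], and those on the estimators concern the additional copy. Hence
    every process is replaced by a clamped version, bounded everywhere, and null events are carried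
    from the copy to the test observations. Independence enters as the invariance of the law of the
    sample when one coordinate is redrawn ([resamplable]); redrawing a test coordinate with the
    others fixed is conditioning in disguise. The set on which the functional is continuous is not
    compact: a common radius comes from ultralimits of counterexamples, along which the parameter
    may vary, and this is where the closure of the variance functions enters. Prelimit paths jump,
    so their moduli are small only for test sets that are large depending on the mesh; the mesh and
    the cells are therefore fixed before [n]. *)

Local Notation mfunT := (measurable_fun setT) (only parsing).

Lemma le_of_eq {R : realType} (x y : R) : x = y -> x <= y.
Proof. by move=> ->. Qed.

Lemma t01E {R : realType} (t : R) : 0 <= t -> t <= 1 -> t \in `[0, 1].
Proof. by move=> t0 t1; rewrite in_itv/= t0. Qed.

(** * Integrals of real functions under a probability *)

Notation L1 mu f := (mu.-integrable setT (EFin \o f)).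

Section expectation.
Context {d : measure_display} {T : measurableType d} {R : realType}.
Variable mu : probability T R.
Implicit Types f g : T -> R.

Lemma L1_measurable f : L1 mu f -> mfunT f.
Proof. by move=> /integrableP[/measurable_EFinP]. Qed.

Lemma L1_bounded f (c : R) : mfunT f ->
  (forall x, `|f x| <= c) -> L1 mu f.
Proof.
move=> mf fc; apply: measurable_bounded_integrable => //.
  by apply: (le_lt_trans (probability_le1 mu measurableT)); rewrite ltry.
exists c; split; first exact: num_real.
by move=> x cx y _ /=; rewrite (le_trans (fc y))// ltW.
Qed.

Lemma L1_le f g : mfunT f -> L1 mu g ->
  (forall x, `|f x| <= g x) -> L1 mu f.
Proof.
move=> mf ig fg; apply: (le_integrable _ _ _ ig) => //.
  exact/measurable_EFinP.
by move=> x _ /=; rewrite lee_fin (le_trans (fg x)) ?ler_norm.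
Qed.

Lemma L1_le_ae f g : mfunT f -> L1 mu g ->
  {ae mu, forall x, `|f x| <= g x} -> L1 mu f.
Proof.
move=> mf ig fg; apply/integrableP; split; first exact/measurable_EFinP.
move/integrableP : (ig) => [mg]; apply: le_lt_trans.
apply: ae_ge0_le_integral => //.
- apply: measurableT_comp => //; exact/measurable_EFinP.
- exact: measurableT_comp.
- by apply: filterS fg => x fgx _ /=; rewrite lee_fin (le_trans fgx) ?ler_norm.
Qed.

Lemma L1_cst (c : R) : L1 mu (fun=> c).
Proof. by apply: (@L1_bounded _ `|c|). Qed.

Lemma L1D f g : L1 mu f -> L1 mu g -> L1 mu (fun x => f x + g x).
Proof. by move=> h1 h2; exact: (integrableD _ h1 h2). Qed.

Lemma L1B f g : L1 mu f -> L1 mu g -> L1 mu (fun x => f x - g x).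
Proof. by move=> h1 h2; exact: (integrableB _ h1 h2). Qed.

Lemma L1Z (k : R) f : L1 mu f -> L1 mu (fun x => k * f x).
Proof. by move=> h1; exact: (integrableZl _ k h1). Qed.

Lemma L1_abs f : L1 mu f -> L1 mu (fun x => `|f x|).
Proof. by move=> h1; exact: (integrable_abse h1). Qed.

Lemma L1_sum (I : Type) (s : seq I) (F : I -> T -> R) :
  (forall i, L1 mu (F i)) -> L1 mu (fun x => \sum_(i <- s) F i x).
Proof.
move=> h; elim: s => [|i s ih].
  by under eq_fun do rewrite big_nil; exact: L1_cst.
by under eq_fun do rewrite big_cons; exact: L1D.
Qed.

Lemma L1M f g (c : R) : L1 mu f -> mfunT g ->
  (forall x, `|g x| <= c) -> L1 mu (fun x => g x * f x).
Proof.
move=> hf mg gc; apply: (@L1_le _ (fun x => c * `|f x|)).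
- by apply: measurable_funM => //; exact: L1_measurable.
- exact/L1Z/L1_abs.
- by move=> x; rewrite normrM ler_wpM2r.
Qed.

Lemma L1_indic f (A : set T) : measurable A -> L1 mu f ->
  L1 mu (fun x => \1_A x * f x).
Proof.
move=> mA hf; apply: (@L1M _ _ 1) => // x.
by rewrite indicE; case: (_ \in _); rewrite ?normr1 ?normr0.
Qed.

Lemma EFin_Rint f : L1 mu f -> (\int[mu]_x (f x)%:E = (\int[mu]_x f x)%:E)%E.
Proof. by move=> hf; rewrite fineK//; exact: integrable_fin_num. Qed.

Lemma RintD f g : L1 mu f -> L1 mu g ->
  \int[mu]_x (f x + g x) = \int[mu]_x f x + \int[mu]_x g x.
Proof. exact: RintegralD. Qed.

Lemma RintB f g : L1 mu f -> L1 mu g ->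
  \int[mu]_x (f x - g x) = \int[mu]_x f x - \int[mu]_x g x.
Proof. exact: RintegralB. Qed.

Lemma RintZ (k : R) f : L1 mu f -> \int[mu]_x (k * f x) = k * \int[mu]_x f x.
Proof. exact: RintegralZl. Qed.

Lemma Rint_cst (c : R) : \int[mu]_x c = c.
Proof.
rewrite Rintegral_cst//; transitivity (c * fine (1%E : \bar R)); last by rewrite mulr1.
by congr (_ * fine _); exact: probability_setT.
Qed.

Lemma Rint_sum (I : Type) (s : seq I) (F : I -> T -> R) :
  (forall i, L1 mu (F i)) ->
  \int[mu]_x (\sum_(i <- s) F i x) = \sum_(i <- s) \int[mu]_x F i x.
Proof.
move=> h; elim: s => [|i s ih].
  by under eq_Rintegral do rewrite big_nil; rewrite Rint_cst big_nil.
under eq_Rintegral do rewrite big_cons.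
by rewrite RintD// ?ih ?big_cons//; exact: L1_sum.
Qed.

Lemma Rint_le f g : L1 mu f -> L1 mu g -> (forall x, f x <= g x) ->
  \int[mu]_x f x <= \int[mu]_x g x.
Proof. by move=> hf hg fg; apply: le_Rintegral. Qed.

Lemma Rint_abs f : L1 mu f -> `|\int[mu]_x f x| <= \int[mu]_x `|f x|.
Proof. exact: le_normr_Rintegral. Qed.

Lemma Rint_ge0 f : (forall x, 0 <= f x) -> 0 <= \int[mu]_x f x.
Proof. by move=> h; apply: Rintegral_ge0. Qed.

Lemma Rint_ae f g : mfunT f -> mfunT g ->
  {ae mu, forall x, f x = g x} -> \int[mu]_x f x = \int[mu]_x g x.
Proof.
move=> mf mg fg; congr fine; apply: ae_eq_integral => //;
  try exact/measurable_EFinP.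
by apply: filterS fg => x -> _.
Qed.

(** The maximum of [f] and [g] equals [g] almost everywhere and dominates [f] everywhere, which
    reduces the claim to [Rint_le]. *)
Lemma Rint_le_ae f g : L1 mu f -> L1 mu g -> {ae mu, forall x, f x <= g x} ->
  \int[mu]_x f x <= \int[mu]_x g x.
Proof.
move=> hf hg fg.
have mf := L1_measurable hf; have mg := L1_measurable hg.
have hm : L1 mu (fun x => Num.max (f x) (g x)).
  apply: (@L1_le _ (fun x => `|f x| + `|g x|)).
  - exact: measurable_maxr.
  - by apply: L1D; exact: L1_abs.
  - move=> x; rewrite maxEle; case: ifP => _; by rewrite ?lerDl ?lerDr.
rewrite (@Rint_ae g (fun x => Num.max (f x) (g x))) //.
- by apply: Rint_le => // x; rewrite le_max lexx.
- exact: measurable_maxr.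
- by apply: filterS fg => x fgx; rewrite max_r.
Qed.

Lemma Rint_indic (A : set T) : measurable A -> \int[mu]_x \1_A x = fine (mu A).
Proof. by move=> mA; rewrite /Rintegral integral_indic// setIT. Qed.

Lemma L1_indicT (A : set T) : measurable A -> L1 mu (\1_A : T -> R).
Proof. by move=> mA; exact: integrable_indic. Qed.

Lemma Rint_dominated (F : nat -> T -> R) f g :
  (forall n, mfunT (F n)) -> mfunT f -> L1 mu g ->
  (forall n x, `|F n x| <= g x) ->
  {ae mu, forall x, F n x @[n --> \oo] --> f x} ->
  L1 mu f /\ \int[mu]_x F n x @[n --> \oo] --> \int[mu]_x f x.
Proof.
move=> mF mf hg Fg Ff.
have [] := @dominated_convergence _ _ _ mu setT measurableT
  (fun n x => (F n x)%:E) (EFin \o f) (EFin \o g) _ _ _ hg _.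
- by move=> n; exact/measurable_EFinP.
- exact/measurable_EFinP.
- by apply: filterS Ff => x Ffx _; by apply: cvg_EFin => //; exact: nearW.
- by apply: aeW => x n _ /=; rewrite lee_fin.
move=> hf _ cF; split=> //.
have hF n : L1 mu (F n) by exact: L1_le (mF n) hg (Fg n).
move: cF; rewrite /= (EFin_Rint hf).
under eq_fun do rewrite (EFin_Rint (hF _)).
by move=> /fine_cvgP[].
Qed.

Lemma Rint_markov f (e : R) (A : set T) : measurable A -> L1 mu f -> 0 < e ->
  (forall x, 0 <= f x) -> (forall x, A x -> e <= f x) ->
  fine (mu A) <= e^-1 * \int[mu]_x f x.
Proof.
move=> mA hf e0 f0 Af; rewrite mulrC ler_pdivlMr// mulrC -Rint_indic// -RintZ; last first.
  exact: L1_indicT.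
apply: Rint_le => //; first exact/L1Z/L1_indicT.
move=> x; rewrite indicE; case: (boolP (x \in A)) => xA.
  by rewrite mulr1 Af// -inE.
by rewrite mulr0.
Qed.

Lemma L1_sqr_abs f : mfunT f -> L1 mu (fun x => f x ^+ 2) ->
  L1 mu f.
Proof.
move=> mf hf; apply: (@L1_le _ (fun x => 1 + f x ^+ 2)) => //.
  exact: L1D (L1_cst 1) hf.
move=> x; have := sqr_ge0 (`|f x| - 1); rewrite sqrrB expr1n mulr1 real_normK ?num_real//.
have := sqr_ge0 (f x).
have : 0 <= `|f x| by []. nra.
Qed.

Lemma L1_sqrM f g : mfunT f -> mfunT g ->
  L1 mu (fun x => f x ^+ 2) -> L1 mu (fun x => g x ^+ 2) ->
  L1 mu (fun x => f x * g x).
Proof.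
move=> mf mg hf hg; apply: (L1_le _ (L1D hf hg)); first exact: measurable_funM.
move=> x; rewrite ler_norml; have := sqr_ge0 (f x - g x).
have := sqr_ge0 (f x + g x); nra.
Qed.

(** The quadratic t^2 a - 2 t c + b is the integral of (t |f| - |g|)^2, hence nonnegative for every
    t; its minimum is at t = c / a. *)
Lemma Rint_CS f g : mfunT f -> mfunT g ->
  L1 mu (fun x => f x ^+ 2) -> L1 mu (fun x => g x ^+ 2) ->
  \int[mu]_x `|f x * g x| <=
    Num.sqrt (\int[mu]_x (f x ^+ 2)) * Num.sqrt (\int[mu]_x (g x ^+ 2)).
Proof.
move=> mf mg hf hg.
set a := \int[mu]_x (f x ^+ 2); set b := \int[mu]_x (g x ^+ 2).
have a0 : 0 <= a by apply: Rint_ge0 => x; exact: sqr_ge0.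
have b0 : 0 <= b by apply: Rint_ge0 => x; exact: sqr_ge0.
have hfg := L1_abs (L1_sqrM mf mg hf hg).
set c := \int[mu]_x `|f x * g x|.
have c0 : 0 <= c by apply: Rint_ge0 => x.
have key (t : R) : 0 <= t ^+ 2 * a - 2 * t * c + b.
  have -> : t ^+ 2 * a - 2 * t * c + b =
    \int[mu]_x (t ^+ 2 * (f x ^+ 2) - (2 * t) * `|f x * g x| + g x ^+ 2).
    rewrite RintD//; last by apply: L1B; exact: L1Z.
    rewrite RintB//; [|exact: L1Z..].
    by rewrite !RintZ.
  apply: Rint_ge0 => x.
  have -> : t ^+ 2 * f x ^+ 2 - 2 * t * `|f x * g x| + g x ^+ 2 =
    (t * `|f x| - `|g x|) ^+ 2.
    rewrite sqrrB exprMn !real_normK ?num_real// normrM; ring.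
  exact: sqr_ge0.
have h : c ^+ 2 <= a * b.
  have [a00|an0] := eqVneq a 0.
    rewrite a00 mul0r; have [->|cn0] := eqVneq c 0; first by rewrite expr0n.
    (* For a = 0 the quadratic is affine in t, and this t would give it the value -1. *)
    have := key ((b + 1) / (2 * c)); rewrite a00 mulr0 add0r.
    have -> : 2 * ((b + 1) / (2 * c)) * c = b + 1 by field.
    lra.
  have ap : 0 < a by rewrite lt_def an0.
  have := key (c / a).
  have -> : (c / a) ^+ 2 * a - 2 * (c / a) * c + b = (a * b - c ^+ 2) / a by field.
  by rewrite pmulr_lge0 ?invr_gt0// subr_ge0.
rewrite -sqrtrM// -[leLHS]ger0_norm// -sqrtr_sqr ler_sqrt//.
exact: mulr_ge0.
Qed.

End expectation.

(** * Measurability and centring with respect to a sub-sigma-algebra *)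

Section sigma_fields.
Context {R : realType}.

Lemma measurable_wrtP (d : measure_display) (S : measurableType d)
    (A : set (set S)) (Z : S -> R) : sigma_algebra setT A ->
  measurable_wrt A Z <->
  mfunT (Z : g_sigma_algebraType A -> R).
Proof.
move=> sA; split.
  by move=> h _ B mB; rewrite setTI; apply: sub_sigma_algebra; exact: h.
move=> h B mB; have := h measurableT B mB; rewrite setTI.
by rewrite /measurable/= sigma_algebra_id.
Qed.

(** Counts thresholds: it evaluates the staircase of [bounded_approx] and expresses a counting path
    through its number of jumps. *)
Lemma sum_ltn_minn n m : (\sum_(i < n) (i < m) = minn n m)%N.
Proof.
elim: n => [|n ih]; first by rewrite big_ord0 min0n.
by rewrite big_ord_recr /= ih; lia.
Qed.

(** A staircase with [n] equal steps across [-c1, c1]: the sum counts the thresholds below [Z x], so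
    that it rounds [Z x] down on a grid of mesh 2 c1 / n. Superlevel sets are all it involves, and
    it applies to any system of sets containing them. *)
Lemma bounded_approx (U : Type) (A : set (set U)) (Z : U -> R) (c : R) :
  (forall r, A (Z @^-1` [set x | r <= x])) -> (forall x, `|Z x| <= c) ->
  forall e : R, 0 < e -> exists n (b : R) (a : nat -> R) (B : nat -> set U),
    (forall i, A (B i)) /\
    forall x, `|Z x - (b + \sum_(i < n) a i * \1_(B i) x)| <= e.
Proof.
move=> hA hc e e0.
(* The added 1 keeps the range of the staircase positive when [c] is zero. *)
pose c1 := `|c| + 1.
have c0 : 0 < c1 by rewrite ltr_wpDl.
pose n := (Num.truncn (2 * c1 / e)).+1.
have n0 : 0 < n%:R :> R by rewrite ltr0n.
pose dl := 2 * c1 / n%:R.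
have dl0 : 0 < dl by rewrite /dl divr_gt0// mulr_gt0.
have hn : dl <= e.
  rewrite ler_pdivrMr// [e * _]mulrC -ler_pdivrMr//.
  have q0 : 0 <= 2 * c1 / e by rewrite divr_ge0 ?ltW// mulr_gt0.
  by have /andP[_ /ltW] := truncn_itv q0; rewrite /n.
exists n, (- c1), (fun=> dl), (fun i => Z @^-1` [set x | i.+1%:R * dl - c1 <= x]).
split=> [i|x]; first exact: hA.
have : `|Z x| <= c1 by rewrite (le_trans (hc x))// (le_trans (ler_norm c))// lerDl.
rewrite ler_norml => /andP[h1 h2].
pose m := Num.truncn ((Z x + c1) / dl).
have q0 : 0 <= (Z x + c1) / dl by apply: divr_ge0; [rewrite -lerBlDr sub0r|exact: ltW].
have /andP[hm1 hm2] := truncn_itv q0; rewrite -/m in hm1 hm2.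
have mn : (m <= n)%N.
  rewrite -(ler_nat R) (le_trans hm1)// ler_pdivrMr// /dl mulrCA divff ?mulr1; first by lra.
  by rewrite gt_eqF.
rewrite ler_pdivlMr// in hm1; rewrite ltr_pdivrMr// in hm2.
have -> : \sum_(i < n) dl * \1_(Z @^-1` [set x | i.+1%:R * dl - c1 <= x]) x = dl * m%:R.
  rewrite -mulr_sumr; congr (_ * _).
  rewrite -[in RHS](minn_idPr mn) -sum_ltn_minn natr_sum; apply: eq_bigr => i _.
  rewrite truncn_gt_nat indicE ler_pdivlMr// -lerBlDr; congr (nat_of_bool _ )%:R.
  by apply/idP/idP => [/set_mem//|h]; apply/mem_set.
rewrite -natr1 in hm2; rewrite ler_norml; apply/andP; split; lra.
Qed.

End sigma_fields.

Section clamp.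
Context {R : realType}.
Implicit Types a b c x : R.

Definition clamp a b x := Num.max a (Num.min b x).

Lemma clamp_id a b x : a <= x -> x <= b -> clamp a b x = x.
Proof. by move=> h1 h2; rewrite /clamp (min_r h2) (max_r h1). Qed.

Lemma clamp_ge a b x : a <= clamp a b x.
Proof. by rewrite le_max lexx. Qed.

Lemma clamp_le a b x : a <= b -> clamp a b x <= b.
Proof. by move=> ab; rewrite ge_max ab ge_min lexx. Qed.

Lemma clamp_norm c x : 0 <= c -> `|clamp (- c) c x| <= c.
Proof. by move=> c0; rewrite ler_norml clamp_ge clamp_le//; lra. Qed.

Lemma clamp_norm_le c x : 0 <= c -> `|clamp (- c) c x| <= `|x|.
Proof.
move=> c0; rewrite /clamp minEle; case: (leP c x) => cx.
  rewrite max_r; last by lra.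
  by rewrite !ger0_norm//; lra.
case: (leP (- c) x) => cx2; first by rewrite lexx.
by rewrite !ler0_norm//; lra.
Qed.

Lemma measurable_clamp a b : mfunT (clamp a b).
Proof. by apply: measurable_maxr => //; exact: measurable_minr. Qed.

End clamp.

Lemma sigma_algebra_setT {T : Type} (A : set (set T)) : sigma_algebra setT A -> A setT.
Proof. by case=> h0 /(_ _ h0); rewrite setD0. Qed.

Lemma sigma_algebra_setI {T : pointedType} (A : set (set T)) X Y :
  sigma_algebra setT A -> A X -> A Y -> A (X `&` Y).
Proof.
move=> sA AX AY; rewrite -(sigma_algebra_id sA).
by apply: (@measurableI _ (g_sigma_algebraType A)); apply: sub_sigma_algebra.
Qed.

Section pull_out.
Context {d : measure_display} {T : measurableType d} {R : realType}.
Variable mu : probability T R.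
Variable A : set (set T).
Hypothesis sA : sigma_algebra setT A.
Hypothesis Am : A `<=` measurable.

Lemma measurable_wrt_sub (Z : T -> R) : measurable_wrt A Z -> mfunT Z.
Proof. by move=> h _ B mB; rewrite setTI; exact/Am/h. Qed.

Lemma measurable_wrt_comp (Z : T -> R) (g : R -> R) : mfunT g ->
  measurable_wrt A Z -> measurable_wrt A (g \o Z).
Proof. by move=> mg h B mB; rewrite comp_preimage; apply: h; rewrite -[X in measurable X]setTI; exact: mg. Qed.

Lemma measurable_wrtM (Z W : T -> R) : measurable_wrt A Z -> measurable_wrt A W ->
  measurable_wrt A (fun x => Z x * W x).
Proof.
move=> /(measurable_wrtP _ sA) hZ /(measurable_wrtP _ sA) hW.
by apply/(measurable_wrtP _ sA); exact: measurable_funM.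
Qed.

Lemma measurable_wrtB (Z W : T -> R) : measurable_wrt A Z -> measurable_wrt A W ->
  measurable_wrt A (fun x => Z x - W x).
Proof.
move=> /(measurable_wrtP _ sA) hZ /(measurable_wrtP _ sA) hW.
by apply/(measurable_wrtP _ sA); exact: measurable_funB.
Qed.

Lemma measurable_wrt_indic (B : set T) : A B -> measurable_wrt A (\1_B : T -> R).
Proof.
move=> AB; apply/(measurable_wrtP _ sA).
apply: (@measurable_indic _ (g_sigma_algebraType A)).
by apply: sub_sigma_algebra.
Qed.

Lemma measurable_wrt_le (Z : T -> R) (r : R) : measurable_wrt A Z ->
  A (Z @^-1` [set x | r <= x]).
Proof.
move=> h; apply: h.
have -> : [set x | r <= x] = `[r, +oo[%classic.
  by apply/seteqP; split=> x /=; rewrite in_itv/= andbT.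
exact: measurable_itv.
Qed.

Variable D : T -> R.
Hypothesis iD : L1 mu D.
Hypothesis D0 : forall B, A B -> \int[mu]_x (\1_B x * D x) = 0.

(** [D0] says that [D] has conditional mean zero given [A]. A bounded [Z] is within e / (I + 1) of a
    combination of indicators of sets of [A], whose integrals against [D] vanish; the error is at
    most that constant times I, the integral of |D|. *)
Lemma pull_out_bounded (Z : T -> R) (c : R) : measurable_wrt A Z ->
  (forall x, `|Z x| <= c) -> \int[mu]_x (Z x * D x) = 0.
Proof.
move=> hZ Zc; have mZ := measurable_wrt_sub hZ.
have iZD := L1M iD mZ Zc.
have iAD := L1_abs iD.
apply/eqP; rewrite -normr_le0; apply/ler_addgt0Pl => e e0; rewrite addr0.
pose I := \int[mu]_x `|D x|.
have I0 : 0 <= I by exact: Rint_ge0.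
have e1 : 0 < e / (I + 1) by rewrite divr_gt0// ltr_wpDl.
have [n [b [a [B [AB hB]]]]] := bounded_approx (fun r => measurable_wrt_le r hZ) Zc e1.
pose S x := b + \sum_(i < n) a i * \1_(B i) x.
have iB i : L1 mu (fun x => \1_(B i) x * D x) by apply: L1_indic => //; exact: Am.
have iSD : L1 mu (fun x => S x * D x).
  under eq_fun do rewrite /S mulrDl mulr_suml.
  apply: L1D; first exact: L1Z.
  apply: L1_sum => i; under eq_fun do rewrite -mulrA.
  exact: L1Z.
have S0 : \int[mu]_x (S x * D x) = 0.
  under eq_Rintegral do rewrite /S mulrDl mulr_suml.
  rewrite RintD; last 2 first.
    exact: L1Z.
    by apply: L1_sum => i; under eq_fun do rewrite -mulrA; exact: L1Z.
  rewrite RintZ// Rint_sum; last first.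
    by move=> i; under eq_fun do rewrite -mulrA; exact: L1Z.
  rewrite big1 => [|i _]; last first.
    under eq_Rintegral do rewrite -mulrA.
    by rewrite RintZ// D0 ?mulr0.
  have := D0 (sigma_algebra_setT sA).
  by under eq_Rintegral do rewrite indicT mul1r; move=> ->; rewrite mulr0 addr0.
rewrite -[X in `|X|]subr0 -S0 -RintB//.
apply: (le_trans (Rint_abs (L1B iZD iSD))).
apply: (@le_trans _ _ (\int[mu]_x (e / (I + 1) * `|D x|))).
  apply: Rint_le; [exact/L1_abs/L1B|exact: L1Z|] => x.
  by rewrite -mulrBl normrM ler_wpM2r.
rewrite RintZ// -/I mulrAC ler_pdivrMr ?ltr_wpDl// ler_pM2l//; lra.
Qed.

(** Truncating [Z] by [clamp] reduces to the bounded case; |Z D| dominates the truncated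
    products. *)
Lemma pull_out (Z : T -> R) : measurable_wrt A Z -> L1 mu (fun x => Z x * D x) ->
  \int[mu]_x (Z x * D x) = 0.
Proof.
move=> hZ iZD; have mZ := measurable_wrt_sub hZ.
pose F (n : nat) x := clamp (- n%:R) n%:R (Z x) * D x.
have [|||||_] := @Rint_dominated _ _ _ mu F (fun x => Z x * D x) (fun x => `|Z x * D x|).
- move=> n; apply: measurable_funM; last exact: L1_measurable iD.
  exact: (measurableT_comp (measurable_clamp _ _)).
- exact: L1_measurable iZD.
- exact: L1_abs.
- move=> n x; by rewrite /F !normrM ler_wpM2r// clamp_norm_le.
- apply: aeW => x; apply: cvg_near_cst; exists (Num.truncn `|Z x|).+1 => // n /= hn.
  rewrite /F; congr (_ * _).
  have : `|Z x| <= n%:R.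
    have /andP[_ /ltW h] := truncn_itv (normr_ge0 (Z x)).
    by rewrite (le_trans h)// ler_nat.
  by rewrite ler_norml => /andP[h1 h2]; rewrite clamp_id.
have -> : (fun n => \int[mu]_x F n x) = fun=> 0.
  apply/funext => n; apply: (@pull_out_bounded _ n%:R).
    exact: (measurable_wrt_comp (measurable_clamp _ _)).
  by move=> x; rewrite clamp_norm.
by move=> /(cvg_lim (@norm_hausdorff R R^o)) <-; rewrite lim_cst//; exact: norm_hausdorff.
Qed.

End pull_out.

(** * Doob's maximal inequality *)

Section doob.
Context {d : measure_display} {T : measurableType d} {R : realType}.
Variable mu : probability T R.

(** Tangent line inequality for the second and fourth powers; the gap is a square times a
    nonnegative factor. Squares will control suprema, fourth powers moduli of continuity. *)
Lemma convex_even_pow (q : nat) (x z : R) : q = 1%N \/ q = 2 ->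
  x ^+ q.*2 + q.*2%:R * x ^+ q.*2.-1 * (z - x) <= z ^+ q.*2.
Proof.
case=> ->; rewrite -subr_ge0 ?[1.*2]/2%N ?[2.*2]/4%N.
  have -> : z ^+ 2 - (x ^+ 2 + 2%:R * x ^+ 2.-1 * (z - x)) = (z - x) ^+ 2 by rewrite /=; ring.
  exact: sqr_ge0.
have -> : z ^+ 4 - (x ^+ 4 + 4%:R * x ^+ 4.-1 * (z - x)) =
   (z - x) ^+ 2 * ((z + x) ^+ 2 + x ^+ 2 + x ^+ 2) by rewrite /=; ring.
by rewrite mulr_ge0 ?sqr_ge0// !addr_ge0 ?sqr_ge0.
Qed.

Lemma L1_pow_le (q k : nat) (f : T -> R) : (k <= q.*2)%N -> mfunT f ->
  L1 mu (fun x => f x ^+ q.*2) -> L1 mu (fun x => f x ^+ k).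
Proof.
move=> kq mf hf; apply: (L1_le _ (L1D (L1_cst mu 1) hf)).
  exact: measurable_funX.
move=> x; rewrite normrX -[f x ^+ q.*2]ger0_norm ?exprn_even_ge0 ?odd_double//.
rewrite normrX; have [x1|x1] := leP `|f x| 1.
  by rewrite (le_trans (exprn_ile1 _ _ _))// lerDl exprn_ge0.
by rewrite (le_trans (ler_weXn2l (ltW x1) kq))// lerDr.
Qed.

Lemma L1_pow_mul (q : nat) (f g : T -> R) : (0 < q)%N -> mfunT f ->
  mfunT g -> L1 mu (fun x => f x ^+ q.*2) ->
  L1 mu (fun x => g x ^+ q.*2) -> L1 mu (fun x => f x ^+ q.*2.-1 * g x).
Proof.
move=> q0 mf mg hf hg; apply: (L1_le _ (L1D hf hg)).
  by apply: measurable_funM => //; exact: measurable_funX.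
move=> x; rewrite -[f x ^+ q.*2]ger0_norm ?exprn_even_ge0 ?odd_double//.
rewrite -[g x ^+ q.*2]ger0_norm ?exprn_even_ge0 ?odd_double//.
rewrite normrM !normrX.
have -> : q.*2 = q.*2.-1.+1 by rewrite prednK// double_gt0.
rewrite succnK; set m := q.*2.-1; rewrite !exprSr; have [h|h] := leP `|f x| `|g x|.
  rewrite ler_wpDl//; 
  by rewrite ler_wpM2r// lerXn2r// nnegrE.
rewrite ler_wpDr//; 
by rewrite ler_wpM2l ?exprn_ge0// ltW.
Qed.

(** The exceptional event is split according to the first index at which the level is exceeded. On
    each piece the tangent inequality at [D k] bounds D k^2q by D K^2q minus a multiple of D K - D
    k, and the integral of that multiple vanishes because its coefficient is known at time [k]. *)
Lemma doob_discrete (q K : nat) (D : nat -> T -> R) (F : nat -> set (set T)) (e : R) :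
  q = 1%N \/ q = 2 -> 0 < e ->
  (forall k, sigma_algebra setT (F k)) -> (forall k, F k `<=` measurable) ->
  (forall j k, (j <= k)%N -> F j `<=` F k) ->
  (forall k, measurable_wrt (F k) (D k)) ->
  (forall k, (k <= K)%N -> L1 mu (fun x => D k x ^+ q.*2)) ->
  (forall k A, (k <= K)%N -> F k A -> \int[mu]_x (\1_A x * (D K x - D k x)) = 0) ->
  let B := \bigcup_(k in `I_K.+1) [set x | e < `|D k x|] in
  measurable B /\ fine (mu B) <= (e ^+ q.*2)^-1 * \int[mu]_x (D K x ^+ q.*2).
Proof.
move=> q12 e0 sF Fm Fmono mD iD Dmart.
have q0 : (0 < q)%N by case: q12 => ->.
have mDm k : mfunT (D k) by exact: (measurable_wrt_sub (Fm k)).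
pose B k := \bigcup_(j in `I_k) [set x | e < `|D j x|].
have FE k : F k [set x | e < `|D k x|].
  have -> : [set x | e < `|D k x|] = D k @^-1` (Num.norm @^-1` `]e, +oo[%classic).
    by apply/seteqP; split=> x /=; rewrite in_itv/= andbT.
  apply: mD; rewrite -[X in measurable X]setTI; exact: normr_measurable.
have FB k : F k (B k.+1).
  have -> : B k.+1 = \bigcup_j (if (j <= k)%N then [set x | e < `|D j x|] else set0).
    apply/seteqP; split=> x [j /= hj h].
      by exists j => //; rewrite -ltnS hj.
    by exists j; move: h; case: ifP => //=; rewrite ltnS.
  have [_ _ h] := sF k; apply: h => j; case: ifP => jk; first exact: (Fmono _ _ jk).
  by have [] := sF k.
have FBk j k : (j <= k.+1)%N -> F k (B j).
  case: j => [_|j jk]; last exact: Fmono (FB j).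
  by rewrite /B II0 bigcup_set0; have [] := sF k.
have mB k : measurable (B k) by apply: (Fm k); exact: FBk.
split; first exact: mB.
rewrite mulrC ler_pdivlMr ?exprn_gt0// mulrC -Rint_indic//; last exact: mB.
rewrite -RintZ; last by apply: L1_indicT; exact: mB.
have iK := iD K (leqnn K).
suff H k : (k <= K.+1)%N -> \int[mu]_x (e ^+ q.*2 * \1_(B k) x) <= \int[mu]_x (\1_(B k) x * D K x ^+ q.*2).
  apply: le_trans (H K.+1 (leqnn _)) _; apply: Rint_le => //.
    by apply: L1_indic => //; exact: mB.
  move=> x; rewrite indicE; case: (_ \in _); rewrite ?mul1r ?mul0r//.
  by rewrite exprn_even_ge0// odd_double.
elim: k => [_|k ih kK].
  rewrite /B II0 bigcup_set0; under eq_Rintegral do rewrite indic0 mulr0.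
  by under [in leRHS]eq_Rintegral do rewrite indic0 mul0r.
(* The level is exceeded at index [k] and at none before. *)
pose A := B k.+1 `\` B k.
have FA : F k A by rewrite /A setDE; apply: sigma_algebra_setI => //; have [_ h _] := sF k; rewrite -setTD; apply: h; exact: FBk.
have mA : measurable A by exact: Fm FA.
have BA x : \1_(B k.+1) x = \1_(B k) x + \1_A x :> R.
  rewrite !indicE /A in_setD; have [xk|xk] := boolP (x \in B k).
    rewrite (_ : x \in B k.+1) ?andbF ?addr0//.
    by move: xk; rewrite !inE => -[j /= jk h]; exists j => //=; rewrite ltnS ltnW.
  by rewrite andbT add0r.
have iA (g : T -> R) : L1 mu g -> L1 mu (fun x => \1_A x * g x) by exact: L1_indic.
have iB (g : T -> R) : L1 mu g -> L1 mu (fun x => \1_(B k) x * g x) by apply: L1_indic; exact: mB.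
under eq_Rintegral do rewrite BA mulrDr.
under [in leRHS]eq_Rintegral do rewrite BA mulrDl.
rewrite RintD ?RintD; [|exact: iB|exact: iA|by apply: L1Z; apply: L1_indicT; exact: mB|by apply/L1Z/L1_indicT].
rewrite lerD//; first exact: ih (ltnW kK).
have kK' : (k <= K)%N by rewrite -ltnS.
have ik := iD k kK'.
have AD x : A x -> e < `|D k x|.
  move=> [[j /= jk h] nB]; move: jk; rewrite ltnS leq_eqVlt => /orP[/eqP <-//|jk].
  by exfalso; apply: nB; exists j.
(* Slope of the tangent at [D k] on that event, to be pulled out of D K - D k. *)
pose Z x := \1_A x * (q.*2%:R * D k x ^+ q.*2.-1).
have mZ : measurable_wrt (F k) Z.
  apply: (measurable_wrtM (sF k)); first exact: (measurable_wrt_indic (sF k)).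
  apply: (measurable_wrt_comp (g := fun z : R => q.*2%:R * z ^+ q.*2.-1)) => //.
  by apply: measurable_funM => //; exact: measurable_funX.
have iDkK : L1 mu (fun x => D K x - D k x).
  by apply: L1B; [have := L1_pow_le (k := 1) _ (mDm K) iK|have := L1_pow_le (k := 1) _ (mDm k) ik]; rewrite ?double_gt0//; apply.
have iZ : L1 mu (fun x => Z x * (D K x - D k x)).
  rewrite /Z; under eq_fun do rewrite -!mulrA.
  apply/iA/L1Z; under eq_fun do rewrite mulrBr -exprSr prednK ?double_gt0//.
  by apply: L1B => //; exact: L1_pow_mul.
have := pull_out (sF k) (Fm k) iDkK (fun C => Dmart k C kK') mZ iZ.
move=> Z0; rewrite -[leRHS]subr0 -Z0 -RintB//; last exact: iA.
apply: Rint_le; [by apply/L1Z/L1_indicT|by apply: L1B => //; exact: iA|] => x.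
rewrite /Z -mulrA -mulrBr mulrC; have := AD x; rewrite indicE; have [/set_mem xA|] := boolP (x \in A); last by rewrite !mul0r.
move=> /(_ xA) exD; rewrite !mul1r.
have := convex_even_pow (D k x) (D K x) q12.
rewrite -lerBrDr; apply: le_trans.
rewrite -[D k x ^+ q.*2]ger0_norm ?exprn_even_ge0 ?odd_double// normrX.
by rewrite lerXn2r// ?nnegrE ltW.
Qed.

End doob.

Section natural_filtration_theory.
Context {d : measure_display} {T : measurableType d} {R : realType}.
Variable Z : R -> T -> R.

Lemma natural_filtration_sigma t : sigma_algebra setT (natural_filtration Z t).
Proof. exact: smallest_sigma_algebra. Qed.

Lemma natural_filtration_mono s t : s <= t ->
  natural_filtration Z s `<=` natural_filtration Z t.
Proof.
move=> st; apply: sub_smallest2r; first exact: smallest_sigma_algebra.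
move=> A [u /= us ZA]; exists u => //=.
by move: us; rewrite !in_itv/= => /andP[-> /le_trans]; apply.
Qed.

Lemma natural_filtration_adapted s t : s \in `[0, t] ->
  measurable_wrt (natural_filtration Z t) (Z s).
Proof.
move=> st B mB; apply: sub_gen_smallest; exists s => //=.
by exists B => //; rewrite setTI.
Qed.

Lemma natural_filtration_sub t : t <= 1 ->
  (forall u, u \in `[0, 1] -> mfunT (Z u)) ->
  natural_filtration Z t `<=` measurable.
Proof.
move=> t1 mZ; apply: smallest_sub; first exact: sigma_algebra_measurable.
move=> A [u /= ut [B mB <-]]; apply: mZ => //.
by move: ut; rewrite !in_itv/= => /andP[-> /le_trans]; apply.
Qed.

End natural_filtration_theory.

Section doob_path.
Context {d : measure_display} {T : measurableType d} {R : realType}.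
Variable mu : probability T R.

Lemma dyadic_between (a b t s : R) : a <= t -> t < s -> s <= b ->
  exists L i, (i <= 2 ^ L)%N /\ t < a + (b - a) * (i%:R / 2 ^+ L) < s.
Proof.
move=> a_t ts sb; have ba : 0 < b - a by lra.
(* The mesh (b - a) / 2^L is then smaller than s - t, by n < 2^n, and some grid point falls strictly
   between [t] and [s]. *)
pose L := (Num.truncn ((b - a) / (s - t))).+1.
have st0 : 0 < s - t by lra.
have hL : b - a < (s - t) * 2 ^+ L.
  have /andP[_] := truncn_itv (ltW (divr_gt0 ba st0)).
  rewrite -/L ltr_pdivrMr// mulrC => /lt_trans; apply.
  by rewrite ltr_pM2l// -natrX ltr_nat ltn_expl.
have p0 : 0 < 2 ^+ L :> R by rewrite exprn_gt0.
pose q := (t - a) / (b - a) * 2 ^+ L.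
have q0 : 0 <= q by rewrite mulr_ge0 ?exprn_ge0// divr_ge0//; lra.
have /andP[h1 h2] := truncn_itv q0.
have tE : t = a + (b - a) * (q / 2 ^+ L).
  by rewrite /q; field; rewrite ?gt_eqF.
exists L, (Num.truncn q).+1; split.
  rewrite truncn_lt_nat// natrX /q gtr_pMl// ltr_pdivrMr// mul1r; lra.
apply/andP; split.
  by rewrite [X in X < _]tE ltrD2l ltr_pM2l// ltr_pM2r// invr_gt0.
rewrite -[X in X / _]natr1 [(_ + 1) / _]mulrDl [(b - a) * _]mulrDr addrA mul1r.
apply: (@le_lt_trans _ _ (t + (b - a) / 2 ^+ L)).
  rewrite lerD2r [leRHS]tE lerD2l ler_pM2l// ler_pM2r// ?invr_gt0//.
by rewrite -ltrBrDl ltr_pdivrMr.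
Qed.

(** The discrete inequality holds with the same bound on every dyadic grid of [a, b]. The grids are
    nested, so the exceptional events increase and their union keeps the bound; right-continuity
    then carries the estimate from dyadic points to every time. *)
Lemma doob_path (q : nat) (Z : R -> T -> R) (a b e : R) :
  q = 1%N \/ q = 2 -> 0 < e -> 0 <= a -> a <= b -> b <= 1 ->
  (forall t, t \in `[0, 1] -> mfunT (Z t)) ->
  (forall t, t \in `[0, 1] -> L1 mu (fun x => Z t x ^+ q.*2)) ->
  (forall s t A, 0 <= s -> s <= t -> t <= 1 -> natural_filtration Z s A ->
    \int[mu]_x (\1_A x * (Z t x - Z s x)) = 0) ->
  (forall y t, t \in `[0, 1[ -> Z s y @[s --> t^'+] --> Z t y) ->
  exists B, [/\ measurable B,
    fine (mu B) <= (e ^+ q.*2)^-1 * \int[mu]_x ((Z b x - Z a x) ^+ q.*2) &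
    forall y, ~ B y -> forall t, t \in `[a, b] -> `|Z t y - Z a y| <= e].
Proof.
move=> q12 e0 a0 ab b1 mZ iZ Zmart Zrc.
have q0 : (0 < q)%N by case: q12 => ->.
(* Clipping the index at 2^L makes the grid a total monotone function of [i], constant equal to [b]
   from the last point on. *)
pose g L i : R := a + (b - a) * (minn i (2 ^ L))%:R / 2 ^+ L.
have p0 L : 0 < 2 ^+ L :> R by rewrite exprn_gt0.
have gab L i : a <= g L i <= b.
  rewrite /g lerDl; apply/andP; split.
    by rewrite divr_ge0 ?exprn_ge0// mulr_ge0// subr_ge0.
  rewrite -lerBrDl ler_pdivrMr// ler_wpM2l ?subr_ge0// -natrX ler_nat.
  exact: geq_minr.
have g01 L i : g L i \in `[0, 1].
  rewrite in_itv/=; have /andP[h1 h2] := gab L i.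
  by rewrite (le_trans a0 h1) (le_trans h2 b1).
have gmono L i j : (i <= j)%N -> g L i <= g L j.
  move=> ij; rewrite /g lerD2l ler_pM2r ?invr_gt0// ler_wpM2l ?subr_ge0// ler_nat.
  by rewrite leq_min geq_minr andbT (leq_trans (geq_minl _ _)).
have gK L : g L (2 ^ L)%N = b.
  by rewrite /g minnn natrX mulfK ?gt_eqF// addrC subrK.
have a01 : a \in `[0, 1] by rewrite in_itv/= a0 (le_trans ab).
have b01 : b \in `[0, 1] by rewrite in_itv/= b1 (le_trans a0).
pose D L i x := Z (g L i) x - Z a x.
have iD t : t \in `[0, 1] -> L1 mu (fun x => (Z t x - Z a x) ^+ q.*2).
  move=> t01; apply: (L1_le _ (L1Z (2 ^+ q.*2) (L1D (iZ t t01) (iZ a a01)))).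
    by apply: measurable_funX; apply: measurable_funB; exact: mZ.
  move=> x; rewrite -[Z t x ^+ _]ger0_norm ?exprn_even_ge0 ?odd_double//.
  rewrite -[Z a x ^+ _]ger0_norm ?exprn_even_ge0 ?odd_double// !normrX.
  set x1 := Z t x; set x2 := Z a x.
  have H (u v w : R) : `|w| <= 2 * `|u| -> `|w| ^+ q.*2 <= 2 ^+ q.*2 * (`|u| ^+ q.*2 + `|v| ^+ q.*2).
    move=> h; rewrite mulrDr -exprMn ler_wpDr ?mulr_ge0 ?exprn_ge0//.
    by rewrite lerXn2r// nnegrE mulr_ge0.
  have h0 := ler_normB x1 x2.
  have [h|h] := leP `|x2| `|x1|; first by apply: H; rewrite (le_trans h0)//; lra.
  by rewrite [X in _ * X]addrC; apply: H; rewrite (le_trans h0)//; lra.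
pose BL L := \bigcup_(k in `I_(2 ^ L).+1) [set x | e < `|D L k x|].
have HB L : measurable (BL L) /\
    fine (mu (BL L)) <= (e ^+ q.*2)^-1 * \int[mu]_x ((Z b x - Z a x) ^+ q.*2).
  have [] := @doob_discrete _ _ _ mu q (2 ^ L) (D L) (fun i => natural_filtration Z (g L i)) e q12 e0.
  - by move=> k; exact: natural_filtration_sigma.
  - move=> k; apply: natural_filtration_sub => //.
    by have := g01 L k; rewrite in_itv/= => /andP[].
  - by move=> j k jk; apply: natural_filtration_mono; exact: gmono.
  - move=> k; apply: measurable_wrtB; first exact: natural_filtration_sigma.
      apply: natural_filtration_adapted; rewrite in_itv/= lexx andbT.
      by have := g01 L k; rewrite in_itv/= => /andP[].
    apply: natural_filtration_adapted; rewrite in_itv/= a0.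
    by have /andP[] := gab L k.
  - by move=> k _; exact: iD.
  - move=> k A _ FA; have h := g01 L k; rewrite in_itv/= in h.
    have /andP[h1 h2] := h.
    have := @Zmart (g L k) (g L (2 ^ L)%N) A h1.
    rewrite gK; have /andP[_ h3] := gab L k => /(_ h3 b1 FA) <-.
    apply: eq_Rintegral => x _; rewrite /D gK; congr (_ * _); ring.
  - by move=> h1 h2; split=> //; rewrite (le_trans h2)// /D gK.
have BLmono : nondecreasing_seq BL.
  apply/nondecreasing_seqP => L; apply/subsetPset => x [i /= iL h].
  exists (i.*2)%N => /=.
    by rewrite ltnS expnS mul2n leq_double.
  suff -> : D L.+1 i.*2 x = D L i x by [].
  rewrite /D; congr (Z _ x - _); rewrite /g; congr (_ + _).
  rewrite (minn_idPl _); last by rewrite expnS mul2n leq_double.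
  rewrite (minn_idPl _)// -mul2n natrM exprS; field.
  by rewrite gt_eqF.
exists (\bigcup_L BL L); split.
- by apply: bigcup_measurable => L _; have [] := HB L.
- have mBL L : measurable (BL L) by have [] := HB L.
  have cB := nondecreasing_cvg_mu mBL (bigcup_measurable (fun L _ => mBL L)) BLmono (mu := mu).
  have fB : (mu (\bigcup_L BL L)) \is a fin_num.
    by apply: fin_num_measure; apply: bigcup_measurable.
  rewrite -lee_fin fineK//; rewrite -(cvg_lim _ cB)//.
  apply: lime_le; first by apply/cvg_ex; eexists; exact: cB.
  apply: nearW => L /=; have [_] := HB L.
  by rewrite -lee_fin fineK//; apply: fin_num_measure.
- move=> y nB.
  have Hg L i : (i <= 2 ^ L)%N -> `|Z (a + (b - a) * (i%:R / 2 ^+ L)) y - Z a y| <= e.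
    move=> iL; rewrite leNgt; apply/negP => h; apply: nB; exists L => //; exists i => //=.
    by rewrite /D /g (minn_idPl iL) -mulrA.
  move=> t; rewrite in_itv/= => /andP[a_t]; rewrite le_eqVlt => /orP[/eqP ->|tb].
    (* At [b], where no right limit inside the interval is available, the estimate is read off
       directly: [b] is the last point of the coarsest grid. *)
    have := Hg 0%N 1%N (leqnn _); rewrite expr0 divr1 mulr1.
    by rewrite [a + _]addrC subrK.
  rewrite leNgt; apply/negP => h.
  have t01 : t \in `[0, 1[ by rewrite in_itv/= (le_trans a0 a_t) (lt_le_trans tb).
  have c : (fun s => `|Z s y - Z a y|) s @[s --> t^'+] --> `|Z t y - Z a y|.
    apply: cvg_norm; apply: cvgB; [exact: Zrc|exact: cvg_cst].
  suff : ~ (\forall s \near t^'+, [pred s | e < `|Z s y - Z a y|] s).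
    by apply; exact: (cvgr_gt _ c _ h).
  apply/not_near_at_rightP => dl.
  have [L [i [iL /andP[h1 h2]]]] : exists L i, (i <= 2 ^ L)%N /\ t < a + (b - a) * (i%:R / 2 ^+ L) < Num.min b (t + dl%:num).
    apply: dyadic_between => //; last by rewrite ge_min lexx.
    by rewrite lt_min tb /= ltrDl.
  exists (a + (b - a) * (i%:R / 2 ^+ L)).
    by rewrite h1/=; move: h2; rewrite lt_min => /andP[].
  by apply/negP; rewrite -leNgt; exact: Hg.
Qed.

End doob_path.

(** * Normal laws: moments and cosine transform through Stein's identity *)

Section ftc_line.
Context {R : realType}.
Notation leb := (@lebesgue_measure R).

(** The fundamental theorem of calculus on [-n, n], followed by dominated convergence; the boundary
    terms are controlled along integers. *)
Lemma FTC_line (F f : R -> R) : (forall x, is_derive x (1 : R) F (f x)) ->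
  continuous f -> leb.-integrable setT (EFin \o f) ->
  F n%:R @[n --> \oo] --> (0 : R) -> F (- n%:R) @[n --> \oo] --> (0 : R) ->
  (\int[leb]_x (f x)%:E = 0)%E.
Proof.
move=> Ff cf intf F1 F2.
pose I (n : nat) : set R := `[- n%:R, n%:R]%classic.
have mI n : measurable (I n) by exact: measurable_itv.
have mf : mfunT f by exact: continuous_measurable_fun.
have fE (n : nat) : (\int[leb]_x (f x * \1_(I n.+1) x)%:E = (F n.+1%:R - F (- n.+1%:R))%:E)%E.
  rewrite EFinB -(@continuous_FTC2 R f F)//.
  - rewrite [RHS]integral_mkcond; apply: eq_integral => x _.
    by rewrite /patch indicE; case: ifP => _; rewrite ?mulr1 ?mulr0.
  - by have n0 : 0 < n.+1%:R :> R by []; lra.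
  - exact: continuous_subspaceT.
  - split.
    + by move=> x _; have := Ff x => /@ex_derive.
    + apply: cvg_at_right_filter; apply/differentiable_continuous/derivable1_diffP.
      by have := Ff (- n.+1%:R) => /@ex_derive.
    + apply: cvg_at_left_filter; apply/differentiable_continuous/derivable1_diffP.
      by have := Ff n.+1%:R => /@ex_derive.
  - by move=> x _; rewrite derive1E; have := Ff x => /@derive_val.
have [|||||_ _ h] := @dominated_convergence _ _ _ leb setT measurableT
  (fun n x => (f x * \1_(I n.+1) x)%:E) (EFin \o f) (fun x => `|(f x)%:E|%E).
- by move=> n; apply/measurable_EFinP/measurable_funM => //; exact: (measurable_indic (mI n.+1)).
- exact/measurable_EFinP.
- apply: aeW => x _; apply: cvg_near_cst; exists (Num.truncn `|x|).+1 => // n /= hn.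
  rewrite indicE mem_set ?mulr1// /I/= in_itv/= -ler_norml.
  have /andP[_ /ltW h] := truncn_itv (normr_ge0 x).
  by rewrite (le_trans h)// ler_nat ltnW.
- exact: integrable_abse.
- apply: aeW => x n _; rewrite /= lee_fin normrM indicE.
  by case: (_ \in _); rewrite ?normr1 ?normr0 ?mulr1 ?mulr0.
apply/esym; apply: (cvg_unique _ _ h); first exact: ereal_hausdorff.
rewrite (_ : (fun _ => _) = (fun n => (F n.+1%:R - F (- n.+1%:R))%:E)); last exact/funext.
apply: cvg_EFin; first exact: nearW.
rewrite -[X in _ --> X](subr0 0); apply: cvgB.
  by rewrite -(cvg_shiftS (fun n => F n%:R)) in F1.
by rewrite -(cvg_shiftS (fun n => F (- n%:R))) in F2.
Qed.

End ftc_line.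

Section normal_moments.
Context {R : realType}.
Variables (m s : R).
Hypothesis s0 : s != 0.
Notation leb := (@lebesgue_measure R).
Notation N := (normal_prob m s).

Lemma expR_ge_pow (v : R) (k : nat) : 0 <= v -> (0 < k)%N -> (v / k%:R) ^+ k <= expR v.
Proof.
move=> v0 k0; have kE : v = k%:R * (v / k%:R).
  by rewrite mulrC divfK// pnatr_eq0 -lt0n.
rewrite [in leRHS]kE expRM_natl lerXn2r ?nnegrE ?divr_ge0 ?expR_ge0//.
by rewrite (le_trans _ (expR_ge1Dx _))// lerDr.
Qed.

Lemma pow_normal_fun_le (t : R) (k : nat) (x : R) : 0 < t -> (0 < k)%N ->
  (x - m) ^+ k.*2 * expR (- (x - m) ^+ 2 / t) <= (t * k%:R) ^+ k.
Proof.
move=> t0 k0; set u := x - m.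
have := expR_ge_pow (divr_ge0 (sqr_ge0 u) (ltW t0)) k0.
rewrite mulNr expRN ler_pdivrMr ?expR_gt0// => h.
have k0' : 0 < k%:R :> R by rewrite ltr0n.
apply: le_trans (ler_wpM2l _ h); last by rewrite exprn_ge0// mulr_ge0// ltW.
rewrite -exprMn -mul2n exprM.
by rewrite (_ : t * k%:R * (u ^+ 2 / t / k%:R) = u ^+ 2)//; field; rewrite !gt_eqF.
Qed.

(** The density coincides almost everywhere with the Radon-Nikodym derivative of the law, to which
    the change of variables formula applies. *)
Lemma ge0_integral_normal (f : R -> R) : mfunT f -> (forall x, 0 <= f x) ->
  (\int[N]_x (f x)%:E = \int[leb]_x (f x * normal_pdf m s x)%:E)%E.
Proof.
move=> mf f0; have dom := @normal_prob_dominates R m s.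
rewrite -(@Radon_Nikodym_SigmaFinite.change_of_variables _ _ _ _ _ dom)//; last first.
  exact/measurable_EFinP.
apply: ae_eq_integral => //.
- apply: emeasurable_funM => //; first exact/measurable_EFinP.
  by apply: measurable_int; exact: Radon_Nikodym_SigmaFinite.f_integrable.
- apply/measurable_EFinP/measurable_funM => //; exact: measurable_normal_pdf.
rewrite (_ : (fun x => (f x * normal_pdf m s x)%:E) = (fun x => (f x)%:E * (normal_pdf m s x)%:E)%E)//.
apply: ae_eqe_mul2l; apply: integral_ae_eq => //.
- exact: Radon_Nikodym_SigmaFinite.f_integrable.
- by apply/measurable_EFinP; exact: measurable_normal_pdf.
- by move=> E _ mE; rewrite -Radon_Nikodym_SigmaFinite.f_integral.
Qed.

Lemma L1_normal_leb (f : R -> R) : mfunT f ->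
  L1 N f <-> L1 leb (fun x => f x * normal_pdf m s x).
Proof.
move=> mf; have mabs := measurableT_comp (@normr_measurable R setT) mf.
have key := ge0_integral_normal mabs (fun=> normr_ge0 _).
split=> /integrableP[_ h]; apply/integrableP; split.
- by apply/measurable_EFinP/measurable_funM => //; exact: measurable_normal_pdf.
- move: h; rewrite key; congr (_ < _)%E; apply: eq_integral => x _ /=.
  by rewrite normrM (ger0_norm (normal_pdf_ge0 _ _ _)).
- exact/measurable_EFinP.
- rewrite key; move: h; congr (_ < _)%E; apply: eq_integral => x _ /=.
  by rewrite normrM (ger0_norm (normal_pdf_ge0 _ _ _)).
Qed.

Lemma integral_normal (f : R -> R) : L1 N f ->
  (\int[N]_x (f x)%:E = \int[leb]_x (f x * normal_pdf m s x)%:E)%E.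
Proof.
move=> hf; have mf := L1_measurable hf; have /(L1_normal_leb mf) hl := hf.
pose fp x := Num.max (f x) 0; pose fn x := Num.max (- f x) 0.
have fE x : f x = fp x - fn x.
  by rewrite /fp /fn; case: (leP (f x) 0) => h; case: (leP (- f x) 0) => h2; lra.
have mfp : mfunT fp by exact: measurable_maxr.
have mfn : mfunT fn by apply: measurable_maxr => //; exact: measurableT_comp.
have fp0 x : 0 <= fp x by rewrite le_max lexx orbT.
have fn0 x : 0 <= fn x by rewrite le_max lexx orbT.
have hfp : L1 N fp.
  apply: (@L1_le _ _ _ N fp (fun x => `|f x|)) => // [|x]; [exact: L1_abs|rewrite ger0_norm//].
  by rewrite ge_max ler_norm normr_ge0.
have hfn : L1 N fn.
  apply: (@L1_le _ _ _ N fn (fun x => `|f x|)) => // [|x]; [exact: L1_abs|rewrite ger0_norm//].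
  by rewrite ge_max -normrN ler_norm normr_ge0.
under eq_integral do rewrite fE EFinB.
rewrite integralB//= !ge0_integral_normal// -integralB//=; last 2 first.
- exact/L1_normal_leb.
- exact/L1_normal_leb.
by apply: eq_integral => x _; rewrite -EFinB -mulrBl -fE.
Qed.

Lemma normal_pdf_exp x : normal_pdf m s x = normal_peak s * expR (- (x - m) ^+ 2 / (s ^+ 2 *+ 2)).
Proof. by rewrite normal_pdfE. Qed.

Lemma L1_normal_pow (k : nat) : L1 N (fun x => (x - m) ^+ k.*2).
Proof.
have [->|k0] := posnP k; first by under eq_fun do rewrite expr0; exact: L1_cst.
have mp : mfunT (fun x : R => (x - m) ^+ k.*2).
  by apply: measurable_funX; exact: measurable_funB.
apply/L1_normal_leb => //.
(* The dominating function is a multiple of the normal density of variance 2 s^2: half of the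
   exponent is that density, the other half absorbs the power of x - m. *)
pose s2 := s * Num.sqrt 2.
have s20 : s2 != 0 by rewrite mulf_neq0// gt_eqF// sqrtr_gt0.
have s2E : s2 ^+ 2 *+ 2 = s ^+ 2 * 4 by rewrite exprMn sqr_sqrtr// -mulr_natr; ring.
have sp : 0 < s ^+ 2 by rewrite exprn_even_gt0.
pose c := normal_peak s * (s ^+ 2 * 4 * k%:R) ^+ k / normal_peak s2.
apply: (le_integrable _ _ _ (integrableZl _ c (integrable_normal_pdf m s2))) => //.
  by apply/measurable_EFinP/measurable_funM => //; exact: measurable_normal_pdf.
move=> x _ /=; rewrite lee_fin normal_pdf_exp normal_pdfE// /normal_fun s2E.
have e0 (a : R) : `|expR a| = expR a by rewrite ger0_norm// expR_ge0.
rewrite !normrM !e0 !(ger0_norm (normal_peak_ge0 _)).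
have -> : `|(normal_peak s2)^-1| = (normal_peak s2)^-1 by rewrite ger0_norm// invr_ge0 normal_peak_ge0.
rewrite [leRHS]mulrA divfK; last by rewrite gt_eqF// normal_peak_gt0.
have -> : expR (- (x - m) ^+ 2 / (s ^+ 2 *+ 2)) =
   expR (- (x - m) ^+ 2 / (s ^+ 2 * 4)) * expR (- (x - m) ^+ 2 / (s ^+ 2 * 4)).
  by rewrite -expRD; congr expR; rewrite -mulr_natr; field; rewrite ?s0.
rewrite mulrCA -[leRHS]mulrA ler_wpM2l ?normal_peak_ge0// mulrA ler_wpM2r ?expR_ge0//.
rewrite [`|_ ^+ k.*2|]ger0_norm ?exprn_even_ge0 ?odd_double//.
apply: le_trans (ler_norm _).
by apply: pow_normal_fun_le => //; rewrite mulr_gt0.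
Qed.

(** Stein's identity: the derivative of [F] times the density is the density times f - F (x - m) /
    s^2, and it integrates to zero. Mean, variance, fourth moment and cosine transform are all
    instances; growth of order four is allowed so as to cover F = (x - m)^3. *)
Lemma normal_stein (F f : R -> R) (K : R) :
  (forall x, is_derive x (1 : R) F (f x)) -> continuous f ->
  (forall x, `|F x| <= K * (1 + (x - m) ^+ 4)) ->
  (forall x, `|f x| <= K * (1 + (x - m) ^+ 4)) ->
  [/\ L1 N f, L1 N (fun x => F x * (x - m)) &
      \int[N]_x (F x * (x - m)) = s ^+ 2 * \int[N]_x f x].
Proof.
move=> Ff cf FK fK.
have sp : 0 < s ^+ 2 by rewrite exprn_even_gt0.
have cF : continuous F.
  by move=> x; apply/differentiable_continuous/derivable1_diffP; have := Ff x => /@ex_derive.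
have K0 : 0 <= K.
  by have := FK m; rewrite subrr expr0n/= addr0 mulr1; exact: le_trans.
have mF : mfunT F by exact: continuous_measurable_fun.
have mf : mfunT f by exact: continuous_measurable_fun.
have mx : mfunT (fun x : R => x - m) by exact: measurable_funB.
have h2 := L1_normal_pow 1; have h4 := L1_normal_pow 2; have h6 := L1_normal_pow 3.
rewrite /= in h2 h4 h6.
have c1 : L1 N (fun _ : R => 1 : R) by exact: L1_cst.
have hf : L1 N f.
  apply: (@L1_le _ _ _ N f (fun x => K * (1 + (x - m) ^+ 4))) => //.
  by apply: L1Z; exact: L1D.
have hFx : L1 N (fun x => F x * (x - m)).
  apply: (@L1_le _ _ _ N _ (fun x => K * ((1 + (x - m) ^+ 4) * (1 + (x - m) ^+ 2)))).
  - exact: measurable_funM.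
  - apply: L1Z.
    rewrite (_ : (fun x => _) = (fun x => (1 + (x - m) ^+ 2) + ((x - m) ^+ 4 + (x - m) ^+ 6))).
      by apply: L1D; exact: L1D.
    by apply/funext => x; ring.
  - move=> x; rewrite normrM mulrA; apply: ler_pM => //.
    rewrite ler_norml; have := sqr_ge0 (x - m - 1); have := sqr_ge0 (x - m + 1).
    by rewrite !expr2; nra.
split => //.
pose w := normal_pdf m s.
have wE x : w x = normal_peak s * expR (- (x - m) ^+ 2 / (s ^+ 2 *+ 2)) by exact: normal_pdf_exp.
have dw x : is_derive x (1 : R) w (- (x - m) / s ^+ 2 * w x).
  rewrite (_ : w = (fun x => normal_peak s * expR (- (x - m) ^+ 2 / (s ^+ 2 *+ 2)))); last exact/funext.
  apply: is_derive_eq.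
  by rewrite /GRing.scale /= -[s ^+ 2 *+ 2]mulr_natr; field; rewrite ?s0.
pose H x := F x * w x; pose h x := (f x - F x * (x - m) / s ^+ 2) * w x.
have dH x : is_derive x (1 : R) H (h x).
  have := Ff x; have := dw x => *.
  by apply: is_derive_eq; rewrite /GRing.scale/= /h; field; rewrite s0.
have cw : continuous w by exact: continuous_normal_pdf.
have cx : continuous (fun x : R => x - m).
  by move=> x; apply: cvgB; [exact: cvg_id|exact: cvg_cst].
have ch : continuous h.
  move=> x; apply: cvgM; last exact: cw.
  apply: cvgB; first exact: cf.
  by apply: cvgM; [apply: cvgM; [exact: cF|exact: cx]|exact: cvg_cst].
have ihh : L1 N (fun x => f x - F x * (x - m) / s ^+ 2).
  apply: L1B => //.
  rewrite (_ : (fun x => _) = (fun x => (s ^+ 2)^-1 * (F x * (x - m)))); first exact: L1Z.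
  by apply/funext => x; rewrite mulrC.
have mhh := L1_measurable ihh.
have intH : (@lebesgue_measure R).-integrable setT (EFin \o h) by exact/L1_normal_leb.
(* Decay of [F] times the density like 1 / (1 + (x - m)^2). Multiplied by 1 + (x - m)^2, the growth
   bound on [F] has degree 6, whence the powers 2, 4 and 6 below. *)
have HB : exists B, forall x, `|H x| <= B / (1 + (x - m) ^+ 2).
  pose t := s ^+ 2 *+ 2.
  have t0 : 0 < t by rewrite mulrn_wgt0.
  have w0 x : 0 <= w x by exact: normal_pdf_ge0.
  have p0 : 0 <= normal_peak s by exact: normal_peak_ge0.
  have wk k x : (0 < k)%N -> (x - m) ^+ k.*2 * w x <= normal_peak s * (t * k%:R) ^+ k.
    by move=> k0; rewrite wE mulrCA ler_wpM2l//; exact: pow_normal_fun_le.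
  exists (K * (normal_peak s * (1 + (t * 1) ^+ 1 + (t * 2) ^+ 2 + (t * 3) ^+ 3))) => x.
  have u0 : 0 < 1 + (x - m) ^+ 2 by rewrite ltr_wpDr// sqr_ge0.
  rewrite ler_pdivlMr// /H normrM (ger0_norm (w0 x)).
  apply: (@le_trans _ _ (K * ((1 + (x - m) ^+ 4) * w x * (1 + (x - m) ^+ 2)))).
    rewrite [leRHS](_ : _ = K * (1 + (x - m) ^+ 4) * (w x * (1 + (x - m) ^+ 2))); last by ring.
    rewrite -[leLHS]mulrA; apply: ler_wpM2r; [by rewrite mulr_ge0// ltW|exact: FK].
  rewrite ler_wpM2l//.
  have w1 := normal_pdf_ub m x s0.
  have := wk 1%N x isT; have := wk 2%N x isT; have := wk 3%N x isT.
  rewrite -[1.*2]/2%N -[2.*2]/4%N -[3.*2]/6%N -/w in w1 *.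
  move=> h6' h4' h2'.
  rewrite [leRHS](_ : _ = normal_peak s + normal_peak s * (t * 1) ^+ 1 + normal_peak s * (t * 2) ^+ 2 + normal_peak s * (t * 3) ^+ 3); last by ring.
  rewrite [leLHS](_ : _ = w x + (x - m) ^+ 2 * w x + (x - m) ^+ 4 * w x + (x - m) ^+ 6 * w x); last by ring.
  by rewrite !lerD.
have [B HB'] := HB.
have B0 : 0 <= B.
  by have := le_trans (normr_ge0 _) (HB' m); rewrite subrr expr0n/= addr0 divr1.
have Hcv (u : nat -> R) : (forall n, (n%:R <= `|u n|)) -> H (u n) @[n --> \oo] --> (0 : R).
  move=> hu; apply/cvgrPdist_le => /= e e0; exists (Num.truncn (`|m| + 1 + B / e)).+1 => // n /= hn.
  rewrite sub0r normrN (le_trans (HB' _))//.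
  have nb : `|m| + 1 + B / e <= n%:R.
    have q0 : 0 <= `|m| + 1 + B / e by rewrite !addr_ge0// divr_ge0// ltW.
    have /andP[_ /ltW hq] := truncn_itv q0.
    by rewrite (le_trans hq)// ler_nat.
  have u0 : 0 < 1 + (u n - m) ^+ 2 by rewrite ltr_wpDr// sqr_ge0.
  rewrite ler_pdivrMr// mulrC -ler_pdivrMr//.
  have Be : 0 <= B / e by rewrite divr_ge0// ltW.
  have h1 : B / e + 1 <= `|u n - m|.
    by have := ler_norm (`|u n| - `|m|); have := lerB_dist (u n) m; have := hu n; lra.
  have : (B / e + 1) ^+ 2 <= (u n - m) ^+ 2.
    by rewrite -[leRHS]real_normK ?num_real// lerXn2r// nnegrE; lra.
  by nra.
have hn1 (n : nat) : n%:R <= `|(n%:R : R)| by rewrite normr_nat.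
have hn2 (n : nat) : n%:R <= `|(- n%:R : R)| by rewrite normrN normr_nat.
have := FTC_line dH ch intH (Hcv _ hn1) (Hcv _ hn2).
rewrite -integral_normal// EFin_Rint// => /(congr1 (@fine R)) /=.
have iF2 : L1 N (fun x => (s ^+ 2)^-1 * (F x * (x - m))) by exact: L1Z.
rewrite (_ : (fun x => f x - F x * (x - m) / s ^+ 2) = (fun x => f x - (s ^+ 2)^-1 * (F x * (x - m)))); last first.
  by apply/funext => x; rewrite [X in _ - X]mulrC.
rewrite RintB// RintZ// => /eqP; rewrite subr_eq0 => /eqP ->.
by rewrite mulrA divff ?mul1r// gt_eqF.
Qed.

Lemma cst_bound (c x : R) : `|c| <= `|c| * (1 + (x - m) ^+ 4).
Proof. by rewrite ler_peMr// lerDl exprn_even_ge0. Qed.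

Lemma norm_pow_le4 (x : R) k : (k <= 4)%N -> `|(x - m) ^+ k| <= 1 + (x - m) ^+ 4.
Proof.
move=> k4; rewrite normrX -[(x - m) ^+ 4]ger0_norm ?exprn_even_ge0// normrX.
have [h|h] := leP `|x - m| 1; first by rewrite (le_trans (exprn_ile1 _ _ _))// lerDl exprn_ge0.
by rewrite (le_trans (ler_weXn2l (ltW h) k4))// lerDr.
Qed.

Lemma normal_mean : \int[N]_x (x - m) = 0.
Proof.
have [|x|x|_ _] := @normal_stein (fun=> 1) (fun=> 0) 1.
- by move=> x; exact: cvg_cst.
- by have := cst_bound 1 x; rewrite normr1.
- by rewrite normr0 mul1r addr_ge0// exprn_even_ge0.
by rewrite Rint_cst mulr0; under eq_Rintegral do rewrite mul1r.
Qed.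

Lemma normal_variance : \int[N]_x ((x - m) ^+ 2) = s ^+ 2.
Proof.
have [x||x|x|_ _] := @normal_stein (fun x => x - m) (fun=> 1) 1.
- by apply: is_derive_eq; rewrite subr0.
- by move=> x; exact: cvg_cst.
- by rewrite mul1r; exact: (@norm_pow_le4 x 1).
- by have := cst_bound 1 x; rewrite normr1.
by rewrite Rint_cst mulr1; under eq_Rintegral do rewrite -expr2.
Qed.

Lemma normal_moment4 : \int[N]_x ((x - m) ^+ 4) = 3 * s ^+ 4.
Proof.
have [x||x|x|_ _] := @normal_stein (fun x => (x - m) ^+ 3) (fun x => 3 * (x - m) ^+ 2) 3.
- by apply: is_derive_eq; rewrite /GRing.scale/=; ring.
- move=> x; apply: cvgM; first exact: cvg_cst.
  apply: (@continuous_comp _ _ _ (fun x => x - m) (fun x : R => x ^+ 2)).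
    by apply: cvgB; [exact: cvg_id|exact: cvg_cst].
  exact: exprn_continuous.
- have := @norm_pow_le4 x 3%N isT; have : 0 <= 1 + (x - m) ^+ 4 by rewrite addr_ge0// exprn_even_ge0.
  by move=> h1 h2; rewrite (le_trans h2)// ler_peMl//; lra.
- by rewrite normrM ger0_norm// ler_wpM2l//; exact: (@norm_pow_le4 x 2).
rewrite RintZ; last exact: (L1_normal_pow 1).
rewrite normal_variance; under eq_Rintegral do rewrite -exprSr.
by move=> ->; ring.
Qed.

Hypothesis m0 : m = 0.

(** The phase [c] lets cosines alone carry the whole characteristic function: c = 0 and c = - pi / 2
    give its real and imaginary parts. *)
Let psi (c a : R) := \int[N]_x cos (a * x + c).

(** Differentiating under the integral gives minus the mean of x sin (a x + c); Stein's identity for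
    the sine turns it into - s^2 a times the transform itself. *)
Lemma is_derive_psi (c a : R) : is_derive a (1 : R) (psi c) (- (s ^+ 2 * a) * psi c a).
Proof.
have mcos b : mfunT (fun x : R => cos (b * x + c)).
  apply: (measurableT_comp (f := cos)); first exact: (continuous_measurable_fun (@continuous_cos R)).
  by apply: measurable_funD => //; exact: measurable_funM.
have dlin (x b : R) : is_derive b (1 : R) (fun b => b * x + c) x.
  by apply: is_derive_eq; rewrite /GRing.scale/=; ring.
have dcos (x b : R) : is_derive b (1 : R) (fun b => cos (b * x + c)) (- x * sin (b * x + c)).
  have := dlin x b => ?.
  by apply: is_derive_eq; rewrite /GRing.scale/=; ring.
have Ia : `]a - 1, a + 1[%classic a by rewrite /= in_itv/=; apply/andP; split; lra.
have L1x : L1 N (fun x => `|x|).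
  apply: (@L1_le _ _ _ N _ (fun x => 1 + (x - m) ^+ 4)) => //.
    exact: normr_measurable.
    by apply: L1D; [exact: L1_cst|exact: (L1_normal_pow 2)].
  by move=> x; rewrite normr_id -[x in `|x|](subr0 x) -{1}m0; exact: (@norm_pow_le4 x 1).
pose f b x := cos (b * x + c).
have d1 b x : partial1of2 f b x = - x * sin (b * x + c).
  by rewrite /partial1of2 derive1E; have := dcos x b => /@derive_val.
have intf b : `]a - 1, a + 1[%classic b -> L1 N (f b).
  move=> _; apply: (@L1_bounded _ _ _ N _ 1) => [|x]; first exact: mcos.
  by rewrite ler_norml cos_geN1 cos_le1.
have derf b x : `]a - 1, a + 1[%classic b -> setT x -> derivable (f ^~ x) b 1.
  by move=> _ _; have := dcos x b => /@ex_derive.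
have ub b x : `]a - 1, a + 1[%classic b -> setT x -> `|partial1of2 f b x| <= `|x|.
  move=> _ _; rewrite d1 normrM normrN ler_piMr// ler_norml sin_geN1 sin_le1//.
have D1 := @differentiation_under_integral R _ _ N f setT measurableT a _ _ Ia intf derf _ (fun=> normr_ge0 _) L1x ub.
have D2 := @derivable_under_integral R _ _ N f setT measurableT a _ _ Ia intf derf _ (fun=> normr_ge0 _) L1x ub.
apply: DeriveDef; first exact: D2.
rewrite -derive1E D1.
have dsin (x : R) : is_derive x (1 : R) (fun x => sin (a * x + c)) (a * cos (a * x + c)).
  have : is_derive x (1 : R) (fun x => a * x + c) a.
    by apply: is_derive_eq; rewrite /GRing.scale/=; ring.
  move=> ?; by apply: is_derive_eq; rewrite /GRing.scale/=; ring.
have cc : continuous (fun x : R => a * cos (a * x + c)).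
  move=> x; apply: cvgM; first exact: cvg_cst.
  apply: (@continuous_comp _ _ _ (fun x => a * x + c) cos); last exact: continuous_cos.
  by apply: cvgD; [apply: cvgM; [exact: cvg_cst|exact: cvg_id]|exact: cvg_cst].
have [x|x|i1 i2] := @normal_stein _ _ (1 + `|a|) dsin cc.
- rewrite (@le_trans _ _ 1)//; first by rewrite ler_norml sin_geN1 sin_le1.
  have : 0 <= (x - m) ^+ 4 by rewrite exprn_even_ge0.
  by have := normr_ge0 a; nra.
- rewrite normrM (@le_trans _ _ `|a|)//.
    by rewrite ler_piMr// ler_norml cos_geN1 cos_le1.
  have : 0 <= (x - m) ^+ 4 by rewrite exprn_even_ge0.
  by have := normr_ge0 a; nra.
rewrite RintZ; last exact: (intf a).
move=> e; transitivity (- (\int[N]_x (sin (a * x + c) * (x - m)))).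
  rewrite -mulN1r -RintZ//; apply: eq_Rintegral => x _.
  by rewrite d1 m0 subr0; ring.
by rewrite e /psi; ring.
Qed.

(** By this differential equation [psi] times exp (s^2 a^2 / 2) is constant in [a], equal to its
    value at 0. *)
Lemma normal_cos (a c : R) : \int[N]_x cos (a * x + c) = expR (- (s ^+ 2 * a ^+ 2) / 2) * cos c.
Proof.
pose H b := psi c b * expR (s ^+ 2 * b ^+ 2 / 2).
have dH b : is_derive b (1 : R) H 0.
  have := is_derive_psi c b => ?.
  by apply: is_derive_eq; rewrite /GRing.scale/=; field.
have := is_derive_0_is_cst a 0 dH; rewrite /H.
have -> : psi c 0 = cos c.
  by rewrite /psi; under eq_Rintegral do rewrite mul0r add0r; rewrite Rint_cst.
rewrite expr0n/= mulr0 mul0r expR0 mulr1 => <-.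
by rewrite mulrCA -expRD mulNr addNr expR0 mulr1.
Qed.

End normal_moments.

(** * Fubini's theorem for real integrals *)

Section probability_product.
Context {d1 d2 : measure_display} {T1 : measurableType d1} {T2 : measurableType d2} {R : realType}.
Variables (m1 : probability T1 R) (m2 : probability T2 R).
Notation prodm := (m1 \x m2)%E.
Implicit Type k : T1 * T2 -> R.

(** Splits a real integral into two nonnegative ones without asking for integrability, default
    values of [fine] included. Measurability of parametrized integrals and changes of variables thus
    follow unconditionally from the nonnegative case. *)
Lemma RintE_pos_neg (d : measure_display) (T : measurableType d) (mu : {measure set T -> \bar R}) (f : T -> R) :
  \int[mu]_x f x = fine (\int[mu]_x (Num.max (f x) 0)%:E - \int[mu]_x (Num.max (- f x) 0)%:E)%E.
Proof.
rewrite /Rintegral integralE; congr (fine (_ - _)%E); apply: eq_integral => x _.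
  by rewrite funeposE/= EFin_max.
by rewrite funenegE/= EFin_max.
Qed.

Lemma measurable_Rint2 k : mfunT k ->
  mfunT (fun x => \int[m2]_y k (x, y)).
Proof.
move=> mk; under eq_fun do rewrite RintE_pos_neg.
apply: measurableT_comp => //.
apply: emeasurable_funB.
  apply: (@measurable_fun_fubini_tonelli_F _ _ _ _ _ m2 (fun z => (Num.max (k z) 0)%:E)).
    by apply/measurable_EFinP; exact: measurable_maxr.
  by move=> x; rewrite lee_fin le_max lexx orbT.
apply: (@measurable_fun_fubini_tonelli_F _ _ _ _ _ m2 (fun z => (Num.max (- k z) 0)%:E)).
  by apply/measurable_EFinP; apply: measurable_maxr => //; exact: measurableT_comp.
by move=> x; rewrite lee_fin le_max lexx orbT.
Qed.

Lemma measurable_Rint1 k : mfunT k ->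
  mfunT (fun y => \int[m1]_x k (x, y)).
Proof.
move=> mk; under eq_fun do rewrite RintE_pos_neg.
apply: measurableT_comp => //.
apply: emeasurable_funB.
  apply: (@measurable_fun_fubini_tonelli_G _ _ _ _ _ m1 (fun z => (Num.max (k z) 0)%:E)).
    by apply/measurable_EFinP; exact: measurable_maxr.
  by move=> x; rewrite lee_fin le_max lexx orbT.
apply: (@measurable_fun_fubini_tonelli_G _ _ _ _ _ m1 (fun z => (Num.max (- k z) 0)%:E)).
  by apply/measurable_EFinP; apply: measurable_maxr => //; exact: measurableT_comp.
by move=> x; rewrite lee_fin le_max lexx orbT.
Qed.

Lemma ae_integrable (d : measure_display) (T : measurableType d) (mu : {measure set T -> \bar R}) (f g : T -> \bar R) :
  mfunT f -> {ae mu, forall x, setT x -> g x = f x} -> mu.-integrable setT g -> mu.-integrable setT f.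
Proof.
move=> mf fg /integrableP[mg hg]; apply/integrableP; split=> //.
rewrite (@ae_eq_integral _ _ _ mu setT (abse \o g))//; [exact: measurableT_comp|exact: measurableT_comp|].
by apply: filterS fg => x fgx _ /=; rewrite fgx.
Qed.

Lemma L1_prod1 k : L1 prodm k -> {ae m1, forall x, L1 m2 (fun y => k (x, y))}.
Proof. exact: ae_integrable1. Qed.

Lemma L1_prod2 k : L1 prodm k -> {ae m2, forall y, L1 m1 (fun x => k (x, y))}.
Proof. exact: ae_integrable2. Qed.

(** The inner real integral agrees with the extended one where the section is integrable, that is
    almost everywhere; the two are exchanged under the outer integral. *)
Lemma Rint_prod12 k : L1 prodm k ->
  L1 m1 (fun x => \int[m2]_y k (x, y)) /\
  \int[m1]_x \int[m2]_y k (x, y) = \int[prodm]_z k z.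
Proof.
move=> hk.
have hF := integrable_fubini_F hk.
have mk : mfunT k by move/integrableP : (hk) => [/measurable_EFinP].
have ae : {ae m1, forall x, setT x -> fubini_F m2 (EFin \o k) x = (\int[m2]_y k (x, y))%:E}.
  by apply: filterS (L1_prod1 hk) => x hx _; rewrite /fubini_F /= EFin_Rint.
have mR : mfunT (EFin \o (fun x => \int[m2]_y k (x, y))).
  by apply/measurable_EFinP; exact: measurable_Rint2.
split.
  exact: ae_integrable mR ae hF.
rewrite /Rintegral -(integral12_prod_meas1 hk); congr fine.
apply: ae_eq_integral => //; first exact: measurable_int hF.
by apply: filterS ae => x hx /hx ->.
Qed.

Lemma Rint_prod21 k : L1 prodm k ->
  L1 m2 (fun y => \int[m1]_x k (x, y)) /\
  \int[m2]_y \int[m1]_x k (x, y) = \int[prodm]_z k z.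
Proof.
move=> hk.
have mk : mfunT k by move/integrableP : (hk) => [/measurable_EFinP].
have hG : m2.-integrable setT (fubini_G m1 (EFin \o k)).
  apply/integrableP; split; first exact: (measurable_fubini_G hk).
  have h := @integrable21ltyP _ _ _ _ _ m1 m2 (EFin \o k) (measurable_int _ hk).
  apply: le_lt_trans (h.1 hk); apply: ge0_le_integral => //.
  - by apply: measurableT_comp => //; exact: (measurable_fubini_G hk).
  - apply: (@measurable_fun_fubini_tonelli_G _ _ _ _ _ m1 (fun z => `|(k z)%:E|%E)) => //.
    by apply: measurableT_comp => //; exact/measurable_EFinP.
  - move=> y _; apply: le_abse_integral => //.
    by apply/measurable_EFinP; exact: measurableT_comp.
have ae : {ae m2, forall y, setT y -> fubini_G m1 (EFin \o k) y = (\int[m1]_x k (x, y))%:E}.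
  by apply: filterS (L1_prod2 hk) => x hx _; rewrite /fubini_G /= EFin_Rint.
have mR : mfunT (EFin \o (fun y => \int[m1]_x k (x, y))).
  by apply/measurable_EFinP; exact: measurable_Rint1.
split.
  exact: ae_integrable mR ae hG.
rewrite /Rintegral -(integral21_prod_meas1 hk); congr fine.
apply: ae_eq_integral => //; first exact: measurable_int hG.
by apply: filterS ae => x hx /hx ->.
Qed.

End probability_product.

(** * Integration against a counting path *)

Section jumps.
Context {R : realType}.
Implicit Type f : cumulative R R.

Definition njumps f : nat := Num.truncn (f 1).

(* the value 2 encodes that there is no [k+1]-st jump in [0, 1] *)
Definition jump f (k : nat) : R :=
  if k.+1%:R <= f 1 then inf [set t | t \in `[0, 1] /\ k.+1%:R <= f t] else 2.

(** The integral of [h] against the path over (0, t], as a finite sum over jump times; it agrees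
    with [int_dN] for measurable [h]. The jumps summed are those in [0, 1], whatever [t]. *)
Definition jsum f (h : R -> R) (t : R) : R :=
  \sum_(k < njumps f) h (jump f k) * (jump f k <= t)%R%:R.

Lemma counting_path_homo f s t : s <= t -> f s <= f t.
Proof. exact: cumulative_is_nondecreasing. Qed.

Variable f : cumulative R R.
Hypothesis hf : counting_path f.

Let f0 : f 0 = 0. Proof. by case: hf. Qed.
Let in01_1 : (1 : R) \in `[0, 1]. Proof. by rewrite in_itv/= ler01 lexx. Qed.

Lemma counting_path_nat t : t \in `[0, 1] -> exists n : nat, f t = n%:R.
Proof. by case: hf => _ h _ /h /natrP. Qed.

Lemma njumpsE : f 1 = (njumps f)%:R.
Proof. by have [n fn] := counting_path_nat in01_1; rewrite /njumps fn natrK. Qed.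

Lemma counting_path_ge0 t : 0 <= t -> 0 <= f t.
Proof. by move=> t0; rewrite -f0; exact: counting_path_homo. Qed.

(** Right-continuity makes the infimum attained, so jump times and values of the path determine each
    other. The facts on jumps below rest on this equivalence. *)
Lemma jump_le k t : t \in `[0, 1] -> (jump f k <= t) = (k.+1%:R <= f t).
Proof.
rewrite in_itv/= => /andP[t0 t1]; rewrite /jump; case: ifPn => h1; last first.
  have -> : (2 <= t) = false by apply/negbTE; rewrite -ltNge; lra.
  apply/esym/negbTE; rewrite -!ltNge in h1 *.
  by rewrite (le_lt_trans _ h1)//; exact: counting_path_homo.
have hi : has_inf [set t | t \in `[0, 1] /\ k.+1%:R <= f t].
  split; first by exists 1; split.
  by exists 0 => s [+ _]; rewrite in_itv/= => /andP[].
apply/idP/idP => [it|kt].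
  rewrite leNgt; apply/negP => ft.
  have rc := cumulative_is_right_continuous f t.
  have [t1'|] := ltP t 1; last first.
    by move=> t1'; move: ft; rewrite (_ : t = 1) ?ltNge ?h1//; apply/eqP; rewrite eq_le t1 t1'.
  have hn : \forall s \near t^'+, f s < k.+1%:R by exact: (cvgr_lt _ rc _ ft).
  have [s [ts s1 fs]] : exists s, [/\ t < s, s <= 1 & f s < k.+1%:R].
    near t^'+ => s; exists s; split; last by near: s.
      by near: s; exact: nbhs_right_gt.
    by near: s; exact: nbhs_right_le.
  have st0 : 0 < s - t by rewrite subr_gt0.
  have [u [u01 ku] us] := inf_adherent st0 hi.
  have : f u <= f s by apply: counting_path_homo; lra.
  by rewrite leNgt (lt_le_trans fs ku).
by apply: inf_lbound; [case: hi|split=> //; rewrite in_itv/= t0].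
Unshelve. all: by end_near. Qed.

Lemma jump_gt0 k : 0 < jump f k.
Proof.
by rewrite ltNge jump_le ?f0 ?in_itv/= ?lexx ?ler01// -ltNge ltr0n.
Qed.

Lemma jump_le1 k : (jump f k <= 1) = (k < njumps f)%N.
Proof. by rewrite jump_le// njumpsE ler_nat. Qed.

(** If two successive jumps coincided at t, the path would be at least k + 2 there with a left limit
    at most k, against jumps of size at most 1. *)
Lemma jump_homo k : jump f k <= 1 -> jump f k < jump f k.+1.
Proof.
move=> h1; set t := jump f k.
have t01 : t \in `]0, 1] by rewrite in_itv/= jump_gt0.
have t01' : t \in `[0, 1] by rewrite in_itv/= h1 ltW// jump_gt0.
rewrite ltNge jump_le//; apply/negP => h2.
have [_ _ /(_ _ t01)] := hf; apply/negP; rewrite -ltNge.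
have : lim (f s @[s --> t^'-]) <= k%:R.
  apply: limr_le.
    apply: nondecreasing_at_left_is_cvgr; first by apply: nearW => x a b _ _; exact: counting_path_homo.
    by apply: nearW => x; exists (f t) => _ [y /= + <-]; rewrite in_itv/= => /andP[_ /ltW]; exact: counting_path_homo.
  near=> s.
  have s01 : s \in `[0, 1].
    rewrite in_itv/=; apply/andP; split.
      by near: s; apply: nbhs_left_ge; rewrite /t jump_gt0.
    by rewrite (le_trans _ h1)//; near: s; exact: nbhs_left_le.
  have : s < t by near: s; exact: nbhs_left_lt.
  rewrite ltNge jump_le//; have [n ->] := counting_path_nat s01.
  by rewrite !ler_nat -ltnNge ltnS.
rewrite -natr1 -natr1 in h2; lra.
Unshelve. all: by end_near. Qed.

Lemma stieltjes_ocitv a b : a <= b ->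
  lebesgue_stieltjes_measure f `]a, b]%classic = (f b - f a)%:E.
Proof.
move=> ab; rewrite /lebesgue_stieltjes_measure/= /measure_extension/= measurable_mu_extE/=; last exact: is_ocitv.
by rewrite wlength_itv_bnd.
Qed.

Definition jump_measure : {measure set (measurableTypeR R) -> \bar R} :=
  msum (fun k => dirac (jump f k : measurableTypeR R)) (njumps f).

Lemma jump_measureE (A : set R) : jump_measure A = (\sum_(k < njumps f) \1_A (jump f k))%:E.
Proof. by rewrite /jump_measure/= /msum -sumEFin. Qed.

Lemma jump_measure_ocitv a b : a \in `[0, 1] -> b \in `[0, 1] -> a <= b ->
  jump_measure `]a, b]%classic = (f b - f a)%:E.
Proof.
move=> a01 b01 ab; rewrite jump_measureE; congr EFin.
have cnt t : t \in `[0, 1] -> f t = (\sum_(k < njumps f) (jump f k <= t)%R)%:R.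
  move=> t01; have [n fn] := counting_path_nat t01.
  have nj : (n <= njumps f)%N.
    by rewrite -(ler_nat R) -fn -njumpsE; apply: counting_path_homo; move: t01; rewrite in_itv/= => /andP[].
  rewrite fn -[in LHS](minn_idPr nj) -sum_ltn_minn; congr _%:R; apply: eq_bigr => k _.
  by rewrite jump_le// fn ler_nat.
rewrite (cnt b)// (cnt a)// !natr_sum -sumrB; apply: eq_bigr => k _.
rewrite indicE mem_setE in_itv/=; have [h|h] := leP (jump f k) a.
  by rewrite (le_trans h ab) subrr.
by rewrite /= subr0.
Qed.

(** Both measures give the increment of the path to half-open intervals. They are restricted to ]0,
    1] because a counting path is unconstrained elsewhere. *)
Lemma stieltjes_jumps (A : set R) : measurable A -> A `<=` `]0, 1]%classic ->
  lebesgue_stieltjes_measure f A = jump_measure A.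
Proof.
move=> mA A01.
have m01 : measurable (`]0, 1]%classic : set R) by exact: measurable_itv.
pose m1 : {measure set (measurableTypeR R) -> \bar R} := mrestr (lebesgue_stieltjes_measure f) m01.
pose m2 : {measure set (measurableTypeR R) -> \bar R} := mrestr jump_measure m01.
(* Intersecting with ]0, 1] clamps the end points; the maximum covers an interval that becomes
   empty. *)
have ioc (a b : R) : exists c e, [/\ c \in `[0, 1], e \in `[0, 1], c <= e &
    `]a, b]%classic `&` `]0, 1]%classic = `]c, e]%classic :> set R].
  exists (clamp 0 1 a), (Num.max (clamp 0 1 a) (clamp 0 1 b)); split.
  - by rewrite in_itv/= clamp_ge clamp_le.
  - by rewrite in_itv/= le_max clamp_ge/= ge_max !clamp_le.
  - by rewrite le_max lexx.
  - apply/seteqP; split => x /=; rewrite !in_itv/=.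
      move=> [/andP[ax xb] /andP[x0 x1]]; apply/andP; split.
        by rewrite /clamp gt_max x0 gt_min ax orbT.
      by rewrite le_max; apply/orP; right; rewrite /clamp le_max le_min x1 xb orbT.
    move=> /andP[h1]; rewrite le_max leNgt h1/=.
    move: h1; rewrite /clamp gt_max gt_min => /andP[x0 h1].
    rewrite le_max leNgt x0/= le_min => /andP[x1 ->].
    by move: h1; rewrite ltNge x1/= => ->.
have := @measure_unique _ R (measurableTypeR R) (@ocitv R) (fun k => `]- k%:R, k%:R]%classic) _ _ _ _ m1 m2 _ _ A mA.
rewrite /m1 /m2 /= /mrestr (setIidl A01); apply => //.
- exact: ocitvI.
- by move=> k; exact: is_ocitv.
- apply/seteqP; split=> // x _; exists (Num.truncn `|x|).+1 => //=.
  have /andP[_ h] := truncn_itv (normr_ge0 x).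
  by rewrite in_itv/=; move: h; rewrite ltr_norml => /andP[-> /ltW ->].
- move=> X [[a b] _ <-]; have [c [e [c01 e01 ce ->]]] := ioc a b.
  by rewrite jump_measure_ocitv// stieltjes_ocitv.
- move=> k; have [c [e [c01 e01 ce ->]]] := ioc (- k%:R) k%:R.
  by rewrite stieltjes_ocitv// ltry.
Qed.

Lemma int_dN_jsum (h : R -> R) t : measurable_fun (`]0, 1]%classic : set R) h ->
  t \in `[0, 1] -> int_dN f h t = jsum f h t.
Proof.
move=> mh t01; rewrite /int_dN /Rintegral.
have sub : (`]0, t]%classic : set R) `<=` `]0, 1]%classic.
  move: t01; rewrite in_itv/= => /andP[_ t1] x /=; rewrite !in_itv/= => /andP[-> /=] /le_trans; exact.
rewrite (eq_measure_integral (jump_measure)); last first.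
  by move=> A mA At; apply: stieltjes_jumps => //; exact: subset_trans sub.
have mh' := measurable_funS (measurable_itv _) sub mh.
have mt : measurable (`]0, t]%classic : set R) by exact: measurable_itv.
have key (g : R -> R) : measurable_fun (`]0, t]%classic : set R) g -> (forall x, 0 <= g x) ->
  (\int[jump_measure]_(x in `]0%R, t]) (g x)%:E = (jsum f g t)%:E)%E.
  move=> mg g0; have mgE : measurable_fun (`]0, t]%classic : set R) (EFin \o g) by exact/measurable_EFinP.
  etransitivity.
    apply: (@ge0_integral_measure_sum _ (measurableTypeR R) R
      (fun k => dirac (jump f k : measurableTypeR R)) _ mt (fun x => (g x)%:E)) => //.
    by move=> x _; rewrite lee_fin.
  rewrite /jsum -sumEFin; apply: eq_bigr => k _.
  etransitivity; first by apply: integral_dirac => //; exact: mgE.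
  rewrite diracE mem_setE in_itv/= jump_gt0/= -EFinM mulrC.
  by [].
rewrite integralE.
have -> : ((fun x => (h x)%:E)^\+ = (fun x => (Num.max (h x) 0)%:E))%E by apply/funext => x; rewrite funeposE/= -EFin_max.
have -> : ((fun x => (h x)%:E)^\- = (fun x => (Num.max (- h x) 0)%:E))%E by apply/funext => x; rewrite funenegE/= -EFin_max.
rewrite !key; [|by apply: measurable_maxr => //; exact: measurableT_comp|by move=> x; rewrite le_max lexx orbT|exact: measurable_maxr|by move=> x; rewrite le_max lexx orbT].
rewrite /= /jsum -sumrB; apply: eq_bigr => k _; rewrite -mulrBl; congr (_ * _).
by case: (leP (h (jump f k)) 0) => h1; case: (leP (- h (jump f k)) 0) => h2; lra.
Qed.

Lemma jsum_widen (h : R -> R) t K : (njumps f <= K)%N -> t \in `[0, 1] ->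
  jsum f h t = \sum_(k < K) h (jump f k) * (jump f k <= t)%R%:R.
Proof.
move=> nK t01; rewrite /jsum (big_ord_widen_cond _ predT (fun k => h (jump f k) * (jump f k <= t)%R%:R) nK).
rewrite big_mkcond/=; apply: eq_bigr => k _; case: ifPn => //.
rewrite -leqNgt => nk; rewrite (_ : (jump f k <= t) = false) ?mulr0//.
apply/negbTE; rewrite -ltNge (@le_lt_trans _ _ 1)//.
  by move: t01; rewrite in_itv/= => /andP[].
by rewrite ltNge jump_le1 -leqNgt.
Qed.

Lemma counting_path_jsum t : t \in `[0, 1] -> f t = jsum f (fun=> 1) t.
Proof.
move=> t01; have [n fn] := counting_path_nat t01.
have nj : (n <= njumps f)%N.
  by rewrite -(ler_nat R) -fn -njumpsE; apply: counting_path_homo; move: t01; rewrite in_itv/= => /andP[].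
rewrite /jsum fn -[in LHS](minn_idPr nj) -sum_ltn_minn natr_sum; apply: eq_bigr => k _.
by rewrite mul1r jump_le// fn ler_nat.
Qed.

Lemma jsumB (h : R -> R) a b : a <= b ->
  jsum f h b - jsum f h a = \sum_(k < njumps f) h (jump f k) * (a < jump f k <= b)%R%:R.
Proof.
move=> ab; rewrite /jsum -sumrB; apply: eq_bigr => k _; rewrite -mulrBr; congr (_ * _).
by have [h1|h1] /= := leP (jump f k) a; rewrite ?(le_trans h1 ab) ?subrr ?subr0.
Qed.

Lemma le_jsumB (h : R -> R) (c a b : R) : (forall x, `|h x| <= c) -> a \in `[0, 1] -> b \in `[0, 1] ->
  a <= b -> `|jsum f h b - jsum f h a| <= c * (f b - f a).
Proof.
move=> hc a01 b01 ab; rewrite (counting_path_jsum a01) (counting_path_jsum b01) !jsumB// mulr_sumr.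
apply: le_trans (ler_norm_sum _ _ _) _; apply: ler_sum => k _.
by rewrite normrM normr_nat mul1r ler_wpM2r.
Qed.

Lemma jsum0 (h : R -> R) : jsum f h 0 = 0.
Proof.
by rewrite /jsum big1// => k _; rewrite leNgt jump_gt0 mulr0.
Qed.

Lemma jump_gap : exists2 e : R, 0 < e & forall k l, (k < l < njumps f)%N -> jump f k + e <= jump f l.
Proof.
suff H K : (K <= njumps f)%N -> exists2 e : R, 0 < e & forall k l, (k < l < K)%N -> jump f k + e <= jump f l.
  by have [e] := H _ (leqnn _); exists e.
elim: K => [_|K ih nK]; first by exists 1 => // k l; rewrite ltn0 andbF.
have [e e0 he] := ih (ltnW nK).
have [->|K0] := posnP K; first by exists 1 => // k [|l]; rewrite ?ltn0// andbF.
have hK : jump f K.-1 < jump f K.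
  by rewrite -[in X in _ < X](prednK K0); apply: jump_homo; rewrite jump_le1 (leq_trans _ nK)// ltnS leq_pred.
exists (Num.min e (jump f K - jump f K.-1)); first by rewrite lt_min e0 subr_gt0.
move=> k l /andP[kl]; rewrite ltnS leq_eqVlt => /orP[/eqP lK|lK]; last first.
  by rewrite (le_trans _ (he k l _)) ?kl// lerD2l ge_min lexx.
rewrite lK in kl *; have : jump f k <= jump f K.-1.
  have : (k <= K.-1)%N by rewrite -ltnS prednK.
  rewrite leq_eqVlt => /orP[/eqP -> //|kK].
  have kK' : (k < K.-1 < K)%N by rewrite kK ltn_predL.
  by apply: le_trans (he _ _ kK'); rewrite lerDl ltW.
have : Num.min e (jump f K - jump f K.-1) <= jump f K - jump f K.-1 by rewrite ge_min lexx orbT.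
lra.
Qed.

(** As soon as the dyadic mesh is below the smallest gap between jumps, each cell contains at most
    one of them: the sum of squared increments is then exactly the sum of squared jumps, and the
    path itself moves by at most 1 in a cell. The rank depends on the path. *)
Lemma jsum_qv (h : R -> R) : \forall m \near \oo,
  \sum_(i < 2 ^ m) (jsum f h (i.+1%:R / 2 ^+ m) - jsum f h (i%:R / 2 ^+ m)) ^+ 2 =
  jsum f (fun s => h s ^+ 2) 1 /\
  forall i, (i < 2 ^ m)%N -> f (i.+1%:R / 2 ^+ m) - f (i%:R / 2 ^+ m) <= 1.
Proof.
have [e e0 he] := jump_gap.
exists (Num.truncn e^-1).+1 => // m /= hm.
have p0 : 0 < 2 ^+ m :> R by rewrite exprn_gt0.
have me : (2 ^+ m)^-1 < e.
  rewrite -[ltRHS]invrK ltf_pV2 ?posrE ?invr_gt0//.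
  have /andP[_ h1] := truncn_itv (ltW (eqbRL (invr_gt0 e) e0)).
  rewrite (lt_le_trans h1)// -natrX ler_nat (leq_trans hm)// ltnW// ltn_expl//.
have cell (i : nat) (k l : 'I_(njumps f)) : k != l ->
   (i%:R / 2 ^+ m < jump f k <= i.+1%:R / 2 ^+ m) && (i%:R / 2 ^+ m < jump f l <= i.+1%:R / 2 ^+ m) = false.
  wlog kl : k l / (k < l)%N.
    move=> H kl; have [|] := ltnP k l; first by move/H; apply.
    rewrite leq_eqVlt => /orP[/eqP lk|lk]; first by move: kl; rewrite -val_eqE /= lk eqxx.
    by rewrite andbC; apply: H => //; rewrite eq_sym.
  move=> _; apply/negbTE/negP => /andP[/andP[h1 h2] /andP[h3 h4]].
  have := he k l; rewrite kl ltn_ord => /(_ isT).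
  by move: h4; rewrite -natr1 mulrDl mul1r; lra.
have le_i (i : nat) : i%:R / 2 ^+ m <= i.+1%:R / 2 ^+ m :> R.
  by rewrite ler_pM2r ?invr_gt0// ler_nat.
have i01 i : (i <= 2 ^ m)%N -> (i%:R / 2 ^+ m : R) \in `[0, 1].
  move=> im; rewrite in_itv/= divr_ge0 ?exprn_ge0//= ler_pdivrMr// mul1r -natrX ler_nat//.
split; last first.
  move=> i im; rewrite (counting_path_jsum (i01 _ im)) (counting_path_jsum (i01 _ (ltnW im))) jsumB//.
  have [/existsP[k0 hk0]|] := boolP [exists k : 'I_(njumps f), (i%:R / 2 ^+ m < jump f k <= i.+1%:R / 2 ^+ m)].
    rewrite (bigD1 k0)//= big1 ?addr0 ?mul1r; last first.
      by move=> k kk0; have := cell i k k0 kk0; rewrite hk0 andbT mul1r => ->.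
    by case: (_ && _).
  rewrite negb_exists => /forallP hk; rewrite big1 ?ler01// => k _.
  by rewrite (negbTE (hk k)) mulr0.
under eq_bigr do rewrite jsumB//.
transitivity (\sum_(i < 2 ^ m) \sum_(k < njumps f) h (jump f k) ^+ 2 * (i%:R / 2 ^+ m < jump f k <= i.+1%:R / 2 ^+ m)%R%:R).
  apply: eq_bigr => i _; rewrite expr2 big_distrl/=; apply: eq_bigr => k _.
  rewrite big_distrr/= (bigD1 k)//= [X in _ + X]big1 ?addr0.
    by case: (_ && _); rewrite ?mulr1 ?mulr0// expr2.
  move=> l lk; rewrite mulrACA -natrM mulnb cell ?mulr0//.
  by rewrite eq_sym.
transitivity (\sum_(i < 2 ^ m) (jsum f (fun s => h s ^+ 2) (i.+1%:R / 2 ^+ m) - jsum f (fun s => h s ^+ 2) (i%:R / 2 ^+ m))).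
  by apply: eq_bigr => i _; rewrite jsumB.
rewrite -(big_mkord predT (fun i => jsum f (fun s => h s ^+ 2) (i.+1%:R / 2 ^+ m) - jsum f (fun s => h s ^+ 2) (i%:R / 2 ^+ m))).
rewrite telescope_sumr// mul0r jsum0 subr0 natrX divff// gt_eqF//.
Qed.

Lemma cvg_sumr (I U : Type) (s : seq I) (F : set_system U) (FF : Filter F) (h : I -> U -> R) (l : I -> R) :
  (forall i, h i u @[u --> F] --> l i) -> \sum_(i <- s) h i u @[u --> F] --> \sum_(i <- s) l i.
Proof.
move=> hl; elim: s => [|i s ih].
  by rewrite big_nil; under eq_fun do rewrite big_nil; exact: cvg_cst.
by rewrite big_cons; under eq_fun do rewrite big_cons; exact: cvgD.
Qed.

Lemma jsum_cadlag (h : R -> R) : cadlag (jsum f h).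
Proof.
have step (T : R) : (forall t, (fun s => (T <= s)%R%:R : R) s @[s --> t^'+] --> ((T <= t)%R%:R : R)) /\
   (forall t, cvg ((fun s => (T <= s)%R%:R : R) s @[s --> t^'-])).
  split=> t.
    have [Tt|tT] := leP T t; apply: cvg_near_cst.
      near=> s; congr (nat_of_bool _)%:R; apply: (le_trans Tt).
      by apply: ltW; near: s; exact: nbhs_right_gt.
    near=> s; have sT : s < T by near: s; exact: nbhs_right_lt.
    by rewrite leNgt sT.
  have [Tt|tT] := ltP T t.
    apply/cvg_ex; exists 1; apply: cvg_near_cst; near=> s.
    by rewrite ltW//; near: s; exact: nbhs_left_gt.
  apply/cvg_ex; exists 0; apply: cvg_near_cst; near=> s.
  have st : s < t by near: s; exact: nbhs_left_lt.
  by rewrite leNgt (lt_le_trans st tT).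
split=> t _.
  apply: cvg_sumr => k; apply: cvgM; first exact: cvg_cst.
  exact: (step _).1.
apply/cvg_ex; exists (\sum_(k < njumps f) h (jump f k) * lim ((fun s => (jump f k <= s)%R%:R : R) s @[s --> t^'-])).
apply: cvg_sumr => k; apply: cvgM; first exact: cvg_cst.
exact: (step _).2.
Unshelve. all: by end_near. Qed.

End jumps.

Section path_measurability.
Context {R : realType} {d : measure_display} {S : measurableType d}.
Variables (N : S -> cumulative R R).
Hypothesis hN : forall y, counting_path (N y).
Variable t : R.
Hypothesis t01 : t \in `[0, 1].
Hypothesis mN : forall u, u \in `[0, t] -> mfunT (fun y => N y u).

(** Jump times are stopping times: cut at [t], they are determined by the path up to [t]. The
    measurable structure on [S] is left free so that it can be taken to be the sigma-algebra at time
    [t]. *)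
Lemma measurable_jump_min k : mfunT (fun y => Num.min (jump (N y) k) t).
Proof.
apply: (measurability (@RGenOInfty.G R)); first exact: RGenOInfty.measurableE.
move=> A [_ [u ->] <-]; rewrite setTI.
have [tu|ut] := leP t u.
  rewrite (_ : _ @^-1` _ = set0) ?measurable0//; apply/seteqP; split=> y //=.
  by rewrite in_itv/= andbT lt_min => /andP[_]; rewrite ltNge tu.
have [u0|u0] := ltP u 0.
  rewrite (_ : _ @^-1` _ = setT) ?measurableT//; apply/seteqP; split=> y //= _.
  by rewrite in_itv/= andbT lt_min ut andbT (lt_trans u0)// jump_gt0.
have u01 : u \in `[0, 1] by move: t01; rewrite !in_itv/= u0/= => /andP[_]; apply: le_trans; exact: ltW.
have ut' : u \in `[0, t] by rewrite in_itv/= u0 ltW.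
rewrite (_ : _ @^-1` _ = setT `&` (fun y => N y u) @^-1` `]-oo, k.+1%:R[%classic); first exact: mN.
apply/seteqP; split=> y /=; rewrite !in_itv/= andbT lt_min ut andbT ltNge jump_le// -ltNge; first by [].
by case.
Qed.

Lemma measurable_jump_le k : measurable [set y | jump (N y) k <= t].
Proof.
rewrite [X in measurable X](_ : _ = setT `&` (fun y => N y t) @^-1` `[k.+1%:R, +oo[%classic).
  apply: mN => //; move: t01; rewrite !in_itv/= => /andP[-> _]; exact: lexx.
by apply/seteqP; split=> y /=; rewrite in_itv/= andbT jump_le// => -[].
Qed.

(** The number of summands is random; the integral is the limit of sums with a fixed number of
    terms, eventually constant for each outcome. *)
Lemma measurable_jsum (h : R * S -> R) : mfunT h ->
  mfunT (fun y => jsum (N y) (fun s => h (s, y)) t).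
Proof.
move=> mh.
pose g K y := \sum_(k < K) h (Num.min (jump (N y) k) t, y) * \1_[set y | jump (N y) k <= t] y.
apply: (@measurable_fun_cvg _ _ _ _ g).
- move=> K; apply: measurable_sum => k; apply: measurable_funM.
    apply: (measurableT_comp mh); apply: measurable_fun_pair => //.
    exact: measurable_jump_min.
  by apply: measurable_indic; exact: measurable_jump_le.
- move=> y _; apply: cvg_near_cst; exists (njumps (N y)) => // K /= hK.
  rewrite (jsum_widen (hN y) _ hK t01); apply: eq_bigr => k _; rewrite indicE.
  have [hk|hk] := boolP (jump (N y) k <= t).
    by rewrite mem_set// (min_l hk).
  by rewrite memNset ?mulr0//; apply/negP.
Qed.

End path_measurability.

(** * Lebesgue measure on [0, 1] as a probability on the line *)

Section unit_interval_measure.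
Context {R : realType}.

(* The Lebesgue measure of the library lives on a copy of [R] with another
   measure display; it is transported to [R] along the identity. *)
Definition leb01_fun : set R -> \bar R :=
  pushforward (uniform_prob (@ltr01 R)) (idfun : measurableTypeR R -> R).

Let id_meas : mfunT (idfun : measurableTypeR R -> R).
Proof. by move=> _ A mA; rewrite setTI. Qed.

Let leb01_0 : leb01_fun set0 = 0%E. Proof. exact: measure0. Qed.
Let leb01_ge0 A : (0 <= leb01_fun A)%E. Proof. exact: measure_ge0. Qed.
Let leb01_sigma : semi_sigma_additive leb01_fun.
Proof. by move=> F mF tF mUF; apply: (@measure_semi_sigma_additive _ _ _ (uniform_prob (@ltr01 R))). Qed.

HB.instance Definition _ := isMeasure.Build _ _ _ leb01_fun leb01_0 leb01_ge0 leb01_sigma.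

Let leb01_setT : leb01_fun setT = 1%E.
Proof. exact: (@probability_setT _ _ _ (uniform_prob (@ltr01 R))). Qed.

HB.instance Definition _ := @Measure_isProbability.Build _ _ R leb01_fun leb01_setT.

Definition leb01 : probability R R := leb01_fun.

Lemma ge0_integral_leb01 (f : R -> \bar R) : mfunT f -> (forall x, 0 <= f x)%E ->
  (\int[leb01]_s f s = \int[lebesgue_measure]_(s in `[0%R, 1%R]) f s)%E.
Proof.
move=> mf f0.
transitivity (\int[uniform_prob (@ltr01 R)]_s f s)%E.
  exact: (@ge0_integral_pushforward _ _ (measurableTypeR R) R R _ id_meas (uniform_prob (@ltr01 R)) setT f).
by rewrite integral_uniform// subr0 invr1 mul1e.
Qed.

Lemma Rint_leb01 (f : R -> R) : mfunT f ->
  \int[leb01]_s f s = \int[lebesgue_measure]_(s in `[0, 1]) f s.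
Proof.
move=> mf; rewrite RintE_pos_neg /Rintegral.
rewrite !ge0_integral_leb01//; first last.
- by move=> x; rewrite lee_fin le_max lexx orbT.
- by apply/measurable_EFinP; apply: measurable_maxr => //; exact: measurableT_comp.
- by move=> x; rewrite lee_fin le_max lexx orbT.
- by apply/measurable_EFinP; apply: measurable_maxr => //; exact: measurableT_comp.
rewrite [in RHS]integralE; congr (fine (_ - _)%E); apply: eq_integral => x _.
  by rewrite funeposE/= EFin_max.
by rewrite funenegE/= EFin_max.
Qed.

Lemma int_ds_leb01 (f : R -> R) t : t \in `[0, 1] -> mfunT f ->
  int_ds f t = \int[leb01]_s (\1_`[0, t] s * f s).
Proof.
move=> t01 mf; rewrite Rint_leb01; last by apply: measurable_funM => //; exact: measurable_indic.
rewrite /int_ds Rintegral_mkcond [RHS]Rintegral_mkcond; apply: eq_Rintegral => s _.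
rewrite /patch indicE !mem_setE !in_itv/=; move: t01; rewrite in_itv/= => /andP[t0 t1].
have [s0|] := leP 0 s; rewrite ?andbF//=; have [st|] := leP s t; rewrite ?mul0r ?if_same//=.
by rewrite (le_trans st t1) mul1r.
Qed.

Lemma int_ds_ext (f g : R -> R) t : t \in `[0, 1] -> (forall s, s \in `[0, 1] -> f s = g s) ->
  int_ds f t = int_ds g t.
Proof.
rewrite in_itv/= => /andP[t0 t1] fg; apply: eq_Rintegral => s; rewrite inE/= in_itv/= => /andP[s0 st].
by rewrite fg// in_itv/= s0 (le_trans st).
Qed.

Lemma jsum_ext (N : cumulative R R) (f g : R -> R) t : counting_path N ->
  (forall s, s \in `]0, 1] -> f s = g s) -> jsum N f t = jsum N g t.
Proof.
move=> hN fg; apply: eq_bigr => k _; congr (_ * _); rewrite fg// in_itv/= jump_gt0//=.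
by rewrite jump_le1.
Qed.

Lemma measurable_int_ds (d : measure_display) (S : measurableType d) (h : R * S -> R) t :
  t \in `[0, 1] -> mfunT h ->
  mfunT (fun y => int_ds (fun s => h (s, y)) t).
Proof.
move=> t01 mh.
have -> : (fun y => int_ds (fun s => h (s, y)) t) =
  (fun y => \int[leb01]_s (\1_`[0, t] (s, y).1 * h (s, y))).
  by apply/funext => y; rewrite int_ds_leb01//; exact: measurable_fun_pair1.
apply: (@measurable_Rint1 _ _ _ _ _ leb01 (fun z => \1_`[0, t] z.1 * h z)).
by apply: measurable_funM => //; exact: measurableT_comp.
Qed.

End unit_interval_measure.

(** * Predictable integrands and compensation *)

Section predictable_processes.
Context {R : realType} {d : measure_display} {S : measurableType d}.
Implicit Types (F : R -> set (set S)) (H K : R -> S -> R).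

Definition filtration F :=
  [/\ forall t, t \in `[0, 1] -> sigma_algebra setT (F t),
      forall t, t \in `[0, 1] -> F t `<=` measurable &
      forall s t, 0 <= s -> s <= t -> t <= 1 -> F s `<=` F t].

(** [predictable_sets] is a sigma-algebra on [0, 1] x S. Allowing anything outside that strip makes
    it one on the whole type, so that predictability becomes measurability for it. *)
Definition predictable_system F : set (set (R * S)) :=
  [set B | predictable_sets F ((`[0, 1] `*` setT) `&` B)].

Variable F : R -> set (set S).
Hypothesis hF : filtration F.

Let D01s : set (R * S) := `[0, 1]%classic `*` setT.

Lemma predictable_system_sigma : sigma_algebra setT (predictable_system F).
Proof.
have [h0 hC hU] := @smallest_sigma_algebra _ D01s ([set [set 0] `*` A | A in F 0] `|`
    [set B | exists s t A, [/\ 0 <= s < t, t <= 1, F s A & B = `]s, t]%classic `*` A]]).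
split; rewrite /predictable_system/=.
- by rewrite setI0; exact: h0.
- move=> B hB /=; rewrite (_ : _ `&` _ = D01s `\` (D01s `&` B)); first exact: hC.
  by apply/seteqP; split=> z /=; [move=> [? [_ nB]]; split=> // -[]|move=> [h nB]; split=> //; split=> // Bz; exact: nB].
- by move=> B hB; rewrite setI_bigcupr; exact: hU.
Qed.

Lemma predictableP H : predictable F H <-> measurable_wrt (predictable_system F) (fun z => H z.1 z.2).
Proof. by []. Qed.

Lemma predictable_ext H K : (forall t y, t \in `[0, 1] -> H t y = K t y) ->
  predictable F H -> predictable F K.
Proof.
move=> HK hH B mB; rewrite (_ : _ `&` _ = (`[0, 1] `*` setT) `&` (fun z : R * S => H z.1 z.2) @^-1` B); first exact: hH.
by apply/seteqP; split=> -[t y] /= [[t01 _]]; rewrite HK.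
Qed.

Lemma predictableM H K : predictable F H -> predictable F K -> predictable F (fun t y => H t y * K t y).
Proof. by move=> hH hK; exact: (measurable_wrtM predictable_system_sigma hH hK). Qed.

Lemma predictableB H K : predictable F H -> predictable F K -> predictable F (fun t y => H t y - K t y).
Proof. by move=> hH hK; exact: (measurable_wrtB predictable_system_sigma hH hK). Qed.

Lemma predictable_comp H (g : R -> R) : mfunT g -> predictable F H ->
  predictable F (fun t y => g (H t y)).
Proof. by move=> mg hH; exact: (measurable_wrt_comp (A := predictable_system F) (Z := fun z : R * S => H z.1 z.2) mg hH). Qed.

Lemma predictable_cst (c : R) : predictable F (fun _ _ => c).
Proof.
have sA := predictable_system_sigma.
by apply/(measurable_wrtP _ sA); exact: measurable_cst.
Qed.

Lemma predictable_indic (a b : R) (A : set S) : 0 <= a -> b <= 1 -> F a A ->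
  predictable F (fun t y => \1_`]a, b] t * \1_A y).
Proof.
move=> a0 b1 FA; have sA := predictable_system_sigma.
have AB : predictable_system F (`]a, b]%classic `*` A).
  rewrite /predictable_system/=; have [ab|ba] := ltP a b; last first.
    rewrite (_ : _ `&` _ = set0); first by have [] := @smallest_sigma_algebra _ D01s ([set [set 0] `*` A | A in F 0] `|`
    [set B | exists s t A, [/\ 0 <= s < t, t <= 1, F s A & B = `]s, t]%classic `*` A]]).
    apply/seteqP; split=> -[t y] //= [_ [+ _]]; rewrite in_itv/= => /andP[h1 h2].
    by move: (lt_le_trans h1 h2); rewrite ltNge ba.
  rewrite (_ : _ `&` _ = `]a, b]%classic `*` A).
    by apply: sub_gen_smallest; right; exists a, b, A; rewrite a0 ab.
  apply/seteqP; split=> -[t y] /=; first by case.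
  rewrite in_itv/= => -[/andP[h1 h2] Ay]; split; last by rewrite h1 h2.
  by rewrite in_itv/= (le_trans h2 b1) ltW ?(le_lt_trans a0 h1).
have := measurable_wrt_indic sA AB (R := R); congr (measurable_wrt _ _).
apply/funext => -[t y] /=; rewrite !indicE -natrM mulnb; congr (nat_of_bool _)%:R.
by apply/idP/andP; rewrite !inE.
Qed.

Lemma predictable_sets_sub (B : set (R * S)) : predictable_sets F B -> measurable B.
Proof.
have [sF Fm Fmono] := hF.
apply: smallest_sub.
  split; first exact: measurable0.
    by move=> A mA; apply: measurableD => //; exact: measurableX.
  by move=> A mA; exact: bigcupT_measurable.
  move=> A [[C FC <-]|[s [t [C [/andP[s0 st] t1 FC ->]]]]]; apply: measurableX => //.
  - by apply: Fm FC; rewrite in_itv/= lexx ler01.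
  - by apply: Fm FC; rewrite in_itv/= s0/= (le_trans (ltW st)).
Qed.

(** Extension by zero outside [0, t]: processes are unconstrained outside [0, 1], while joint
    measurability is wanted on the whole product. *)
Definition restr_proc (t : R) H : R * S -> R := (fun z => H z.1 z.2) \_ (`[0, t]%classic `*` setT).

(** Predictable sets are progressively measurable. On a generator ]a, b] x C, either a <= t and [C]
    already belongs to [F t], or the rectangle does not meet [0, t]. *)
Lemma progressive t (B : set (R * S)) : t \in `[0, 1] -> predictable_sets F B ->
  @measurable _ (R * g_sigma_algebraType (F t))%type (B `&` (`[0, t]%classic `*` setT)).
Proof.
move=> t01; have [sF Fm Fmono] := hF; move: (t01); rewrite in_itv/= => /andP[t0 t1].
pose G : set (set (R * S)) := [set B | @measurable _ (R * g_sigma_algebraType (F t))%type (B `&` (`[0, t]%classic `*` setT))].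
have mDt : @measurable _ (R * g_sigma_algebraType (F t))%type (`[0, t]%classic `*` setT) by exact: measurableX.
suff : predictable_sets F `<=` G by apply.
apply: smallest_sub.
  split; rewrite /G/=.
  - by rewrite set0I.
  - move=> A hA; rewrite (_ : _ `&` _ = (`[0, t]%classic `*` setT) `\` (A `&` (`[0, t]%classic `*` setT))).
      exact: measurableD.
    apply/seteqP; split=> -[s y] /=.
      by move=> [[_ nA] h]; split=> // -[].
    move=> [[h _] nA]; split=> //; split.
      by split=> //; move: h; rewrite !in_itv/= => /andP[-> h2]; rewrite (le_trans h2).
    by move=> As; apply: nA.
  - by move=> A hA; rewrite setI_bigcupl; exact: bigcup_measurable.
move=> A [[C FC <-]|[a [b [C [/andP[a0 ab] b1 FC ->]]]]]; rewrite /G/= -setXI setIT.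
  by apply: measurableX; [exact: measurableI|apply: sub_sigma_algebra; exact: (Fmono 0)].
have [at_|ta] := leP a t.
  by apply: measurableX; [exact: measurableI|apply: sub_sigma_algebra; exact: (Fmono a)].
rewrite (_ : _ `*` _ = set0); first exact: measurable0.
apply/seteqP; split=> -[s y] //= [[+ +] _]; rewrite !in_itv/= => /andP[h1 _] /andP[_ h2].
by move: (lt_le_trans h1 h2); rewrite ltNge (ltW ta).
Qed.

Lemma measurable_restr_proc t H : t \in `[0, 1] -> predictable F H ->
  mfunT (restr_proc t H : R * g_sigma_algebraType (F t) -> R).
Proof.
move=> t01 hH; apply/(measurable_restrictT _ _).1; first exact: measurableX.
move=> _ B mB; rewrite (_ : _ `&` _ = ((`[0, 1] `*` setT) `&` (fun z : R * S => H z.1 z.2) @^-1` B) `&` (`[0, t]%classic `*` setT)).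
  by apply: progressive => //; exact: hH.
apply/seteqP; split=> -[s y] /=; last by case=> [[]].
move=> [[h _] HB]; split=> //; split=> //; split=> //.
by move: h t01; rewrite !in_itv/= => /andP[-> h2] /andP[_]; exact: le_trans.
Qed.

Lemma measurable_predictable H : predictable F H ->
  mfunT (restr_proc 1 H).
Proof.
move=> hH; apply/(measurable_restrictT _ _).1; first exact: measurableX.
by move=> _ B mB; apply: predictable_sets_sub; exact: hH.
Qed.

(** A generator ]a, b] x C has a nonempty section at [t] only if a < t, and then [C] is known
    strictly before [t]. At time 0 the generators over the singleton remain, in accordance with the
    convention for [left_sigma]. *)
Lemma predictable_left H t : t \in `[0, 1] -> predictable F H ->
  measurable_wrt (left_sigma F t) (H t).
Proof.
move=> t01 hH B mB; have [sF Fm Fmono] := hF; move: (t01); rewrite in_itv/= => /andP[t0 t1].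
have [s0 sC sU] : sigma_algebra setT (left_sigma F t).
  rewrite /left_sigma; case: eqP => [_|_]; last exact: smallest_sigma_algebra.
  by apply: sF; rewrite in_itv/= lexx ler01.
pose G : set (set (R * S)) := [set B | left_sigma F t [set y | B (t, y)]].
suff : predictable_sets F `<=` G.
  move=> /(_ _ (hH B mB)); rewrite /G/=; congr (left_sigma F t).
  by apply/seteqP; split=> y /=; [case|split].
apply: smallest_sub.
  split; rewrite /G/=.
  - exact: s0.
  - move=> A hA; rewrite (_ : [set y | _] = setT `\` [set y | A (t, y)]); first exact: sC.
    by apply/seteqP; split=> y /=; [case=> _ ?; split|case=> _ ?; split=> //; split].
  - move=> A hA; rewrite (_ : [set y | _] = \bigcup_i [set y | A i (t, y)]); first exact: sU.
    by apply/seteqP; split=> y /= [i _ h]; exists i.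
move=> A [[C FC <-]|[a [b [C [/andP[a0 ab] b1 FC ->]]]]]; rewrite /G/=.
  have [tt|tn] := eqVneq t 0.
    rewrite (_ : [set y | _] = C); first by rewrite /left_sigma tt eqxx.
    by apply/seteqP; split=> y /=; [case|split].
  rewrite (_ : [set y | _] = set0)//; apply/seteqP; split=> y //= [t00 _].
  by rewrite t00 eqxx in tn.
have [h|h] := boolP (t \in `]a, b]); last first.
  by rewrite (_ : [set y | _] = set0)//; apply/seteqP; split=> y //= [h' _]; rewrite h' in h.
rewrite (_ : [set y | _] = C); last by apply/seteqP; split=> y /=; [case|split].
move: h; rewrite in_itv/= => /andP[at_ tb].
rewrite /left_sigma gt_eqF; last exact: le_lt_trans at_.
by apply: sub_gen_smallest; exists a => //=; rewrite in_itv/= a0.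
Qed.

(** A left-continuous adapted process is the pointwise limit of the step processes taking on each
    cell the value at its left end. *)
Lemma predictable_caglad H : (forall y, caglad (H ^~ y)) -> adapted F H -> predictable F H.
Proof.
move=> cH aH; have [sF Fm Fmono] := hF.
(* Numbering the cells downwards from time 1 makes the integer part produce cells open on the left
   and closed on the right. *)
pose j (n : nat) (t : R) := Num.truncn ((1 - t) * n.+1%:R).
pose a (n i : nat) : R := 1 - i.+1%:R / n.+1%:R.
have n0 (n : nat) : 0 < n.+1%:R :> R by [].
have [D0 DC DU] := @smallest_sigma_algebra _ D01s ([set [set 0] `*` A | A in F 0] `|`
    [set B | exists s t A, [/\ 0 <= s < t, t <= 1, F s A & B = `]s, t]%classic `*` A]]).
have jP n i t : (i <= n)%N -> t \in `]a n i, a n i + n.+1%:R^-1] -> j n t = i.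
  move=> iN; rewrite in_itv/= /a -natr1 mulrDl mul1r => /andP[h1 h2].
  apply: truncn_def; apply/andP; split.
    rewrite -ler_pdivrMr//.
    by move: (i%:R / n.+1%:R : R) (n.+1%:R^-1 : R) h1 h2 => x w; lra.
  rewrite -ltr_pdivlMr// -[X in X / _]natr1 mulrDl mul1r.
  by move: (i%:R / n.+1%:R : R) (n.+1%:R^-1 : R) h1 h2 => x w; lra.
have jt n t : t \in `]0, 1] -> (j n t <= n)%N /\ t \in `]a n (j n t), a n (j n t) + n.+1%:R^-1].
  rewrite in_itv/= => /andP[t0 t1].
  have q0 : 0 <= (1 - t) * n.+1%:R by rewrite mulr_ge0// subr_ge0.
  have /andP[h1 h2] := truncn_itv q0; rewrite -/(j n t) in h1 h2.
  split.
    rewrite -ltnS -(ltr_nat R) (le_lt_trans h1)// gtr_pMl//; lra.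
  rewrite in_itv/= /a; rewrite -ler_pdivrMr// in h1; rewrite -ltr_pdivlMr// in h2.
  move: h2; rewrite -[X in X / _]natr1 mulrDl mul1r.
  by move: ((j n t)%:R / n.+1%:R : R) (n.+1%:R^-1 : R) h1 => x w h1 h2; apply/andP; split; lra.
have j0 n : j n 0 = n.+1 by rewrite /j subr0 mul1r natrK.
(* At time 0 the index is n + 1 and its left end is negative; the maximum selects [H 0] there. *)
pose K n t y := H (Num.max 0 (a n (j n t))) y.
have a0 n i : (i <= n)%N -> 0 <= a n i.
  by move=> iN; rewrite /a subr_ge0 ler_pdivrMr// mul1r ler_nat.
have aE n i : a n i + n.+1%:R^-1 = 1 - i%:R / n.+1%:R.
  by rewrite /a -natr1 mulrDl mul1r; ring.
have pK n : predictable F (K n).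
  move=> B mB.
  rewrite (_ : _ `&` _ = \bigcup_i (if (i <= n)%N then `]a n i, a n i + n.+1%:R^-1]%classic `*` (H (a n i) @^-1` B) else [set 0] `*` (H 0 @^-1` B))).
    apply: DU => i; case: ifPn => iN; apply: sub_gen_smallest; last first.
      by left; exists (H 0 @^-1` B) => //; apply: aH => //; rewrite in_itv/= lexx ler01.
    right; exists (a n i), (a n i + n.+1%:R^-1), (H (a n i) @^-1` B); split => //.
    - by rewrite a0//= ltrDl invr_gt0.
    - by rewrite aE gerBl divr_ge0.
    - apply: aH => //; rewrite in_itv/= a0//= /a gerBl divr_ge0//.
  apply/seteqP; split=> -[t y] /=.
    move=> [[t01 _] KB]; have [tt|tn] := eqVneq t 0.
      exists n.+1 => //; rewrite ltnn; split=> //=; move: KB.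
      rewrite /K tt j0 max_l// /a subr_le0 ler_pdivlMr// mul1r ler_nat//.
    have t01' : t \in `]0, 1] by move: t01; rewrite !in_itv/= lt_def tn.
    have [h1 h2] := jt n t t01'; exists (j n t) => //; rewrite h1; split=> //=.
    by move: KB; rewrite /K max_r// a0.
  move=> [i _]; case: ifPn => iN [/= h1 h2].
    have ti := jP n i t iN h1; split.
      split=> //; move: h1; rewrite !in_itv/= aE => /andP[h3 h4].
      rewrite (le_trans (a0 _ _ iN) (ltW h3))/= (le_trans h4)// gerBl divr_ge0//.
    by rewrite /K ti max_r// a0.
  rewrite h1; split; first by split=> //; rewrite in_itv/= lexx ler01.
  by rewrite /K j0 max_l// /a subr_le0 ler_pdivlMr// mul1r ler_nat.
pose H1 t y := \1_`[0, 1] t * H t y.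
apply: (@predictable_ext H1).
  by move=> t y t01; rewrite /H1 indicE mem_set// mul1r.
have sA := predictable_system_sigma.
apply/(measurable_wrtP _ sA).
apply: (@measurable_fun_cvg _ (g_sigma_algebraType (predictable_system F)) R setT (fun n (z : R * S) => \1_`[0, 1] z.1 * K n z.1 z.2)).
  move=> n; apply/(measurable_wrtP (fun z : R * S => \1_`[0, 1] z.1 * K n z.1 z.2) sA).
  suff : predictable F (fun t y => \1_`[0, 1] t * K n t y) by [].
  apply: (@predictable_ext (K n)) => // t y t01.
  by rewrite indicE mem_set// mul1r.
move=> [t y] _ /=; rewrite /H1.
have [t01|t01] := boolP (t \in `[0, 1]); last first.
  apply: cvg_near_cst; apply: nearW => n.
  by rewrite indicE memNset ?mul0r//; apply/negP.
apply: cvgM; first exact: cvg_cst.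
have [tt|tn] := eqVneq t 0.
  apply: cvg_near_cst; apply: nearW => n; rewrite /K tt j0 max_l// /a subr_le0 ler_pdivlMr// mul1r ler_nat//.
have t01' : t \in `]0, 1] by move: t01; rewrite !in_itv/= lt_def tn.
have [cl _] := cH y; have {}cl := cl t t01'.
apply: (cvg_comp _ _ _ cl).
move=> P [e /= e0 he]; exists (Num.truncn e^-1).+1 => // n /= hn.
have [h1] := jt n t t01'; rewrite in_itv/= max_r ?a0// => /andP[h2 h3].
apply: he => //=; rewrite ger0_norm ?subr_ge0; last exact: ltW.
have : n.+1%:R^-1 < e.
  rewrite -[ltRHS]invrK ltf_pV2 ?posrE ?invr_gt0//.
  have /andP[_ h4] := truncn_itv (ltW (eqbRL (invr_gt0 e) e0)).
  by rewrite (lt_le_trans h4)// ler_nat (leq_trans hn).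
by move: (a n (j n t)) (n.+1%:R^-1 : R) h3 h2 => u w; lra.
Qed.

Variable N : S -> cumulative R R.
Hypothesis hN : forall y, counting_path (N y).
Hypothesis aN : adapted F (fun t y => N y t).

(** Progressive measurability of the integrand meets the measurability at time [t] of jump times cut
    at [t]: the generic lemma is instantiated with [F t] as measurable structure. *)
Lemma adapted_jsum H : predictable F H -> adapted F (fun t y => jsum (N y) (H ^~ y) t).
Proof.
move=> hH t t01; have [sF Fm Fmono] := hF; move: (t01); rewrite in_itv/= => /andP[t0 t1].
apply/(measurable_wrtP _ (sF t t01)).
have -> : (fun y => jsum (N y) (H ^~ y) t) = (fun y => jsum (N y) (fun s => restr_proc t H (s, y)) t).
  apply/funext => y; apply: eq_bigr => k _.
  have [h|] := leP (jump (N y) k) t; rewrite ?mulr0//; congr (_ * _).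
  by rewrite /restr_proc patchT//= inE/=; split=> //=; rewrite in_itv/= h ltW// jump_gt0.
apply: (@measurable_jsum _ _ (g_sigma_algebraType (F t))) => //.
  move=> u; rewrite in_itv/= => /andP[u0 ut]; apply/measurable_wrtP; first exact: sF.
  have u01 : u \in `[0, 1] by rewrite in_itv/= u0 (le_trans ut).
  by move=> B mB; apply: (Fmono u t u0 ut t1); exact: aN.
exact: measurable_restr_proc.
Qed.

Lemma adapted_int_ds H : predictable F H -> adapted F (fun t y => int_ds (H ^~ y) t).
Proof.
move=> hH t t01; have [sF Fm Fmono] := hF; move: (t01); rewrite in_itv/= => /andP[t0 t1].
apply/(measurable_wrtP _ (sF t t01)).
have -> : (fun y => int_ds (H ^~ y) t) = (fun y => int_ds (fun s => restr_proc t H (s, y)) t).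
  apply/funext => y; apply: eq_Rintegral => s; rewrite inE/= => h.
  by rewrite /restr_proc patchT//= inE/=; split.
by apply: (@measurable_int_ds _ _ (g_sigma_algebraType (F t))) => //; exact: measurable_restr_proc.
Qed.

End predictable_processes.

Section compensation.
Context {R : realType} {d : measure_display} {S : measurableType d}.
Variable Q : probability S R.
Variable F : R -> set (set S).
Hypothesis hF : filtration F.
Variable N : S -> cumulative R R.
Hypothesis hN : forall y, counting_path (N y).
Hypothesis aN : adapted F (fun t y => N y t).
Hypothesis iN : L1 Q (fun y => N y 1).
Variable lam : R -> S -> R.
Hypothesis plam : predictable F lam.
Hypothesis ilam : L1 (leb01 \x Q)%E (restr_proc 1 lam).
Hypothesis mart : forall s t A, 0 <= s -> s <= t -> t <= 1 -> F s A ->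
  \int[Q]_y (\1_A y * ((N y t - N y s) - (int_ds (lam ^~ y) t - int_ds (lam ^~ y) s))) = 0.

Notation D01 := (`[(0 : R), 1]%classic `*` [set: S]).
Notation P := (leb01 \x Q)%E.

Let in1 : (1 : R) \in `[0, 1]. Proof. exact: t01E. Qed.

Lemma measurable_counting t : t \in `[0, 1] -> mfunT (fun y => N y t).
Proof.
move=> t01; have [sF Fm _] := hF.
exact: (measurable_wrt_sub (Fm t t01) (aN t01)).
Qed.

Definition jump_integral (h : R * S -> R) (y : S) := jsum (N y) (fun s => h (s, y)) 1.

Lemma jump_integral_ext (h k : R * S -> R) y :
  (forall s, s \in `[0, 1] -> h (s, y) = k (s, y)) -> jump_integral h y = jump_integral k y.
Proof.
move=> hk; apply: jsum_ext => // s; rewrite in_itv/= => /andP[s0 s1].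
by rewrite hk// in_itv/= ltW.
Qed.

Lemma measurable_jump_integral (h : R * S -> R) : mfunT (h \_ D01) ->
  mfunT (jump_integral h).
Proof.
move=> mh; rewrite (_ : jump_integral h = jump_integral (h \_ D01)); last first.
  by apply/funext => y; apply: jump_integral_ext => s s01; rewrite patchT// inE/=.
by apply: measurable_jsum => // u /measurable_counting.
Qed.

Lemma jump_integral_le (h : R * S -> R) (c : R) y : (forall s, `|h (s, y)| <= c) ->
  `|jump_integral h y| <= c * N y 1.
Proof.
move=> hc; have := @le_jsumB _ (N y) (hN y) (fun s => h (s, y)) c 0 1 hc.
rewrite jsum0// subr0 (_ : N y 0 = 0) ?subr0; last by case: (hN y).
by apply; rewrite ?in_itv/= ?lexx ?ler01.
Qed.

Lemma L1_jump_integral (h : R * S -> R) (c : R) : mfunT (h \_ D01) ->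
  (forall z, `|h z| <= c) -> L1 Q (jump_integral h).
Proof.
move=> mh hc; apply: (L1_le (measurable_jump_integral mh) (L1Z c iN)) => y.
exact: jump_integral_le.
Qed.

Definition drift_integral (h : R * S -> R) := \int[P]_z ((h \_ D01) z * restr_proc 1 lam z).

Lemma L1_drift (h : R * S -> R) (c : R) : mfunT (h \_ D01) ->
  (forall z, `|h z| <= c) -> L1 P (fun z => (h \_ D01) z * restr_proc 1 lam z).
Proof.
move=> mh hc; apply: (L1M (c := `|c|)) => // z.
rewrite /patch; case: ifP => _; last by rewrite normr0.
exact: le_trans (hc z) (ler_norm c).
Qed.

(** Difference of the two sides of the compensation formula. It is linear and bounded for the sup
    norm, and vanishes on the generators of the predictable sets. *)
Let defect (h : R * S -> R) := \int[Q]_y jump_integral h y - drift_integral h.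

Let defectD (h k : R * S -> R) (a c : R) : mfunT (h \_ D01) -> mfunT (k \_ D01) ->
  (forall z, `|h z| <= c) -> (forall z, `|k z| <= c) ->
  defect (fun z => h z + a * k z) = defect h + a * defect k.
Proof.
move=> mh mk hc kc; rewrite /defect.
have -> : (fun y => jump_integral (fun z => h z + a * k z) y) =
          (fun y => jump_integral h y + a * jump_integral k y).
  apply/funext => y; rewrite /jump_integral /jsum mulr_sumr -big_split/=.
  by apply: eq_bigr => i _; ring.
rewrite RintD; [|exact: L1_jump_integral hc|by apply: L1Z; exact: L1_jump_integral kc].
rewrite RintZ; last exact: L1_jump_integral kc.
have -> : drift_integral (fun z => h z + a * k z) = drift_integral h + a * drift_integral k.
  rewrite /drift_integral -RintZ; last exact: L1_drift kc.
  rewrite -RintD; [|exact: L1_drift hc|by apply: L1Z; exact: L1_drift kc].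
  apply: eq_Rintegral => z _; rewrite /patch; case: (z \in D01); last by rewrite !mul0r mulr0 addr0.
  by rewrite mulrDl mulrA.
by ring.
Qed.

Let defect_le (h : R * S -> R) (e : R) : mfunT (h \_ D01) -> (forall z, `|h z| <= e) ->
  `|defect h| <= e * (\int[Q]_y N y 1 + \int[P]_z `|restr_proc 1 lam z|).
Proof.
move=> mh he.
have e0 : 0 <= e by exact: le_trans (he (0, point)).
rewrite mulrDr (le_trans (ler_normB _ _))//; apply: lerD.
  apply: (le_trans (Rint_abs (L1_jump_integral mh he))).
  rewrite -RintZ//; apply: Rint_le; [exact/L1_abs/(L1_jump_integral mh he)|exact: L1Z|].
  by move=> y; exact: jump_integral_le.
have id := L1_drift mh he.
apply: (le_trans (Rint_abs id)).
rewrite -RintZ; last exact: L1_abs.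
apply: Rint_le; [exact: L1_abs|by apply: L1Z; exact: L1_abs|] => z.
rewrite normrM ler_wpM2r// /patch; case: ifP => _; by [exact: he|rewrite normr0].
Qed.

Let mind (B : set (R * S)) : predictable_sets F B -> mfunT ((\1_B : R * S -> R) \_ D01).
Proof.
move=> pB; apply/(measurable_restrictT _ _).1; first exact: measurableX.
apply: measurable_funTS; apply: measurable_indic; exact: (predictable_sets_sub hF).
Qed.

Let ind1 (B : set (R * S)) z : `|\1_B z| <= 1 :> R.
Proof. by rewrite indicE; case: (_ \in _); rewrite ?normr1 ?normr0. Qed.

Let in0 : (0 : R) \in `[0, 1]. Proof. exact: t01E. Qed.

Let pset0 A : F 0 A -> predictable_sets F ([set 0] `*` A).
Proof. by move=> FA; apply: sub_gen_smallest; left; exists A. Qed.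

Let psetI (a b : R) A : 0 <= a -> a < b -> b <= 1 -> F a A -> predictable_sets F (`]a, b]%classic `*` A).
Proof. by move=> a0 ab b1 FA; apply: sub_gen_smallest; right; exists a, b, A; rewrite a0 ab. Qed.

Lemma leb01_set1 (r : R) : @leb01 R [set r] = 0%E.
Proof. exact: (@integral_set1 R). Qed.

(** There is no jump at time 0, and that time is negligible for Lebesgue measure. *)
Let defect_null A : F 0 A -> defect \1_([set 0] `*` A) = 0.
Proof.
move=> FA; rewrite /defect.
have -> : jump_integral \1_([set 0] `*` A) = fun=> 0.
  apply/funext => y; rewrite /jump_integral /jsum big1// => k _.
  rewrite indicE memNset ?mul0r//= => -[h _].
  by have := jump_gt0 (hN y) k; rewrite h ltxx.
have mk := mind (pset0 FA).
rewrite Rint_cst sub0r /drift_integral (@Rint_ae _ _ _ P _ (fun=> 0)) ?Rint_cst ?oppr0//.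
  by apply: measurable_funM => //; exact: L1_measurable ilam.
exists ([set 0] `*` setT); split; first exact: measurableX.
  have h : (leb01 \x Q)%E ([set 0%R] `*` setT) = (@leb01 R [set 0%R] * Q setT)%E.
    exact: product_measure1E.
  by apply: (etrans h); rewrite leb01_set1 mul0e.
move=> [t y] /= nz; split=> //=; apply: contrapT => t0; apply: nz.
rewrite /patch; case: ifP => _; rewrite ?mul0r//.
by rewrite indicE memNset ?mul0r//= => -[].
Qed.

Lemma measurable_restr_path y : mfunT (fun s => restr_proc 1 lam (s, y)).
Proof. exact: (measurable_fun_pair1 _ (L1_measurable ilam)). Qed.

Lemma int_ds_restr y t : t \in `[0, 1] ->
  int_ds (lam ^~ y) t = \int[leb01]_s (\1_`[0, t] s * restr_proc 1 lam (s, y)).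
Proof.
move=> t01; rewrite -int_ds_leb01//; last exact: measurable_restr_path.
by apply: int_ds_ext => // s s01; rewrite /restr_proc patchT// inE/=.
Qed.

(** On such a rectangle the defect is the integral over [A] of the increment of the compensated
    process, zero by [mart]. *)
Let defect_rect (a b : R) A : 0 <= a -> a < b -> b <= 1 -> F a A ->
  defect \1_(`]a, b]%classic `*` A) = 0.
Proof.
move=> a0 ab b1 FA; rewrite -(mart a0 (ltW ab) b1 FA).
have [sF Fm Fmono] := hF.
have a01 : a \in `[0, 1] by rewrite in_itv/= a0 (le_trans (ltW ab)).
have b01 : b \in `[0, 1] by rewrite in_itv/= b1 (le_trans a0 (ltW ab)).
have mA : measurable A by exact: (Fm a).
have pB := psetI a0 ab b1 FA; have mk := mind pB.
have ind_ty t y : \1_(`]a, b]%classic `*` A) (t, y) = \1_`]a, b] t * \1_A y :> R.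
  rewrite !indicE -natrM mulnb; congr (nat_of_bool _)%:R.
  by apply/idP/andP; rewrite !inE.
have JE y : jump_integral \1_(`]a, b]%classic `*` A) y = \1_A y * (N y b - N y a).
  rewrite (counting_path_jsum (hN y) a01) (counting_path_jsum (hN y) b01) jsumB ?ltW// mulr_sumr.
  apply: eq_bigr => k _; rewrite ind_ty mul1r !indicE mem_setE in_itv/= -!natrM !mulnb.
  congr (nat_of_bool _)%:R; case: (y \in A); rewrite ?andbF ?andbT//=.
  apply/andP/idP => [[]//|h]; split=> //; have /andP[_ h2] := h; exact: le_trans h2 b1.
have ik := L1_drift mk (ind1 _).
have [iI EI] := Rint_prod21 ik.
rewrite /defect /drift_integral -EI.
have iJ : L1 Q (jump_integral \1_(`]a, b]%classic `*` A)) by exact: L1_jump_integral (ind1 _).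
rewrite -RintB//.
have mint t : t \in `[0, 1] -> mfunT (fun y => int_ds (lam ^~ y) t).
  move=> t01; apply: (measurable_wrt_sub (Fm t t01)).
  exact: (adapted_int_ds hF plam).
apply: Rint_ae.
- by apply: measurable_funB; [exact: L1_measurable iJ|exact: L1_measurable iI].
- apply: measurable_funM; first exact: measurable_indic.
  apply: measurable_funB; apply: measurable_funB; by [exact: measurable_counting|exact: mint].
apply: filterS (L1_prod2 ilam) => y iy.
rewrite mulrBr JE; congr (_ - _); rewrite !int_ds_restr//.
have i1 t : L1 (@leb01 R) (fun s => \1_`[0, t] s * restr_proc 1 lam (s, y)).
  by apply: L1_indic.
rewrite -RintB// -RintZ; last exact: L1B.
apply: eq_Rintegral => s _; rewrite /patch.
case: ifPn => sD; last first.
  rewrite mul0r /restr_proc patchN// !mulr0 subrr mulr0//.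
rewrite ind_ty -mulrBl mulrA; congr (_ * _); rewrite mulrC; congr (_ * _).
move: sD; rewrite inE/= => -[]; rewrite in_itv/= => /andP[s0 s1] _.
rewrite !indicE !mem_setE !in_itv/= s0/=; have [sa|sa] := leP s a.
  by rewrite (le_trans sa (ltW ab)) subrr.
by rewrite subr0.
Qed.

Let psub B : predictable_sets F B -> B `<=` D01.
Proof.
suff H : predictable_sets F `<=` [set B | B `<=` D01] by exact: H.
apply: smallest_sub.
  split.
  - exact: sub0set.
  - by move=> A _; exact: subDsetl.
  - by move=> A hA z [i _ Aiz]; exact: (hA i).
move=> A [[C FC <-]|[a [b [C [/andP[a0 ab] b1 FC ->]]]]] [t y] /= [h _]; split=> //.
  by rewrite h.
move: h; rewrite !in_itv/= => /andP[h1 h2]; rewrite (le_trans h2 b1) andbT.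
exact: le_trans a0 (ltW h1).
Qed.

(** Monotone class argument: the generators are stable under intersection, and by linearity and
    dominated convergence the predictable sets of zero defect form a lambda-system. *)
Let defect_set B0 : predictable_sets F B0 -> defect \1_B0 = 0.
Proof.
have [sF Fm Fmono] := hF.
have [P0 PC PU] := @smallest_sigma_algebra _ D01 ([set [set 0] `*` A | A in F 0] `|`
    [set B | exists s t A, [/\ 0 <= s < t, t <= 1, F s A & B = `]s, t]%classic `*` A]]).
pose M := [set B | [/\ predictable_sets F B, B `<=` D01 & defect \1_B = 0]].
suff H : predictable_sets F `<=` M by move=> /H [].
have F00 : F 0 set0 by have [] := sF 0 in0.
have FT t : t \in `[0, 1] -> F t setT by move=> /sF; exact: sigma_algebra_setT.
have d0 : D01 = ([set 0] `*` setT) `|` (`]0, 1]%classic `*` setT).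
  apply/seteqP; split=> -[t y] /=; rewrite !in_itv/=.
    move=> [/andP[t0 t1] _]; have [->|tn] := eqVneq t 0; first by left.
    by right; rewrite lt_def tn t0.
  by move=> [[-> _]|[/andP[t0 t1] _]]; split=> //; rewrite ?lexx ?ler01// t1 ltW.
have pD : predictable_sets F D01 by rewrite -(setD0 D01); exact: PC.
apply: lambda_system_subset => //.
- move=> X Y [[A FA <-]|[a [b [A [/andP[a0 ab] b1 FA ->]]]]] [[B FB <-]|[c [e [B [/andP[c0 ce] e1 FB ->]]]]].
  + left; exists (A `&` B); first exact: (sigma_algebra_setI (sF 0 in0)).
    by rewrite -setXI setIid.
  + left; exists set0 => //; apply/seteqP; split=> -[t y] /=; first by case.
    by move=> [[-> _] [+ _]]; rewrite in_itv/= ltNge c0.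
  + left; exists set0 => //; apply/seteqP; split=> -[t y] /=; first by case.
    by move=> [[/= + _] [t0 _]]; rewrite t0 in_itv/= ltNge a0.
  + have -> : `]a, b]%classic `*` A `&` (`]c, e]%classic `*` B) =
        `]Num.max a c, Num.min b e]%classic `*` (A `&` B).
      apply/seteqP; split=> -[t y] /=; rewrite !in_itv/= gt_max le_min.
        by move=> [[/andP[-> ->] ?] [/andP[-> ->] ?]].
      by move=> [/andP[/andP[-> ->] /andP[-> ->]] []].
    have [h|h] := ltP (Num.max a c) (Num.min b e).
      right; exists (Num.max a c), (Num.min b e), (A `&` B); split.
      * by rewrite h le_max a0.
      * by rewrite ge_min b1.
      * have m01 : Num.max a c \in `[0, 1] by rewrite in_itv/= le_max a0/= (le_trans (ltW h))// ge_min b1.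
        have m1 : Num.max a c <= 1 by move: m01; rewrite in_itv/= => /andP[].
        apply: (sigma_algebra_setI (sF _ m01)); [apply: (Fmono a) FA|apply: (Fmono c) FB] => //; by rewrite le_max lexx ?orbT.
      * by [].
    left; exists set0 => //; apply/seteqP; split=> -[t y] /=; first by case.
    rewrite in_itv/= => -[/andP[h1 h2] _].
    by move: (lt_le_trans h1 h2); rewrite ltNge h.
- split.
  + by move=> A [].
  + split=> //; rewrite d0.
    have -> : \1_([set 0] `*` setT `|` `]0, 1]%classic `*` setT) = (fun z => \1_([set 0] `*` [set: S]) z + 1 * \1_(`]0, 1]%classic `*` [set: S]) z) :> (R * S -> R).
      apply/funext => -[t y]; rewrite mul1r !indicE.
      have -> : ((t, y) \in [set 0] `*` [set: S]) = (t == 0).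
        by apply/idP/eqP; rewrite inE/=; [case|move=> ->].
      have -> : ((t, y) \in `]0, 1]%classic `*` [set: S]) = (t \in `]0, 1]).
        by apply/idP/idP => [/set_mem[]//|h]; apply/mem_set.
      have -> : ((t, y) \in [set 0] `*` [set: S] `|` `]0, 1]%classic `*` [set: S]) = (t == 0) || (t \in `]0, 1]).
        apply/idP/orP; first by rewrite inE/= => -[[-> _]|[h _]]; [left|right].
        by move=> [/eqP|] h; rewrite inE/=; [left|right].
      rewrite in_itv/=; have [->|_] := eqVneq t 0; first by rewrite ltxx addr0.
      by rewrite add0r.
    have F0T := FT 0 in0.
    have pT := pset0 F0T; have pT' := psetI (lexx 0) ltr01 (lexx 1) F0T.
    have dT := defect_null F0T; have dT' := defect_rect (lexx 0) ltr01 (lexx 1) F0T.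
    by rewrite (@defectD _ _ 1 1) ?dT ?dT' ?mulr0 ?addr0//; exact: mind.
  + move=> A B BA [pA sA dA] [pB sB dB].
    have pAB : predictable_sets F (A `\` B).
      rewrite (_ : A `\` B = D01 `\` ((D01 `\` A) `|` B)).
        apply: (PC); rewrite -(bigcup2E (D01 `\` A) B); apply: (PU (bigcup2 _ _)) => i.
        by case: i => [|[|i]]; [exact: PC pA|exact: pB|exact: P0].
      apply/seteqP; split=> z /=; first by move=> [Az nB]; split; [exact: sA|move=> [[]|]].
      move=> [Dz nz]; split; last by move=> Bz; apply: nz; right.
      by apply: contrapT => nA; apply: nz; left.
    split=> //; first exact: subset_trans (@subDsetl _ _ _) sA.
    have -> : \1_(A `\` B) = (fun z => \1_A z + (-1) * \1_B z) :> (R * S -> R).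
      apply/funext => z; rewrite !indicE in_setD mulN1r.
      have [zB|zB] := boolP (z \in B); last by rewrite andbT subr0.
      by rewrite andbF (_ : z \in A) ?subrr//; move: zB; rewrite !inE; exact: BA.
    by rewrite (@defectD _ _ (-1) 1) ?dA ?dB ?mulr0 ?addr0//; exact: mind.
  + move=> A ndA mA; have pU : predictable_sets F (\bigcup_n A n) by apply: PU => n; have [] := mA n.
    split=> //; first exact: psub.
    have cA z : \1_(A n) z @[n --> \oo] --> (\1_(\bigcup_n A n) z : R).
      have [[n _ An]|nz] := pselect ((\bigcup_n A n) z); apply: cvg_near_cst.
        exists n => // m /= nm; rewrite !indicE !mem_set//; first by exists n.
        by move: An; apply/subsetPset/ndA.
      apply: nearW => n; rewrite !indicE !memNset// => An; by apply: nz; exists n.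
    have mU := mind pU.
    have mAn n : mfunT ((\1_(A n) : R * S -> R) \_ D01) by apply: mind; have [] := mA n.
    have h1 : \int[Q]_y jump_integral \1_(A n) y @[n --> \oo] --> \int[Q]_y jump_integral \1_(\bigcup_n A n) y.
      have [] // := @Rint_dominated _ _ _ Q (fun n => jump_integral \1_(A n)) (jump_integral \1_(\bigcup_n A n)) (fun y => 1 * N y 1).
      - by move=> n; exact: measurable_jump_integral.
      - exact: measurable_jump_integral.
      - exact: L1Z.
      - by move=> n y; exact: jump_integral_le.
      - by apply: aeW => y; apply: cvg_sumr => k; apply: cvgM; [exact: cA|exact: cvg_cst].
    have h2 : drift_integral \1_(A n) @[n --> \oo] --> drift_integral \1_(\bigcup_n A n).
      have mlam := L1_measurable ilam.
      have [] // := @Rint_dominated _ _ _ P (fun n z => ((\1_(A n) : R * S -> R) \_ D01) z * restr_proc 1 lam z) (fun z => ((\1_(\bigcup_n A n) : R * S -> R) \_ D01) z * restr_proc 1 lam z) (fun z => `|restr_proc 1 lam z|).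
      - by move=> n; exact: measurable_funM.
      - exact: measurable_funM.
      - exact: L1_abs.
      - by move=> n z; rewrite normrM ler_piMl// /patch; case: ifP => _; rewrite ?normr0.
      - apply: aeW => z; apply: cvgM; last exact: cvg_cst.
        by rewrite /patch; case: ifP => _; [exact: cA|exact: cvg_cst].
    have h3 : defect \1_(A n) @[n --> \oo] --> defect \1_(\bigcup_n A n) by exact: cvgB h1 h2.
    rewrite (_ : (fun n => defect \1_(A n)) = fun=> 0) in h3; last by apply/funext => n; have [_ _] := mA n.
    by rewrite -(cvg_lim (@Rhausdorff R) h3) lim_cst//; exact: Rhausdorff.
- move=> A [[C FC <-]|[a [b [C [/andP[a0 ab] b1 FC ->]]]]].
    by have p := pset0 FC; split; [exact: p|exact: psub p|exact: defect_null].
  by have p := psetI a0 ab b1 FC; split; [exact: p|exact: psub p|exact: defect_rect].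
Qed.

Lemma measurable_wrt_predictable (h : R * S -> R) : measurable_wrt (predictable_system F) h ->
  mfunT (h \_ D01).
Proof.
move=> mh; have := @measurable_predictable _ _ _ F hF (fun t y => h (t, y)).
rewrite /restr_proc (_ : (fun z => h (z.1, z.2)) = h); last by apply/funext => -[].
by apply => B mB; have := mh B mB; rewrite /predictable_system/= (_ : (fun z => h (z.1, z.2)) = h)//; apply/funext => -[].
Qed.

(** From indicators to bounded integrands: these are uniform limits of combinations of predictable
    indicators, and [defect_le] bounds the defect of the remainder. *)
Lemma compensation (h : R * S -> R) (c : R) : measurable_wrt (predictable_system F) h -> (forall z, `|h z| <= c) ->
  \int[Q]_y jump_integral h y = drift_integral h.
Proof.
move=> mh hc; apply/eqP; rewrite -subr_eq0 -/(defect h) -normr_le0; apply/ler_addgt0Pl => e e0; rewrite addr0.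
pose K := \int[Q]_y N y 1 + \int[P]_z `|restr_proc 1 lam z|.
have K0 : 0 <= K.
  by rewrite addr_ge0//; apply: Rint_ge0 => // y; exact: counting_path_ge0.
have e1 : 0 < e / (K + 1) by rewrite divr_gt0// ltr_wpDl.
have [n [b [a [B [AB hB]]]]] := bounded_approx (fun r => measurable_wrt_le r mh) hc e1.
have sA := predictable_system_sigma F.
pose s k z := b + \sum_(i < k) a i * \1_(B i) z.
have ms k : measurable_wrt (predictable_system F) (s k).
  apply/(measurable_wrtP _ sA); apply: measurable_funD => //; apply: measurable_sum => i.
  apply: measurable_funM => //.
  by apply/(measurable_wrtP _ sA); exact: measurable_wrt_indic.
have bs k : forall z, `|s k z| <= `|b| + \sum_(i < k) `|a i|.
  move=> z; rewrite (le_trans (ler_normD _ _))// lerD2l (le_trans (ler_norm_sum _ _ _))// ler_sum// => i _.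
  by rewrite normrM ler_piMr.
have defect_ext (f g : R * S -> R) : (forall z, D01 z -> f z = g z) -> defect f = defect g.
  move=> fg; rewrite /defect /drift_integral; congr (_ - _).
    by apply: eq_Rintegral => y _; apply: jump_integral_ext => t t01; apply: fg.
  by apply: eq_Rintegral => z _; rewrite /patch; case: ifPn => //; rewrite inE => /fg ->.
have d1 (A : set (R * S)) : predictable_system F A -> defect \1_A = 0.
  move=> pA; rewrite (defect_ext _ \1_(D01 `&` A)); first exact: defect_set.
  by move=> z Dz; rewrite !indicE in_setI (mem_set Dz).
have mm (f : R * S -> R) : measurable_wrt (predictable_system F) f -> mfunT (f \_ D01).
  exact: measurable_wrt_predictable.
have ds k : defect (s k) = 0.
  elim: k => [|k ih].
    rewrite (defect_ext _ (fun z => 0 * \1_setT z + b * \1_setT z)); last first.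
      by move=> z _; rewrite /s big_ord0 indicT mul0r mulr1 add0r addr0.
    have pT := sigma_algebra_setT sA.
    have m1 := mm _ (measurable_wrt_indic (R := R) sA pT).
    have m0 : measurable_wrt (predictable_system F) (fun z : R * S => 0 * \1_setT z : R).
      by apply/(measurable_wrtP _ sA); apply: measurable_funM => //; apply/(measurable_wrtP _ sA); exact: measurable_wrt_indic.
    rewrite (@defectD _ _ b 1) ?d1 ?mulr0 ?addr0//; [|exact: mm|by move=> z; rewrite mul0r normr0].
    rewrite (defect_ext _ (fun z => \1_setT z + (-1) * \1_setT z)); last first.
      by move=> z _; rewrite mul0r mulN1r subrr.
    by rewrite (@defectD _ _ (-1) 1) ?d1 ?mulr0 ?addr0.
  rewrite (defect_ext _ (fun z => s k z + a k * \1_(B k) z)); last first.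
    by move=> z _; rewrite /s big_ord_recr/= addrA.
  have mB := mm _ (measurable_wrt_indic (R := R) sA (AB k)).
  have b1 z : `|\1_(B k) z| <= `|b| + \sum_(i < k) `|a i| + 1.
    by rewrite (le_trans (ind1 _ _))// lerDr addr_ge0// sumr_ge0.
  rewrite (@defectD _ _ _ (`|b| + \sum_(i < k) `|a i| + 1)) ?ih ?d1 ?mulr0 ?addr0//; first exact: mm.
  by move=> z; rewrite (le_trans (bs k z))// lerDl.
pose r z := h z - s n z.
have mr : measurable_wrt (predictable_system F) r.
  by apply/(measurable_wrtP _ sA); apply: measurable_funB; exact/(measurable_wrtP _ sA).
have rb z : `|r z| <= e / (K + 1) by exact: hB.
have -> : defect h = defect r.
  pose c2 := `|b| + \sum_(i < n) `|a i| + e / (K + 1).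
  rewrite (defect_ext _ (fun z => r z + 1 * s n z)); last by move=> z _; rewrite /r; ring.
  rewrite (@defectD _ _ _ c2) ?ds ?mulr0 ?addr0//; [exact: mm|exact: mm| |].
    by move=> z; rewrite (le_trans (rb z))// /c2 lerDr addr_ge0// sumr_ge0.
  by move=> z; rewrite (le_trans (bs n z))// /c2 lerDl ltW.
apply: (le_trans (defect_le (mm _ mr) rb)).
by rewrite -/K mulrAC ler_pdivrMr ?ltr_wpDl// ler_pM2l// lerDl.
Qed.

End compensation.

Lemma norm_indic {R : realType} (T : Type) (A : set T) x : `|\1_A x| = \1_A x :> R.
Proof. by rewrite indicE normr_nat. Qed.

(** * Increments of time integrals, and removal of truncations *)

Section lebesgue_increments.
Context {R : realType}.

Lemma leb01_oc (s t : R) : 0 <= s -> s <= t -> t <= 1 -> @leb01 R `]s, t]%classic = (t - s)%:E.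
Proof.
move=> s0 st t1.
have -> : @leb01 R `]s, t]%classic = (\int[leb01]_x (\1_(`]s, t]%classic : set R) x)%:E)%E.
  by rewrite integral_indic// setIT.
rewrite ge0_integral_leb01//; last first.
  by apply/measurable_EFinP; exact: measurable_indic.
rewrite integral_indic//= (_ : _ `&` _ = `]s, t]%classic); last first.
  apply/seteqP; split=> x /=; first by case.
  move=> h; split=> //; move: h; rewrite !in_itv/= => /andP[h1 h2].
  by rewrite (le_trans s0 (ltW h1)) (le_trans h2).
by rewrite lebesgue_measure_itv/= lte_fin; case: ltgtP st => // ->; rewrite subrr.
Qed.

Lemma leb01_out : @leb01 R (~` `[0, 1]%classic) = 0%E.
Proof.
have -> : @leb01 R (~` `[0, 1]%classic) = (\int[leb01]_x (\1_(~` (`[0, 1]%classic : set R)) x)%:E)%E.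
  by rewrite integral_indic// ?setIT//; exact: measurableC.
rewrite ge0_integral_leb01//; last first.
  by apply/measurable_EFinP; apply: measurable_indic; exact: measurableC.
by rewrite integral_indic//=; [rewrite setICl measure0|exact: measurableC].
Qed.

Lemma int_dsB (f : R -> R) (c s t : R) : mfunT f -> (forall x, `|f x| <= c) ->
  0 <= s -> s <= t -> t <= 1 ->
  int_ds f t - int_ds f s = \int[leb01]_x (\1_`]s, t] x * f x).
Proof.
move=> mf fc s0 st t1.
have s01 : s \in `[0, 1] by rewrite in_itv/= s0 (le_trans st).
have t01 : t \in `[0, 1] by rewrite in_itv/= t1 (le_trans s0).
have fi := L1_bounded leb01 mf fc.
rewrite !int_ds_leb01// -RintB//; [|exact: L1_indic|exact: L1_indic].
apply: Rint_ae.
- by apply: measurable_funB; apply: measurable_funM => //; exact: measurable_indic.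
- by apply: measurable_funM => //; exact: measurable_indic.
exists (~` `[0, 1]%classic); split.
- exact: measurableC.
- exact: leb01_out.
move=> x /= nx x01; apply: nx.
rewrite -mulrBl; congr (_ * _); rewrite !indicE !mem_setE !in_itv/=.
move: x01; rewrite in_itv/= => /andP[x0 x1]; rewrite x0/=.
by have [xs|xs] := leP x s; rewrite ?subr0// (le_trans xs st) subrr.
Qed.

Lemma int_dsB_le (f : R -> R) (c s t : R) : mfunT f -> (forall x, `|f x| <= c) ->
  0 <= s -> s <= t -> t <= 1 -> `|int_ds f t - int_ds f s| <= c * (t - s).
Proof.
move=> mf fc s0 st t1; rewrite (int_dsB mf fc)//.
have fi := L1_bounded leb01 mf fc.
apply: (le_trans (Rint_abs (L1_indic _ fi))) => //.
have -> : c * (t - s) = \int[leb01]_x (c * \1_`]s, t] x).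
  rewrite RintZ; last exact: L1_indicT.
  by rewrite Rint_indic// leb01_oc.
apply: Rint_le; [exact/L1_abs/L1_indic|by apply: L1Z; exact: L1_indicT|] => x.
by rewrite normrM mulrC norm_indic ler_wpM2r.
Qed.

Lemma int_ds0 (f : R -> R) : mfunT f -> int_ds f 0 = 0.
Proof.
move=> mf; rewrite /int_ds set_itv1 /Rintegral integral_set1//.
Qed.

End lebesgue_increments.

Section truncation.
Context {d : measure_display} {T : measurableType d} {R : realType}.
Variable mu : probability T R.

(** Used where integrability is not yet known: moments are estimated after truncation, uniformly in
    the level, and monotone convergence removes the truncation. *)
Lemma L1_trunc_lim (f : T -> R) (p : nat) (K : R) : mfunT f ->
  (forall x, 0 <= f x) ->
  (forall k : R, 0 <= k -> \int[mu]_x (Num.min (f x) k ^+ p) <= K) ->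
  L1 mu (fun x => f x ^+ p) /\ \int[mu]_x (f x ^+ p) <= K.
Proof.
move=> mf f0 hK.
have m0 (k : R) x : 0 <= k -> 0 <= Num.min (f x) k by move=> k0; rewrite le_min f0.
have E : (\int[mu]_x (f x ^+ p)%:E <= K%:E)%E.
  pose g k x := (Num.min (f x) k%:R ^+ p)%:E.
  have cg x : g k x @[k --> \oo] --> (f x ^+ p)%:E.
    apply: cvg_near_cst; exists (Num.truncn (f x)).+1 => // k /= hk.
    congr (_ ^+ _)%:E; apply/min_idPl.
    by rewrite (le_trans (ltW (truncnS_gt (f x))))// ler_nat.
  have mg k : mfunT (g k).
    by apply/measurable_EFinP; apply: measurable_funX; exact: measurable_minr.
  have g0 k x : setT x -> (0 <= g k x)%E by move=> _; rewrite lee_fin exprn_ge0// m0.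
  have ndg x : setT x -> {homo g ^~ x : k l / (k <= l)%N >-> (k <= l)%E}.
    move=> _ k l kl; rewrite lee_fin lerXn2r ?nnegrE ?m0//.
    by rewrite le_min ge_min lexx/= ge_min ler_nat kl orbT.
  have := @cvg_monotone_convergence _ _ _ mu setT measurableT g mg g0 ndg.
  rewrite (_ : (fun x => lim _) = fun x => (f x ^+ p)%:E); last first.
    by apply/funext => x; exact: cvg_lim.
  move=> cv; apply: (cvge_le _ cv); apply: nearW => k.
  rewrite EFin_Rint ?lee_fin ?hK//.
  apply: (@L1_bounded _ _ _ _ _ (k%:R ^+ p)); first by apply/measurable_EFinP; exact: mg.
  move=> x; rewrite ger0_norm ?exprn_ge0 ?m0//; apply: lerXn2r; rewrite ?nnegrE ?m0//.
  by rewrite ge_min lexx orbT.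
have iF : L1 mu (fun x => f x ^+ p).
  apply/integrableP; split; first by apply/measurable_EFinP; exact: measurable_funX.
  under eq_integral => x _ do rewrite /= ger0_norm ?exprn_ge0//.
  by rewrite (le_lt_trans E) ?ltry.
by split=> //; rewrite -lee_fin -EFin_Rint.
Qed.

End truncation.

(** * Square-integrable martingales and stochastic integrals *)

Section square_martingale.
Context {R : realType} {d : measure_display} {T : measurableType d}.
Variable mu : probability T R.
Variable F : R -> set (set T).
Hypothesis sF : forall t, t \in `[0, 1] -> sigma_algebra setT (F t).
Hypothesis Fm : forall t, t \in `[0, 1] -> F t `<=` measurable.
Variable Z : R -> T -> R.
Hypothesis aZ : adapted F Z.
Hypothesis iZ2 : forall t, t \in `[0, 1] -> L1 mu (fun x => Z t x ^+ 2).
Hypothesis mZ : forall s t A, 0 <= s -> s <= t -> t <= 1 -> F s A ->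
  \int[mu]_x (\1_A x * (Z t x - Z s x)) = 0.

Let mZt t : t \in `[0, 1] -> mfunT (Z t).
Proof. by move=> t01; apply: (measurable_wrt_sub (Fm t01)); exact: aZ. Qed.

Lemma mart_cov s t : 0 <= s -> s <= t -> t <= 1 ->
  \int[mu]_x (Z s x * Z t x) = \int[mu]_x (Z s x ^+ 2).
Proof.
move=> s0 st t1.
have s01 : s \in `[0, 1] by rewrite in_itv/= s0 (le_trans st).
have t01 : t \in `[0, 1] by rewrite in_itv/= t1 (le_trans s0).
have iM u v : u \in `[0, 1] -> v \in `[0, 1] -> L1 mu (fun x => Z u x * Z v x).
  by move=> u01 v01; apply: L1_sqrM; [exact: mZt|exact: mZt|exact: iZ2|exact: iZ2].
have iZ u : u \in `[0, 1] -> L1 mu (Z u) by move=> u01; apply: L1_sqr_abs; [exact: mZt|exact: iZ2].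
have iP : L1 mu (fun x => Z s x * (Z t x - Z s x)).
  rewrite (_ : (fun x => _) = fun x => Z s x * Z t x - Z s x * Z s x); last by apply/funext => x; ring.
  by apply: L1B; exact: iM.
have := pull_out (sF s01) (Fm s01) (L1B (iZ t t01) (iZ s s01)) (fun B FB => mZ s0 st t1 FB) (aZ s01) iP.
rewrite (_ : (fun x => _) = fun x => Z s x * Z t x - Z s x ^+ 2); last by apply/funext => x; ring.
by rewrite RintB//; [move/eqP; rewrite subr_eq0 => /eqP|exact: iM|exact: iZ2].
Qed.

Lemma mart_sqr_incr s t : 0 <= s -> s <= t -> t <= 1 ->
  \int[mu]_x ((Z t x - Z s x) ^+ 2) = \int[mu]_x (Z t x ^+ 2) - \int[mu]_x (Z s x ^+ 2).
Proof.
move=> s0 st t1.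
have s01 : s \in `[0, 1] by rewrite in_itv/= s0 (le_trans st).
have t01 : t \in `[0, 1] by rewrite in_itv/= t1 (le_trans s0).
have iM : L1 mu (fun x => Z s x * Z t x) by apply: L1_sqrM; [exact: mZt|exact: mZt|exact: iZ2|exact: iZ2].
rewrite (_ : (fun x => _) = fun x => Z t x ^+ 2 - (2 * (Z s x * Z t x) - Z s x ^+ 2)); last by apply/funext => x; ring.
rewrite RintB; [|exact: iZ2|by apply: L1B; [exact: L1Z|exact: iZ2]].
rewrite RintB; [|exact: L1Z|exact: iZ2].
by rewrite RintZ// mart_cov//; ring.
Qed.

(** The covariance at two times is the second moment at the earlier one. Applied to the sums of
    stochastic integrals and to the Gaussian limit, it yields the same quadratic form in the
    variance function. *)
Lemma mart_lincomb (k : nat) (a t : 'I_k -> R) : (forall i, t i \in `[0, 1]) ->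
  \int[mu]_x ((\sum_(i < k) a i * Z (t i) x) ^+ 2) =
  \sum_(i < k) \sum_(j < k) a i * a j * \int[mu]_x (Z (Num.min (t i) (t j)) x ^+ 2).
Proof.
move=> t01.
have iM i j : L1 mu (fun x => Z (t i) x * Z (t j) x).
  by apply: L1_sqrM; [exact: mZt|exact: mZt|exact: iZ2|exact: iZ2].
have -> : (fun x => (\sum_(i < k) a i * Z (t i) x) ^+ 2) =
    (fun x => \sum_(i < k) \sum_(j < k) a i * a j * (Z (t i) x * Z (t j) x)).
  apply/funext => x; rewrite expr2 mulr_suml; apply: eq_bigr => i _.
  by rewrite mulr_sumr; apply: eq_bigr => j _; ring.
rewrite Rint_sum; last by move=> i; apply: L1_sum => j; exact: L1Z.
apply: eq_bigr => i _; rewrite Rint_sum; last by move=> j; exact: L1Z.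
apply: eq_bigr => j _; rewrite RintZ//; congr (_ * _).
have := t01 i; have := t01 j; rewrite !in_itv/= => /andP[j0 j1] /andP[i0 i1].
case: leP => h; first by rewrite mart_cov.
by rewrite -(mart_cov j0 (ltW h) i1); apply: eq_Rintegral => x _; rewrite mulrC.
Qed.

End square_martingale.

Section stochastic_integral.
Context {R : realType} {d : measure_display} {S : measurableType d}.
Variable Q : probability S R.
Variable F : R -> set (set S).

(** Predictability constrains times in [0, 1]; joint measurability and the bound are imposed at all
    times, so that the lemmas on bounded measurable functions apply directly to paths and
    sections. *)
Definition bpred (c : R) (H : R -> S -> R) :=
  [/\ predictable F H, mfunT (fun z : R * S => H z.1 z.2) & forall t y, `|H t y| <= c].

Hypothesis hF : filtration F.

Lemma bpredM c c' H K : bpred c H -> bpred c' K -> bpred (c * c') (fun t y => H t y * K t y).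
Proof.
move=> [pH mH bH] [pK mK bK]; split; first exact: predictableM.
  exact: measurable_funM.
by move=> t y; rewrite normrM ler_pM.
Qed.

Lemma bpredB c c' H K : bpred c H -> bpred c' K -> bpred (c + c') (fun t y => H t y - K t y).
Proof.
move=> [pH mH bH] [pK mK bK]; split; first exact: predictableB.
  exact: measurable_funB.
by move=> t y; rewrite (le_trans (ler_normB _ _))// lerD.
Qed.

Lemma bpred_cst (c : R) : bpred `|c| (fun _ _ => c).
Proof. by split=> //; exact: predictable_cst. Qed.

Lemma bpred_sqr c H : bpred c H -> bpred (c ^+ 2) (fun t y => H t y ^+ 2).
Proof.
move=> bH; have := bpredM bH bH; rewrite -expr2.
by under eq_fun do under eq_fun do rewrite -expr2.
Qed.

Lemma bpred_indic (a b : R) (A : set S) : 0 <= a -> a <= b -> b <= 1 -> F a A ->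
  bpred 1 (fun t y => \1_`]a, b] t * \1_A y).
Proof.
move=> a0 ab b1 FA; split; first exact: predictable_indic.
  apply: measurable_funM; apply: measurableT_comp => //; apply: measurable_indic => //.
  by have [_ Fm _] := hF; apply: (Fm a) => //; rewrite in_itv/= a0 (le_trans ab).
move=> t y; rewrite normrM !norm_indic !indicE -natrM mulnb.
by case: (_ && _).
Qed.

Lemma bpred_measurable1 c H y : bpred c H -> mfunT (H ^~ y).
Proof. by move=> [_ mH _]; exact: (measurable_fun_pair1 y mH). Qed.

Variable N : S -> cumulative R R.
Hypothesis hN : forall y, counting_path (N y).
Hypothesis aN : adapted F (fun t y => N y t).
Hypothesis iN : L1 Q (fun y => N y 1).
Variables (lam : R -> S -> R) (C : R).
Hypothesis blam : bpred C lam.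
Hypothesis comp : forall c H, bpred c H ->
  \int[Q]_y jsum (N y) (H ^~ y) 1 = \int[(leb01 \x Q)%E]_z (H z.1 z.2 * lam z.1 z.2).

Definition sint (H : R -> S -> R) t y :=
  jsum (N y) (H ^~ y) t - int_ds (fun s => H s y * lam s y) t.

Let bHl c H : bpred c H -> bpred (c * C) (fun t y => H t y * lam t y).
Proof. by move=> bH; exact: bpredM blam. Qed.

Lemma adapted_sint c H : bpred c H -> adapted F (sint H).
Proof.
move=> bH t t01; have [sF Fm _] := hF.
apply: (measurable_wrtB (sF t t01)).
  by apply: (adapted_jsum hF hN aN) => //; case: bH.
by apply: (adapted_int_ds hF) => //; case: (bHl bH).
Qed.

Lemma measurable_sint c H t : bpred c H -> t \in `[0, 1] -> mfunT (sint H t).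
Proof.
move=> bH t01; have [sF Fm _] := hF.
by apply: (measurable_wrt_sub (Fm t t01)); exact: adapted_sint bH _ t01.
Qed.

Let mN t : t \in `[0, 1] -> mfunT (fun y => N y t).
Proof. exact: (measurable_counting hF aN). Qed.

Lemma sintB_le c H s t y : bpred c H -> 0 <= s -> s <= t -> t <= 1 ->
  `|sint H t y - sint H s y| <= c * (N y t - N y s) + c * C * (t - s).
Proof.
move=> bH s0 st t1; have [_ _ hc] := bH.
have s01 := t01E s0 (le_trans st t1); have t01 := t01E (le_trans s0 st) t1.
have -> : sint H t y - sint H s y = (jsum (N y) (H ^~ y) t - jsum (N y) (H ^~ y) s) -
    (int_ds (fun r => H r y * lam r y) t - int_ds (fun r => H r y * lam r y) s).
  by rewrite /sint; ring.
apply: (le_trans (ler_normB _ _)); apply: lerD.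
  by apply: (le_jsumB (hN y)) => // x; exact: hc.
have [_ _ hlc] := bHl bH.
by apply: int_dsB_le => //; exact: bpred_measurable1 (bHl bH).
Qed.

Lemma sint0 c H y : bpred c H -> sint H 0 y = 0.
Proof.
by move=> bH; rewrite /sint jsum0// int_ds0 ?subr0//; exact: bpred_measurable1 (bHl bH).
Qed.

Let N0 y : N y 0 = 0. Proof. by case: (hN y). Qed.

Lemma sint_le c H t y : bpred c H -> t \in `[0, 1] ->
  `|sint H t y| <= c * (N y 1 + C).
Proof.
move=> bH; rewrite in_itv/= => /andP[t0 t1].
have [_ _ hc] := bH; have c0 : 0 <= c by exact: le_trans (hc 0 y).
have [_ _ lC] := blam; have C0 : 0 <= C by exact: le_trans (lC 0 y).
have := sintB_le y bH (lexx 0) t0 t1; rewrite (sint0 y bH) !subr0 N0 subr0 => /le_trans; apply.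
rewrite mulrDr lerD//; first by rewrite ler_wpM2l// counting_path_homo.
by rewrite ler_piMr// mulr_ge0.
Qed.

Lemma L1_sint c H t : bpred c H -> t \in `[0, 1] -> L1 Q (sint H t).
Proof.
move=> bH t01; apply: (L1_le (measurable_sint bH t01) (g := fun y => c * (N y 1 + C))).
  by apply: L1Z; apply: L1D => //; exact: L1_cst.
by move=> y; exact: sint_le.
Qed.

Lemma jsum_itv (f : cumulative R R) (h : R -> R) (s t : R) : counting_path f -> s <= t -> t <= 1 ->
  jsum f (fun r => \1_`]s, t] r * h r) 1 = jsum f h t - jsum f h s.
Proof.
move=> cf st t1; rewrite jsumB//; apply: eq_bigr => k _.
rewrite indicE mem_setE in_itv/= mulrAC -natrM mulnb mulrC; congr (_ * (nat_of_bool _)%:R).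
by apply/andP/idP => [[]//|/andP[h1 h2]]; rewrite h1 h2 (le_trans h2).
Qed.

(** This is the compensation formula for the integrand cut to ]s, t] x A. *)
Lemma sint_mart c H s t A : bpred c H -> 0 <= s -> s <= t -> t <= 1 -> F s A ->
  \int[Q]_y (\1_A y * (sint H t y - sint H s y)) = 0.
Proof.
move=> bH s0 st t1 FA; have [sF Fm _] := hF.
have s01 := t01E s0 (le_trans st t1); have t01 := t01E (le_trans s0 st) t1.
have mA : measurable A by exact: (Fm s).
have bK := bpredM (bpred_indic s0 st t1 FA) bH.
have := comp bK; have [_ mKl bKl] := bpredM bK blam.
have [iI <-] := Rint_prod21 (L1_bounded (leb01 \x Q)%E mKl (fun z => bKl z.1 z.2)).
move=> /eqP; rewrite -subr_eq0 => /eqP <-.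
have JE y : jsum (N y) (fun r => \1_`]s, t] r * \1_A y * H r y) 1 = \1_A y * (jsum (N y) (H ^~ y) t - jsum (N y) (H ^~ y) s).
  rewrite -jsum_itv// mulr_sumr; apply: eq_bigr => k _; ring.
have mJ u : u \in `[0, 1] -> mfunT (fun y => jsum (N y) (H ^~ y) u).
  move=> u01; apply: (measurable_wrt_sub (Fm u u01)).
  by apply: (adapted_jsum hF hN aN) => //; case: bH.
rewrite -RintB//; last first.
  apply: (L1_le _ (L1Z c iN)).
    rewrite (_ : (fun y => _) = fun y => \1_A y * (jsum (N y) (H ^~ y) t - jsum (N y) (H ^~ y) s)); last exact/funext/JE.
    by apply: measurable_funM; [exact: measurable_indic|apply: measurable_funB; exact: mJ].
  move=> y; rewrite JE normrM norm_indic.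
  have [_ _ hc] := bH; have c0 : 0 <= c by exact: le_trans (hc 0 y).
  apply: (@le_trans _ _ `|jsum (N y) (H ^~ y) t - jsum (N y) (H ^~ y) s|).
    by rewrite ler_piMl// indicE; case: (_ \in _).
  apply: (le_trans (le_jsumB (hN y) _ s01 t01 st)) => [x|]; first exact: hc.
  rewrite ler_wpM2l// lerBlDr (le_trans (counting_path_homo (N y) t1))// lerDl.
  exact: counting_path_ge0.
apply: eq_Rintegral => y _; rewrite /= JE /sint.
have [_ _ hlc] := bHl bH.
have mHl := bpred_measurable1 y (bHl bH).
have -> : \int[leb01]_x (\1_`]s, t] x * \1_A y * H x y * lam x y) = \1_A y * (int_ds (fun r => H r y * lam r y) t - int_ds (fun r => H r y * lam r y) s).
  rewrite (int_dsB mHl (hlc ^~ y))// -RintZ; last by apply: L1_indic => //; exact: L1_bounded (hlc ^~ y).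
  by apply: eq_Rintegral => x _; ring.
ring.
Qed.

Lemma sint1 t y : t \in `[0, 1] ->
  sint (fun _ _ => 1) t y = N y t - int_ds (lam ^~ y) t.
Proof.
move=> t01; rewrite /sint -counting_path_jsum//; congr (_ - _).
by apply: int_ds_ext => // s _; rewrite mul1r.
Qed.

Lemma L1_counting t : t \in `[0, 1] -> L1 Q (fun y => N y t).
Proof.
move=> t01; apply: (L1_le (mN t01) iN) => y.
move: t01; rewrite in_itv/= => /andP[t0 t1].
by rewrite ger0_norm ?counting_path_homo// counting_path_ge0.
Qed.

(** Conditional form of E(N_t - N_s) <= C (t - s): a nonnegative bounded weight known at time [s] is
    pulled out of the martingale increment. *)
Lemma counting_incr_le (Z : S -> R) (c s t : R) : 0 <= s -> s <= t -> t <= 1 ->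
  measurable_wrt (F s) Z -> (forall y, 0 <= Z y <= c) ->
  \int[Q]_y (Z y * (N y t - N y s)) <= C * (t - s) * \int[Q]_y Z y.
Proof.
move=> s0 st t1 mZ hZ; have [sF Fm _] := hF.
have s01 := t01E s0 (le_trans st t1); have t01 := t01E (le_trans s0 st) t1.
have mZT := measurable_wrt_sub (Fm s s01) mZ.
have Zc y : `|Z y| <= c by have /andP[h1 h2] := hZ y; rewrite ger0_norm.
have b1 := bpred_cst 1.
have iD := L1B (L1_sint b1 t01) (L1_sint b1 s01).
have := pull_out_bounded (sF s s01) (Fm s s01) iD (fun B FB => sint_mart b1 s0 st t1 FB) mZ Zc.
have iZ : L1 Q Z by exact: L1_bounded Zc.
have iZN : L1 Q (fun y => Z y * (N y t - N y s)) by apply: (L1M (c := c)) => //; apply: L1B; exact: L1_counting.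
have iZD : L1 Q (fun y => Z y * (sint (fun _ _ => 1) t y - sint (fun _ _ => 1) s y)) by exact: (L1M (c := c)).
move=> E0; rewrite -[leLHS]subr0 -E0 -RintB// -RintZ//.
apply: Rint_le; [exact: L1B|exact: L1Z|] => y.
have [_ _ lC] := blam.
have := int_dsB_le (bpred_measurable1 y blam) (lC ^~ y) s0 st t1.
have /andP[z0 _] := hZ y.
rewrite ler_norml => /andP[_ h]; rewrite !sint1//.
rewrite -mulrBr mulrC ler_wpM2r//.
by apply: le_trans h; lra.
Qed.

(** Test function for the fourth moment. The shift is such that one unit jump at most doubles it,
    since (7 / 6)^4 <= 2; the truncation at [k] keeps its mean finite. Its value at 0 is 1296. *)
Let q4 (k x : R) : R := (Num.min x k + 6) ^+ 4.

(** As each jump at most doubles [q4], its growth along the path is bounded by its integral against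
    N, whose mean is at most C (t - s) times the final mean. On an interval with C (t - s) <= 1 / 2
    this absorbs itself. The bound is linear in t - s, not quadratic, because jumps have unit
    size. *)
Lemma counting_moment4 s t : 0 <= s -> s <= t -> t <= 1 -> C * (t - s) <= 2^-1 ->
  L1 Q (fun y => (N y t - N y s) ^+ 4) /\
  \int[Q]_y ((N y t - N y s) ^+ 4) <= 2592 * (C * (t - s)).
Proof.
move=> s0 st t1 Cts; have [sF Fm Fmono] := hF.
have [_ _ lC] := blam; have C0 : 0 <= C by exact: le_trans (lC 0 point).
have s01 := t01E s0 (le_trans st t1); have t01 := t01E (le_trans s0 st) t1.
(* The dyadic grid of [0, 1] clipped to [s, t], for which [jsum_qv] gives at most one jump per
   cell. *)
pose u m i : R := Num.max s (Num.min t (i%:R / 2 ^+ m)).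
have us m i : s <= u m i by rewrite /u le_max lexx.
have ut m i : u m i <= t by rewrite /u ge_max st ge_min lexx.
have u01 m i : u m i \in `[0, 1] by apply: t01E; [exact: le_trans (us m i)|exact: le_trans (ut m i) t1].
have uS m i : u m i <= u m i.+1.
  have h : (i%:R / 2 ^+ m : R) <= i.+1%:R / 2 ^+ m by rewrite ler_pM2r ?invr_gt0 ?exprn_gt0// ler_nat.
  by rewrite /u ge_max !le_max lexx/= le_min !ge_min lexx h !orbT.
have u0 m : u m 0 = s.
  by rewrite /u mul0r (_ : Num.min t 0 = 0) ?(max_idPl _)//; apply/min_idPr; exact: le_trans st.
have u1 m : u m (2 ^ m)%N = t.
  rewrite /u natrX divff ?expf_neq0// (_ : Num.min t 1 = t); last exact/min_idPl.
  exact/max_idPr.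
pose D v y := N y v - N y s.
have D0 v y : s <= v -> 0 <= D v y by move=> sv; rewrite subr_ge0 counting_path_homo.
have mD v : v \in `[0, 1] -> s <= v -> measurable_wrt (F v) (D v).
  move=> v01 sv; apply: (measurable_wrtB (sF v v01)); first exact: aN.
  move=> B mB; move: (v01); rewrite in_itv/= => /andP[_ v1].
  by apply: (Fmono s v) => //; exact: aN.
have mq k : mfunT (q4 k).
  apply: measurable_funX; apply: measurable_funD => //; exact: measurable_minr.
have q0 k x : 0 <= q4 k x by rewrite /q4 exprn_even_ge0.
have qle k x y : 0 <= x -> 0 <= k -> x <= y -> q4 k x <= q4 k y.
  move=> x0 k0 xy; apply: lerXn2r; rewrite ?nnegrE ?addr_ge0 ?le_min ?x0//; first by rewrite (le_trans x0 xy).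
  by rewrite lerD2r le_min !ge_min xy lexx orbT.
have qk k x : 0 <= x -> 0 <= k -> q4 k x <= (k + 6) ^+ 4.
  by move=> x0 k0; apply: lerXn2r; rewrite ?nnegrE ?addr_ge0 ?le_min ?x0// lerD2r ge_min lexx orbT.
have q1 k x : 0 <= x -> 0 <= k -> q4 k (x + 1) <= 2 * q4 k x.
  move=> x0 k0.
  have h : 0 <= Num.min x k by rewrite le_min x0.
  have h2 : Num.min (x + 1) k <= Num.min x k + 1.
    by rewrite addr_minl le_min !ge_min lexx/= lerDl ler01 orbT.
  apply: (@le_trans _ _ ((Num.min x k + 1 + 6) ^+ 4)).
    apply: lerXn2r; rewrite ?nnegrE ?addr_ge0 ?le_min ?addr_ge0 ?x0//.
    by rewrite lerD2r.
  rewrite /q4; move: (Num.min x k) h => z z0.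
  rewrite -subr_ge0 (_ : _ - _ = z ^+ 4 + 20 * z ^+ 3 + 138 * z ^+ 2 + 356 * z + 191); last by ring.
  have := exprn_ge0 2 z0; have := exprn_ge0 3 z0; have := exprn_ge0 4 z0; lra.
(* 1296 is the initial value, and the last term bounds the mean growth. The truncation makes both
   means finite, so that one can later be subtracted from the other. *)
have key k : 0 <= k -> \int[Q]_y q4 k (D t y) <= 1296 + C * (t - s) * \int[Q]_y q4 k (D t y).
  move=> k0.
  pose Sm m y := \sum_(i < 2 ^ m) q4 k (D (u m i) y) * (N y (u m i.+1) - N y (u m i)).
  have iq v : v \in `[0, 1] -> s <= v -> L1 Q (fun y => q4 k (D v y)).
    move=> v01 sv; apply: (@L1_bounded _ _ _ _ _ ((k + 6) ^+ 4)).
      apply: measurableT_comp => //; exact: (measurable_wrt_sub (Fm v v01) (mD v v01 sv)).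
    by move=> y; rewrite ger0_norm ?qk ?D0.
  have iS m : L1 Q (Sm m).
    apply: L1_sum => i; apply: (L1M (c := (k + 6) ^+ 4)).
    - by apply: L1B; exact: L1_counting.
    - exact: L1_measurable (iq _ (u01 m i) (us m i)).
    - by move=> y; rewrite ger0_norm ?qk ?D0.
  have S0 m y : 0 <= Sm m y.
    by apply: sumr_ge0 => i _; rewrite mulr_ge0// subr_ge0 counting_path_homo.
  have ES m : \int[Q]_y Sm m y <= C * (t - s) * \int[Q]_y q4 k (D t y).
    rewrite Rint_sum; last first.
      move=> i; apply: (L1M (c := (k + 6) ^+ 4)).
      - by apply: L1B; exact: L1_counting.
      - exact: L1_measurable (iq _ (u01 m i) (us m i)).
      - by move=> y; rewrite ger0_norm ?qk ?D0.
    apply: (@le_trans _ _ (\sum_(i < 2 ^ m) C * (u m i.+1 - u m i) * \int[Q]_y q4 k (D t y))).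
      apply: ler_sum => i _.
      have ui0 : 0 <= u m i by move: (u01 m i); rewrite in_itv/= => /andP[].
      have ui1 : u m i.+1 <= 1 by move: (u01 m i.+1); rewrite in_itv/= => /andP[].
      apply: (@le_trans _ _ (C * (u m i.+1 - u m i) * \int[Q]_y q4 k (D (u m i) y))).
        apply: (@counting_incr_le _ ((k + 6) ^+ 4)) => //.
          exact: (measurable_wrt_comp _ (mD _ (u01 m i) (us m i))).
        by move=> y; rewrite q0 qk ?D0.
      rewrite ler_wpM2l ?mulr_ge0 ?subr_ge0//.
      apply: Rint_le; [exact: iq|exact: iq|] => y.
      by apply: qle => //; [exact: D0|rewrite lerD2r counting_path_homo].
    rewrite -mulr_suml -mulr_sumr (_ : \sum_(i < 2 ^ m) _ = t - s)//.
    rewrite -(big_mkord xpredT (fun i => u m i.+1 - u m i)) telescope_sumr// u0 u1//.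
  (* The growth is bounded by [Sm] only from a rank depending on the path. The minimum equals the
     growth from that rank on and is dominated by it at every rank. *)
  pose g m y := Num.min (Sm m y) (q4 k (D t y) - 1296).
  have q1296 y : 0 <= q4 k (D t y) - 1296.
    rewrite subr_ge0 (_ : 1296 = q4 k 0); first by apply: qle => //; exact: D0.
    by rewrite /q4 (min_idPl k0) add0r; ring.
  have mg m : mfunT (g m).
    apply: measurable_minr; first exact: L1_measurable (iS m).
    by apply: measurable_funB => //; exact: L1_measurable (iq t t01 st).
  have ig : L1 Q (fun y => q4 k (D t y) - 1296).
    by apply: L1B; [exact: iq|exact: L1_cst].
  have [] // := @Rint_dominated _ _ _ Q g (fun y => q4 k (D t y) - 1296) (fun y => q4 k (D t y) - 1296) mg (L1_measurable ig) ig.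
  - by move=> m y; rewrite ger0_norm ?ge_min ?lexx ?orbT// le_min S0 q1296.
  - apply: aeW => y; apply: cvg_near_cst.
    have := jsum_qv (hN y) (fun=> 1); apply: filterS => m [_ hm].
    apply/min_idPr.
    have -> : q4 k (D t y) - 1296 = \sum_(i < 2 ^ m) (q4 k (D (u m i.+1) y) - q4 k (D (u m i) y)).
      rewrite -(big_mkord xpredT (fun i => q4 k (D (u m i.+1) y) - q4 k (D (u m i) y))) (telescope_sumr (fun i => q4 k (D (u m i) y)))// u0 u1 /D subrr.
      by rewrite /q4 (min_idPl k0) add0r; ring.
    apply: ler_sum => i _.
    have [a [b [Na Nb ab]]] : exists a b : nat, [/\ N y (u m i) = a%:R, N y (u m i.+1) = b%:R & (a <= b <= a.+1)%N].
      have [a Na] := counting_path_nat (hN y) (u01 m i).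
      have [b Nb] := counting_path_nat (hN y) (u01 m i.+1).
      exists a, b; split=> //; rewrite -(ler_nat R) -Na -Nb counting_path_homo//=.
      rewrite -(ler_nat R) -natr1 -Na -Nb.
      have hi := hm i (ltn_ord i).
      rewrite /u; set p := i%:R / 2 ^+ m in hi *; set p' := i.+1%:R / 2 ^+ m in hi *.
      have pp : p <= p' by rewrite ler_pM2r ?invr_gt0 ?exprn_gt0// ler_nat.
      have [ps|sp] := leP (Num.min t p') s.
        by rewrite (le_trans (y := N y (Num.max s (Num.min t p))))// ?lerDl// counting_path_homo// le_max lexx.
      have [tp|pt] := leP t p.
        rewrite (max_idPr st).
        by rewrite (le_trans (y := N y t)) ?lerDl// counting_path_homo// ge_min lexx.
      apply: (@le_trans _ _ (N y p')); first by rewrite counting_path_homo// ge_min lexx orbT.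
      apply: (@le_trans _ _ (N y p + 1)); first by rewrite -lerBlDl.
      by rewrite lerD2r counting_path_homo// le_max lexx orbT.
    have Di := D0 (u m i) y (us m i).
    rewrite Na Nb.
    have -> : D (u m i.+1) y = D (u m i) y + (b%:R - a%:R) by rewrite /D Na Nb; ring.
    have [->|->] : b = a \/ b = a.+1.
      move: ab => /andP[h1]; rewrite leq_eqVlt => /predU1P[->|]; first by right.
      by rewrite ltnS => h2; left; apply/eqP; rewrite eqn_leq h2.
      by rewrite subrr addr0 mulr0 subrr.
    by rewrite -natr1 [_ + 1 - _]addrAC subrr add0r mulr1 lerBlDr -mulr2n -mulr_natl q1.
  move=> _ cv.
  have : \int[Q]_y (q4 k (D t y) - 1296) <= C * (t - s) * \int[Q]_y q4 k (D t y).
    rewrite -(cvg_lim (@Rhausdorff R) cv); apply: limr_le; first exact: cvgP cv.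
    apply: nearW => m; apply: le_trans (ES m).
    apply: Rint_le => //; first by apply: (L1_le (mg m) ig) => y; rewrite ger0_norm ?ge_min ?lexx ?orbT// le_min S0 q1296.
    by move=> y; rewrite /g ge_min lexx.
  rewrite RintB; [|exact: iq|exact: L1_cst]; rewrite Rint_cst; lra.
(* Since C (t - s) <= 1 / 2, the mean of [q4] is at most 2592, twice 1296; reinserted in [key], this
   makes its growth at most 2592 C (t - s), and the growth dominates the fourth power. *)
have key2 k : 0 <= k -> \int[Q]_y (Num.min (D t y) k ^+ 4) <= 2592 * (C * (t - s)).
  move=> k0; have := key k k0; set I := \int[Q]_y q4 k (D t y) => hI.
  have I2 : I <= 2592.
    have I0 : 0 <= I by apply: Rint_ge0 => y; exact: q0.
    have : C * (t - s) * I <= 2^-1 * I by rewrite ler_wpM2r.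
    by move: (C * (t - s) * I) hI => z; lra.
  have : I - 1296 <= 2592 * (C * (t - s)).
    have : C * (t - s) * I <= C * (t - s) * 2592 by rewrite ler_wpM2l// mulr_ge0// subr_ge0.
    by move: hI; rewrite [C * (t - s) * 2592]mulrC; move: (C * (t - s) * I) => z; lra.
  apply: le_trans.
  have mDt := measurable_wrt_sub (Fm t t01) (mD t t01 st).
  have iI : L1 Q (fun y => q4 k (D t y)).
    apply: (@L1_bounded _ _ _ _ _ ((k + 6) ^+ 4)); first exact: measurableT_comp.
    by move=> y; rewrite ger0_norm ?qk ?D0.
  rewrite /I -(Rint_cst Q 1296) -RintB//; last exact: L1_cst.
  apply: Rint_le.
  - apply: (@L1_bounded _ _ _ _ _ (k ^+ 4)).
      by apply: measurable_funX; exact: measurable_minr.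
    have h y : 0 <= Num.min (D t y) k by rewrite le_min D0.
    move=> y; rewrite (ger0_norm (exprn_ge0 _ (h y))).
    by apply: (lerXn2r 4 (h y) k0); rewrite ge_min lexx orbT.
  - exact: L1B iI (L1_cst _ _).
  move=> y; rewrite /q4 {key hI I2 iI I}.
  have : 0 <= Num.min (D t y) k by rewrite le_min D0.
  move: (Num.min _ _) => z z0.
  rewrite -subr_ge0 (_ : _ - _ = 24 * z ^+ 3 + 216 * z ^+ 2 + 864 * z); last by ring.
  have := exprn_ge0 2 z0; have := exprn_ge0 3 z0; have := exprn_ge0 4 z0; lra.
have mDt := measurable_wrt_sub (Fm t t01) (mD t t01 st).
exact: (@L1_trunc_lim _ _ _ Q (D t) 4 _ mDt (fun y => D0 t y st) key2).
Qed.

Let C0 : 0 <= C.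
Proof. by have [_ _ lC] := blam; exact: le_trans (lC 0 point). Qed.

(** [0, 1] is cut into intervals with C times the length at most 1 / 2; each contributes at most
    1296, and (a + b)^4 <= 8 (a^4 + b^4) costs a factor 16 per interval. *)
Definition counting_moment_bound : R := 1296 * 16 ^+ (Num.truncn (2 * C)).+1.

Lemma counting_total_moment4 : L1 Q (fun y => N y 1 ^+ 4) /\
  \int[Q]_y (N y 1 ^+ 4) <= counting_moment_bound.
Proof.
rewrite /counting_moment_bound; set q := (Num.truncn (2 * C)).+1.
have qC : C * q%:R^-1 <= 2^-1.
  have q0 : (0 : R) < q%:R by rewrite ltr0n.
  rewrite ler_pdivrMr// -ler_pdivrMl ?invr_gt0// invrK ltW//.
  exact: truncnS_gt.
have H i : (i <= q)%N -> L1 Q (fun y => N y (i%:R / q%:R) ^+ 4) /\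
    \int[Q]_y (N y (i%:R / q%:R) ^+ 4) <= 1296 * 16 ^+ i.
  elim: i => [_|i ih iq].
    rewrite mul0r (_ : (fun y => _) = fun=> 0); last by apply/funext => y; rewrite N0 expr0n.
    by split; [exact: L1_cst|rewrite Rint_cst expr0 mulr1 ler0n].
  have [i1 e1] := ih (ltnW iq).
  have q0 : (0 : R) < q%:R by rewrite ltr0n.
  pose s : R := i%:R / q%:R; pose t : R := i.+1%:R / q%:R.
  have ts : t - s = q%:R^-1 by rewrite /t /s -natr1 mulrDl mul1r addrAC subrr add0r.
  have s0 : 0 <= s by rewrite divr_ge0.
  have st : s <= t by rewrite ler_pM2r ?invr_gt0// ler_nat.
  have t1 : t <= 1 by rewrite ler_pdivrMr// mul1r ler_nat.
  have [i2 e2] := counting_moment4 s0 st t1 (ltac:(by rewrite ts)).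
  rewrite -/s -/t in i1 e1 *.
  have le8 y : N y t ^+ 4 <= 8 * ((N y t - N y s) ^+ 4 + N y s ^+ 4).
    have -> : N y t = (N y t - N y s) + N y s by ring.
    have : 0 <= N y t - N y s by rewrite subr_ge0 counting_path_homo.
    have : 0 <= N y s by exact: counting_path_ge0.
    rewrite [N y t - N y s + N y s - N y s]addrK.
    move: (N y s) (N y t - N y s) => a b _ _.
    have h1 : (b + a) ^+ 2 <= 2 * (b ^+ 2 + a ^+ 2).
      rewrite -subr_ge0 (_ : _ - _ = (b - a) ^+ 2) ?sqr_ge0//; ring.
    have h2 : (b ^+ 2 + a ^+ 2) ^+ 2 <= 2 * (b ^+ 4 + a ^+ 4).
      rewrite -subr_ge0 (_ : _ - _ = (b ^+ 2 - a ^+ 2) ^+ 2) ?sqr_ge0//; ring.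
    have : ((b + a) ^+ 2) ^+ 2 <= (2 * (b ^+ 2 + a ^+ 2)) ^+ 2.
      by apply: lerXn2r h1; rewrite nnegrE ?sqr_ge0// mulr_ge0// addr_ge0// sqr_ge0.
    rewrite -exprM exprMn => /le_trans; apply.
    rewrite (_ : 8 = 2 ^+ 2 * 2); last by ring.
    by rewrite -mulrA ler_wpM2l// sqr_ge0.
  have i8 : L1 Q (fun y => 8 * ((N y t - N y s) ^+ 4 + N y s ^+ 4)) by apply: L1Z; exact: L1D.
  have t01 := t01E (le_trans s0 st) t1.
  have iT : L1 Q (fun y => N y t ^+ 4).
    apply: (L1_le _ i8); first by apply: measurable_funX; exact: mN.
    by move=> y; rewrite ger0_norm// exprn_ge0// counting_path_ge0//; move: t01; rewrite in_itv/= => /andP[].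
  split=> //; apply: (le_trans (Rint_le iT i8 le8)).
  rewrite RintZ; last exact: L1D.
  rewrite RintD//.
  have p1 : (1 : R) <= 16 ^+ i by rewrite exprn_ege1// ler1n.
  have := le_trans e2 (ler_wpM2l (ler0n _ 2592) (ltac:(by rewrite ts) : C * (t - s) <= 2^-1)).
  rewrite exprS; move: (\int[Q]_y _) (\int[Q]_y _) (16 ^+ i) e1 p1 => u v w; lra.
by have := H q (leqnn q); rewrite divff// pnatr_eq0.
Qed.

Lemma L1_counting_pow4 t : t \in `[0, 1] -> L1 Q (fun y => N y t ^+ 4).
Proof.
move=> t01; have [i4 _] := counting_total_moment4.
apply: (L1_le _ i4); first by apply: measurable_funX; exact: mN.
move=> y; move: t01; rewrite in_itv/= => /andP[t0 t1].
have h := counting_path_ge0 (hN y) t0.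
by rewrite ger0_norm ?exprn_ge0//; apply: lerXn2r; rewrite ?nnegrE ?counting_path_homo// counting_path_ge0.
Qed.

Let pow4D (a b : R) : (a + b) ^+ 4 <= 8 * (a ^+ 4 + b ^+ 4).
Proof.
have h1 : (a + b) ^+ 2 <= 2 * (a ^+ 2 + b ^+ 2).
  rewrite -subr_ge0 (_ : _ - _ = (a - b) ^+ 2) ?sqr_ge0//; ring.
have h2 : (a ^+ 2 + b ^+ 2) ^+ 2 <= 2 * (a ^+ 4 + b ^+ 4).
  rewrite -subr_ge0 (_ : _ - _ = (a ^+ 2 - b ^+ 2) ^+ 2) ?sqr_ge0//; ring.
have : ((a + b) ^+ 2) ^+ 2 <= (2 * (a ^+ 2 + b ^+ 2)) ^+ 2.
  by apply: lerXn2r h1; rewrite nnegrE ?sqr_ge0// mulr_ge0// addr_ge0// sqr_ge0.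
rewrite -exprM exprMn => /le_trans; apply.
rewrite (_ : 8 = 2 ^+ 2 * 2); last by ring.
by rewrite -mulrA ler_wpM2l// sqr_ge0.
Qed.

Lemma sint_moment4 c H t : bpred c H -> t \in `[0, 1] ->
  L1 Q (fun y => sint H t y ^+ 4) /\
  \int[Q]_y (sint H t y ^+ 4) <= 8 * c ^+ 4 * (counting_moment_bound + C ^+ 4).
Proof.
move=> bH t01; have [i4 e4] := counting_total_moment4.
have iB : L1 Q (fun y => 8 * c ^+ 4 * (N y 1 ^+ 4 + C ^+ 4)).
  by apply: L1Z; apply: L1D => //; exact: L1_cst.
have le4 y : sint H t y ^+ 4 <= 8 * c ^+ 4 * (N y 1 ^+ 4 + C ^+ 4).
  have h := sint_le y bH t01.
  have : `|sint H t y| ^+ 4 <= (c * (N y 1 + C)) ^+ 4.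
    by apply: lerXn2r (h); rewrite nnegrE ?normr_ge0//; exact: le_trans h.
  rewrite -normrX ger0_norm ?exprn_even_ge0// => /le_trans; apply.
  by rewrite exprMn [8 * _]mulrC -[leRHS]mulrA ler_wpM2l ?exprn_even_ge0.
have iS : L1 Q (fun y => sint H t y ^+ 4).
  apply: (L1_le _ iB); first by apply: measurable_funX; exact: measurable_sint bH t01.
  by move=> y; rewrite ger0_norm ?exprn_even_ge0.
split=> //; apply: (le_trans (Rint_le iS iB le4)).
rewrite RintZ; last by apply: L1D => //; exact: L1_cst.
rewrite RintD//; last exact: L1_cst.
by rewrite Rint_cst ler_wpM2l ?lerD2r// mulr_ge0// exprn_even_ge0.
Qed.

(** 2593 is 2592 + 1: the drift adds (C (t - s))^4, which is at most C (t - s). *)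
Lemma sint_incr_moment4 c H s t : bpred c H -> 0 <= s -> s <= t -> t <= 1 -> C * (t - s) <= 2^-1 ->
  L1 Q (fun y => (sint H t y - sint H s y) ^+ 4) /\
  \int[Q]_y ((sint H t y - sint H s y) ^+ 4) <= 8 * c ^+ 4 * (2593 * (C * (t - s))).
Proof.
move=> bH s0 st t1 Cts; have [i4 e4] := counting_moment4 s0 st t1 Cts.
have s01 := t01E s0 (le_trans st t1); have t01 := t01E (le_trans s0 st) t1.
have iB : L1 Q (fun y => 8 * c ^+ 4 * ((N y t - N y s) ^+ 4 + (C * (t - s)) ^+ 4)).
  by apply: L1Z; apply: L1D => //; exact: L1_cst.
have le4 y : (sint H t y - sint H s y) ^+ 4 <= 8 * c ^+ 4 * ((N y t - N y s) ^+ 4 + (C * (t - s)) ^+ 4).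
  have h := sintB_le y bH s0 st t1; rewrite -mulrA -mulrDr in h.
  have : `|sint H t y - sint H s y| ^+ 4 <= (c * ((N y t - N y s) + C * (t - s))) ^+ 4.
    by apply: lerXn2r (h); rewrite nnegrE ?normr_ge0//; exact: le_trans h.
  rewrite -normrX ger0_norm ?exprn_even_ge0// => /le_trans; apply.
  by rewrite exprMn [8 * _]mulrC -[leRHS]mulrA ler_wpM2l ?exprn_even_ge0.
have iS : L1 Q (fun y => (sint H t y - sint H s y) ^+ 4).
  apply: (L1_le _ iB); last by move=> y; rewrite ger0_norm ?exprn_even_ge0.
  by apply: measurable_funX; apply: measurable_funB; exact: measurable_sint bH _.
split=> //; apply: (le_trans (Rint_le iS iB le4)).
rewrite RintZ; last by apply: L1D => //; exact: L1_cst.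
rewrite RintD//; last exact: L1_cst.
rewrite Rint_cst; apply: ler_wpM2l; first by rewrite mulr_ge0// exprn_even_ge0.
have h0 : 0 <= C * (t - s) by rewrite mulr_ge0// subr_ge0.
have : (C * (t - s)) ^+ 4 <= C * (t - s).
  rewrite exprS ler_piMr// exprn_ile1// (le_trans Cts)// invf_le1// ler1n//.
by move: e4; move: (\int[Q]_y _) (C * (t - s)) ((C * (t - s)) ^+ 4) => u v w; lra.
Qed.

Lemma L1_sint_sqr c H t : bpred c H -> t \in `[0, 1] -> L1 Q (fun y => sint H t y ^+ 2).
Proof.
move=> bH t01; apply: (@L1_pow_le _ _ _ Q 2 2) => //; first exact: measurable_sint bH t01.
by have [] := sint_moment4 bH t01.
Qed.

(** Orthogonality of martingale increments gives the sums of squared dyadic increments a constant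
    mean; along each path they converge to the sum of squared jumps of the integral. *)
Lemma sint_isometry1 c H : bpred c H ->
  \int[Q]_y (sint H 1 y ^+ 2) = \int[Q]_y jsum (N y) (fun s => H s y ^+ 2) 1.
Proof.
move=> bH; have [sF Fm Fmono] := hF.
have c0 : 0 <= c by have [_ _ hc] := bH; exact: le_trans (hc 0 point).
pose u m i : R := i%:R / 2 ^+ m.
have p2 m : (0 : R) < 2 ^+ m by rewrite exprn_gt0.
have u0 m : u m 0 = 0 by rewrite /u mul0r.
have u1 m : u m (2 ^ m)%N = 1 by rewrite /u natrX divff// expf_neq0.
have uS m i : u m i <= u m i.+1 by rewrite ler_pM2r ?invr_gt0// ler_nat.
have du m i : u m i.+1 - u m i = (2 ^+ m)^-1 by rewrite /u -natr1 mulrDl mul1r addrAC subrr add0r.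
have uge m i : 0 <= u m i by rewrite divr_ge0// ltW.
have ule m i : (i <= 2 ^ m)%N -> u m i <= 1 by move=> h; rewrite ler_pdivrMr// mul1r -natrX ler_nat.
have h11 : (1 : R) \in `[0, 1] by apply: t01E.
pose V m y := \sum_(i < 2 ^ m) (sint H (u m i.+1) y - sint H (u m i) y) ^+ 2.
have h01 m (i : 'I_(2 ^ m)) : u m i \in `[0, 1] by apply: t01E => //; exact/ule/ltnW.
have h02 m (i : 'I_(2 ^ m)) : u m i.+1 \in `[0, 1] by apply: t01E => //; exact: ule.
have mV m : mfunT (V m).
  apply: measurable_sum => i; apply: measurable_funX; apply: measurable_funB; exact: measurable_sint bH _.
have iJ : L1 Q (fun y => jsum (N y) (fun s => H s y ^+ 2) 1).
  have b2 := bpred_sqr bH.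
  rewrite (_ : (fun y => _) = fun y => sint (fun s y => H s y ^+ 2) 1 y + int_ds (fun s => H s y ^+ 2 * lam s y) 1); last first.
    by apply/funext => y; rewrite /sint subrK.
  apply: L1D; first exact: L1_sint b2 _.
  have [p m b] := bHl b2; apply: (@L1_bounded _ _ _ _ _ (c ^+ 2 * C)).
    exact: (measurable_int_ds h11 m).
  move=> y; rewrite -[int_ds _ _]subr0 -(int_ds0 (f := fun s => H s y ^+ 2 * lam s y)); last exact: bpred_measurable1 (bHl b2).
  apply: (le_trans (int_dsB_le (c := c ^+ 2 * C) _ _ _ _ _)) => //; last by rewrite subr0 mulr1.
  exact: bpred_measurable1 (bHl b2).
have EV m : \int[Q]_y V m y = \int[Q]_y (sint H 1 y ^+ 2).
  rewrite Rint_sum; last first.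
    move=> i; have : L1 Q (fun y => (sint H (u m i.+1) y - sint H (u m i) y) ^+ 4).
      have [i1 _] := sint_moment4 bH (h01 m i); have [i2 _] := sint_moment4 bH (h02 m i).
      apply: (L1_le _ (L1Z 8 (L1D i2 i1))).
        by apply: measurable_funX; apply: measurable_funB; exact: measurable_sint bH _.
      move=> y; rewrite ger0_norm ?exprn_even_ge0// (le_trans (pow4D _ _))// ler_wpM2l// lerD2l.
      by rewrite exprNn -signr_odd/= expr0 mul1r.
    by move/(@L1_pow_le _ _ _ Q 2 2); apply=> //; apply: measurable_funB; exact: measurable_sint bH _.
  pose v i := \int[Q]_y (sint H (u m i) y ^+ 2).
  transitivity (\sum_(i < 2 ^ m) (v i.+1 - v i)).
    apply: eq_bigr => i _; apply: (mart_sqr_incr sF Fm) => //.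
    - exact: adapted_sint bH.
    - by move=> t t01; exact: L1_sint_sqr bH t01.
    - by move=> s t A s0 st t1 FA; exact: (sint_mart bH).
    - exact: ule.
  rewrite -(big_mkord xpredT (fun i => v i.+1 - v i)) telescope_sumr// /v u0 u1.
  rewrite [X in _ - X](_ : _ = 0) ?subr0//.
  rewrite (_ : (fun y => _) = fun=> 0) ?Rint_cst//.
  by apply/funext => y; rewrite (sint0 y bH) expr0n.
(* Dominates at every mesh: a sum of squares of nonnegative numbers is at most the square of their
   sum. *)
pose g y := (c * (N y 1 + C)) ^+ 2.
have ig : L1 Q g.
  rewrite (_ : g = fun y => c ^+ 2 * (N y 1 ^+ 2 + (2 * C * N y 1 + C ^+ 2))); last by apply/funext => y; rewrite /g; ring.
  apply: L1Z; apply: L1D; last by apply: L1D; [exact: L1Z|exact: L1_cst].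
  by apply: (@L1_pow_le _ _ _ Q 2 2) => //; [exact: mN|exact: L1_counting_pow4].
have Vg m y : `|V m y| <= g y.
  rewrite ger0_norm; last by apply: sumr_ge0 => i _; exact: sqr_ge0.
  pose b (i : 'I_(2 ^ m)) := c * (N y (u m i.+1) - N y (u m i)) + c * C * (u m i.+1 - u m i).
  have b0 i : 0 <= b i.
    by rewrite addr_ge0 ?mulr_ge0// subr_ge0// counting_path_homo.
  have bS : \sum_(i < 2 ^ m) b i = c * (N y 1 + C).
    rewrite big_split/= -!mulr_sumr.
    rewrite -(big_mkord xpredT (fun i => N y (u m i.+1) - N y (u m i))) (telescope_sumr (fun i => N y (u m i)))//.
    rewrite -(big_mkord xpredT (fun i => u m i.+1 - u m i)) (telescope_sumr (u m))//.
    by rewrite u0 u1 N0 !subr0 mulr1 mulrDr.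
  apply: (@le_trans _ _ (\sum_(i < 2 ^ m) b i * (c * (N y 1 + C)))).
    apply: ler_sum => i _.
    have h : `|sint H (u m i.+1) y - sint H (u m i) y| <= b i by apply: (sintB_le y bH) => //; exact: ule.
    rewrite -real_normK ?num_real// expr2 ler_pM//.
    apply: (le_trans h); rewrite -bS (bigD1 i)//= lerDl.
    by apply: sumr_ge0.
  by rewrite -mulr_suml bS -expr2.
have [] // := @Rint_dominated _ _ _ Q V (fun y => jsum (N y) (fun s => H s y ^+ 2) 1) g mV (L1_measurable iJ) ig Vg.
  apply: aeW => y.
  (* K / 2^m bounds the difference between the squared increments of the integral and those of its
     jump part, as the drift moves by at most c C / 2^m over one cell. *)
  pose K := 2 * c * C * (c * N y 1) + (c * C) ^+ 2.
  have N1 : 0 <= N y 1 by exact: counting_path_ge0.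
  have K0 : 0 <= K by rewrite addr_ge0 ?mulr_ge0 ?sqr_ge0.
  apply/cvgrPdist_le => e e0.
  have cK : (K / 2 ^+ m) @[m --> \oo] --> (0 : R).
    rewrite -[X in _ --> X](mulr0 K); apply: cvgMr.
    under eq_fun do rewrite -exprVn.
    by apply: cvg_expr; rewrite ger0_norm ?invr_ge0// invf_lt1// ltr1n.
  have := jsum_qv (hN y) (H ^~ y); move/cvgrPdist_le: cK => /(_ e e0).
  apply: filterS2 => m hK [qv _].
  rewrite -qv -sumrB; apply: (le_trans (ler_norm_sum _ _ _)).
  move: hK; rewrite sub0r normrN; apply: le_trans.
  rewrite ger0_norm; last by rewrite divr_ge0// ltW.
  pose b (i : 'I_(2 ^ m)) := 2 * c * C / 2 ^+ m * (c * (N y (u m i.+1) - N y (u m i))) + (c * C / 2 ^+ m) ^+ 2.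
  apply: (@le_trans _ _ (\sum_(i < 2 ^ m) b i)).
    apply: ler_sum => i _; rewrite /sint -!/(u _ _).
    set a := jsum _ _ _ - jsum _ _ _.
    set l := int_ds _ _; set l' := int_ds _ _.
    rewrite (_ : jsum (N y) (H^~ y) (u m i.+1) - l - _ = a - (l - l')); last by rewrite /a; ring.
    have aN1 : `|a| <= c * (N y (u m i.+1) - N y (u m i)).
      by apply: (le_jsumB (hN y)) => // x; have [_ _ hc] := bH; exact: hc.
    have ll : `|l - l'| <= c * C / 2 ^+ m.
      rewrite -(du m i); have [_ _ hc] := bHl bH; apply: int_dsB_le => //.
      - exact: bpred_measurable1 (bHl bH).
      - exact: ule.
    rewrite (_ : _ - _ = 2 * a * (l - l') - (l - l') ^+ 2); last by ring.
    rewrite (le_trans (ler_normB _ _))// /b lerD//.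
      rewrite !normrM ger0_norm// -mulrA.
      rewrite (_ : _ * (c * _) = 2 * ((c * (N y (u m i.+1) - N y (u m i))) * (c * C / 2 ^+ m))); last by ring.
      by rewrite ler_wpM2l// ler_pM.
    by rewrite normrX lerXn2r// nnegrE ?normr_ge0// (le_trans _ ll).
  rewrite big_split/= -!mulr_sumr.
  rewrite -(big_mkord xpredT (fun i => N y (u m i.+1) - N y (u m i))) (telescope_sumr (fun i => N y (u m i)))//.
  rewrite u0 u1 N0 subr0 (_ : \sum_(i < 2 ^ m) (2 : R) ^- m = 1); last first.
    by rewrite sumr_const card_ord -(mulr_natl (2 ^- m)) natrX divff// expf_neq0.
  rewrite mulr1 /K le_eqVlt.
  by apply/orP; left; apply/eqP; ring.
move=> _; rewrite (_ : (fun m => _) = fun=> \int[Q]_y (sint H 1 y ^+ 2)); last by apply/funext => m; exact: EV.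
by move/(cvg_lim (@Rhausdorff R)) => <-; rewrite lim_cst//; exact: Rhausdorff.
Qed.

(** The case of time 1, for the integrand cut to ]0, t]. *)
Lemma sint_isometry c H t : bpred c H -> t \in `[0, 1] ->
  \int[Q]_y (sint H t y ^+ 2) = \int[Q]_y jsum (N y) (fun s => H s y ^+ 2) t.
Proof.
move=> bH; rewrite in_itv/= => /andP[t0 t1]; have [sF Fm Fmono] := hF.
have FT : F 0 setT by apply: sigma_algebra_setT; apply: sF; exact: t01E.
have bK := bpredM (bpred_indic (lexx 0) t0 t1 FT) bH.
have := sint_isometry1 bK.
have JE (h : R -> R) y : jsum (N y) (fun r => \1_`]0, t] r * h r) 1 = jsum (N y) h t.
  by have := jsum_itv h (hN y) t0 t1; rewrite (jsum0 (hN y)) subr0.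
under eq_Rintegral => y _.
  rewrite /sint; under [X in jsum _ X]eq_fun do rewrite indicT mulr1.
  rewrite JE.
  under [X in int_ds X]eq_fun do rewrite indicT mulr1 -mulrA.
  over.
have E2 y : jsum (N y) (fun s => (\1_`]0, t] s * \1_setT y * H s y) ^+ 2) 1 = jsum (N y) (fun s => H s y ^+ 2) t.
  rewrite -JE; apply: eq_bigr => k _; rewrite indicT mulr1 exprMn; congr (_ * _ * _).
  by rewrite indicE; case: (_ \in _); rewrite ?expr1n ?expr0n.
under [X in _ = X -> _]eq_Rintegral do rewrite E2.
move=> <-; apply: eq_Rintegral => y _; congr (_ ^+ 2); rewrite /sint; congr (_ - _).
have [_ _ hlc] := bHl bH.
have mHl := bpred_measurable1 y (bHl bH).
have E0 := int_dsB mHl (hlc ^~ y) (lexx 0) t0 t1; rewrite (int_ds0 mHl) subr0 in E0; rewrite E0.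
rewrite int_ds_leb01 ?t01E//.
  apply: Rint_ae.
  - by apply: measurable_funM => //; exact: measurable_indic.
  - by apply: measurable_funM; [exact: measurable_indic|apply: measurable_funM => //; exact: measurable_indic].
  exists (~` `[0, 1]%classic); split; [exact: measurableC|exact: leb01_out|].
  by move=> x /= nx x01; apply: nx; rewrite [\1_`[0, 1] x]indicE mem_set// mul1r.
by apply: measurable_funM => //; exact: measurable_indic.
Qed.

Lemma jsum_mean c H t : bpred c H -> t \in `[0, 1] ->
  L1 Q (fun y => jsum (N y) (H ^~ y) t) /\
  `|\int[Q]_y jsum (N y) (H ^~ y) t| <= C * \int[(leb01 \x Q)%E]_z `|H z.1 z.2|.
Proof.
move=> bH t01; move: (t01); rewrite in_itv/= => /andP[t0 t1]; have [sF Fm Fmono] := hF.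
have [pH mH hH] := bH.
have FT : F 0 setT by apply: sigma_algebra_setT; apply: sF; exact: t01E.
have bK := bpredM (bpred_indic (lexx 0) t0 t1 FT) bH.
have JE y : jsum (N y) (fun r => \1_`]0, t] r * \1_setT y * H r y) 1 = jsum (N y) (H ^~ y) t.
  have := jsum_itv (H ^~ y) (hN y) t0 t1; rewrite (jsum0 (hN y)) subr0 => <-.
  by apply: eq_bigr => k _; rewrite indicT mulr1.
split.
  apply: (L1_le _ (L1Z c iN)).
    by apply: (measurable_wrt_sub (Fm t t01)); exact: (adapted_jsum hF hN aN pH).
  move=> y; have := @le_jsumB _ (N y) (hN y) (H ^~ y) c 0 t (hH ^~ y) (t01E (lexx 0) ler01) t01 t0.
  rewrite (jsum0 (hN y)) subr0 N0 subr0 => /le_trans; apply.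
  rewrite ler_wpM2l ?counting_path_homo//.
  exact: le_trans (hH 0 y).
have := comp bK; under eq_Rintegral do rewrite JE.
move=> ->; have [_ mKl bKl] := bpredM bK blam.
have iKl := L1_bounded (leb01 \x Q)%E mKl (fun z => bKl z.1 z.2).
have iHn : L1 (leb01 \x Q)%E (fun z : R * S => `|H z.1 z.2|).
  by apply: L1_abs; exact: (L1_bounded _ mH (fun z => hH z.1 z.2)).
rewrite -RintZ//; apply: (le_trans (Rint_abs iKl)).
apply: Rint_le; [exact: L1_abs|exact: L1Z|] => z.
have [_ _ hl] := blam.
rewrite normrM mulrC ler_pM// normrM normrM !norm_indic ler_piMl// !indicE -natrM mulnb.
Qed.

End stochastic_integral.

(** * Local martingales, integrability and uniqueness of the intensity *)

Section ae_integration.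
Context {d : measure_display} {T : measurableType d} {R : realType}.
Variable mu : probability T R.

Lemma Rint_dominated_ae (F : nat -> T -> R) (f g : T -> R) :
  (forall n, mfunT (F n)) -> mfunT f -> L1 mu g ->
  {ae mu, forall x, forall n, `|F n x| <= g x} ->
  {ae mu, forall x, F n x @[n --> \oo] --> f x} ->
  L1 mu f /\ \int[mu]_x F n x @[n --> \oo] --> \int[mu]_x f x.
Proof.
move=> mF mf hg Fg Ff.
have hF n : L1 mu (F n).
  by apply: (L1_le_ae (mF n) hg); apply: filterS Fg => x; exact.
have [] := @dominated_convergence _ _ _ mu setT measurableT
  (fun n x => (F n x)%:E) (EFin \o f) (EFin \o g) _ _ _ hg _.
- by move=> n; exact/measurable_EFinP.
- exact/measurable_EFinP.
- by apply: filterS Ff => x Ffx _; apply: cvg_EFin => //; exact: nearW.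
- by apply: filterS Fg => x h n _ /=; rewrite lee_fin.
move=> hf _ cF; split=> //.
move: cF; rewrite /= (EFin_Rint hf).
under eq_fun do rewrite (EFin_Rint (hF _)).
by move=> /fine_cvgP[].
Qed.

Lemma Rint_eq0_ae f : L1 mu f -> (forall x, 0 <= f x) -> \int[mu]_x f x = 0 ->
  {ae mu, forall x, f x = 0}.
Proof.
move=> hf f0 I0.
have mf : mfunT (EFin \o f) by apply/measurable_EFinP; exact: L1_measurable hf.
have [h _] := ae_eq_integral_abs mu measurableT mf.
have : (\int[mu]_x `|(EFin \o f) x| = 0)%E.
  by under eq_integral => x _ do rewrite /= ger0_norm//; rewrite EFin_Rint// I0.
by move=> /h; apply: filterS => x /(_ Logic.I) [].
Qed.

Lemma Rint_leb01_L1 (f : R -> R) : mfunT f ->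
  lebesgue_measure.-integrable `[0, 1] (EFin \o f) -> L1 (@leb01 R) f.
Proof.
move=> mf /integrableP[_ h]; apply/integrableP; split; first exact/measurable_EFinP.
rewrite ge0_integral_leb01//.
by apply/measurable_EFinP; apply: measurableT_comp.
Qed.

End ae_integration.

Section local_martingales.
Context {R : realType} {d : measure_display} {S : measurableType d}.
Variable Q : probability S R.
Variable F : R -> set (set S).
Hypothesis hF : filtration F.

Lemma condexp_increment (A : set (set S)) (Z Y : S -> R) B : A `<=` measurable ->
  is_condexp Q A Z Y -> A B -> \int[Q]_y (\1_B y * (Z y - Y y)) = 0.
Proof.
move=> Am [iZ iY mY h] AB.
have mB : measurable B by exact: Am.
have E (f : S -> R) : L1 Q f -> (\int[Q]_y (\1_B y * f y)%:E = \int[Q]_(y in B) (f y)%:E)%E.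
  move=> hf; rewrite [RHS]integral_mkcond; apply: eq_integral => y _.
  by rewrite restrict_EFin/= patch_indic mulrC.
have := h B AB; rewrite -!E// !EFin_Rint; [|exact: L1_indic|exact: L1_indic].
move=> [e]; under eq_Rintegral do rewrite mulrBr.
by rewrite RintB; [rewrite e subrr|exact: L1_indic|exact: L1_indic].
Qed.

(** The localizing sequence reaches time 1 at a finite rank, after which stopping has no effect; the
    dominating variable allows the passage to the limit. *)
Lemma local_martingale_dominated (Z : R -> S -> R) (D : S -> R) :
  local_martingale Q F Z -> adapted F Z -> L1 Q D ->
  {ae Q, forall y, forall t, t \in `[0, 1] -> `|Z t y| <= D y} ->
  forall s t A, 0 <= s -> s <= t -> t <= 1 -> F s A ->
  \int[Q]_y (\1_A y * (Z t y - Z s y)) = 0.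
Proof.
move=> [tau [st _ tau1 mart]] aZ iD ZD s t A s0 st' t1 FA; have [sF Fm _] := hF.
have s01 := t01E s0 (le_trans st' t1); have t01 := t01E (le_trans s0 st') t1.
have mA : measurable A by exact: (Fm s).
have mZ u : u \in `[0, 1] -> mfunT (Z u).
  by move=> u01; apply: (measurable_wrt_sub (Fm u u01)); exact: aZ.
pose Zk k u y := Z (Num.min u (tau k y)) y.
have iZk k u : u \in `[0, 1] -> L1 Q (Zk k u).
  by rewrite in_itv/= => /andP[u0 u1]; have [] := mart k u u u0 (lexx u) u1.
have [] // := @Rint_dominated_ae _ _ _ Q (fun k y => \1_A y * (Zk k t y - Zk k s y)) (fun y => \1_A y * (Z t y - Z s y)) (fun y => D y + D y).
- move=> k; apply: measurable_funM; first exact: measurable_indic.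
  by apply: measurable_funB; apply: L1_measurable; exact: iZk.
- apply: measurable_funM; first exact: measurable_indic.
  by apply: measurable_funB; exact: mZ.
- exact: L1D.
- apply: filterS ZD => y hy k; rewrite normrM norm_indic.
  apply: (@le_trans _ _ (`|Zk k t y - Zk k s y|)).
    by rewrite ler_piMl// indicE; case: (_ \in _).
  have h u : u \in `[0, 1] -> `|Zk k u y| <= D y.
    rewrite in_itv/= => /andP[u0 u1]; apply: hy; apply: t01E.
      by rewrite le_min u0 (st k).1.
    by rewrite ge_min u1.
  by rewrite (le_trans (ler_normB _ _))// lerD// h.
- apply: filterS tau1 => y hy; apply: cvg_near_cst; apply: filterS hy => k hk.
  rewrite /Zk !(min_idPl _)// ?(le_trans _ hk)//.
  exact: le_trans st' t1.
move=> _; rewrite (_ : (fun k => _) = fun=> 0); last first.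
  apply/funext => k; apply: (condexp_increment (Fm s s01)) => //.
  exact: (mart k s t).
by move/(cvg_lim (@Rhausdorff R)) => <-; rewrite lim_cst//; exact: Rhausdorff.
Qed.

Variable N : S -> cumulative R R.
Hypothesis hN : forall y, counting_path (N y).
Hypothesis aN : adapted F (fun t y => N y t).

Let N0 y : N y 0 = 0. Proof. by case: (hN y). Qed.

Let mN t : t \in `[0, 1] -> mfunT (fun y => N y t).
Proof. exact: (measurable_counting hF aN). Qed.

Section one_intensity.
Variable lam : R -> S -> R.
Hypothesis plam : predictable F lam.

Let rl : R * S -> R := restr_proc 1 lam.

Let mrl : mfunT rl.
Proof. exact: (measurable_predictable hF plam). Qed.

Let mrl1 y : mfunT (fun s => rl (s, y)).
Proof. exact: (measurable_fun_pair1 y mrl). Qed.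

Let rlE y s : s \in `[0, 1] -> rl (s, y) = lam s y.
Proof. by move=> s01; rewrite /rl /restr_proc patchT// inE/=. Qed.

Let int_rl y t : t \in `[0, 1] -> int_ds (lam ^~ y) t = \int[leb01]_s (\1_`[0, t] s * rl (s, y)).
Proof.
move=> t01; rewrite -int_ds_leb01//.
by apply: int_ds_ext => // s s01; rewrite rlE.
Qed.

Let adapted_comp : adapted F (compensated N lam).
Proof.
have [sF Fm _] := hF; move=> t t01; apply: (measurable_wrtB (sF t t01)); first exact: aN.
exact: adapted_int_ds.
Qed.

Let leb0 : @leb01 R [set 0] = 0%E.
Proof. by have := leb01_set1 (0 : R). Qed.

(** The bound being one-sided, it makes the compensated process at least - C. By a Fatou argument
    along the localizing sequence, Z_1 + C is integrable with mean at most C; it is the sum of N_1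
    and of the integral of C - lambda, both nonnegative, so each is integrable. *)
Lemma intensity_bounded_above C : 0 <= C ->
  local_martingale Q F (compensated N lam) ->
  {ae Q, forall y, lebesgue_measure.-integrable `[0, 1] (EFin \o (lam ^~ y))} ->
  {ae Q, forall y, forall t, t \in `[0, 1] -> lam t y <= C} ->
  L1 Q (fun y => N y 1) /\ L1 (leb01 \x Q)%E rl.
Proof.
move=> C0 lm ilam lamC; have [sF Fm _] := hF.
have h01 : (0 : R) \in `[0, 1] by apply: t01E.
have h11 : (1 : R) \in `[0, 1] by apply: t01E.
pose Z := compensated N lam.
have good : {ae Q, forall y, L1 (@leb01 R) (fun s => rl (s, y)) /\ forall t, t \in `[0, 1] -> lam t y <= C}.
  move: lamC; apply: filterS2 ilam => y ly lC; split=> //; apply: Rint_leb01_L1 => //.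
  apply: eq_integrable ly => //= s; rewrite inE/= => s01.
  by rewrite /= rlE.
have [tau [st _ tau1 mart]] := lm.
pose Zk k y := Z (Num.min 1 (tau k y)) y.
have iZk k : L1 Q (Zk k) by have [] := mart k 1 1 ler01 (lexx 1) (lexx 1).
(* Stopped values have the mean of the initial value, which is zero almost surely. *)
have EZk k : \int[Q]_y Zk k y = 0.
  have FT : F 0 setT by apply: sigma_algebra_setT; exact: sF.
  have := condexp_increment (Fm 0 h01) (mart k 0 1 (lexx 0) ler01 (lexx 1)) FT.
  have iZ0 : L1 Q (fun y => Z (Num.min 0 (tau k y)) y) by have [] := mart k 0 0 (lexx 0) (lexx 0) ler01.
  under eq_Rintegral do rewrite indicT mul1r.
  rewrite (RintB (iZk k) iZ0) => /eqP; rewrite subr_eq0 => /eqP ->.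
  rewrite (@Rint_ae _ _ _ Q _ (fun=> 0)) ?Rint_cst//; first exact: L1_measurable iZ0.
  apply: filterS good => y [iy _].
  rewrite (min_idPl ((st k).1 y)) /Z /compensated N0 sub0r int_rl// (@Rint_ae _ _ _ leb01 _ (fun=> 0)) ?Rint_cst ?oppr0//.
    by apply: measurable_funM => //; exact: measurable_indic.
  exists [set 0]; split=> //= s /= ns; apply: contrapT => /eqP s0; apply: ns.
  by rewrite set_itv1 indicE memNset ?mul0r//= => /eqP; rewrite (negbTE s0).
have Zge y u : L1 (@leb01 R) (fun s => rl (s, y)) -> (forall t, t \in `[0, 1] -> lam t y <= C) ->
    0 <= u -> u <= 1 -> 0 <= Z u y + C.
  move=> iy lC u0 u1; have u01 := t01E u0 u1.
  rewrite /Z /compensated int_rl//.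
  have : \int[leb01]_s (\1_`[0, u] s * rl (s, y)) <= C.
    rewrite -[leRHS](Rint_cst (@leb01 R)); apply: Rint_le; [exact: L1_indic|exact: L1_cst|] => s.
    rewrite indicE; case: (boolP (s \in _)) => h; rewrite ?mul0r// mul1r.
    move: h; rewrite inE/= in_itv/= => /andP[h1 h2].
    have s01 := t01E h1 (le_trans h2 u1).
    by rewrite rlE// lC.
  have := counting_path_ge0 (hN y) u0; lra.
pose f y := Num.max (Z 1 y + C) 0.
have mZ1 : mfunT (Z 1).
  by apply: (measurable_wrt_sub (Fm 1 h11)); exact: adapted_comp.
have mf : mfunT f by apply: measurable_maxr => //; exact: measurable_funD.
have f0 y : 0 <= f y by rewrite /f le_max lexx orbT.
have [if1 _] : L1 Q (fun y => f y ^+ 1) /\ \int[Q]_y (f y ^+ 1) <= C.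
  apply: L1_trunc_lim => // k k0.
  (* Bounded truncations of the stopped values: dominated convergence here, followed by
     [L1_trunc_lim], plays the part of Fatou's lemma. *)
  pose g n y := Num.min (Num.max (Zk n y + C) 0) k.
  have g0 n y : 0 <= g n y by rewrite /g le_min k0 le_max lexx orbT.
  have gk n y : g n y <= k by rewrite /g ge_min lexx orbT.
  have mg n : mfunT (g n).
    apply: measurable_minr => //; apply: measurable_maxr => //.
    by apply: measurable_funD => //; exact: L1_measurable (iZk n).
  have [] // := @Rint_dominated _ _ _ Q g (fun y => Num.min (f y) k ^+ 1) (fun=> k) mg.
  - by apply: measurable_funX; exact: measurable_minr.
  - exact: L1_cst.
  - by move=> n y; rewrite ger0_norm.
  - apply: filterS tau1 => y hy; apply: cvg_near_cst; apply: filterS hy => n hn.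
    by rewrite /g /f expr1 /Zk (min_idPl hn).
  move=> _ cv; rewrite -(cvg_lim (@Rhausdorff R) cv); apply: limr_le; first exact: cvgP cv.
  apply: nearW => n; rewrite -[leRHS]add0r -(EZk n) -[X in _ <= _ + X](Rint_cst Q) -RintD//; last exact: L1_cst.
  apply: Rint_le_ae.
  - by apply: (@L1_bounded _ _ _ _ _ k) => // y; rewrite ger0_norm.
  - by apply: L1D => //; exact: L1_cst.
  apply: filterS good => y [iy lC].
  rewrite /g ge_min; apply/orP; left; rewrite ge_max lexx/=.
  apply: Zge => //; first by rewrite le_min ler01 (st n).1.
  by rewrite ge_min lexx.
have iF : L1 Q f by move: if1; under eq_fun do rewrite expr1.
(* The decomposition into two nonnegative parts, from which both integrability claims follow. *)
have fE : {ae Q, forall y, [/\ L1 (@leb01 R) (fun s => rl (s, y)), f y = N y 1 + \int[leb01]_s `|C - rl (s, y)| & 0 <= \int[leb01]_s `|C - rl (s, y)|]}.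
  apply: filterS good => y [iy lC]; split=> //; last by apply: Rint_ge0.
  rewrite /f (max_idPl _); last exact: Zge.
  rewrite /Z /compensated int_rl// -addrA; congr (_ + _).
  rewrite addrC -[X in X - _](Rint_cst (@leb01 R)) -RintB; [|exact: L1_cst|exact: L1_indic].
  apply: Rint_ae.
  - by apply: measurable_funB => //; apply: measurable_funM => //; exact: measurable_indic.
  - by apply: measurableT_comp => //; apply: measurable_funB.
  exists (~` `[0, 1]%classic); split; [exact: measurableC|exact: leb01_out|].
  move=> s /= ns s01; apply: ns; rewrite indicE mem_set// mul1r ger0_norm// subr_ge0 rlE//.
  exact: lC.
split.
  apply: (L1_le_ae _ iF); first exact: mN.
  apply: filterS fE => y [_ -> h]; rewrite ger0_norm ?lerDl//.
  exact: counting_path_ge0.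
have mC : mfunT (fun z => `|C - rl z|).
  by apply: measurableT_comp => //; apply: measurable_funB.
have iC : L1 (leb01 \x Q)%E (fun z => C - rl z).
  apply/integrableP; split; first by apply/measurable_EFinP; exact: measurable_funB.
  rewrite (@fubini_tonelli2 _ _ _ _ _ leb01 Q (fun z => `|(C - rl z)%:E|%E))//; last first.
    by apply/measurable_EFinP.
  have /integrableP[_] := iF; apply: le_lt_trans.
  apply: ae_ge0_le_integral => //.
  - by move=> y _; apply: integral_ge0.
  - by apply: measurable_fun_fubini_tonelli_G => //; exact/measurable_EFinP.
  - by apply/measurable_EFinP; exact: measurableT_comp.
  apply: filterS fE => y [iy fy h] _; rewrite /fubini_G/=.
  have iCy : L1 (@leb01 R) (fun s => `|C - rl (s, y)|).
    by apply: L1_abs; apply: L1B => //; exact: L1_cst.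
  rewrite [X in (X <= _)%E](_ : _ = (\int[leb01]_s `|C - rl (s, y)|)%:E); last exact: EFin_Rint.
  by rewrite lee_fin ger0_norm// fy lerDr counting_path_ge0.
rewrite (_ : rl = fun z => C - (C - rl z)); last by apply/funext => z; ring.
by apply: L1B => //; exact: L1_cst.
Qed.

Lemma intensity_martingale : local_martingale Q F (compensated N lam) ->
  L1 Q (fun y => N y 1) -> L1 (leb01 \x Q)%E rl ->
  forall s t A, 0 <= s -> s <= t -> t <= 1 -> F s A ->
  \int[Q]_y (\1_A y * ((N y t - N y s) - (int_ds (lam ^~ y) t - int_ds (lam ^~ y) s))) = 0.
Proof.
move=> lm iN irl s t A s0 st t1 FA.
have [iI _] := Rint_prod21 (L1_abs irl).
have := @local_martingale_dominated _ _ lm adapted_comp (L1D iN iI) _ s t A s0 st t1 FA.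
rewrite (_ : (fun y => \1_A y * (compensated N lam t y - _)) = (fun y => \1_A y * ((N y t - N y s) - (int_ds (lam ^~ y) t - int_ds (lam ^~ y) s)))); last first.
  by apply/funext => y; rewrite /compensated; ring.
apply; apply: filterS (L1_prod2 irl) => y iy u u01.
rewrite /compensated int_rl// (le_trans (ler_normB _ _))//; apply: lerD.
  move: u01; rewrite in_itv/= => /andP[u0 u1].
  by rewrite ger0_norm ?counting_path_homo// counting_path_ge0.
apply: (le_trans (Rint_abs (L1_indic _ iy))) => //.
apply: Rint_le; [by apply: L1_abs; exact: L1_indic|exact: L1_abs|] => s'.
by rewrite normrM norm_indic ler_piMl// indicE; case: (_ \in _).
Qed.

End one_intensity.

(** Both processes compensate the same [N], so the compensation formula gives them equal integrals
    over predictable sets; tested where one is at least the other, it makes them equal almost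
    everywhere. The bounds 0 and [C] thus pass to [lam], which may be replaced by its clamped
    version in the formula. *)
Lemma intensity_unique (lam blam : R -> S -> R) (C : R) : 0 <= C ->
  predictable F lam -> predictable F blam ->
  L1 Q (fun y => N y 1) -> L1 (leb01 \x Q)%E (restr_proc 1 lam) ->
  L1 (leb01 \x Q)%E (restr_proc 1 blam) ->
  local_martingale Q F (compensated N lam) -> local_martingale Q F (compensated N blam) ->
  {ae Q, forall y, forall t, t \in `[0, 1] -> blam t y <= C} ->
  let lamc := fun t y => clamp (- C) C (restr_proc 1 lam (t, y)) in
  [/\ bpred F C lamc, {ae (leb01 \x Q)%E, forall z, restr_proc 1 lam z = lamc z.1 z.2} &
   forall c H, bpred F c H ->
    \int[Q]_y jsum (N y) (H ^~ y) 1 = \int[(leb01 \x Q)%E]_z (H z.1 z.2 * lamc z.1 z.2)].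
Proof.
move=> C0 pl pb iN il ib lml lmb bC lamc; have [sF Fm Fmono] := hF.
have ml := intensity_martingale pl lml iN il.
have mb := intensity_martingale pb lmb iN ib.
have cl := compensation hF hN aN iN pl il ml.
have cb := compensation hF hN aN iN pb ib mb.
have mrl := L1_measurable il; have mrb := L1_measurable ib.
have sA := predictable_system_sigma F.
pose D := `[(0 : R), 1]%classic `*` [set: S].
have rE (f : R -> S -> R) z : D z -> restr_proc 1 f z = f z.1 z.2.
  by move=> Dz; rewrite /restr_proc patchT// inE.
have r0 (f : R -> S -> R) z : ~ D z -> restr_proc 1 f z = 0.
  by move=> Dz; rewrite /restr_proc patchN// notin_setE.
have pos (f g : R -> S -> R) : predictable F f -> predictable F g ->
    L1 (leb01 \x Q)%E (restr_proc 1 f) -> L1 (leb01 \x Q)%E (restr_proc 1 g) ->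
    (forall h c, measurable_wrt (predictable_system F) h -> (forall z, `|h z| <= c) -> (forall z, 0 <= h z) ->
      drift_integral Q g h <= drift_integral Q f h) ->
    {ae (leb01 \x Q)%E, forall z, restr_proc 1 g z <= restr_proc 1 f z}.
  move=> pf pg If Ig hfg.
  (* The predictable set where [g] is at least [f]; comparing the integrals over it leaves no mass
     to the positive part of g - f. *)
  pose B := (fun z : R * S => g z.1 z.2 - f z.1 z.2) @^-1` [set x | 0 <= x].
  have pB : predictable_system F B.
    exact: (measurable_wrt_le 0 ((predictableP F (fun t y => g t y - f t y)).1 (predictableB pg pf))).
  have mh := measurable_wrt_indic (R := R) sA pB.
  have h1 (z : R * S) : `|\1_B z| <= 1 :> R by rewrite norm_indic indicE; case: (_ \in _).
  have h0 (z : R * S) : 0 <= \1_B z :> R by rewrite indicE.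
  have := hfg _ 1 mh h1 h0; rewrite /drift_integral.
  have mD := measurable_wrt_predictable hF mh.
  have ifB := L1_drift If mD h1; have igB := L1_drift Ig mD h1.
  rewrite -subr_le0 -RintB//.
  have hE z : ((\1_B : R * S -> R) \_ D) z * restr_proc 1 g z - ((\1_B : R * S -> R) \_ D) z * restr_proc 1 f z = Num.max (restr_proc 1 g z - restr_proc 1 f z) 0.
    have [Dz|Dz] := pselect (D z); last by rewrite !r0// !mulr0 subrr maxxx.
    rewrite patchT ?inE// -mulrBr !rE//; rewrite indicE; case: (boolP (z \in B)).
      by rewrite inE /B/= => h; rewrite mul1r; exact/esym/max_idPl.
    by rewrite notin_setE /B/= => /negP; rewrite -ltNge => h; rewrite mul0r; apply/esym/max_idPr/ltW.
  under eq_Rintegral do rewrite hE.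
  move=> I0; have iM : L1 (leb01 \x Q)%E (fun z => Num.max (restr_proc 1 g z - restr_proc 1 f z) 0).
    by have := L1B igB ifB; under eq_fun do rewrite hE.
  have M0 z : 0 <= Num.max (restr_proc 1 g z - restr_proc 1 f z) 0 by rewrite le_max lexx orbT.
  have E0 : \int[(leb01 \x Q)%E]_z Num.max (restr_proc 1 g z - restr_proc 1 f z) 0 = 0.
    by apply/eqP; rewrite eq_le I0/=; exact: Rint_ge0.
  have := Rint_eq0_ae iM M0 E0.
  by apply: filterS => z e; rewrite -subr_le0 -e le_max lexx.
have zc (c : R) : L1 (leb01 \x Q)%E (restr_proc 1 (fun _ _ => c : R)).
  apply: (@L1_bounded _ _ _ _ _ `|c|); first exact: (measurable_predictable hF (@predictable_cst _ _ _ F c)).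
  by move=> z; rewrite /restr_proc /patch; case: ifP; rewrite ?normr0.
have lb : {ae (leb01 \x Q)%E, forall z, restr_proc 1 lam z <= restr_proc 1 blam z}.
  by apply: pos => // h c mh hc _; rewrite -(cl _ _ mh hc) (cb _ _ mh hc).
have bl : {ae (leb01 \x Q)%E, forall z, restr_proc 1 blam z <= restr_proc 1 lam z}.
  by apply: pos => // h c mh hc _; rewrite -(cl _ _ mh hc) (cb _ _ mh hc).
(* Comparison with the zero process: the jump integral of a nonnegative integrand is nonnegative. *)
have b0 : {ae (leb01 \x Q)%E, forall z, restr_proc 1 (fun _ _ => 0 : R) z <= restr_proc 1 blam z}.
  apply: (pos _ _ pb (@predictable_cst _ _ _ F 0) ib (zc 0)) => h c mh hc h0.
  rewrite -(cb _ _ mh hc) /drift_integral (_ : (fun z => _) = fun=> 0); last first.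
    by apply/funext => z; rewrite [restr_proc _ _ _]/restr_proc [X in _ * X](_ : _ = 0) ?mulr0// /patch; case: ifP.
  rewrite Rint_cst; apply: Rint_ge0 => y; apply: sumr_ge0 => k _.
  by rewrite mulr_ge0.
have bleC : {ae (leb01 \x Q)%E, forall z, restr_proc 1 blam z <= C}.
  pose K z := Num.max (restr_proc 1 blam z - C) 0.
  have K0 z : 0 <= K z by rewrite /K le_max lexx orbT.
  have mK : mfunT K by apply: measurable_maxr => //; exact: measurable_funB.
  have iK : L1 (leb01 \x Q)%E K.
    apply: (L1_le mK (L1D (L1_abs ib) (L1_cst _ C))) => z; rewrite ger0_norm// /K.
    rewrite ge_max addr_ge0// andbT; have := ler_norm (restr_proc 1 blam z); lra.
  have [iI EI] := Rint_prod21 iK.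
  have E0 : \int[(leb01 \x Q)%E]_z K z = 0.
    rewrite -EI (@Rint_ae _ _ _ Q _ (fun=> 0)) ?Rint_cst//; first exact: L1_measurable iI.
    apply: filterS bC => y hy; rewrite (_ : (fun s => _) = fun=> 0) ?Rint_cst//.
    apply/funext => s; apply/max_idPr; rewrite subr_le0.
    have [h|h] := pselect (D (s, y)); first by rewrite rE//; apply: hy; case: h.
    by rewrite r0.
  apply: filterS (Rint_eq0_ae iK K0 E0) => z e.
  by rewrite -subr_le0 -e /K le_max lexx.
have mlamc : mfunT (fun z : R * S => lamc z.1 z.2).
  rewrite (_ : (fun z => _) = clamp (- C) C \o restr_proc 1 lam); last by apply/funext => -[t y].
  by apply: measurableT_comp => //; exact: measurable_clamp.
have lE : {ae (leb01 \x Q)%E, forall z, restr_proc 1 lam z = lamc z.1 z.2}.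
  have z0 z : restr_proc 1 (fun (_ : R) (_ : S) => 0 : R) z = 0 by rewrite /restr_proc /patch; case: ifP.
  apply: filterS (filterI lb (filterI bl (filterI b0 bleC))) => -[t y] [h1 [h2 [h3 h4]]].
  rewrite z0 in h3; have e : restr_proc 1 lam (t, y) = restr_proc 1 blam (t, y) by apply/eqP; rewrite eq_le h1.
  rewrite /lamc/= clamp_id//; rewrite e// (le_trans _ h3)// oppr_le0//.
have bc : bpred F C lamc.
  split=> //; last by move=> t y; exact: clamp_norm.
  apply: (@predictable_ext _ _ _ F (fun t y => clamp (- C) C (lam t y))).
    by move=> t y t01; rewrite /lamc rE.
  by apply: predictable_comp => //; exact: measurable_clamp.
split=> // c H [pH mH bH].
have mh : measurable_wrt (predictable_system F) (fun z => H z.1 z.2) by exact/predictableP.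
have := cl _ c mh (fun z => bH z.1 z.2); rewrite /jump_integral /= => ->.
apply: Rint_ae.
- by apply: measurable_funM => //; exact: (measurable_wrt_predictable hF mh).
- exact: measurable_funM.
apply: filterS lE => -[t y] /= e; have [Dz|Dz] := pselect (D (t, y)).
  by rewrite patchT ?inE// e.
by rewrite -e r0// !mulr0.
Qed.

End local_martingales.

(** * Taylor bounds for sine, cosine and exponential *)

Section trigonometric_bounds.
Context {R : realType}.
Implicit Types x y h v : R.

Lemma is_derive_continuous_seg (f f' : R -> R) (a b : R) :
  (forall x, is_derive x (1 : R) f (f' x)) -> {within `[a, b], continuous f}.
Proof.
move=> df; apply: continuous_subspaceT => x.
by apply/differentiable_continuous/derivable1_diffP; have := df x => /@ex_derive.
Qed.

(** By the mean value theorem; iterated, it gives the alternating Taylor bounds of sine and cosine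
    one order at a time. *)
Lemma ge0_from_derive (f f' : R -> R) : (forall x, is_derive x (1 : R) f (f' x)) ->
  f 0 = 0 -> (forall x, 0 <= x -> 0 <= f' x) -> forall x, 0 <= x -> 0 <= f x.
Proof.
move=> df f0 f'0 x x0.
have [c cx e] := MVT_segment x0 (fun y _ => df y) (is_derive_continuous_seg df).
move: e; rewrite f0 !subr0 => ->; rewrite mulr_ge0//; apply: f'0.
by move: cx; rewrite in_itv/= => /andP[].
Qed.

Lemma sin_le_id x : 0 <= x -> sin x <= x.
Proof.
move=> x0; rewrite -subr_ge0; move: x x0; apply: (@ge0_from_derive (fun x => x - sin x) (fun x => 1 - cos x)).
- by rewrite sin0 subrr.
- by move=> z _; rewrite subr_ge0 cos_le1.
Qed.

Lemma cos_ge_quadratic x : 0 <= x -> 1 - x ^+ 2 / 2 <= cos x.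
Proof.
move=> x0; rewrite -subr_ge0 (_ : _ - _ = cos x + 2^-1 * x ^+ 2 - 1); last by field.
move: x x0; apply: (@ge0_from_derive (fun x => cos x + 2^-1 * x ^+ 2 - 1) (fun x => - sin x + x)).
- move=> z; apply: is_derive_eq; rewrite /GRing.scale/= ; by field.
- by rewrite cos0 expr0n/= mulr0 addr0 subrr.
- by move=> z z0; rewrite addrC subr_ge0 sin_le_id.
Qed.

Lemma sin_ge_cubic x : 0 <= x -> x - x ^+ 3 / 6 <= sin x.
Proof.
move=> x0; rewrite -subr_ge0 (_ : _ - _ = sin x + 6^-1 * x ^+ 3 - x); last by field.
move: x x0; apply: (@ge0_from_derive (fun x => sin x + 6^-1 * x ^+ 3 - x) (fun x => cos x + 2^-1 * x ^+ 2 - 1)).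
- move=> z; apply: is_derive_eq; rewrite /GRing.scale/= ; by field.
- by rewrite sin0 expr0n/= mulr0 addr0 subrr.
- move=> z /cos_ge_quadratic; lra.
Qed.

Lemma cos_le_quartic x : 0 <= x -> cos x <= 1 - x ^+ 2 / 2 + x ^+ 4 / 24.
Proof.
move=> x0; rewrite -subr_ge0 (_ : _ - _ = 24^-1 * x ^+ 4 - 2^-1 * x ^+ 2 + 1 - cos x); last by field.
move: x x0; apply: (@ge0_from_derive (fun x => 24^-1 * x ^+ 4 - 2^-1 * x ^+ 2 + 1 - cos x) (fun x => sin x + 6^-1 * x ^+ 3 - x)).
- move=> z; apply: is_derive_eq; rewrite /GRing.scale/= ; by field.
- by rewrite cos0 !expr0n/= !mulr0 subrr add0r subrr.
- move=> z /sin_ge_cubic; lra.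
Qed.

Lemma sin_taylor x : `|sin x - x| <= `|x| ^+ 3.
Proof.
have H y : 0 <= y -> `|sin y - y| <= y ^+ 3.
  move=> y0; have := sin_le_id y0; have := sin_ge_cubic y0; have := exprn_ge0 3 y0.
  move=> h1 h2 h3; rewrite ler_norml; apply/andP; split; move: (y ^+ 3) h1 h2 => w; lra.
have [x0|/ltW x0] := leP 0 x; first by rewrite (ger0_norm x0); exact: H.
have := H (- x); rewrite oppr_ge0 => /(_ x0); rewrite sinN -opprD normrN (ler0_norm x0); exact.
Qed.

Lemma cos_taylor x : `|cos x - (1 - x ^+ 2 / 2)| <= x ^+ 4.
Proof.
have H y : 0 <= y -> `|cos y - (1 - y ^+ 2 / 2)| <= y ^+ 4.
  move=> y0; have := cos_ge_quadratic y0; have := cos_le_quartic y0; have := exprn_ge0 4 y0.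
  move=> h1 h2 h3; rewrite ler_norml; apply/andP; split; move: (y ^+ 4) (y ^+ 2) h1 h2 h3 => w w2; lra.
have [x0|/ltW x0] := leP 0 x; first exact: H.
by have := H (- x); rewrite oppr_ge0 => /(_ x0); rewrite cosN sqrrN -[4%N]/(2 * 2)%N !exprM sqrrN.
Qed.

Lemma expRN_taylor v : 0 <= v -> `|expR (- v) - (1 - v)| <= v ^+ 2.
Proof.
move=> v0; have h1 := expR_ge1Dx (- v).
have h2 : expR (- v) <= 1 - v + v ^+ 2.
  rewrite expRN; apply: (@le_trans _ _ (1 + v)^-1).
    by rewrite lef_pV2 ?posrE ?expR_gt0 ?expR_ge1Dx// ltr_wpDr.
  rewrite -[leLHS]mul1r ler_pdivrMr ?ltr_wpDr// -subr_ge0.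
  by rewrite (_ : _ - _ = v ^+ 3) ?exprn_ge0//; ring.
by rewrite ler_norml; apply/andP; split; [have := sqr_ge0 v|]; lra.
Qed.

End trigonometric_bounds.

(** * Independent samples *)

Section set_coordinate.
Context {S : Type} {n : nat}.

Definition set_tnth (z : n.-tuple S) (j : 'I_n) (y : S) : n.-tuple S :=
  [tuple if i == j then y else tnth z i | i < n].

Lemma tnth_set_tnth z j y i : tnth (set_tnth z j y) i = if i == j then y else tnth z i.
Proof. by rewrite tnth_mktuple. Qed.

End set_coordinate.

Section resampling_def.
Context {R : realType} {d : measure_display} {S : measurableType d} {n : nat}.
Variables (mu : probability (n.-tuple S) R) (Q : probability S R).

Lemma measurable_set_tnth (j : 'I_n) :
  mfunT (fun z : n.-tuple S * S => set_tnth z.1 j z.2).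
Proof.
apply/measurable_fun_tnthP => i; rewrite (_ : _ \o _ = fun z : n.-tuple S * S => if i == j then z.2 else tnth z.1 i); last first.
  by apply/funext => z /=; rewrite tnth_set_tnth.
case: (i == j); first exact: measurable_snd.
exact: (measurableT_comp (measurable_tnth i) measurable_fst).
Qed.

(* the j-th coordinate is independent of the others, with law Q *)
Definition resamplable := forall (j : 'I_n) (A : set (n.-tuple S)), measurable A ->
  mu A = (mu \x Q)%E [set z | A (set_tnth z.1 j z.2)].

Definition cylinder (A : 'I_n -> set S) : set (n.-tuple S) := [set z | forall i, A i (tnth z i)].

Lemma measurable_cylinder A : (forall i, measurable (A i)) -> measurable (cylinder A).
Proof.
move=> mA; rewrite (_ : cylinder A = \bigcap_(i in [set: 'I_n]) ((@tnth n S)^~ i) @^-1` (A i)).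
  apply: fin_bigcap_measurable; first exact: finite_finset.
  by move=> i _; rewrite -[X in measurable X]setTI; exact: measurable_tnth.
by apply/seteqP; split=> z h i; [move=> _; exact: h|exact: (h i Logic.I)].
Qed.

(** Cylinders are stable under intersection and generate; on them, redrawing coordinate [j] just
    replaces one factor of the product by itself. *)
Lemma resamplableP : (forall A, (forall i, measurable (A i)) -> mu (cylinder A) = (\prod_(i < n) Q (A i))%E) ->
  resamplable.
Proof.
move=> muE j A mA.
pose G : set (set (n.-tuple S)) := [set B | exists2 A, (forall i, measurable (A i)) & B = cylinder A].
have ms : mfunT (fun z : n.-tuple S * S => set_tnth z.1 j z.2) by exact: measurable_set_tnth.
have @m2 : {measure set (n.-tuple S) -> \bar R}.
  by refine [the {measure set (n.-tuple S) -> \bar R} of pushforward (mu \x Q)%E (fun z : n.-tuple S * S => set_tnth z.1 j z.2)]; exact: ms.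
have := @measure_unique _ R _ G (fun=> setT) _ _ _ _ mu m2.
have gT : G setT.
  by exists (fun=> setT) => //; apply/seteqP; split.
move=> h; apply: (h _ _ _ _ _ _ _ mA) => {h A mA}.
- apply/seteqP; split; last first.
    by apply: smallest_sub; [exact: sigma_algebra_measurable|move=> _ [A mA ->]; exact: measurable_cylinder].
  apply: smallest_sub; first exact: smallest_sigma_algebra.
  move=> B; rewrite -bigcup_seq/= => -[i _ [C mC <-]]; apply: sub_sigma_algebra.
  exists (fun k => if k == i then C else setT); first by move=> k; case: ifP.
  rewrite setTI; apply/seteqP; split=> z /= h; first by move=> k; case: eqP => // ->.
  by have := h i; rewrite eqxx.
- move=> _ _ [A mA ->] [B mB ->]; exists (fun i => A i `&` B i); first by move=> i; exact: measurableI.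
  by apply/seteqP; split=> z /=; [move=> [h1 h2] i; split|move=> h; split=> i; have [] := h i].
- by [].
- by apply: bigcup_const; exists 0%N.
- move=> _ [A mA ->]; transitivity (\prod_(i < n) Q (A i))%E; first exact: muE.
  rewrite /m2/= /pushforward/=.
  pose A' i := if i == j then setT else A i.
  have -> : (fun z : n.-tuple S * S => set_tnth z.1 j z.2) @^-1` cylinder A = cylinder A' `*` A j.
    apply/seteqP; split=> -[z y] /=.
      move=> h; split; first by move=> i; rewrite /A'; case: eqP => // /eqP ij; have := h i; rewrite tnth_set_tnth (negbTE ij).
      by have := h j; rewrite tnth_set_tnth eqxx.
    move=> [h1 h2] i; rewrite tnth_set_tnth; case: eqP => [->//|/eqP ij].
    by have := h1 i; rewrite /A' (negbTE ij).
  have mA' i : measurable (A' i) by rewrite /A'; case: ifP.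
  have := @product_measure1E _ _ _ _ R mu Q (cylinder A') (A j) (measurable_cylinder mA') (mA j).
  have e : mu (cylinder A') = (\prod_(i < n) Q (A' i))%E := muE A' mA'.
  move=> h; apply/esym; apply: (etrans h); apply: (etrans (congr2 (fun a b => a * b)%E e erefl)).
  rewrite (bigD1 j)//= [RHS](bigD1 j)//= {1}/A' eqxx probability_setT mul1e muleC.
  by congr (_ * _)%E; apply: eq_bigr => i ij; rewrite /A' (negbTE ij).
- by move=> k; apply: (le_lt_trans (probability_le1 mu measurableT)); rewrite ltry.
Qed.

End resampling_def.

Section resampling.
Context {R : realType} {d : measure_display} {S : measurableType d} {n : nat}.
Variables (mu : probability (n.-tuple S) R) (Q : probability S R).
Hypothesis res : resamplable mu Q.

Lemma ge0_integral_resample (j : 'I_n) (f : n.-tuple S -> \bar R) : mfunT f ->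
  (forall z, 0 <= f z)%E ->
  (\int[mu]_z f z = \int[(mu \x Q)%E]_z f (set_tnth z.1 j z.2))%E.
Proof.
move=> mf f0.
have ms : mfunT (fun z : n.-tuple S * S => set_tnth z.1 j z.2) by exact: measurable_set_tnth.
have := ge0_integral_pushforward ms (mu \x Q)%E measurableT mf (fun z _ => f0 z).
rewrite preimage_setT => <-.
by apply: eq_measure_integral => A mA _; first [exact: res|exact/esym/res].
Qed.

Lemma Rint_resample (j : 'I_n) (f : n.-tuple S -> R) : mfunT f ->
  (L1 mu f <-> L1 (mu \x Q)%E (fun z => f (set_tnth z.1 j z.2))) /\
  \int[mu]_z f z = \int[(mu \x Q)%E]_z f (set_tnth z.1 j z.2).
Proof.
move=> mf.
have ms : mfunT (fun z : n.-tuple S * S => set_tnth z.1 j z.2) by exact: measurable_set_tnth.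
have mfs : mfunT (fun z : n.-tuple S * S => f (set_tnth z.1 j z.2)).
  by apply: measurableT_comp.
split.
  have E := @ge0_integral_resample j (fun z => `|(f z)%:E|%E).
  split=> /integrableP[_ h]; apply/integrableP; split; do ?exact/measurable_EFinP.
    by move: h; rewrite /= E//; apply/measurable_EFinP; exact: measurableT_comp.
  by rewrite E//; apply/measurable_EFinP; exact: measurableT_comp.
rewrite !RintE_pos_neg; congr (fine (_ - _)).
  apply: ge0_integral_resample => [|z]; last by rewrite lee_fin le_max lexx orbT.
  by apply/measurable_EFinP; exact: measurable_maxr.
apply: ge0_integral_resample => [|z]; last by rewrite lee_fin le_max lexx orbT.
by apply/measurable_EFinP; apply: measurable_maxr => //; exact: measurableT_comp.
Qed.

Lemma Rint_resample_iter (j : 'I_n) (f : n.-tuple S -> R) : L1 mu f ->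
  L1 mu (fun z => \int[Q]_y f (set_tnth z j y)) /\
  \int[mu]_z f z = \int[mu]_z \int[Q]_y f (set_tnth z j y).
Proof.
move=> hf; have [h1 h2] := Rint_resample j (L1_measurable hf).
by have [i e] := Rint_prod12 (h1.1 hf); split=> //; rewrite h2 -e.
Qed.

Section test_points.
Context {d' : measure_display} {X : measurableType d'}.
Variable tr : n.-tuple S -> X.
Hypothesis mtr : mfunT tr.

(** [tr] will extract the training data, so these are the coordinates on which nothing has been
    fitted. *)
Definition test_index (i : 'I_n) := forall z y, tr (set_tnth z i y) = tr z.

Definition new_eval (a : S * X -> R) : n.-tuple S * S -> R := fun z => a (z.2, tr z.1).
Definition test_eval (a : S * X -> R) (i : 'I_n) : n.-tuple S -> R := fun z => a (tnth z i, tr z).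

Lemma measurable_new_eval a : mfunT a -> mfunT (new_eval a).
Proof.
move=> ma; apply: measurableT_comp => //; apply: measurable_fun_pair; first exact: measurable_snd.
by apply: measurableT_comp => //; exact: measurable_fst.
Qed.

Lemma measurable_test_eval a i : mfunT a -> mfunT (test_eval a i).
Proof.
move=> ma; apply: measurableT_comp => //; apply: measurable_fun_pair => //.
exact: measurable_tnth.
Qed.

Lemma test_eval_set a i z y : test_index i -> test_eval a i (set_tnth z i y) = new_eval a (z, y).
Proof. by move=> ti; rewrite /test_eval /new_eval tnth_set_tnth eqxx ti. Qed.

Lemma test_eval_set_neq a i j z y : test_index j -> i != j -> test_eval a i (set_tnth z j y) = test_eval a i z.
Proof. by move=> tj ij; rewrite /test_eval tnth_set_tnth (negbTE ij) tj. Qed.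

(** Redrawing coordinate [i] leaves the training data alone: jointly with them, a test observation
    has the law of an independent new observation. *)
Lemma test_law a i : test_index i -> mfunT a ->
  (L1 mu (test_eval a i) <-> L1 (mu \x Q)%E (new_eval a)) /\
  \int[mu]_z test_eval a i z = \int[(mu \x Q)%E]_z new_eval a z.
Proof.
move=> ti ma; have := Rint_resample i (measurable_test_eval i ma).
rewrite (_ : (fun z : n.-tuple S * S => test_eval a i (set_tnth z.1 i z.2)) = new_eval a)//.
by apply/funext => -[z y]; rewrite test_eval_set.
Qed.

Lemma test_law_ge0 (a : S * X -> \bar R) i : test_index i -> mfunT a -> (forall z, 0 <= a z)%E ->
  (\int[mu]_z a (tnth z i, tr z) = \int[(mu \x Q)%E]_z a (z.2, tr z.1))%E.
Proof.
move=> ti ma a0; rewrite (ge0_integral_resample i)//.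
  by apply: eq_integral => -[z y] _; rewrite /= tnth_set_tnth eqxx ti.
apply: measurableT_comp => //; apply: measurable_fun_pair => //; exact: measurable_tnth.
Qed.

Variable J : {set 'I_n}.
Hypothesis tJ : forall j, j \in J -> test_index j.

Definition test_sum (a : S * X -> R) (z : n.-tuple S) := \sum_(j in J) test_eval a j z.

Lemma measurable_test_sum a : mfunT a -> mfunT (test_sum a).
Proof. move=> ma; rewrite (_ : test_sum a = fun z => \sum_(j < n) (if j \in J then test_eval a j z else 0)).
  by apply: measurable_sum => j; case: (j \in J) => //; exact: measurable_test_eval.
by apply/funext => z; rewrite /test_sum big_mkcond. Qed.

Lemma test_sum_set a j z y : j \in J -> test_sum a (set_tnth z j y) =
  new_eval a (z, y) + \sum_(i in J | i != j) test_eval a i z.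
Proof.
move=> jJ; rewrite /test_sum (bigD1 j)//= test_eval_set; last exact: tJ.
by congr (_ + _); apply: eq_bigr => i /andP[iJ ij]; rewrite test_eval_set_neq//; exact: tJ.
Qed.

Lemma test_sum_abs a : mfunT a -> L1 (mu \x Q)%E (new_eval a) ->
  L1 mu (test_sum a) /\
  \int[mu]_z `|test_sum a z| <= #|J|%:R * \int[(mu \x Q)%E]_z `|new_eval a z|.
Proof.
move=> ma ia.
have ij j : j \in J -> L1 mu (test_eval a j) by move=> jJ; exact: (test_law (tJ jJ) ma).1.2.
have iS : L1 mu (test_sum a).
  rewrite (_ : test_sum a = fun z => \sum_(j <- enum J) test_eval a j z); last by apply/funext => z; rewrite big_enum.
  rewrite (_ : (fun z => _) = fun z => \sum_(j <- enum J) (if j \in J then test_eval a j z else 0)).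
    by apply: L1_sum => j; case: (boolP (j \in J)) => [/ij//|_]; exact: L1_cst.
  by apply/funext => z; rewrite big_enum [RHS]big_enum; apply: eq_bigr => j ->.
split=> //.
pose b z : R := \sum_(j in J) `|test_eval a j z|.
have eb z : b z = \sum_(j < n) (if j \in J then `|test_eval a j z| else 0) by rewrite /b big_mkcond.
have ibj j : L1 mu (fun z => if j \in J then `|test_eval a j z| else 0).
  by case: (boolP (j \in J)) => [/ij/L1_abs//|_]; exact: L1_cst.
have bE : b = fun z => \sum_(j < n) (if j \in J then `|test_eval a j z| else 0) by exact/funext/eb.
have ib : L1 mu b by rewrite bE; exact: L1_sum.
apply: (@le_trans _ _ (\int[mu]_z b z)).
  by apply: Rint_le => //; [exact: L1_abs|move=> z; exact: ler_norm_sum].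
rewrite bE Rint_sum// (eq_bigr (fun j => if j \in J then \int[(mu \x Q)%E]_z `|new_eval a z| else 0)).
  by rewrite -big_mkcond/= sumr_const mulr_natl.
move=> j _; case: (boolP (j \in J)) => jJ; last by rewrite Rint_cst.
have ma' : mfunT (fun z => `|a z|) by exact: measurableT_comp.
by have [_ ->] := test_law (tJ jJ) ma'.
Qed.

(** Redrawing one of the two observations of a cross term, with the other and the training data
    fixed, shows that the term vanishes by conditional centring. The second moment is therefore of
    order [#|J|] rather than its square. *)
Lemma test_sum_sqr a : mfunT a -> L1 (mu \x Q)%E (fun z => new_eval a z ^+ 2) ->
  (forall z, L1 Q (fun y => new_eval a (z, y))) -> (forall z, \int[Q]_y new_eval a (z, y) = 0) ->
  L1 mu (fun z => test_sum a z ^+ 2) /\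
  \int[mu]_z (test_sum a z ^+ 2) = #|J|%:R * \int[(mu \x Q)%E]_z (new_eval a z ^+ 2).
Proof.
move=> ma ia ia1 a0.
have ma2 : mfunT (fun z => a z ^+ 2) by exact: measurable_funX.
have ij j : j \in J -> L1 mu (fun z => test_eval a j z ^+ 2) by move=> jJ; exact: (test_law (tJ jJ) ma2).1.2.
have iij i j : i \in J -> j \in J -> L1 mu (fun z => test_eval a i z * test_eval a j z).
  by move=> iJ jJ; apply: L1_sqrM; [exact: measurable_test_eval|exact: measurable_test_eval|exact: ij|exact: ij].
pose p i j z : R := if (i \in J) && (j \in J) then test_eval a i z * test_eval a j z else 0.
have ip i j : L1 mu (p i j).
  by rewrite /p; case: (boolP (_ && _)) => [/andP[iJ jJ]|_]; [exact: iij|exact: L1_cst].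
have eE z : test_sum a z ^+ 2 = \sum_(i < n) \sum_(j < n) p i j z.
  rewrite expr2 /test_sum big_mkcond/= mulr_suml; apply: eq_bigr => i _.
  rewrite big_mkcond/= mulr_sumr; apply: eq_bigr => j _; rewrite /p.
  by case: (i \in J); case: (j \in J) => /=; rewrite ?mul0r ?mulr0.
under eq_fun do rewrite eE.
split; first by apply: L1_sum => i; exact: L1_sum.
rewrite Rint_sum; last by move=> i; exact: L1_sum.
under eq_bigr do rewrite Rint_sum//.
rewrite -(sumr_const (mem J) (1 : R)) [X in _ = X * _]big_mkcond/= mulr_suml; apply: eq_bigr => i _.
rewrite (bigD1 i)//= big1 ?addr0.
  rewrite /p andbb; case: (boolP (i \in J)) => iJ; last by rewrite mul0r Rint_cst.
  rewrite mul1r; have [_ <-] := test_law (tJ iJ) ma2.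
  by apply: eq_Rintegral => z _; rewrite /test_eval expr2.
move=> j ji; rewrite /p; case: (boolP (_ && _)) => [/andP[iJ jJ]|_]; last by rewrite Rint_cst.
have [_ ->] := Rint_resample_iter j (iij _ _ iJ jJ).
rewrite -[RHS](Rint_cst mu); apply: eq_Rintegral => z _.
rewrite (_ : (fun y => _) = fun y => test_eval a i z * new_eval a (z, y)); last first.
  by apply/funext => y; rewrite (test_eval_set _ _ _ (tJ jJ)) (test_eval_set_neq _ _ _ (tJ jJ))// eq_sym.
by rewrite RintZ ?a0 ?mulr0.
Qed.

(** With all other coordinates fixed, an event of the past of the sum becomes an event of [Fl s] for
    the redrawn observation ([sec]); each summand is then handled by the martingale property of a
    single observation. *)
Lemma test_sum_martingale (Fl : R -> set (set S)) (w : R -> S * X -> R) :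
  filtration Fl ->
  (forall t, t \in `[0, 1] -> mfunT (w t)) ->
  (forall t, t \in `[0, 1] -> L1 (mu \x Q)%E (new_eval (w t))) ->
  (forall x, adapted Fl (fun t y => w t (y, x))) ->
  (forall x s t A, 0 <= s -> s <= t -> t <= 1 -> Fl s A ->
    \int[Q]_y (\1_A y * (w t (y, x) - w s (y, x))) = 0) ->
  forall s t B, 0 <= s -> s <= t -> t <= 1 -> natural_filtration (fun t => test_sum (w t)) s B ->
  \int[mu]_z (\1_B z * (test_sum (w t) z - test_sum (w s) z)) = 0.
Proof.
move=> [sF Fm Fmono] mw iw aw mart s t B s0 st t1 FB.
have s01 : s \in `[0, 1] by rewrite in_itv/= s0 (le_trans st).
have t01 : t \in `[0, 1] by rewrite in_itv/= t1 (le_trans s0).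
have mB : measurable B.
  apply: (natural_filtration_sub (Z := fun t => test_sum (w t)) (le_trans st t1) _ FB).
  by move=> u u01; apply: measurable_test_sum; exact: mw.
have sec j z : j \in J -> Fl s [set y | B (set_tnth z j y)].
  move=> jJ; have [F0 FC FU] := sF s s01.
  suff H : natural_filtration (fun t => test_sum (w t)) s `<=` [set B | Fl s [set y | B (set_tnth z j y)]] by exact: (H B FB).
  apply: smallest_sub.
    split=> /=.
    - exact: F0.
    - by move=> A /= hA; exact: (FC _ hA).
    - by move=> A /= hA; exact: (FU (fun k => [set y | A k (set_tnth z j y)])).
  move=> _ [u /= u0s] [D mD <-]; rewrite setTI /=.
  have u01 : u \in `[0, 1] by move: u0s; rewrite !in_itv/= => /andP[-> us]; rewrite (le_trans us)// (le_trans st).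
  rewrite (_ : [set y | _] = (fun y => w u (y, tr z)) @^-1` ((fun r => r + \sum_(i in J | i != j) test_eval (w u) i z) @^-1` D)); last first.
    by apply/seteqP; split=> y /=; rewrite test_sum_set.
  move: u0s; rewrite in_itv/= => /andP[u0 us].
  apply: (Fmono u s) => //; first exact: le_trans st t1.
  apply: (aw _ _ u01); rewrite -[X in measurable X]setTI.
  have mc : mfunT (fun r : R => r + \sum_(i in J | i != j) test_eval (w u) i z) by exact: measurable_funD.
  exact: mc.
have it u j : u \in `[0, 1] -> j \in J -> L1 mu (test_eval (w u) j).
  by move=> u01 jJ; apply: ((test_law (tJ jJ) (mw u u01)).1.2); exact: iw.
pose p j z : R := if j \in J then \1_B z * (test_eval (w t) j z - test_eval (w s) j z) else 0.
have ip j : L1 mu (p j).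
  rewrite /p; case: (boolP (j \in J)) => jJ; last exact: L1_cst.
  by apply: L1_indic => //; apply: L1B; exact: it.
have -> : (fun z => \1_B z * (test_sum (w t) z - test_sum (w s) z)) = fun z => \sum_(j < n) p j z.
  by apply/funext => z; rewrite /test_sum -sumrB mulr_sumr big_mkcond.
rewrite Rint_sum// big1// => j _; rewrite /p; case: (boolP (j \in J)) => jJ; last by rewrite Rint_cst.
have ij : L1 mu (fun z => \1_B z * (test_eval (w t) j z - test_eval (w s) j z)).
  by apply: L1_indic => //; apply: L1B; exact: it.
have [_ ->] := Rint_resample_iter j ij.
rewrite -[RHS](Rint_cst mu); apply: eq_Rintegral => z _.
have := mart (tr z) s t _ s0 st t1 (sec j z jJ).
apply: etrans; apply: eq_Rintegral => y _.
by rewrite !(test_eval_set _ _ _ (tJ jJ)) !indicE; congr (_ * _); congr (_%:R); apply/idP/idP; rewrite !inE.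
Qed.

End test_points.

Section independent_sums.

Lemma Rint_resample_mul (j : 'I_n) (f : n.-tuple S -> R) (g : S -> R) :
  (forall z y, f (set_tnth z j y) = f z) -> L1 mu f -> L1 Q g ->
  L1 mu (fun z => f z * g (tnth z j)) /\
  \int[mu]_z (f z * g (tnth z j)) = \int[mu]_z f z * \int[Q]_y g y.
Proof.
move=> fj hf hg.
have mfg : mfunT (fun z => f z * g (tnth z j)).
  apply: measurable_funM; first exact: L1_measurable hf.
  exact: (measurableT_comp (L1_measurable hg) (measurable_tnth j)).
have [h _] := Rint_resample j mfg.
have E : (fun z : n.-tuple S * S => f (set_tnth z.1 j z.2) * g (tnth (set_tnth z.1 j z.2) j)) = fun z => f z.1 * g z.2.
  by apply/funext => z; rewrite fj tnth_set_tnth eqxx.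
rewrite E in h.
have mfg2 : mfunT (fun z : n.-tuple S * S => f z.1 * g z.2).
  by apply: measurable_funM; [exact: (measurableT_comp (L1_measurable hf) measurable_fst)|exact: (measurableT_comp (L1_measurable hg) measurable_snd)].
have i2 : L1 (mu \x Q)%E (fun z : n.-tuple S * S => f z.1 * g z.2).
  apply/integrableP; split; first exact/measurable_EFinP.
  rewrite (@fubini_tonelli1 _ _ _ _ _ mu Q (fun z => `|(f z.1 * g z.2)%:E|%E))//; last first.
    by apply/measurable_EFinP; exact: measurableT_comp.
  rewrite (_ : fubini_F _ _ = fun z => (`|f z| * \int[Q]_y `|g y|)%:E); last first.
    apply/funext => z; rewrite /fubini_F/=.
    under eq_integral do rewrite normrM.
    by rewrite EFin_Rint ?RintZ//; [exact: L1_abs|apply: L1Z; exact: L1_abs].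
  rewrite EFin_Rint ?ltry//; under eq_fun do rewrite mulrC.
  by apply: L1Z; exact: L1_abs.
have ifg := h.2 i2; split=> //.
have [_ ->] := Rint_resample_iter j ifg.
rewrite mulrC -RintZ//; apply: eq_Rintegral => z _.
rewrite (_ : (fun y => _) = fun y => f z * g y); last by apply/funext => y; rewrite fj tnth_set_tnth eqxx.
by rewrite RintZ// mulrC.
Qed.

Variable eta : S -> R.
Hypothesis meta : mfunT eta.
Hypothesis eta4 : L1 Q (fun y => eta y ^+ 4).
Hypothesis eta0 : \int[Q]_y eta y = 0.

Definition coord_sum (r : seq 'I_n) (z : n.-tuple S) : R := \sum_(j <- r) eta (tnth z j).

Let ie k : (k <= 4)%N -> L1 Q (fun y => eta y ^+ k).
Proof. by move=> k4; apply: (@L1_pow_le _ _ _ Q 2 k). Qed.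

Lemma coord_sum_set r j z y : j \notin r -> coord_sum r (set_tnth z j y) = coord_sum r z.
Proof.
move=> jr; rewrite /coord_sum big_seq [RHS]big_seq; apply: eq_bigr => i ir.
by rewrite tnth_set_tnth; case: eqP => // ij; rewrite -ij ir in jr.
Qed.

Lemma measurable_coord_sum r : mfunT (coord_sum r).
Proof.
by apply: measurable_sum => j; exact: (measurableT_comp meta (measurable_tnth j)).
Qed.

(** Induction on the number of terms: when the power of a sum of two independent centred variables
    is expanded, products containing a first moment vanish. *)
Lemma coord_sum_moments r : uniq r ->
  [/\ L1 mu (fun z => coord_sum r z ^+ 4), \int[mu]_z coord_sum r z = 0,
      \int[mu]_z (coord_sum r z ^+ 2) = (size r)%:R * \int[Q]_y (eta y ^+ 2) &
      \int[mu]_z (coord_sum r z ^+ 4) <=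
        (size r)%:R * \int[Q]_y (eta y ^+ 4) + 3 * (size r)%:R ^+ 2 * (\int[Q]_y (eta y ^+ 2)) ^+ 2].
Proof.
elim: r => [_|j r ih /= /andP[jr ur]].
  have E : coord_sum [::] = fun=> 0 by apply/funext => z; rewrite /coord_sum big_nil.
  rewrite E; split.
  - by rewrite (_ : (fun z => _) = fun=> 0); [exact: L1_cst|apply/funext => z; rewrite expr0n].
  - by rewrite Rint_cst.
  - by rewrite mul0r (_ : (fun z => _) = fun=> 0) ?Rint_cst//; apply/funext => z; rewrite expr0n.
  - by rewrite Rint_cst /= mul0r !expr0n/= !(mulr0, mul0r, addr0).
have [i4 e1 e2 e4] := ih ur.
have iSk k : (k <= 4)%N -> L1 mu (fun z => coord_sum r z ^+ k).
  by move=> k4; apply: (@L1_pow_le _ _ _ mu 2 k) => //; exact: measurable_coord_sum.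
have prod k l : (k <= 4)%N -> (l <= 4)%N ->
    L1 mu (fun z => coord_sum r z ^+ k * eta (tnth z j) ^+ l) /\
    \int[mu]_z (coord_sum r z ^+ k * eta (tnth z j) ^+ l) = \int[mu]_z (coord_sum r z ^+ k) * \int[Q]_y (eta y ^+ l).
  move=> k4 l4; apply: Rint_resample_mul (iSk k k4) (ie l4) => z y.
  by rewrite coord_sum_set.
have sE z : coord_sum (j :: r) z = coord_sum r z + eta (tnth z j) by rewrite /coord_sum big_cons addrC.
have E1 f : \int[mu]_z (f z ^+ 1) = \int[mu]_z (f z : R) by under eq_Rintegral do rewrite expr1.
have E1' f : \int[Q]_z (f z ^+ 1) = \int[Q]_z (f z : R) by under eq_Rintegral do rewrite expr1.
have E0 (f : n.-tuple S -> R) : \int[mu]_z (f z ^+ 0) = 1.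
  by under eq_Rintegral do rewrite expr0; rewrite Rint_cst.
have E0' (f : S -> R) : \int[Q]_z (f z ^+ 0) = 1.
  by under eq_Rintegral do rewrite expr0; rewrite Rint_cst.
have [i10 p10] := prod 1%N 0%N isT isT; have [i01 p01] := prod 0%N 1%N isT isT.
have [i20 p20] := prod 2%N 0%N isT isT; have [i11 p11] := prod 1%N 1%N isT isT.
have [i02 p02] := prod 0%N 2%N isT isT.
have [i40 p40] := prod 4%N 0%N isT isT; have [i31 p31] := prod 3%N 1%N isT isT.
have [i22 p22] := prod 2%N 2%N isT isT; have [i13 p13] := prod 1%N 3%N isT isT.
have [i04 p04] := prod 0%N 4%N isT isT.
rewrite !(E1, E1', E0, E0', eta0, e1, mulr0, mul0r, mulr1, mul1r) in p10 p01 p20 p11 p02 p40 p31 p22 p13 p04.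
pose q k l z := coord_sum r z ^+ k * eta (tnth z j) ^+ l.
have F4 : (fun z => coord_sum (j :: r) z ^+ 4) = fun z => q 4 0 z + (4 * q 3 1 z + (6 * q 2 2 z + (4 * q 1 3 z + q 0 4 z))).
  by apply/funext => z; rewrite sE /q; ring.
have F2 : (fun z => coord_sum (j :: r) z ^+ 2) = fun z => q 2 0 z + (2 * q 1 1 z + q 0 2 z).
  by apply/funext => z; rewrite sE /q; ring.
have F1 : (fun z => coord_sum (j :: r) z) = fun z => q 1 0 z + q 0 1 z.
  by apply/funext => z; rewrite sE /q; ring.
split.
- rewrite F4; apply: L1D => //; apply: L1D; first exact: L1Z.
  by apply: L1D; [exact: L1Z|apply: L1D => //; exact: L1Z].
- by rewrite F1 RintD// p10 p01 addr0.
- rewrite F2 /q (RintD i20 (L1D (L1Z 2 i11) i02)) (RintD (L1Z 2 i11) i02) (RintZ 2 i11).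
  by rewrite p20 p11 p02 e2 -natr1; ring.
have j1 := L1D (L1Z 4 i13) i04.
have j2 := L1D (L1Z 6 i22) j1.
have j3 := L1D (L1Z 4 i31) j2.
rewrite F4 /q (RintD i40 j3) (RintD (L1Z 4 i31) j2) (RintD (L1Z 6 i22) j1) (RintD (L1Z 4 i13) i04).
rewrite (RintZ 4 i31) (RintZ 6 i22) (RintZ 4 i13) p40 p31 p22 p13 p04 e2.
rewrite (_ : (size r).+1%:R = (size r)%:R + 1 :> R); last by rewrite natr1.
move: e4; set s4 := \int[mu]_z _; set k4 := \int[Q]_y (eta y ^+ 4); set k2 := \int[Q]_y _.
have : 0 <= k2 ^+ 2 by exact: sqr_ge0.
move=> h1; rewrite -subr_ge0 => h2; rewrite -subr_ge0.
(* With r the size, 3 r^2 + 6 r is 3 (r + 1)^2 - 3, which leaves the surplus 3 k2^2. *)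
rewrite [X in 0 <= X](_ : _ = ((size r)%:R * k4 + 3 * (size r)%:R ^+ 2 * k2 ^+ 2 - s4) + 3 * k2 ^+ 2); last by ring.
by rewrite addr_ge0// mulr_ge0.
Qed.

Let eta_sq : R := \int[Q]_y (eta y ^+ 2).

(** Cost of adding one term. With v = a^2 [eta_sq] / 2, the three summands bound the mean of cos (a
    eta) minus 1 - v, exp (- v) minus 1 - v, and the mean of sin (a eta). *)
Definition clt_error (a : R) : R :=
  a ^+ 4 * \int[Q]_y (eta y ^+ 4) + (a ^+ 2 * eta_sq / 2) ^+ 2 + `|a| ^+ 3 * \int[Q]_y (`|eta y| ^+ 3).

(** A central limit estimate by induction: by the addition formula one more independent term
    multiplies the transform by the mean of cos (a eta), close to exp (- v); the sine term is of
    third order because [eta] is centred. All transforms have absolute value at most 1, so the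
    errors simply add up. *)
Lemma coord_sum_cos (a c : R) r : uniq r ->
  `|\int[mu]_z cos (a * coord_sum r z + c) - expR (- ((size r)%:R * (a ^+ 2 * eta_sq / 2))) * cos c|
    <= (size r)%:R * clt_error a.
Proof.
set v := a ^+ 2 * eta_sq / 2.
have v0 : 0 <= v.
  by rewrite /v /eta_sq divr_ge0// mulr_ge0 ?sqr_ge0//; apply: Rint_ge0 => y; exact: sqr_ge0.
have mcos (f : n.-tuple S -> R) : mfunT f -> mfunT (fun z => cos (f z)).
  by move=> mf; apply: measurableT_comp => //; apply: continuous_measurable_fun; exact: continuous_cos.
have msin (f : n.-tuple S -> R) : mfunT f -> mfunT (fun z => sin (f z)).
  by move=> mf; apply: measurableT_comp => //; apply: continuous_measurable_fun; exact: continuous_sin.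
have mcos' (f : S -> R) : mfunT f -> mfunT (fun z => cos (f z)).
  by move=> mf; apply: measurableT_comp => //; apply: continuous_measurable_fun; exact: continuous_cos.
have msin' (f : S -> R) : mfunT f -> mfunT (fun z => sin (f z)).
  by move=> mf; apply: measurableT_comp => //; apply: continuous_measurable_fun; exact: continuous_sin.
have cb (x : R) : `|cos x| <= 1 by rewrite ler_norml cos_geN1 cos_le1.
have sb (x : R) : `|sin x| <= 1 by rewrite ler_norml sin_geN1 sin_le1.
pose A := \int[Q]_y cos (a * eta y); pose B := \int[Q]_y sin (a * eta y).
have mae : mfunT (fun y => a * eta y) by exact: measurable_funM.
have icos : L1 Q (fun y => cos (a * eta y)) by apply: (L1_bounded _ (mcos' _ mae)) => y; exact: cb.
have isin : L1 Q (fun y => sin (a * eta y)) by apply: (L1_bounded _ (msin' _ mae)) => y; exact: sb.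
have ie1 : L1 Q eta by have := @ie 1%N isT; under eq_fun do rewrite expr1.
have i3 : L1 Q (fun y => `|eta y| ^+ 3).
  by under eq_fun do rewrite -normrX; apply: L1_abs; exact: ie.
have hA : `|A - (1 - v)| <= a ^+ 4 * \int[Q]_y (eta y ^+ 4).
  have i2 : L1 Q (fun y => 2^-1 * a ^+ 2 * eta y ^+ 2) by apply: L1Z; exact: ie.
  have -> : A - (1 - v) = \int[Q]_y (cos (a * eta y) - (1 - 2^-1 * a ^+ 2 * eta y ^+ 2)).
    rewrite RintB//; last by apply: L1B => //; exact: L1_cst.
    rewrite RintB//; last exact: L1_cst.
    rewrite Rint_cst RintZ; last exact: ie.
    by congr (_ - (_ - _)); rewrite /v /eta_sq; ring.
  have iL : L1 Q (fun y => cos (a * eta y) - (1 - 2^-1 * a ^+ 2 * eta y ^+ 2)).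
    by apply: L1B => //; apply: L1B => //; exact: L1_cst.
  rewrite -RintZ//; apply: (le_trans (Rint_abs iL)); apply: Rint_le; [exact: L1_abs|exact: L1Z|] => y.
  by have := cos_taylor (a * eta y); rewrite !exprMn; rewrite (_ : a ^+ 2 * eta y ^+ 2 / 2 = 2^-1 * a ^+ 2 * eta y ^+ 2)//; ring.
have hB : `|B| <= `|a| ^+ 3 * \int[Q]_y (`|eta y| ^+ 3).
  have -> : B = \int[Q]_y (sin (a * eta y) - a * eta y).
    by rewrite RintB//; [rewrite RintZ// eta0 mulr0 subr0|exact: L1Z].
  have iL : L1 Q (fun y => sin (a * eta y) - a * eta y) by apply: L1B => //; exact: L1Z.
  rewrite -RintZ//; apply: (le_trans (Rint_abs iL)); apply: Rint_le; [exact: L1_abs|exact: L1Z|] => y.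
  by have := sin_taylor (a * eta y); rewrite normrM exprMn.
elim: r => [_|j r ih /= /andP[jr ur]].
  rewrite mul0r oppr0 expR0 mul1r (_ : (fun z => _) = fun=> cos c) ?Rint_cst ?subrr ?normr0//.
    by rewrite mul0r.
  by apply/funext => z; rewrite /coord_sum big_nil mulr0 add0r.
have mX : mfunT (fun z => a * coord_sum r z + c).
  by apply: measurable_funD => //; apply: measurable_funM => //; exact: measurable_coord_sum.
have iC : L1 mu (fun z => cos (a * coord_sum r z + c)) by apply: (L1_bounded _ (mcos _ mX)) => z; exact: cb.
have iS : L1 mu (fun z => sin (a * coord_sum r z + c)) by apply: (L1_bounded _ (msin _ mX)) => z; exact: sb.
have [i1 e1] := @Rint_resample_mul j _ _ (fun z y => congr1 (fun s => cos (a * s + c)) (coord_sum_set z y jr)) iC icos.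
have [i2 e2] := @Rint_resample_mul j _ _ (fun z y => congr1 (fun s => sin (a * s + c)) (coord_sum_set z y jr)) iS isin.
have -> : (fun z => cos (a * coord_sum (j :: r) z + c)) = (fun z =>
    cos (a * coord_sum r z + c) * cos (a * eta (tnth z j)) - sin (a * coord_sum r z + c) * sin (a * eta (tnth z j))).
  by apply/funext => z; rewrite -cosD /coord_sum big_cons; congr cos; ring.
rewrite RintB// e1 e2 -/A -/B.
set T := \int[mu]_z cos _; set T' := \int[mu]_z sin _.
have T1 : `|T| <= 1.
  apply: (le_trans (Rint_abs iC)); rewrite -[leRHS](Rint_cst mu).
  by apply: Rint_le; [exact: L1_abs|exact: L1_cst|] => z; exact: cb.
have T'1 : `|T'| <= 1.
  apply: (le_trans (Rint_abs iS)); rewrite -[leRHS](Rint_cst mu).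
  by apply: Rint_le; [exact: L1_abs|exact: L1_cst|] => z; exact: sb.
have := ih ur; rewrite -/T; set k := (size r)%:R => hT.
rewrite (_ : (size r).+1%:R = k + 1); last by rewrite natr1.
rewrite (_ : - ((k + 1) * v) = - v - (k * v)); last by ring.
rewrite expRD; set w := expR (- v); set wk := expR (- (k * v)) in hT *.
have w1 : `|w| <= 1 by rewrite ger0_norm ?expR_ge0// -expR0 ler_expR oppr_le0.
(* The two occurrences of 1 - v cancel; there remain the three one-step errors and the inductive
   one, each multiplied by a number of absolute value at most 1. *)
rewrite (_ : T * A - T' * B - w * wk * cos c = T * (A - (1 - v)) - T * (w - (1 - v)) - T' * B + w * (T - wk * cos c)); last by ring.
have hw : `|w - (1 - v)| <= v ^+ 2 by exact: expRN_taylor.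
have l1 : `|T * (A - (1 - v))| <= a ^+ 4 * \int[Q]_y (eta y ^+ 4) by rewrite normrM (le_trans (ler_piMl _ T1)).
have l2 : `|T * (w - (1 - v))| <= v ^+ 2 by rewrite normrM (le_trans (ler_piMl _ T1)).
have l3 : `|T' * B| <= `|a| ^+ 3 * \int[Q]_y (`|eta y| ^+ 3) by rewrite normrM (le_trans (ler_piMl _ T'1)).
have l4 : `|w * (T - wk * cos c)| <= k * clt_error a by rewrite normrM (le_trans (ler_piMl _ w1)).
rewrite mulrDl mul1r addrC; apply: (le_trans (ler_normD _ _)); apply: lerD l4 _.
rewrite /clt_error -/v; apply: (le_trans (ler_normB _ _)); apply: lerD l3.
by apply: (le_trans (ler_normB _ _)); exact: lerD l1 l2.
Qed.

End independent_sums.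

End resampling.

(** * Gaussian variables and the Gaussian martingale *)

Section gaussian_moments.
Context {R : realType} {d : measure_display} {T : measurableType d}.
Variable P : probability T R.
Variable Z : T -> R.
Hypothesis gZ : gaussian_rv P Z.
Hypothesis EZ : ('E_P[Z] = 0)%E.

Let mZ : mfunT Z. Proof. by case: gZ. Qed.

Section nondegenerate.
Variables m s : R.
Hypothesis s0 : s != 0.
Hypothesis law : forall B : set R, measurable B -> P (Z @^-1` B) = normal_prob m s B.

Let ge0_law (f : R -> R) : mfunT f -> (forall x, 0 <= f x) ->
  (\int[P]_y (f (Z y))%:E = \int[normal_prob m s]_x (f x)%:E)%E.
Proof.
move=> mf f0.
have mZ' : mfunT (Z : T -> measurableTypeR R) by exact: mZ.
have mf' : mfunT (fun x : measurableTypeR R => (f x)%:E).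
  by apply/measurable_EFinP; exact: mf.
have := ge0_integral_pushforward mZ' P measurableT mf' (fun x _ => f0 x).
rewrite preimage_setT => <-; apply: eq_measure_integral => A mA _.
exact: law.
Qed.

Lemma normal_law (f : R -> R) : mfunT f ->
  (L1 (normal_prob m s) f -> L1 P (fun y => f (Z y))) /\
  \int[P]_y f (Z y) = \int[normal_prob m s]_x f x.
Proof.
move=> mf; split.
  move=> /integrableP[_ h]; apply/integrableP; split.
    by apply/measurable_EFinP; exact: measurableT_comp.
  rewrite (ge0_law (f := fun x => `|f x|))//.
  exact: measurableT_comp.
rewrite !RintE_pos_neg; congr (fine (_ - _)).
  rewrite (ge0_law (f := fun x => Num.max (f x) 0))//; first exact: measurable_maxr.
  by move=> x; rewrite le_max lexx orbT.
rewrite (ge0_law (f := fun x => Num.max (- f x) 0))//.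
  by apply: measurable_maxr => //; exact: measurableT_comp.
by move=> x; rewrite le_max lexx orbT.
Qed.

End nondegenerate.

(** A degenerate law makes the variable almost surely constant and is treated apart. In both cases
    the parameter [m] is first identified with the mean, hence with 0. *)
Lemma gaussian_rv_moments : exists v : R,
  [/\ 0 <= v, L1 P (fun y => Z y ^+ 4), \int[P]_y (Z y ^+ 2) = v,
      \int[P]_y (Z y ^+ 4) = 3 * v ^+ 2 &
      forall c, \int[P]_y cos (Z y + c) = expR (- v / 2) * cos c].
Proof.
have mX k : mfunT (fun x : R => x ^+ k) by exact: measurable_funX.
have [_ [m [s law]]] := gZ; have [s0|s0] := eqVneq s 0.
  have Zm : {ae P, forall y, Z y = m}.
    exists (Z @^-1` (~` [set m])); split=> //.
    - by rewrite -[X in measurable X]setTI; apply: mZ => //; exact: measurableC.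
    - by rewrite law ?s0 ?eqxx; [rewrite diracE memNset//=; exact|exact: measurableC].
  have E (f : R -> R) : mfunT f -> \int[P]_y f (Z y) = f m.
    move=> mf; rewrite -[RHS](Rint_cst P); apply: Rint_ae => //; first exact: measurableT_comp.
    by apply: filterS Zm => y ->.
  have L (f : R -> R) : mfunT f -> L1 P (fun y => f (Z y)).
    move=> mf; apply: (L1_le_ae _ (L1_cst P `|f m|)); first exact: measurableT_comp.
    by apply: filterS Zm => y ->.
  have m0 : m = 0.
    have := EZ; rewrite unlock (_ : (\int[P]_w (Z w)%:E)%E = (\int[P]_w Z w)%:E); last by apply: EFin_Rint; exact: (L id).
    by rewrite (E id)// => -[].
  exists 0; split=> //.
  - exact: (L (fun x => x ^+ 4)).
  - by rewrite (E (fun x => x ^+ 2))// m0 expr0n.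
  - by rewrite (E (fun x => x ^+ 4))// m0 !expr0n/= mulr0.
  - move=> c; rewrite oppr0 mul0r expR0 mul1r (E (fun x => cos (x + c))) ?m0 ?add0r//.
    apply: measurableT_comp; last exact: measurable_funD.
    by apply: continuous_measurable_fun; exact: continuous_cos.
have lawN (B : set R) : measurable B -> P (Z @^-1` B) = normal_prob m s B.
  by move=> mB; rewrite law// (negbTE s0).
have NL f mf := @normal_law m s lawN f mf.
have i1 : L1 (normal_prob m s) (fun x => x - m).
  apply: L1_sqr_abs; first exact: measurable_funB.
  exact: (L1_normal_pow m s0 1).
have m0 : m = 0.
  have mB : mfunT (fun x : R => x - m) by exact: measurable_funB.
  have [h e] := NL _ mB; rewrite normal_mean// in e.
  have iZ : L1 P Z.
    have := L1D (h i1) (L1_cst P m); under eq_fun do rewrite subrK.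
    exact.
  have := EZ; rewrite unlock (_ : (\int[P]_w (Z w)%:E)%E = (\int[P]_w Z w)%:E); last exact: EFin_Rint.
  move=> [EZ0]; move: e; rewrite RintB//; last exact: L1_cst.
  by rewrite EZ0 Rint_cst sub0r => /eqP; rewrite oppr_eq0 => /eqP.
exists (s ^+ 2); split.
- exact: sqr_ge0.
- have [h _] := NL _ (mX 4%N); apply: h.
  move: (L1_normal_pow m s0 2); rewrite (_ : (fun x : R => (x - m) ^+ 2.*2) = (fun x => x ^+ 4))//.
  by apply/funext => x; rewrite m0 subr0.
- have [_ ->] := NL _ (mX 2%N); rewrite -(normal_variance m s0).
  by apply: eq_Rintegral => x _; rewrite m0 subr0.
- have [_ ->] := NL _ (mX 4%N); rewrite -exprM -(normal_moment4 m s0).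
  by apply: eq_Rintegral => x _; rewrite m0 subr0.
- move=> c; have mc : mfunT (fun x : R => cos (1 * x + c)).
    apply: measurableT_comp; last by apply: measurable_funD => //; exact: measurable_funM.
    by apply: continuous_measurable_fun; exact: continuous_cos.
  have [_] := NL _ mc; rewrite normal_cos//.
  under eq_Rintegral do rewrite mul1r.
  by rewrite expr1n mulr1 mulNr.
Qed.

End gaussian_moments.

Section gaussian_martingale.
Context {R : realType} {d : measure_display} {T : measurableType d}.
Variable P : probability T R.
Variables (V : R -> R) (U : R -> T -> R).
Hypothesis hU : continuous_gaussian_martingale P V U.

Lemma gaussian_path_measurable t : t \in `[0, 1] -> mfunT (U t).
Proof.
move=> t01; have [_ gU _ _] := hU.
have := (gU 1%N (fun=> 1) (fun=> t) (fun=> t01)).1.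
by under eq_fun do rewrite big_ord_recl big_ord0 mul1r addr0.
Qed.

Lemma gaussian_path_moments t : t \in `[0, 1] ->
  [/\ L1 P (fun y => U t y ^+ 4), \int[P]_y (U t y ^+ 2) = V t & \int[P]_y U t y = 0].
Proof.
move=> t01; have [_ gU _ vU] := hU; have [E0 vV] := vU t t01.
have := gU 1%N (fun=> 1) (fun=> t) (fun=> t01).
under eq_fun do rewrite big_ord_recl big_ord0 mul1r addr0.
move=> g; have [v [v0 i4 e2 e4 _]] := gaussian_rv_moments g E0.
have mU := gaussian_path_measurable t01.
have i2 : L1 P (fun y => U t y ^+ 2) by apply: (@L1_pow_le _ _ _ P 2 2).
have i1 : L1 P (U t) by exact: L1_sqr_abs.
have EU : \int[P]_y U t y = 0.
  have := E0; rewrite unlock (_ : (\int[P]_w (U t w)%:E)%E = (\int[P]_w U t w)%:E); last exact: EFin_Rint.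
  by move=> [].
split=> //; move: vV; rewrite /variance covariance.unlock E0 /= unlock.
rewrite (_ : (\int[P]_w _)%E = (\int[P]_w (U t w ^+ 2))%:E); first by move=> [].
rewrite -EFin_Rint//; apply: eq_integral => y _; congr EFin.
by rewrite /GRing.mul/= !subr0 expr2.
Qed.

Let cond t : t \in `[0, 1] -> sigma_algebra setT (natural_filtration U t).
Proof. by move=> _; exact: natural_filtration_sigma. Qed.

Let sub t : t \in `[0, 1] -> natural_filtration U t `<=` measurable.
Proof.
rewrite in_itv/= => /andP[_ t1]; apply: natural_filtration_sub => // u.
exact: gaussian_path_measurable.
Qed.

Let aU : adapted (natural_filtration U) U.
Proof.
move=> t; rewrite in_itv/= => /andP[t0 t1]; apply: natural_filtration_adapted.
by rewrite in_itv/= t0 lexx.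
Qed.

Let iU2 t : t \in `[0, 1] -> L1 P (fun y => U t y ^+ 2).
Proof.
move=> t01; have [i4 _ _] := gaussian_path_moments t01.
by apply: (@L1_pow_le _ _ _ P 2 2) => //; exact: gaussian_path_measurable.
Qed.

Lemma gaussian_path_L1 t : t \in `[0, 1] -> L1 P (U t).
Proof. by move=> t01; apply: L1_sqr_abs; [exact: gaussian_path_measurable|exact: iU2]. Qed.

Lemma gaussian_path_martingale s t A : 0 <= s -> s <= t -> t <= 1 -> natural_filtration U s A ->
  \int[P]_y (\1_A y * (U t y - U s y)) = 0.
Proof.
move=> s0 st t1 FA; have [_ _ mart _] := hU.
have s01 := t01E s0 (le_trans st t1).
by apply: (condexp_increment (sub s01)) => //; exact: mart.
Qed.

(** The definition prescribes variances; covariances follow from the martingale property, as the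
    variance at the smaller time. *)
Lemma gaussian_lincomb_moments (k : nat) (a t : 'I_k -> R) : (forall i, t i \in `[0, 1]) ->
  let Z y := \sum_(i < k) a i * U (t i) y in
  let v := \sum_(i < k) \sum_(j < k) a i * a j * V (Num.min (t i) (t j)) in
  [/\ 0 <= v, L1 P (fun y => Z y ^+ 4), \int[P]_y (Z y ^+ 4) = 3 * v ^+ 2 &
      forall c, \int[P]_y cos (Z y + c) = expR (- v / 2) * cos c].
Proof.
move=> t01 Z v; have [_ gU _ _] := hU.
have i1 i : L1 P (U (t i)) by exact: gaussian_path_L1.
have iZ : L1 P Z by apply: L1_sum => i; exact: L1Z.
have EZ : ('E_P[Z] = 0)%E.
  rewrite unlock (_ : (\int[P]_w (Z w)%:E)%E = (\int[P]_w Z w)%:E); last exact: EFin_Rint.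
  rewrite Rint_sum; last by move=> i; exact: L1Z.
  by rewrite big1// => i _; rewrite RintZ//; have [_ _ ->] := gaussian_path_moments (t01 i); rewrite mulr0.
have [w [w0 i4 e2 e4 ec]] := gaussian_rv_moments (gU k a t t01) EZ.
suff vw : v = w by rewrite vw; split.
rewrite -e2 (mart_lincomb cond sub aU iU2 gaussian_path_martingale)//.
apply: eq_bigr => i _; apply: eq_bigr => j _; congr (_ * _).
have m01 : Num.min (t i) (t j) \in `[0, 1] by rewrite /Num.min; case: ifP.
by have [_ -> _] := gaussian_path_moments m01.
Qed.

Lemma gaussian_incr_moment4 s t : 0 <= s -> s <= t -> t <= 1 ->
  L1 P (fun y => (U t y - U s y) ^+ 4) /\ \int[P]_y ((U t y - U s y) ^+ 4) = 3 * (V t - V s) ^+ 2.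
Proof.
move=> s0 st t1; have s01 := t01E s0 (le_trans st t1); have t01 := t01E (le_trans s0 st) t1.
pose a (i : 'I_2) : R := if i == ord0 then 1 else -1.
pose u (i : 'I_2) : R := if i == ord0 then t else s.
have u01 i : u i \in `[0, 1] by rewrite /u; case: ifP.
have [_ i4 e4 _] := gaussian_lincomb_moments a u01.
have E y : \sum_(i < 2) a i * U (u i) y = U t y - U s y.
  by rewrite !big_ord_recl big_ord0 /a /u /= mul1r mulN1r addr0.
move: i4 e4; rewrite (_ : (fun y => (\sum_(i < 2) a i * U (u i) y) ^+ 4) = (fun y => (U t y - U s y) ^+ 4)); last first.
  by apply/funext => y; rewrite E.
move=> i4 e4; split=> //; rewrite e4; congr (3 * _ ^+ 2).
rewrite !big_ord_recl !big_ord0 /a /u /= !minxx (min_idPr st) (min_idPl st).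
by ring.
Qed.

End gaussian_martingale.

(** * Trigonometric polynomials and Bernstein weights *)

Section trigonometric_polynomials.
Context {R : realType} {N : nat}.
Implicit Types (g h : ('I_N -> R) -> R).

(** A list of cosine terms with phases rather than a closure under algebra operations: expectations
    are compared term by term, and stability under products is the product-to-sum formula. *)
Inductive trig_poly : (('I_N -> R) -> R) -> Prop :=
| trig_poly0 : trig_poly (fun=> 0)
| trig_polyS (b : R) (a : 'I_N -> R) (c : R) g : trig_poly g ->
    trig_poly (fun x => b * cos (\sum_(i < N) a i * x i + c) + g x).

Lemma trig_poly_ext g h : (forall x, g x = h x) -> trig_poly g -> trig_poly h.
Proof. by move=> /funext ->. Qed.

Lemma trig_polyD g h : trig_poly g -> trig_poly h -> trig_poly (fun x => g x + h x).
Proof.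
move=> tg th; elim: tg => [|b a c g' _ ih]; first by apply: trig_poly_ext th => x; rewrite add0r.
by apply: trig_poly_ext (trig_polyS b a c ih) => x; rewrite addrA.
Qed.

Lemma trig_poly_cos (b : R) (a : 'I_N -> R) (c : R) : trig_poly (fun x => b * cos (\sum_(i < N) a i * x i + c)).
Proof. by apply: trig_poly_ext (trig_polyS b a c trig_poly0) => x; rewrite addr0. Qed.

Lemma trig_poly_cst (b : R) : trig_poly (fun=> b).
Proof.
apply: trig_poly_ext (trig_poly_cos b (fun=> 0) 0) => x.
by rewrite big1 ?addr0 ?cos0 ?mulr1// => i _; rewrite mul0r.
Qed.

Lemma trig_polyM g h : trig_poly g -> trig_poly h -> trig_poly (fun x => g x * h x).
Proof.
move=> tg th; elim: tg => [|b a c g' _ ih]; first by apply: trig_poly_ext trig_poly0 => x; rewrite mul0r.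
suff tb : trig_poly (fun x => b * cos (\sum_(i < N) a i * x i + c) * h x).
  by apply: trig_poly_ext (trig_polyD tb ih) => x; rewrite mulrDl.
elim: th => [|b' a' c' h' _ ih']; first by apply: trig_poly_ext trig_poly0 => x; rewrite mulr0.
have t1 := trig_poly_cos (b * b' / 2) (fun i => a i + a' i) (c + c').
have t2 := trig_poly_cos (b * b' / 2) (fun i => a i - a' i) (c - c').
apply: trig_poly_ext (trig_polyD (trig_polyD t1 t2) ih') => x.
have -> : \sum_(i < N) (a i + a' i) * x i + (c + c') = (\sum_(i < N) a i * x i + c) + (\sum_(i < N) a' i * x i + c').
  by rewrite addrACA -big_split/=; congr (_ + _); apply: eq_bigr => i _; rewrite mulrDl.
have -> : \sum_(i < N) (a i - a' i) * x i + (c - c') = (\sum_(i < N) a i * x i + c) - (\sum_(i < N) a' i * x i + c').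
  by rewrite opprD addrACA -sumrB/=; congr (_ + _); apply: eq_bigr => i _; rewrite mulrBl.
rewrite cosD cosB; by field.
Qed.

Lemma trig_poly_prod (I : Type) (s : seq I) (g : I -> ('I_N -> R) -> R) :
  (forall i, trig_poly (g i)) -> trig_poly (fun x => \prod_(i <- s) g i x).
Proof.
move=> tg; elim: s => [|i s ih].
  by apply: trig_poly_ext (trig_poly_cst 1) => x; rewrite big_nil.
by apply: trig_poly_ext (trig_polyM (tg i) ih) => x; rewrite big_cons.
Qed.

Lemma trig_poly_sin (i : 'I_N) (b : R) : trig_poly (fun x => sin (b * x i)).
Proof.
apply: trig_poly_ext (trig_poly_cos 1 (fun j => if j == i then b else 0) (- (pi / 2))) => x.
rewrite mul1r (bigD1 i)//= eqxx big1 ?addr0; last by move=> j /negbTE ->; rewrite mul0r.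
by rewrite -sinDpihalf subrK.
Qed.

End trigonometric_polynomials.

Section bernoulli_weights.
Context {R : realType}.
Implicit Types (y : R) (g h : nat -> R).

(* Expectation of g at a sum of r independent Bernoulli variables of parameter y. *)
Fixpoint bmean r y g : R :=
  if r is r'.+1 then y * bmean r' y (fun j => g j.+1) + (1 - y) * bmean r' y g else g 0%N.

Lemma bmean_ext r y g h : (forall j, (j <= r)%N -> g j = h j) -> bmean r y g = bmean r y h.
Proof.
elim: r g h => [|r ih] g h gh /=; first exact: gh.
by congr (_ * _ + _ * _); apply: ih => j jr; apply: gh => //; exact: leqW.
Qed.

Lemma bmean_sum (I : Type) (s : seq I) r y (a : I -> R) (g : I -> nat -> R) :
  bmean r y (fun j => \sum_(i <- s) a i * g i j) = \sum_(i <- s) a i * bmean r y (g i).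
Proof.
elim: r g => [|r ih] g //=.
rewrite !ih !mulr_sumr -big_split/=; apply: eq_bigr => i _.
by rewrite mulrDr !mulrA [y * _]mulrC [(1 - y) * _]mulrC.
Qed.

Lemma bmean_cst r y (c : R) : bmean r y (fun=> c) = c.
Proof. by elim: r => //= r ->; ring. Qed.

Lemma bmean_le r y g h : 0 <= y <= 1 -> (forall j, g j <= h j) -> bmean r y g <= bmean r y h.
Proof.
move=> /andP[y0 y1]; elim: r g h => [|r ih] g h gh //=.
by apply: lerD; apply: ler_wpM2l; rewrite ?subr_ge0//; apply: ih.
Qed.

Lemma bmean_sqr r y (c : R) : bmean r y (fun j => (j%:R + c) ^+ 2) = r%:R * (y * (1 - y)) + (r%:R * y + c) ^+ 2.
Proof.
elim: r c => [|r ih] c /=; first by rewrite !mul0r !add0r.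
have -> : (fun j => (j.+1%:R + c) ^+ 2) = (fun j => (j%:R + (1 + c)) ^+ 2) :> (nat -> R).
  by apply/funext => j; rewrite -natr1 addrA.
by rewrite !ih -natr1; ring.
Qed.

(** The Bernstein basis polynomial, that is the binomial probability of [j] among [r]. The recursive
    form shows that it is polynomial in [y], and substituting a trigonometric polynomial for [y]
    gives another one. *)
Definition bweight r y (j : nat) : R := bmean r y (fun i => (i == j)%:R).

Lemma bmeanE r y g : bmean r y g = \sum_(j < r.+1) g j * bweight r y j.
Proof.
rewrite /bweight -bmean_sum; apply: bmean_ext => j jr.
rewrite (bigD1 (Ordinal (jr : j < r.+1)%N))//= eqxx mulr1 big1 ?addr0// => i ij.
by rewrite (_ : (j == i) = false) ?mulr0//; apply/negbTE; move: ij; apply: contra => /eqP ji; apply/eqP/val_inj.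
Qed.

Lemma bweight_ge0 r y j : 0 <= y <= 1 -> 0 <= bweight r y j.
Proof. by move=> y01; rewrite -(bmean_cst r y 0); apply: bmean_le. Qed.

Lemma bweight_sum r y : \sum_(j < r.+1) bweight r y j = 1.
Proof.
rewrite -[RHS](bmean_cst r y 1) bmeanE.
by apply: eq_bigr => j _; rewrite mul1r.
Qed.

(** Chebyshev's inequality for the binomial law, with y (1 - y) <= 1 / 4. *)
Lemma bweight_far r y (e : R) : 0 <= y <= 1 -> 0 < e -> (0 < r)%N ->
  \sum_(j < r.+1 | e < `|j%:R / r%:R - y|) bweight r y j <= (4 * r%:R * e ^+ 2)^-1.
Proof.
move=> y01 e0 r0; have r0' : (0 : R) < r%:R by rewrite ltr0n.
have re0 : 0 < (r%:R * e) ^+ 2 by rewrite exprn_gt0// mulr_gt0.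
apply: (@le_trans _ _ (\sum_(j < r.+1) (j%:R - r%:R * y) ^+ 2 / (r%:R * e) ^+ 2 * bweight r y j)).
  rewrite big_mkcond/=; apply: ler_sum => j _; case: ifPn => h; last first.
    by rewrite mulr_ge0 ?bweight_ge0// divr_ge0 ?sqr_ge0.
  rewrite ler_peMl ?bweight_ge0// ler_pdivlMr// mul1r.
  rewrite -[leRHS]real_normK ?num_real// ler_sqr; [|by rewrite nnegrE mulr_ge0// ltW|exact: normr_ge0].
  rewrite (_ : j%:R - r%:R * y = r%:R * (j%:R / r%:R - y)); last by field; rewrite gt_eqF.
  by rewrite normrM (gtr0_norm r0') ler_pM2l// ltW.
have -> : \sum_(j < r.+1) (j%:R - r%:R * y) ^+ 2 / (r%:R * e) ^+ 2 * bweight r y j =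
    ((r%:R * e) ^+ 2)^-1 * bmean r y (fun j => (j%:R + (- (r%:R * y))) ^+ 2).
  by rewrite bmeanE mulr_sumr; apply: eq_bigr => j _; ring.
rewrite bmean_sqr subrr expr0n addr0 mulrC ler_pdivrMr//.
have e2 : 0 < e ^+ 2 by rewrite exprn_gt0.
rewrite (_ : (4 * r%:R * e ^+ 2)^-1 * (r%:R * e) ^+ 2 = r%:R * 4^-1); last first.
  by field; rewrite !gt_eqF.
rewrite ler_pM2l// -subr_ge0 (_ : _ - _ = (y - 2^-1) ^+ 2) ?sqr_ge0//; by field.
Qed.

End bernoulli_weights.

(** * Weak convergence through a partition of unity *)

Section partition_of_unity.
Context {R : realType} {N : nat}.
Variables (r : nat) (B e : R).
Hypothesis B0 : 0 < B.
Hypothesis e0 : 0 < e.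
Hypothesis r0 : (0 < r)%N.

(** A trigonometric polynomial with values in [0, 1], suited to the Bernstein weights; on [-B, B]
    the argument of the sine stays in [-1, 1], where the sine is injective. *)
Definition squash (x : R) : R := (1 + sin (B^-1 * x)) / 2.

Lemma squash01 x : 0 <= squash x <= 1.
Proof.
have h1 := sin_geN1 (B^-1 * x); have h2 := sin_le1 (B^-1 * x).
by rewrite /squash; apply/andP; split; lra.
Qed.

(** The cosine is at least 1 / 2 on [-1, 1], so the sine has slope at least 1 / 2 there; the factors
    1 / 2 and 1 / B of [squash] account for the rest of 4 B. *)
Lemma squash_dist x x' : `|x| <= B -> `|x'| <= B -> `|x - x'| <= 4 * B * `|squash x - squash x'|.
Proof.
have cos_ge_half z : `|z| <= 1 -> 2^-1 <= cos z :> R.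
  move=> z1; have c1 : cos `|z| = cos z by case: ger0P => // _; rewrite cosN.
  rewrite -c1; apply: le_trans (cos_ge_quadratic (normr_ge0 z)).
  have : `|z| ^+ 2 <= 1 by rewrite exprn_ile1.
  by lra.
have sin_dist (a b : R) : `|a| <= 1 -> `|b| <= 1 -> a <= b -> b - a <= 2 * (sin b - sin a).
  move=> a1 b1 ab.
  have df : forall x, is_derive x (1 : R) sin (cos x) by move=> z; exact: is_derive_sin.
  have [c cx ->] := MVT_segment ab (fun y _ => df y) (is_derive_continuous_seg df).
  have := cos_ge_half c; rewrite mulrA => h.
  rewrite ler_peMl ?subr_ge0//.
  have : 2^-1 <= cos c; last by lra.
  apply: h; move: cx a1 b1; rewrite in_itv/= !ler_norml => /andP[h1 h2] /andP[h3 _] /andP[_ h4].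
  by rewrite (le_trans h3 h1) (le_trans h2 h4).
have H a b : `|a| <= B -> `|b| <= B -> a <= b -> `|a - b| <= 4 * B * `|squash a - squash b|.
  move=> aB bB ab.
  have sc z : `|z| <= B -> `|B^-1 * z| <= 1.
    by move=> zB; rewrite normrM gtr0_norm ?invr_gt0// mulrC ler_pdivrMr// mul1r.
  have abB : B^-1 * a <= B^-1 * b by rewrite ler_pM2l// invr_gt0.
  have := sin_dist _ _ (sc a aB) (sc b bB) abB.
  rewrite -mulrBr mulrC ler_pdivrMr// => h.
  rewrite distrC ger0_norm ?subr_ge0// (le_trans h)//.
  rewrite [leRHS](_ : _ = 2 * B * `|sin (B^-1 * b) - sin (B^-1 * a)|); last first.
    rewrite /squash (_ : _ - _ = - 2^-1 * (sin (B^-1 * b) - sin (B^-1 * a))); last by field.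
    by rewrite normrM normrN [`|2^-1|]ger0_norm ?invr_ge0//; field.
  rewrite mulrAC; apply: ler_wpM2l; [by rewrite mulr_ge0// ltW|exact: ler_norm].
move=> xB x'B; have [h|/ltW h] := leP x x'; first exact: H.
by rewrite distrC [`|squash x - _|]distrC; exact: H.
Qed.

Definition cell_index := {ffun 'I_N -> 'I_r.+1}.

Definition cell_weight (k : cell_index) (x : 'I_N -> R) : R :=
  \prod_(i < N) bweight r (squash (x i)) (k i).

Definition near_cell (k : cell_index) (x : 'I_N -> R) : bool :=
  [forall i, `|(k i)%:R / r%:R - squash (x i)| <= e].

Lemma cell_weight_ge0 k x : 0 <= cell_weight k x.
Proof. by apply: prodr_ge0 => i _; apply: bweight_ge0; exact: squash01. Qed.

Lemma cell_weight_sum x : \sum_k cell_weight k x = 1.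
Proof.
rewrite -(bigA_distr_bigA (fun i (j : 'I_r.+1) => bweight r (squash (x i)) j)).
by rewrite big1// => i _; rewrite bweight_sum.
Qed.

(** A union bound over coordinates: the weights of the other coordinates sum to 1 and leave the
    one-dimensional estimate. *)
Lemma cell_weight_far x :
  \sum_(k | ~~ near_cell k x) cell_weight k x <= N%:R * (4 * r%:R * e ^+ 2)^-1.
Proof.
pose far (i : 'I_N) (j : 'I_r.+1) : bool := e < `|j%:R / r%:R - squash (x i)|.
apply: (@le_trans _ _ (\sum_(k : cell_index) \sum_(i < N) (far i (k i))%:R * cell_weight k x)).
  rewrite big_mkcond/=; apply: ler_sum => k _; case: ifPn => h; last first.
    by apply: sumr_ge0 => i _; rewrite mulr_ge0// cell_weight_ge0.
  move: h => /forallPn[i]; rewrite -ltNge => h.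
  rewrite (bigD1 i)//= /far h mul1r lerDl.
  by apply: sumr_ge0 => j _; rewrite mulr_ge0// cell_weight_ge0.
rewrite exchange_big/= -[N in N%:R]card_ord -[_%:R]/(1 *+ _) -sumr_const mulr_suml.
apply: ler_sum => i _; rewrite mul1r.
apply: le_trans (bweight_far (squash01 (x i)) e0 r0).
(* The indicator is put into the factor of coordinate [i], so that the sum over cells factorizes. *)
pose w (i' : 'I_N) (j : 'I_r.+1) : R := (if i' == i then (far i j)%:R else 1) * bweight r (squash (x i')) j.
have -> : \sum_(k : cell_index) (far i (k i))%:R * cell_weight k x = \sum_(k : cell_index) \prod_(i' < N) w i' (k i').
  apply: eq_bigr => k _; rewrite /w big_split/=; congr (_ * _).
  rewrite (bigD1 i)//= eqxx big1 ?mulr1// => i' /negbTE ->//.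
rewrite -(bigA_distr_bigA w) (bigD1 i)//= [X in _ * X]big1 ?mulr1; last first.
  by move=> i' /negbTE ii'; rewrite /w ii'; under eq_bigr do rewrite mul1r; rewrite bweight_sum.
apply: le_of_eq.
rewrite [RHS]big_mkcond/=; apply: eq_bigr => j _; rewrite /w eqxx /far.
by case: ifP => _; rewrite ?mul1r ?mul0r.
Qed.

Lemma trig_poly_bmean i r' (g : nat -> R) : trig_poly (fun x : 'I_N -> R => bmean r' (squash (x i)) g).
Proof.
have tq : trig_poly (fun x : 'I_N -> R => squash (x i)).
  have := trig_polyM (trig_polyD (trig_poly_cst 1) (trig_poly_sin i B^-1)) (trig_poly_cst 2^-1).
  exact: trig_poly_ext.
elim: r' g => [|r' ih] g /=; first exact: trig_poly_cst.
apply: trig_polyD; first by apply: trig_polyM.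
apply: trig_polyM => //; have := trig_polyD (trig_poly_cst 1) (trig_polyM (trig_poly_cst (-1)) tq).
by apply: trig_poly_ext => x; rewrite mulN1r.
Qed.

Lemma trig_poly_cell_weight k : trig_poly (cell_weight k).
Proof. by apply: trig_poly_prod => i; exact: trig_poly_bmean. Qed.

End partition_of_unity.

Section comparison.
Context {R : realType} {d d' : measure_display} {T : measurableType d} {T' : measurableType d'}.
Variables (P : probability T R) (P' : probability T' R).

(** Each variable is replaced by the cell values [a] averaged with the weights. On the second space
    near cells are good off [A']; on the first a near cell may be bad, and the mean weight of the
    bad cells is moved by [conv] to the second space, where it is at most e + e1. The total is 3 e +
    2 e1 for each replacement, e + e1 for the bad cells, and [#|K|] times tau twice. *)
Lemma comparison (K : finType) (D : T -> R) (D' : T' -> R) (w : K -> T -> R) (w' : K -> T' -> R)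
    (near : K -> T -> bool) (near' : K -> T' -> bool) (good : pred K) (a : K -> R)
    (A : set T) (A' : set T') (e e1 tau : R) :
  mfunT D -> mfunT D' ->
  (forall x, `|D x| <= 1) -> (forall x, `|D' x| <= 1) ->
  (forall k, mfunT (w k)) -> (forall k, mfunT (w' k)) ->
  (forall k x, 0 <= w k x) -> (forall k x, 0 <= w' k x) ->
  (forall x, \sum_k w k x = 1) -> (forall x, \sum_k w' k x = 1) ->
  measurable A -> measurable A' -> fine (P A) <= e -> fine (P' A') <= e ->
  (forall k, `|a k| <= 1) -> (forall k, ~~ good k -> a k = 0) -> 0 <= e -> 0 <= e1 ->
  (forall x k, ~ A x -> good k -> near k x -> `|D x - a k| <= e) ->
  (forall x k, ~ A' x -> near' k x -> good k /\ `|D' x - a k| <= e) ->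
  (forall x, \sum_(k | ~~ near k x) w k x <= e1) ->
  (forall x, \sum_(k | ~~ near' k x) w' k x <= e1) ->
  (forall k, `|\int[P]_x w k x - \int[P']_x w' k x| <= tau) ->
  `|\int[P]_x D x - \int[P']_x D' x| <= 7 * e + 5 * e1 + 2 * #|K|%:R * tau.
Proof.
move=> mD mD' D1 D1' mw mw' w0 w0' ws ws' mA mA' PA PA' a1 a0 e0 e10 H H' far far' conv.
have iD := L1_bounded P mD D1; have iD' := L1_bounded P' mD' D1'.
have w1 k x : `|w k x| <= 1.
  rewrite ger0_norm// -(ws x) (bigD1 k)//= lerDl; exact: sumr_ge0.
have w1' k x : `|w' k x| <= 1.
  rewrite ger0_norm// -(ws' x) (bigD1 k)//= lerDl; exact: sumr_ge0.
have iw k := L1_bounded P (mw k) (w1 k); have iw' k := L1_bounded P' (mw' k) (w1' k).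
pose S x := \sum_k a k * w k x; pose S' x := \sum_k a k * w' k x.
pose b x := \sum_k (~~ good k)%:R * w k x; pose b' x := \sum_k (~~ good k)%:R * w' k x.
have iS : L1 P S by apply: L1_sum => k; exact: L1Z.
have iS' : L1 P' S' by apply: L1_sum => k; exact: L1Z.
have ib : L1 P b by apply: L1_sum => k; exact: L1Z.
have ib' : L1 P' b' by apply: L1_sum => k; exact: L1Z.
have ES : \int[P]_x S x = \sum_k a k * \int[P]_x w k x.
  by rewrite Rint_sum; [apply: eq_bigr => k _; rewrite RintZ|move=> k; exact: L1Z].
have ES' : \int[P']_x S' x = \sum_k a k * \int[P']_x w' k x.
  by rewrite Rint_sum; [apply: eq_bigr => k _; rewrite RintZ|move=> k; exact: L1Z].
have Eb : \int[P]_x b x = \sum_k (~~ good k)%:R * \int[P]_x w k x.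
  by rewrite Rint_sum; [apply: eq_bigr => k _; rewrite RintZ|move=> k; exact: L1Z].
have Eb' : \int[P']_x b' x = \sum_k (~~ good k)%:R * \int[P']_x w' k x.
  by rewrite Rint_sum; [apply: eq_bigr => k _; rewrite RintZ|move=> k; exact: L1Z].
have tau0 (c : K -> R) : (forall k, `|c k| <= 1) ->
    `|\sum_k c k * \int[P]_x w k x - \sum_k c k * \int[P']_x w' k x| <= #|K|%:R * tau.
  move=> c1; rewrite -sumrB (le_trans (ler_norm_sum _ _ _))//.
  rewrite -[#|K|%:R]/(1 *+ _) -sumr_const mulr_suml; apply: ler_sum => k _.
  by rewrite -mulrBr normrM mul1r (le_trans _ (conv k))// ler_piMl.
have dist2 x k : `|D x - a k| <= 2 by rewrite (le_trans (ler_normB _ _))// (_ : 2 = 1 + 1)// lerD.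
have dist2' x k : `|D' x - a k| <= 2 by rewrite (le_trans (ler_normB _ _))// (_ : 2 = 1 + 1)// lerD.
have DS x : D x - S x = \sum_k (D x - a k) * w k x.
  rewrite /S -[X in X - _]mulr1 -(ws x) mulr_sumr -sumrB.
  by apply: eq_bigr => k _; rewrite mulrBl.
have DS' x : D' x - S' x = \sum_k (D' x - a k) * w' k x.
  rewrite /S' -[X in X - _]mulr1 -(ws' x) mulr_sumr -sumrB.
  by apply: eq_bigr => k _; rewrite mulrBl.
have b0 x : 0 <= b x by apply: sumr_ge0 => k _; rewrite mulr_ge0.
have b'0 x : 0 <= b' x by apply: sumr_ge0 => k _; rewrite mulr_ge0.
have P1 x : `|D x - S x| <= 2 * \1_A x + (e + (2 * e1 + b x)).
  have [Ax|nA] := pselect (A x).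
    rewrite indicE mem_set// mulr1 (le_trans (ler_normB _ _))//.
    apply: (@le_trans _ _ 2); last by rewrite lerDl !addr_ge0 ?mulr_ge0.
    rewrite (_ : 2 = 1 + 1)// lerD// (le_trans (ler_norm_sum _ _ _))// -(ws x) ler_sum// => k _.
    by rewrite normrM [`|w k x|]ger0_norm// ler_piMl.
  rewrite indicE memNset// mulr0 add0r DS (le_trans (ler_norm_sum _ _ _))//.
  apply: (@le_trans _ _ (\sum_k (e * w k x + (2 * ((~~ near k x)%:R * w k x) + (~~ good k)%:R * w k x)))).
    apply: ler_sum => k _; rewrite normrM [`|w k x|]ger0_norm// !mulrA -!mulrDl ler_wpM2r//.
    case: (boolP (near k x)) => nk; case: (boolP (good k)) => gk; rewrite /= ?mulr0 ?mulr1 ?addr0 ?add0r.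
    - exact: H.
    - by rewrite a0// subr0 (le_trans (D1 x))// lerDr.
    - by rewrite (le_trans (dist2 x k))// lerDr.
    - by rewrite (le_trans (dist2 x k))//; lra.
  rewrite big_split/= -mulr_sumr ws mulr1 lerD2l big_split/= lerD2r -mulr_sumr ler_wpM2l//.
  apply: le_trans (far x); rewrite [leRHS]big_mkcond/=; apply: ler_sum => k _.
  by case: (near k x); rewrite ?mul0r ?mul1r.
have P1' x : `|D' x - S' x| <= 2 * \1_A' x + (e + 2 * e1).
  have [Ax|nA] := pselect (A' x).
    rewrite indicE mem_set// mulr1 (le_trans (ler_normB _ _))//.
    apply: (@le_trans _ _ 2); last by rewrite lerDl !addr_ge0 ?mulr_ge0.
    rewrite (_ : 2 = 1 + 1)// lerD// (le_trans (ler_norm_sum _ _ _))// -(ws' x) ler_sum// => k _.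
    by rewrite normrM [`|w' k x|]ger0_norm// ler_piMl.
  rewrite indicE memNset// mulr0 add0r DS' (le_trans (ler_norm_sum _ _ _))//.
  apply: (@le_trans _ _ (\sum_k (e * w' k x + 2 * ((~~ near' k x)%:R * w' k x)))).
    apply: ler_sum => k _; rewrite normrM [`|w' k x|]ger0_norm// !mulrA -!mulrDl ler_wpM2r//.
    case: (boolP (near' k x)) => nk; rewrite /= ?mulr0 ?mulr1 ?addr0.
    - by have [] := H' x k nA nk.
    - by rewrite (le_trans (dist2' x k))// lerDr.
  rewrite big_split/= -mulr_sumr ws' mulr1 lerD2l -mulr_sumr ler_wpM2l//.
  apply: le_trans (far' x); rewrite [leRHS]big_mkcond/=; apply: ler_sum => k _.
  by case: (near' k x); rewrite ?mul0r ?mul1r.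
have P2' x : b' x <= \1_A' x + e1.
  have [Ax|nA] := pselect (A' x).
    rewrite indicE mem_set// (@le_trans _ _ 1) ?lerDl// -(ws' x) ler_sum// => k _.
    by rewrite ler_piMl//; case: (good k).
  rewrite indicE memNset// add0r (le_trans _ (far' x))// [leRHS]big_mkcond/=; apply: ler_sum => k _.
  case: (boolP (good k)) => gk /=; first by rewrite mul0r; case: ifP.
  by rewrite mul1r; case: (boolP (near' k x)) => // nk; have [] := H' x k nA nk; rewrite (negbTE gk).
have iA := L1_indicT P mA; have iA' := L1_indicT P' mA'.
have E1 : `|\int[P]_x D x - \int[P]_x S x| <= 2 * e + (e + (2 * e1 + \int[P]_x b x)).
  rewrite -RintB//; apply: (le_trans (Rint_abs (L1B iD iS))).
  have c1 := L1D (L1_cst P (2 * e1)) ib; have c2 := L1D (L1_cst P e) c1.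
  apply: (le_trans (Rint_le (L1_abs (L1B iD iS)) (L1D (L1Z 2 iA) c2) P1)).
  rewrite (RintD (L1Z 2 iA) c2) (RintZ 2 iA) Rint_indic// (RintD (L1_cst P e) c1) (RintD (L1_cst P (2 * e1)) ib) !Rint_cst.
  by rewrite lerD2r ler_wpM2l.
have E1' : `|\int[P']_x D' x - \int[P']_x S' x| <= 2 * e + (e + 2 * e1).
  rewrite -RintB//; apply: (le_trans (Rint_abs (L1B iD' iS'))).
  have c2 := L1_cst P' (e + 2 * e1).
  apply: (le_trans (Rint_le (L1_abs (L1B iD' iS')) (L1D (L1Z 2 iA') c2) P1')).
  rewrite (RintD (L1Z 2 iA') c2) (RintZ 2 iA') Rint_indic// !Rint_cst.
  by rewrite lerD2r ler_wpM2l.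
have E2' : \int[P']_x b' x <= e + e1.
  apply: (le_trans (Rint_le ib' (L1D iA' (L1_cst P' e1)) P2')).
  by rewrite (RintD iA' (L1_cst P' e1)) Rint_indic// Rint_cst lerD2r.
have g1 k : `|(~~ good k)%:R| <= 1 :> R by case: (good k); rewrite /= ?normr0 ?normr1.
have := tau0 _ a1; have := tau0 _ g1; rewrite -ES -ES' -Eb -Eb'.
move: E1 E1' E2'; move: (\int[P]_x D x) (\int[P]_x S x) (\int[P]_x b x) (\int[P']_x D' x) (\int[P']_x S' x) (\int[P']_x b' x).
rewrite -[2 * #|K|%:R * tau]mulrA; move: (#|K|%:R * tau) => t u1 u2 u3 v1 v2 v3.
rewrite !ler_norml => /andP[h1 h2] /andP[h3 h4] h5 /andP[h6 h7] /andP[h8 h9].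
by apply/andP; split; lra.
Qed.

End comparison.

(** * Ultralimits of paths and uniform continuity of the functional *)

Section uniform_nearness.
Context {R : realType}.
Notation path := {uniform (@unitI R) -> R}.

Lemma nbhs_uniform_ball (f : path) (A : set path) :
  nbhs f A <-> exists2 e : R, 0 < e & forall g : path, (forall y, `|f y - g y| < e) -> A g.
Proof.
rewrite uniform_nbhs; split.
  move=> [E [entE EA]]; move: entE; rewrite -entourage_ballE => -[e /= e0 bE].
  exists e => // g fg; apply: EA => y _; apply: bE => /=; exact: fg.
move=> [e e0 eA]; exists [set xy | ball xy.1 e xy.2]; split.
  by rewrite -entourage_ballE; exists e.
by move=> g /= fg; apply: eA => y; exact: fg.
Qed.

Lemma within_continuous_cadlag (f : R -> R) : {within `[(0 : R), 1], continuous f} -> cadlag f.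
Proof.
move=> /(continuous_within_itvP f ltr01) [c0 c1 c2]; split=> t; rewrite in_itv/= => /andP[t0 t1].
  move: t0; rewrite le_eqVlt => /predU1P[<-//|t0].
  apply: cvg_at_right_filter; apply: c0; by rewrite in_itv/= t0.
move: t1; rewrite le_eqVlt => /predU1P[->|t1]; first exact: cvgP c2.
have : f x @[x --> t] --> f t by apply: c0; rewrite in_itv/= t0.
by move=> /cvg_at_left_filter/cvgP.
Qed.

Lemma modulus_continuous (f : R -> R) :
  (forall e, 0 < e -> exists2 r : R, 0 < r & forall s t, s \in `[0, 1] -> t \in `[0, 1] -> `|s - t| <= r -> `|f s - f t| <= e) ->
  {within `[(0 : R), 1], continuous f}.
Proof.
move=> hf; apply/subspace_continuousP => t t01; apply/cvgrPdist_le => e e0.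
have [r r0 h] := hf e e0; rewrite near_withinE; near=> s => s01.
apply: h => //; near: s; apply: nbhs_ball_norm_le.
Unshelve. all: by end_near. Qed.

(** A compact set of paths by the theorem of Arzela and Ascoli; a step of [q j] allows an
    oscillation of 1 / (j + 1). *)
Definition modulus_class (B : R) (q : nat -> R) (f : R -> R) :=
  [/\ {within `[(0 : R), 1], continuous f}, forall t, t \in `[0, 1] -> `|f t| <= B &
   forall j s t, s \in `[0, 1] -> t \in `[0, 1] -> `|s - t| <= q j -> `|f s - f t| <= j.+1%:R^-1].

Section ultralimits.
Variable UF : set_system nat.
Hypothesis uUF : UltraFilter UF.

Let pUF : ProperFilter UF. Proof. by case: uUF. Qed.

Lemma bounded_ultralimit (B : R) (a : nat -> R) : (forall n, `|a n| <= B) ->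
  exists l : R, a n @[n --> UF] --> l.
Proof.
move=> aB; have := @segment_compact R (- B) B; rewrite compact_ultra => /(_ (a @ UF)) h.
have [|//|l [_ al]] := h.
  split; first exact: fmap_proper_filter.
  move=> G pG sub; apply/seteqP; split; last exact: sub.
  move=> A GA; have [//|nA] := in_ultra_setVsetC (a @^-1` A) uUF.
  by have := sub (~` A) nA => GnA; have [r []] := filter_ex (filterI GA GnA).
  by rewrite /fmap/=; apply: filterS filterT => n _ /=; rewrite in_itv/= -ler_norml.
by exists l.
Qed.

(** Compactness along an ultrafilter: pointwise limits exist at all times at once, without
    extraction of subsequences. The common modulus passes to the limit and upgrades convergence on a
    finite grid to uniform convergence. *)
Lemma ultralimit_path (B : R) (q : nat -> R) (f : nat -> R -> R) :
  (forall j, 0 < q j) ->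
  (forall n t, t \in `[0, 1] -> `|f n t| <= B) ->
  (forall n j s t, s \in `[0, 1] -> t \in `[0, 1] -> `|s - t| <= q j -> `|f n s - f n t| <= j.+1%:R^-1) ->
  exists2 g : R -> R, {within `[(0 : R), 1], continuous g} &
    forall e, 0 < e -> UF [set n | forall t, t \in `[0, 1] -> `|f n t - g t| <= e].
Proof.
move=> q0 fB fq.
have lim t : {l : R | t \in `[0, 1] -> f n t @[n --> UF] --> l}.
  apply: cid; have [t01|nt] := boolP (t \in `[0, 1]); last by exists 0.
  by have [l hl] := bounded_ultralimit (fun n => fB n t t01); exists l.
pose g t := sval (lim t).
have gP t e : t \in `[0, 1] -> 0 < e -> UF [set n | `|f n t - g t| <= e].
  move=> t01 e0; have /cvgrPdist_le /(_ e e0) := svalP (lim t) t01.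
  by apply: filterS => n /=; rewrite distrC.
have gq j s t : s \in `[0, 1] -> t \in `[0, 1] -> `|s - t| <= q j -> `|g s - g t| <= j.+1%:R^-1.
  move=> s01 t01 st; apply/ler_addgt0Pr => e e0.
  have e2 : 0 < e / 2 by rewrite divr_gt0.
  have [n [/= h1 h2]] := filter_ex (filterI (gP s _ s01 e2) (gP t _ t01 e2)).
  rewrite (_ : g s - g t = (f n s - f n t) - (f n s - g s) + (f n t - g t)); last by ring.
  apply: (@le_trans _ _ ((j.+1%:R^-1 + e / 2) + e / 2)); last by rewrite -addrA -splitr.
  apply: (le_trans (ler_normD _ _)); apply: lerD => //; apply: (le_trans (ler_normB _ _)); apply: lerD => //.
  exact: fq.
have inv0 (e : R) : 0 < e -> exists j : nat, j.+1%:R^-1 <= e.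
  move=> e0; exists (Num.truncn e^-1); rewrite invf_ple ?posrE//.
  exact/ltW/truncnS_gt.
exists g.
  apply: modulus_continuous => e e0; have [j je] := inv0 e e0.
  by exists (q j) => // s t s01 t01 st; exact: le_trans (gq _ _ _ s01 t01 st) je.
move=> e e0; have e3 : 0 < e / 3 by rewrite divr_gt0.
have [j je] := inv0 _ e3.
pose m := (Num.truncn (q j)^-1).+1.
have m0 : (0 : R) < m%:R by rewrite ltr0n.
have mq : m%:R^-1 <= q j by rewrite invf_ple ?posrE//; exact/ltW/truncnS_gt.
have grid i : (i <= m)%N -> (i%:R / m%:R : R) \in `[0, 1].
  by move=> im; rewrite in_itv/= divr_ge0//= ler_pdivrMr// mul1r ler_nat.
have H k : (k <= m.+1)%N -> UF [set n | forall i, (i < k)%N -> `|f n (i%:R / m%:R) - g (i%:R / m%:R)| <= e / 3].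
  elim: k => [_|k ih km]; first by apply: filterS filterT.
  apply: filterS (filterI (ih (ltnW km)) (gP _ _ (grid k km) e3)) => n [/= h1 h2] i.
  by rewrite ltnS leq_eqVlt => /predU1P[->|/h1].
apply: filterS (H m.+1 (leqnn _)) => n /= h t t01.
pose i := Num.truncn (t * m%:R).
move: (t01); rewrite in_itv/= => /andP[t0 t1].
have tm0 : 0 <= t * m%:R by rewrite mulr_ge0// ltW.
have /andP[i1 i2] := truncn_itv tm0.
have im : (i <= m)%N by rewrite -(ler_nat R) (le_trans i1)// ler_piMl// ltW.
have ti : `|t - i%:R / m%:R| <= q j.
  rewrite ger0_norm; last by rewrite subr_ge0 ler_pdivrMr.
  apply: le_trans mq; rewrite lerBlDr -[X in X + _]mul1r -mulrDl addrC natr1 ler_pdivlMr//.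
  exact: ltW.
rewrite (_ : f n t - g t = (f n t - f n (i%:R / m%:R)) + (f n (i%:R / m%:R) - g (i%:R / m%:R)) + (g (i%:R / m%:R) - g t)); last by ring.
rewrite (_ : e = e / 3 + e / 3 + e / 3); last by field.
rewrite (le_trans (ler_normD _ _))// lerD//.
  rewrite (le_trans (ler_normD _ _))// lerD//; last exact: h.
  by rewrite (le_trans _ je)//; apply: fq => //; exact: grid.
by rewrite distrC (le_trans _ je)//; apply: gq => //; exact: grid.
Qed.

End ultralimits.

Variables (Theta : Type) (Theta0 : set Theta) (V : Theta -> R -> R) (L : R).
Hypothesis L0 : 0 < L.
Hypothesis VL : forall th, Theta0 th -> forall s t, s \in `[0, 1] -> t \in `[0, 1] -> `|V th s - V th t| <= L * `|s - t|.
Hypothesis V0 : forall th, Theta0 th -> V th 0 = 0.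
Variable T : path -> path -> R.
Hypothesis hT : forall p, (@C01 R `*` closure [set res01 (V th) | th in Theta0]) p ->
  jointly_continuous_at T p.

Let in0 : (0 : R) \in `[0, 1]. Proof. exact: t01E. Qed.

Lemma lipschitz_cadlag (f : R -> R) :
  (forall s t, s \in `[0, 1] -> t \in `[0, 1] -> `|f s - f t| <= L * `|s - t|) -> cadlag f.
Proof.
move=> fL; apply: within_continuous_cadlag; apply: modulus_continuous => e e0.
exists (e / L); first by rewrite divr_gt0.
move=> s t s01 t01 st; rewrite (le_trans (fL s t s01 t01))// mulrC -ler_pdivlMr//.
Qed.

(** By contradiction: counterexamples with tolerance 1 / (n + 1) have paths in a compact class and
    variance functions with a common Lipschitz constant, so both have ultralimits. Continuity of [T]
    at the limit pair puts the two values within e / 2 of the value there, although they differ by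
    more than [e]. *)
Lemma uniform_nearness (B : R) (q : nat -> R) (e : R) : (forall j, 0 < q j) -> 0 < e ->
  exists2 r : R, 0 < r & forall f th x v, modulus_class B q f -> Theta0 th ->
    cadlag x -> cadlag v ->
    (forall t, t \in `[0, 1] -> `|x t - f t| <= r) ->
    (forall t, t \in `[0, 1] -> `|v t - V th t| <= r) ->
    `|T (res01 x) (res01 v) - T (res01 f) (res01 (V th))| <= e.
Proof.
move=> q0 e0; apply: contrapT => /forall2NP nh.
have bad n : {p : (R -> R) * Theta * (R -> R) * (R -> R) | let: (f, th, x, v) := p in
    [/\ modulus_class B q f, Theta0 th, cadlag x /\ cadlag v,
     (forall t, t \in `[0, 1] -> `|x t - f t| <= n.+1%:R^-1) /\
     (forall t, t \in `[0, 1] -> `|v t - V th t| <= n.+1%:R^-1) &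
     e < `|T (res01 x) (res01 v) - T (res01 f) (res01 (V th))|]}.
  apply: cid; apply: contrapT => nex.
  have [|] := nh n.+1%:R^-1; first by rewrite invr_gt0 ltr0n.
  apply=> f th x v hf hth cx cv hx hv; rewrite leNgt; apply/negP => lt; apply: nex.
  by exists (f, th, x, v).
pose f n := (sval (bad n)).1.1.1; pose th n := (sval (bad n)).1.1.2.
pose x n := (sval (bad n)).1.2; pose v n := (sval (bad n)).2.
have hb n : [/\ modulus_class B q (f n), Theta0 (th n), cadlag (x n) /\ cadlag (v n),
     (forall t, t \in `[0, 1] -> `|x n t - f n t| <= n.+1%:R^-1) /\
     (forall t, t \in `[0, 1] -> `|v n t - V (th n) t| <= n.+1%:R^-1) &
     e < `|T (res01 (x n)) (res01 (v n)) - T (res01 (f n)) (res01 (V (th n)))|].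
  by rewrite /f /th /x /v; move: (svalP (bad n)); case: (sval (bad n)) => -[[]].
have [UF [uUF ooUF]] := @ultraFilterLemma _ \oo _.
have pUF : ProperFilter UF by case: uUF.
have [g cg fg] := @ultralimit_path UF uUF B q f q0
  (fun n t t01 => let: And3 _ h _ := let: And5 h _ _ _ _ := hb n in h in h t t01)
  (fun n j s t s01 t01 st => let: And3 _ _ h := let: And5 h _ _ _ _ := hb n in h in h j s t s01 t01 st).
have VB n t : t \in `[0, 1] -> `|V (th n) t| <= L.
  move=> t01; have [_ tn _ _ _] := hb n.
  have := VL tn t01 in0; rewrite V0// !subr0 => /le_trans; apply.
  move: t01; rewrite in_itv/= => /andP[t0 t1].
  by rewrite ger0_norm// ler_piMr// ltW.
have qL j : 0 < (L * j.+1%:R)^-1 by rewrite invr_gt0 mulr_gt0.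
have Vq n j s t : s \in `[0, 1] -> t \in `[0, 1] -> `|s - t| <= (L * j.+1%:R)^-1 -> `|V (th n) s - V (th n) t| <= j.+1%:R^-1.
  move=> s01 t01 st; have [_ tn _ _ _] := hb n.
  rewrite (le_trans (VL tn s01 t01))// mulrC -ler_pdivlMr//.
  by rewrite -invfM mulrC.
have [W cW VW] := ultralimit_path uUF qL VB Vq.
(* [W] is a uniform limit of variance functions with varying parameters, possibly none of them
   itself: hence the closure in [hT]. *)
pose p : path * path := (res01 g, res01 W).
have cp : jointly_continuous_at T p.
  apply: hT; split=> /=; first by exists g.
  move=> A /nbhs_uniform_ball[r r0 rA].
  have r2 : 0 < r / 2 by rewrite divr_gt0.
  have [n hn] := filter_ex (VW _ r2).
  exists (res01 (V (th n))); split; first by have [_ tn _ _ _] := hb n; exists (th n).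
  apply: rA => y; rewrite /res01/= distrC (le_lt_trans (hn _ _))//; last by lra.
  by have := set_valP y.
have e2 : 0 < e / 2 by rewrite divr_gt0.
move: cp => /cvgrPdist_lt /(_ _ e2); rewrite near_withinE.
move=> [[A1 A2] [/= /nbhs_uniform_ball[r1 r10 rA1] /nbhs_uniform_ball[r2 r20 rA2]] hA].
(* A third, as a passage through the path of the sequence costs up to twice [r] and the
   neighbourhood asks for a strict inequality. *)
pose r := Num.min r1 r2 / 3.
have r0 : 0 < r by rewrite divr_gt0// lt_min r10.
have r3 : 3 * r = Num.min r1 r2 by rewrite /r; field.
have [N _ hN] : \forall n \near \oo, n.+1%:R^-1 <= r.
  exists (Num.truncn r^-1) => // n /= hn; rewrite invf_ple ?posrE//.
  by rewrite (le_trans (ltW (truncnS_gt _)))// ler_nat ltnS.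
have UN : UF [set n | (N <= n)%N] by apply: ooUF; exists N.
have [n [[/= h1 h2] h3]] := filter_ex (filterI (filterI (fg _ r0) (VW _ r0)) UN).
have [[cf _ _] tn [cx cv] [hx hv] lt] := hb n.
have nr := hN n h3.
have uv (y : @unitI R) : set_val y \in `[(0 : R), 1] by have := set_valP y.
have close k l t : `|k t - l t| <= n.+1%:R^-1 -> forall m : R -> R, `|l t - m t| <= r -> `|m t - k t| < 3 * r.
  move=> kl m lm; rewrite (_ : m t - k t = - (l t - m t) - (k t - l t)); last by ring.
  rewrite (le_lt_trans (ler_normB _ _))// normrN (le_lt_trans (lerD lm (le_trans kl nr)))//; lra.
have close0 (l m : R -> R) t : `|l t - m t| <= r -> `|m t - l t| < 3 * r.
  by move=> lm; rewrite distrC (le_lt_trans lm)//; have := r0; lra.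
have q1 : `|T p.1 p.2 - T (res01 (x n)) (res01 (v n))| < e / 2.
  apply: (hA (res01 (x n), res01 (v n))).
    split=> /=; [apply: rA1|apply: rA2] => y; rewrite /res01/=.
      have : `|g (set_val y) - x n (set_val y)| < 3 * r by apply: (close (x n) (f n)); [exact: hx|exact: h1].
      by rewrite r3 lt_min => /andP[].
    have : `|W (set_val y) - v n (set_val y)| < 3 * r by apply: (close (v n) (V (th n))); [exact: hv|exact: h2].
    by rewrite r3 lt_min => /andP[].
  by split=> /=; [exists (x n)|exists (v n)].
have q2 : `|T p.1 p.2 - T (res01 (f n)) (res01 (V (th n)))| < e / 2.
  apply: (hA (res01 (f n), res01 (V (th n)))).
    split=> /=; [apply: rA1|apply: rA2] => y; rewrite /res01/=.
      have : `|g (set_val y) - f n (set_val y)| < 3 * r by apply: close0; exact: h1.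
      by rewrite r3 lt_min => /andP[].
    have : `|W (set_val y) - V (th n) (set_val y)| < 3 * r by apply: close0; exact: h2.
    by rewrite r3 lt_min => /andP[].
  split=> /=; first by exists (f n) => //; exact: within_continuous_cadlag.
  by exists (V (th n)) => //; apply: lipschitz_cadlag => s t; exact: VL.
move: lt; rewrite ltNge => /negP; apply.
rewrite (_ : T _ _ - T _ _ = (T p.1 p.2 - T (res01 (f n)) (res01 (V (th n)))) - (T p.1 p.2 - T (res01 (x n)) (res01 (v n)))); last by ring.
by rewrite (le_trans (ler_normB _ _))// (splitr e) lerD// ltW.
Qed.

End uniform_nearness.

(** * Exceptional events *)

Section union_bounds.
Context {R : realType} {d : measure_display} {T : measurableType d}.
Variable mu : probability T R.

Lemma prob_setU (A B : set T) : measurable A -> measurable B ->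
  fine (mu (A `|` B)) <= fine (mu A) + fine (mu B).
Proof.
move=> mA mB; rewrite -fineD ?fin_num_measure// fine_le ?fin_numD ?fin_num_measure//; last exact: measureU2.
exact: measurableU.
Qed.

(** [good] is an arbitrary predicate, typically about a supremum over an interval of times; what is
    measured is a set outside of which it holds. Path estimates all have this form. *)
Lemma prob_cover (q : nat) (b : R) (good : nat -> T -> Prop) :
  (forall i, (i < q)%N -> exists A, [/\ measurable A, fine (mu A) <= b & forall z, ~ A z -> good i z]) ->
  exists A, [/\ measurable A, fine (mu A) <= q%:R * b & forall z, ~ A z -> forall i, (i < q)%N -> good i z].
Proof.
elim: q => [_|q ih H].
  by exists set0; split=> //; rewrite measure0 mul0r.
have [|A [mA PA hA]] := ih; first by move=> i iq; apply: H; exact: leqW.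
have [B [mB PB hB]] := H q (leqnn _).
exists (A `|` B); split; first exact: measurableU.
  by rewrite -natr1 mulrDl mul1r (le_trans (prob_setU mA mB))// lerD.
move=> z nz i; rewrite ltnS leq_eqVlt => /predU1P[->|iq]; first by apply: hB => Bz; apply: nz; right.
by apply: hA => // Az; apply: nz; left.
Qed.

Lemma measurable_superlevel (f : T -> R) (c : R) : mfunT f -> measurable [set x | c <= f x].
Proof.
move=> mf; rewrite (_ : [set x | _] = f @^-1` `[c, +oo[%classic); last by apply/seteqP; split=> x; rewrite /= in_itv/= andbT.
by rewrite -[X in measurable X]setTI; apply: mf.
Qed.

Lemma markov_event (f : T -> R) (c b : R) : mfunT f -> L1 mu f -> 0 < c ->
  (forall x, 0 <= f x) -> \int[mu]_x f x <= c * b ->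
  exists A, [/\ measurable A, fine (mu A) <= b & forall x, ~ A x -> f x <= c].
Proof.
move=> mf lf c0 f0 fb; exists [set x | c <= f x]; have mA := measurable_superlevel c mf; split=> //.
  by apply: (le_trans (Rint_markov mA lf c0 f0 _)) => //; rewrite ler_pdivrMl.
by move=> x /negP; rewrite -ltNge; exact: ltW.
Qed.

End union_bounds.

Lemma unit_grid_cell {R : realType} (q : nat) (t : R) : (0 < q)%N -> 0 <= t -> t <= 1 ->
  exists i, [/\ (i < q)%N, i%:R / q%:R <= t & t <= i.+1%:R / q%:R].
Proof.
move=> q0 t0 t1; have q0' : (0 : R) < q%:R by rewrite ltr0n.
have tq0 : 0 <= t * q%:R by rewrite mulr_ge0// ltW.
have /andP[k1 k2] := truncn_itv tq0.
have [kq|kq] := ltnP (Num.truncn (t * q%:R)) q.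
  by exists (Num.truncn (t * q%:R)); split=> //; [rewrite ler_pdivrMr|rewrite ler_pdivlMr// ltW].
exists q.-1; rewrite prednK// divff ?gt_eqF//; split=> //.
by rewrite ler_pdivrMr//; apply: le_trans k1; rewrite ler_nat (leq_trans (leq_pred _)).
Qed.

(** * Estimates for one sample at a fixed parameter *)

Section sample.
Context {R : realType} {d : measure_display} {S : measurableType d}.
Variable Q : probability S R.
(** [F0] stands for the filtration of the observable and [F] for the one enlarged by X: the
    intensity is predictable for the former, the residual for the latter. *)
Variables F0 F : R -> set (set S).
Hypothesis hF : filtration F.
Hypothesis hF0 : filtration F0.
Hypothesis F0F : forall t, t \in `[0, 1] -> F0 t `<=` F t.
Variable N : S -> cumulative R R.
Hypothesis hN : forall y, counting_path (N y).
Hypothesis aN : adapted F (fun t y => N y t).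
Hypothesis iN : L1 Q (fun y => N y 1).
Variables (lam : R -> S -> R) (C : R).
Hypothesis blam0 : bpred F0 C lam.
Hypothesis comp : forall c H, bpred F c H ->
  \int[Q]_y jsum (N y) (H ^~ y) 1 = \int[(leb01 \x Q)%E]_z (H z.1 z.2 * lam z.1 z.2).
Variables (G : R -> S -> R) (C' : R).
Hypothesis bG : bpred F C' G.
(** The residual is centred given the past strictly before [t], in the form used below:
    orthogonality to bounded weights known at that time. *)
Hypothesis resG : forall t Z (c : R), t \in `[0, 1] -> measurable_wrt (left_sigma F0 t) Z ->
  (forall y, `|Z y| <= c) -> \int[Q]_y (Z y * G t y) = 0.

Lemma predictable_sub H : predictable F0 H -> predictable F H.
Proof.
move=> pH B mB; suff H' : predictable_sets F0 `<=` predictable_sets F by apply: H'; exact: pH.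
apply: smallest_sub; first exact: smallest_sigma_algebra.
move=> _ [[A FA <-]|[s [t [A [st t1 FA ->]]]]]; apply: sub_gen_smallest.
  by left; exists A => //; apply: F0F => //; exact: t01E.
right; exists s, t, A; split=> //; move: st => /andP[s0 st].
by apply: F0F FA; apply: t01E => //; exact: le_trans (ltW st) t1.
Qed.

Lemma bpred_sub c H : bpred F0 c H -> bpred F c H.
Proof. by move=> [pH mH bH]; split=> //; exact: predictable_sub. Qed.

Let blam : bpred F C lam. Proof. exact: bpred_sub. Qed.

Let C0 : 0 <= C.
Proof. by have [_ _ h] := blam; exact: le_trans (h 0 point). Qed.

Let C'0 : 0 <= C'.
Proof. by have [_ _ h] := bG; exact: le_trans (h 0 point). Qed.

Definition mean_qv t := \int[Q]_y jsum (N y) (fun s => G s y ^+ 2) t.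

Let martS c H := @sint_mart R d S Q F hF N hN aN iN lam C blam comp c H.

Lemma sint_variance t : t \in `[0, 1] -> \int[Q]_y (sint N lam G t y ^+ 2) = mean_qv t.
Proof. exact: (sint_isometry hF hN aN iN blam comp bG). Qed.

Lemma mean_qv0 : mean_qv 0 = 0.
Proof. by rewrite /mean_qv; under eq_Rintegral do rewrite (jsum0 (hN _)); rewrite Rint_cst. Qed.

Let bG2 := bpred_sqr bG.

Let iJ t : t \in `[0, 1] -> L1 Q (fun y => jsum (N y) (fun s => G s y ^+ 2) t).
Proof. by move=> t01; have [] := jsum_mean hF hN aN iN blam comp bG2 t01. Qed.

(** The Lipschitz constant is common to all parameters, which makes the family of variance functions
    equicontinuous. *)
Lemma mean_qv_incr s t : 0 <= s -> s <= t -> t <= 1 ->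
  0 <= mean_qv t - mean_qv s <= C' ^+ 2 * C * (t - s).
Proof.
move=> s0 st t1; have s01 := t01E s0 (le_trans st t1); have t01 := t01E (le_trans s0 st) t1.
have [_ _ hG] := bG.
rewrite /mean_qv -RintB; [|exact: iJ|exact: iJ].
have iB := L1B (iJ t01) (iJ s01).
have E y : jsum (N y) (fun r => G r y ^+ 2) t - jsum (N y) (fun r => G r y ^+ 2) s =
   \sum_(k < njumps (N y)) G (jump (N y) k) y ^+ 2 * (s < jump (N y) k <= t)%R%:R by rewrite jsumB.
apply/andP; split.
  by apply: Rint_ge0 => y; rewrite E; apply: sumr_ge0 => k _; rewrite mulr_ge0// sqr_ge0.
have FT : F s setT by apply: sigma_algebra_setT; have [sF _ _] := hF; exact: sF.
have m1 : measurable_wrt (F s) (fun _ : S => 1 : R).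
  by have := measurable_wrt_indic (R := R) (let: And3 h _ _ := hF in h s s01) FT; rewrite indicT.
have := @counting_incr_le R d S Q F hF N hN aN iN lam C blam comp (fun=> 1) 1 s t s0 st t1 m1 (fun=> ltac:(by rewrite ler01 lexx)).
rewrite Rint_cst mulr1 => h.
rewrite -mulrA; apply: le_trans (ler_wpM2l (sqr_ge0 C') h).
have iNt u : u \in `[0, 1] -> L1 Q (fun y => N y u) := @L1_counting R d S Q F hF N hN aN iN u.
have iD : L1 Q (fun y => 1 * (N y t - N y s)) by apply: L1Z; apply: L1B; exact: iNt.
rewrite -RintZ//; apply: Rint_le => //; first exact: L1Z.
move=> y; rewrite mul1r; apply: le_trans (ler_norm _) _.
apply: (le_jsumB (hN y)) => // x.
by rewrite normrX lerXn2r// nnegrE.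
Qed.

Variable n : nat.
Variable mu : probability (n.-tuple S) R.
Hypothesis res : resamplable mu Q.
Context {dX : measure_display} {X : measurableType dX}.
Variable tr : n.-tuple S -> X.
Hypothesis mtr : mfunT tr.
Variable J : {set 'I_n}.
Hypothesis tJ : forall j, j \in J -> test_index tr j.
Hypothesis J0 : (0 < #|J|)%N.

Notation m := (#|J|%:R : R).
Notation M := [the probability (n.-tuple S * S)%type R of (mu \x Q)%E].

Let m0 : 0 < m. Proof. by rewrite ltr0n. Qed.

(** Integrands fitted on data: for each training sample [x] a bounded predictable process, with
    measurability in [x] added so that one can integrate over the training data. *)
Definition param_bpred (A : R -> set (set S)) (c : R) (K : X -> R -> S -> R) :=
  (forall x, bpred A c (K x)) /\ mfunT (fun z : X * (R * S) => K z.1 z.2.1 z.2.2).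

Lemma param_cst A c H : bpred A c H -> param_bpred A c (fun=> H).
Proof.
move=> bH; split=> //; have [_ mH _] := bH.
exact: (measurableT_comp mH measurable_snd).
Qed.

Lemma paramM A c c' H K : param_bpred A c H -> param_bpred A c' K ->
  param_bpred A (c * c') (fun x t y => H x t y * K x t y).
Proof. by move=> [h1 h2] [k1 k2]; split; [move=> x; exact: bpredM|exact: measurable_funM]. Qed.

Lemma paramB A c c' H K : param_bpred A c H -> param_bpred A c' K ->
  param_bpred A (c + c') (fun x t y => H x t y - K x t y).
Proof. by move=> [h1 h2] [k1 k2]; split; [move=> x; exact: bpredB|exact: measurable_funB]. Qed.

Lemma param_sqr A c H : param_bpred A c H -> param_bpred A (c * c) (fun x t y => H x t y ^+ 2).
Proof. by move=> pH; have := paramM pH pH; under eq_fun do under eq_fun do under eq_fun do rewrite -expr2. Qed.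

Lemma param_abs A c H : param_bpred A c H -> param_bpred A c (fun x t y => `|H x t y|).
Proof.
move=> [h1 h2]; split; last exact: measurableT_comp.
move=> x; have [p mH b] := h1 x; split.
- by apply: predictable_comp => //; exact: measurable_normr.
- exact: measurableT_comp.
- by move=> t y; rewrite normr_id.
Qed.

Lemma param_sub c H : param_bpred F0 c H -> param_bpred F c H.
Proof. by move=> [h1 h2]; split=> // x; exact: bpred_sub. Qed.

Lemma measurable_param A c K : param_bpred A c K ->
  mfunT (fun z : R * (S * X) => K z.2.2 z.1 z.2.1).
Proof.
move=> [_ mK]; suff mp : mfunT (fun z : R * (S * X) => (z.2.2, (z.1, z.2.1))) by exact: (measurableT_comp mK mp).
apply: measurable_fun_pair.
  exact: (measurableT_comp measurable_snd measurable_snd).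
apply: measurable_fun_pair; first exact: measurable_fst.
exact: (measurableT_comp measurable_fst measurable_snd).
Qed.

Let mN t : t \in `[0, 1] -> mfunT (fun y => N y t).
Proof. exact: (measurable_counting hF aN). Qed.

Lemma measurable_param_jsum A c K t : param_bpred A c K -> t \in `[0, 1] ->
  mfunT (fun p : S * X => jsum (N p.1) (K p.2 ^~ p.1) t).
Proof.
move=> bK t01.
apply: (@measurable_jsum R _ _ (fun p : S * X => N p.1) (fun p => hN p.1) t t01 _ (fun z => K z.2.2 z.1 z.2.1)).
  move=> u; rewrite in_itv/= => /andP[u0 ut]; move: t01; rewrite in_itv/= => /andP[_ t1].
  by apply: (measurableT_comp (mN _) measurable_fst); apply: t01E => //; exact: le_trans t1.
exact: measurable_param bK.
Qed.

Lemma measurable_param_int A c K t : param_bpred A c K -> t \in `[0, 1] ->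
  mfunT (fun p : S * X => int_ds (K p.2 ^~ p.1) t).
Proof.
move=> bK t01; apply: (@measurable_int_ds R _ _ (fun z => K z.2.2 z.1 z.2.1) t t01).
exact: measurable_param bK.
Qed.

Let param_lam := param_cst blam.

Lemma measurable_param_sint c K t : param_bpred F c K -> t \in `[0, 1] ->
  mfunT (fun p : S * X => sint N lam (K p.2) t p.1).
Proof.
move=> bK t01; apply: measurable_funB; first exact: measurable_param_jsum bK t01.
exact: measurable_param_int (paramM bK param_lam) t01.
Qed.

(* [M] is the joint law of a sample and a new observation. *)
Definition param_mean (K : X -> R -> S -> R) :=
  \int[(leb01 \x M)%E]_z K (tr z.2.1) z.1 z.2.2.

Lemma measurable_param_new A c K : param_bpred A c K ->
  mfunT (fun z : R * (n.-tuple S * S) => K (tr z.2.1) z.1 z.2.2).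
Proof.
move=> bK; suff mp : mfunT (fun z : R * (n.-tuple S * S) => (z.1, (z.2.2, tr z.2.1))).
  exact: (measurableT_comp (measurable_param bK) mp).
apply: measurable_fun_pair; first exact: measurable_fst.
apply: measurable_fun_pair; first exact: (measurableT_comp measurable_snd measurable_snd).
exact: (measurableT_comp mtr (measurableT_comp measurable_fst measurable_snd)).
Qed.

Lemma L1_param_new A c K : param_bpred A c K ->
  L1 (leb01 \x M)%E (fun z : R * (n.-tuple S * S) => K (tr z.2.1) z.1 z.2.2).
Proof.
move=> bK; apply: (L1_bounded _ (measurable_param_new bK)) => z.
by have [h _] := bK; have [_ _] := h (tr z.2.1); exact.
Qed.

(** The compensation formula is applied with the training sample fixed, the intensity is bounded by
    [C], and Fubini's theorem integrates over the training sample. *)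
Lemma param_mean_jsum c K : param_bpred F c K -> (forall x t y, 0 <= K x t y) ->
  L1 M (new_eval tr (fun p : S * X => jsum (N p.1) (K p.2 ^~ p.1) 1)) /\
  \int[M]_z new_eval tr (fun p : S * X => jsum (N p.1) (K p.2 ^~ p.1) 1) z <= C * param_mean K.
Proof.
move=> bK K0; have h11 : (1 : R) \in `[0, 1] by apply: t01E.
have mJ := measurable_new_eval mtr (measurable_param_jsum bK h11).
have hK x : forall t y, `|K x t y| <= c by have [h _] := bK; have [_ _] := h x.
have c0 : 0 <= c by exact: le_trans (hK point 0 point).
have iNM : L1 M (fun z => c * N z.2 1).
  apply: L1Z; apply/integrableP; split.
    by apply/measurable_EFinP; exact: (measurableT_comp (mN h11) measurable_snd).
  rewrite (@fubini_tonelli2 _ _ _ _ _ mu Q (fun z => `|(N z.2 1)%:E|%E))//; last first.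
    by apply/measurable_EFinP; apply: measurableT_comp => //; exact: (measurableT_comp (mN h11) measurable_snd).
  have /integrableP[_] := iN; apply: le_lt_trans; apply: ge0_le_integral => //.
  - by move=> y _; apply: integral_ge0.
  - apply: measurable_fun_fubini_tonelli_G => //; apply/measurable_EFinP; apply: measurableT_comp => //.
    exact: (measurableT_comp (mN h11) measurable_snd).
  - by apply/measurable_EFinP; apply: measurableT_comp => //; exact: mN.
  - by move=> y _; rewrite /fubini_G/= integral_cst// [X in (_ * X <= _)%E](_ : _ = 1%E) ?mule1//; exact: probability_setT.
have N0 y : N y 0 = 0 by case: (hN y).
have iJM : L1 M (new_eval tr (fun p : S * X => jsum (N p.1) (K p.2 ^~ p.1) 1)).
  apply: (L1_le mJ iNM) => z; rewrite /new_eval/=.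
  have := @le_jsumB _ (N z.2) (hN z.2) (K (tr z.1) ^~ z.2) c 0 1 (fun t => hK _ t _).
  by rewrite jsum0// subr0 N0 subr0; apply => //; exact: t01E.
split=> //; have [i1 <-] := Rint_prod12 iJM.
have iK := L1_param_new bK.
have [i2 e2] := Rint_prod21 iK.
have [i3 e3] := Rint_prod12 i2.
rewrite /param_mean -e2 -e3 -RintZ//.
apply: Rint_le => //; first exact: L1Z.
move=> z; rewrite /new_eval/=; have [bz _] := bK.
have [_] := jsum_mean hF hN aN iN blam comp (bz (tr z)) h11.
move=> /(le_trans (ler_norm _)) /le_trans; apply.
have [_ mz bdz] := bz (tr z).
have iz := L1_bounded (leb01 \x Q)%E mz (fun p => bdz p.1 p.2).
rewrite ler_wpM2l//; apply: le_of_eq.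
have [_ <-] := Rint_prod21 (L1_abs iz).
by apply: eq_Rintegral => y _; apply: eq_Rintegral => s _; rewrite ger0_norm.
Qed.

Lemma L1_new (f : S -> R) : L1 Q f ->
  L1 M (fun z => f z.2) /\ \int[M]_z f z.2 = \int[Q]_y f y.
Proof.
move=> hf; have mf := L1_measurable hf.
have mf2 : mfunT (fun z : n.-tuple S * S => f z.2) := measurableT_comp mf measurable_snd.
have i2 : L1 M (fun z => f z.2).
  apply/integrableP; split; first exact/measurable_EFinP.
  rewrite (@fubini_tonelli1 _ _ _ _ _ mu Q (fun z => `|(f z.2)%:E|%E))//; last first.
    by apply/measurable_EFinP; exact: measurableT_comp.
  have /integrableP[_] := hf; apply: le_lt_trans.
  rewrite (_ : fubini_F Q _ = fun=> (\int[Q]_y `|f y|)%:E); last first.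
    by apply/funext => z; rewrite /fubini_F/= -EFin_Rint//; exact: L1_abs.
  rewrite integral_cst// [X in (_ * X <= _)%E](_ : _ = 1%E); last exact: probability_setT.
  by rewrite mule1 -EFin_Rint//; exact: L1_abs.
split=> //; have [_ <-] := Rint_prod12 i2.
by transitivity (\int[mu]_x (\int[Q]_y f y)); [by []|exact: Rint_cst].
Qed.

Section limit_process.

Definition score t (z : n.-tuple S) := test_sum tr J (fun p : S * X => sint N lam G t p.1) z.

Let pG := param_cst bG.

Let mW t : t \in `[0, 1] -> mfunT (fun p : S * X => sint N lam G t p.1).
Proof. exact: measurable_param_sint pG. Qed.

Lemma measurable_score t : t \in `[0, 1] -> mfunT (score t).
Proof. by move=> t01; apply: measurable_test_sum => //; exact: mW. Qed.

Lemma coord_score (t : R) z : score t z = coord_sum (fun y => sint N lam G t y) (enum J) z.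
Proof. by rewrite /coord_sum big_enum. Qed.

Lemma coord_score_lincomb (k : nat) (a t : 'I_k -> R) z :
  \sum_(i < k) a i * score (t i) z = coord_sum (fun y => \sum_(i < k) a i * sint N lam G (t i) y) (enum J) z.
Proof.
rewrite /coord_sum big_enum exchange_big/=; apply: eq_bigr => i _.
by rewrite -mulr_sumr.
Qed.

Let sint_L1 t : t \in `[0, 1] -> L1 Q (sint N lam G t) := fun t01 => L1_sint hF hN aN iN blam bG t01.

Let sint_L4 t : t \in `[0, 1] -> L1 Q (fun y => sint N lam G t y ^+ 4).
Proof. by move=> t01; have [] := sint_moment4 hF hN aN iN blam comp bG t01. Qed.

Let sint_meas t : t \in `[0, 1] -> mfunT (sint N lam G t) := fun t01 => measurable_sint hF hN aN blam bG t01.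

Lemma sint_mean0 t : t \in `[0, 1] -> \int[Q]_y sint N lam G t y = 0.
Proof.
move=> t01; move: (t01); rewrite in_itv/= => /andP[t0 t1].
have FT : F 0 setT by apply: sigma_algebra_setT; have [sF _ _] := hF; apply: sF; exact: t01E.
have := martS bG (lexx 0) t0 t1 FT; apply: etrans.
by apply: eq_Rintegral => y _; rewrite indicT mul1r (sint0 hN blam y bG) subr0.
Qed.

(** Cauchy-Schwarz twice, to the sum and then to the sum of squares: the first factor [k] gets
    squared, the second does not. *)
Lemma L1_pow4_lincomb (k : nat) (a : 'I_k -> R) (f : 'I_k -> S -> R) :
  (forall i, mfunT (f i)) -> (forall i, L1 Q (fun y => f i y ^+ 4)) ->
  L1 Q (fun y => (\sum_(i < k) a i * f i y) ^+ 4) /\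
  \int[Q]_y ((\sum_(i < k) a i * f i y) ^+ 4) <= k%:R ^+ 3 * \sum_(i < k) a i ^+ 4 * \int[Q]_y (f i y ^+ 4).
Proof.
move=> mf if4.
have H y : (\sum_(i < k) a i * f i y) ^+ 4 <= k%:R ^+ 3 * \sum_(i < k) a i ^+ 4 * f i y ^+ 4.
  have sq (u : 'I_k -> R) : (\sum_(i < k) u i) ^+ 2 <= k%:R * \sum_(i < k) u i ^+ 2.
    rewrite -subr_ge0.
    have -> : k%:R * \sum_(i < k) u i ^+ 2 - (\sum_(i < k) u i) ^+ 2 = 2^-1 * \sum_(i < k) \sum_(j < k) (u i - u j) ^+ 2.
      have -> : \sum_(i < k) \sum_(j < k) (u i - u j) ^+ 2 =
          \sum_(i < k) (k%:R * u i ^+ 2 + (\sum_(j < k) u j ^+ 2 - 2 * u i * \sum_(j < k) u j)).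
        apply: eq_bigr => i _; rewrite !mulr_sumr -sumrB.
        rewrite -[k in k%:R]card_ord -[_%:R]/(1 *+ _) -sumr_const mulr_suml -big_split/=.
        by apply: eq_bigr => j _; ring.
      rewrite big_split/= sumrB -mulr_sumr -mulr_suml -mulr_sumr.
      rewrite sumr_const card_ord -[_ *+ k]mulr_natl.
      by move: (\sum_(i < k) u i) (\sum_(i < k) u i ^+ 2) => s1 s2; field.
    by rewrite mulr_ge0// sumr_ge0// => i _; apply: sumr_ge0 => j _; exact: sqr_ge0.
  have h1 := sq (fun i => a i * f i y).
  have h2 := sq (fun i => (a i * f i y) ^+ 2).
  rewrite -[4%N]/(2 * 2)%N exprM.
  have h3 : ((\sum_(i < k) a i * f i y) ^+ 2) ^+ 2 <= (k%:R * \sum_(i < k) (a i * f i y) ^+ 2) ^+ 2.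
    by apply: lerXn2r h1; rewrite nnegrE ?sqr_ge0// mulr_ge0// sumr_ge0// => i _; exact: sqr_ge0.
  apply: (le_trans h3); rewrite exprMn [k%:R ^+ 3]exprSr -mulrA ler_wpM2l ?sqr_ge0//.
  apply: (le_trans h2); rewrite ler_wpM2l// ler_sum// => i _.
  by rewrite -exprM exprMn.
have iB i : L1 Q (fun y => a i ^+ 4 * f i y ^+ 4) by exact: L1Z.
have iS : L1 Q (fun y => k%:R ^+ 3 * \sum_(i < k) a i ^+ 4 * f i y ^+ 4) by apply: L1Z; exact: L1_sum.
have iL : L1 Q (fun y => (\sum_(i < k) a i * f i y) ^+ 4).
  apply: (L1_le _ iS); first by apply: measurable_funX; apply: measurable_sum => i; exact: measurable_funM.
  by move=> y; rewrite ger0_norm ?exprn_even_ge0.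
split=> //; apply: (le_trans (Rint_le iL iS H)).
rewrite RintZ; last exact: L1_sum.
rewrite Rint_sum// ler_wpM2l ?exprn_ge0// ler_sum// => i _.
by rewrite RintZ.
Qed.

Definition pow4_bound : R := 8 * C' ^+ 4 * (counting_moment_bound C + C ^+ 4).

(** The central limit estimate for one linear combination [eta], at frequency 1 / sqrt m. [K] bounds
    its fourth moment and 1 + K the lower ones, in terms of [C], [C'] and the coefficients, so the
    error is uniform over the parameter. *)
Lemma score_cos (k : nat) (a t : 'I_k -> R) (c v K : R) : (forall i, t i \in `[0, 1]) ->
  v = \sum_(i < k) \sum_(j < k) a i * a j * mean_qv (Num.min (t i) (t j)) ->
  K = k%:R ^+ 3 * \sum_(i < k) a i ^+ 4 * pow4_bound ->
  `|\int[mu]_z cos (\sum_(i < k) a i * ((Num.sqrt m)^-1 * score (t i) z) + c) - expR (- v / 2) * cos c|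
    <= (K + (1 + K) ^+ 2 + (1 + K)) / Num.sqrt m.
Proof.
move=> t01 vE KD.
pose eta y := \sum_(i < k) a i * sint N lam G (t i) y.
have meta : mfunT eta.
  by apply: measurable_sum => i; apply: measurable_funM => //; exact: sint_meas.
have [eta4 K4] := @L1_pow4_lincomb k a (fun i => sint N lam G (t i)) (fun i => sint_meas (t01 i)) (fun i => sint_L4 (t01 i)).
have eta0 : \int[Q]_y eta y = 0.
  rewrite Rint_sum; last by move=> i; apply: L1Z; exact: sint_L1.
  by rewrite big1// => i _; rewrite RintZ ?sint_mean0 ?mulr0//; exact: sint_L1.
have KE : \int[Q]_y (eta y ^+ 4) <= K.
  apply: (le_trans K4); rewrite KD ler_wpM2l ?exprn_ge0// ler_sum// => i _.
  rewrite ler_wpM2l ?exprn_even_ge0//.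
  by have [] := sint_moment4 hF hN aN iN blam comp bG (t01 i).
have ve : \int[Q]_y (eta y ^+ 2) = v.
  rewrite vE.
  have [sF Fm _] := hF.
  rewrite (mart_lincomb sF Fm (adapted_sint hF hN aN blam bG) (fun u u01 => L1_sint_sqr hF hN aN iN blam comp bG u01) (fun s u A s0 su u1 FA => martS bG s0 su u1 FA))//.
  apply: eq_bigr => i _; apply: eq_bigr => j _; congr (_ * _); apply: sint_variance.
  by rewrite /Num.min; case: ifP.
have K0 : 0 <= \int[Q]_y (eta y ^+ 4) by apply: Rint_ge0 => y; rewrite exprn_even_ge0.
have sm0 : 0 < Num.sqrt m by rewrite sqrtr_gt0.
have sm2 : Num.sqrt m ^+ 2 = m by rewrite sqr_sqrtr// ltW.
have sm1 : 1 <= Num.sqrt m.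
  by rewrite -[leLHS]sqrtr1 ler_wsqrtr//; have : (1 <= #|J|)%N by []; rewrite -(ler_nat R).
have := coord_sum_cos res meta eta4 eta0 (Num.sqrt m)^-1 c (enum_uniq (mem J)).
rewrite -cardE.
have -> : m * ((Num.sqrt m)^-1 ^+ 2 * \int[Q]_y (eta y ^+ 2) / 2) = v / 2.
  by rewrite ve exprVn sm2; field; rewrite gt_eqF.
rewrite -[- (v / 2)]mulNr.
rewrite (_ : (fun z => cos ((Num.sqrt m)^-1 * coord_sum eta (enum J) z + c)) = (fun z => cos (\sum_(i < k) a i * ((Num.sqrt m)^-1 * score (t i) z) + c))); last first.
  apply/funext => z; congr (cos (_ + _)); rewrite -coord_score_lincomb mulr_sumr.
  by apply: eq_bigr => i _; ring.
move=> /le_trans; apply; rewrite /clt_error.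
have i2 : L1 Q (fun y => eta y ^+ 2) by apply: (@L1_pow_le _ _ _ Q 2 2).
have i3 : L1 Q (fun y => `|eta y| ^+ 3).
  by under eq_fun do rewrite -normrX; apply: L1_abs; apply: (@L1_pow_le _ _ _ Q 2 3).
have pw (x : R) : x ^+ 2 <= 1 + x ^+ 4 /\ `|x| ^+ 3 <= 1 + x ^+ 4.
  have -> : x ^+ 4 = `|x| ^+ 4 by rewrite -normrX ger0_norm// exprn_even_ge0.
  have -> : x ^+ 2 = `|x| ^+ 2 by rewrite -normrX ger0_norm// exprn_even_ge0.
  have x0 := normr_ge0 x; have [h|/ltW h] := leP `|x| 1.
    have x4 := exprn_ge0 4 x0; have h2 := exprn_ile1 2 x0 h; have h3 := exprn_ile1 3 x0 h.
    by split; lra.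
  have h2 := ler_weXn2l h (isT : 2 <= 4)%N; have h3 := ler_weXn2l h (isT : 3 <= 4)%N.
  by split; rewrite (le_trans h2, le_trans h3)// lerDr.
have k3 : \int[Q]_y (`|eta y| ^+ 3) <= 1 + K.
  apply: le_trans (_ : 1 + \int[Q]_y (eta y ^+ 4) <= _); last by rewrite lerD2l.
  rewrite -[X in X + _](Rint_cst Q) -RintD//; last exact: L1_cst.
  by apply: Rint_le => //; [apply: L1D => //; exact: L1_cst|move=> y; have [] := pw (eta y)].
have k2 : v <= 1 + K.
  rewrite -ve; apply: le_trans (_ : 1 + \int[Q]_y (eta y ^+ 4) <= _); last by rewrite lerD2l.
  rewrite -[X in X + _](Rint_cst Q) -RintD//; last exact: L1_cst.
  by apply: Rint_le => //; [apply: L1D => //; exact: L1_cst|move=> y; have [] := pw (eta y)].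
have v0 : 0 <= v by rewrite -ve; apply: Rint_ge0 => y; exact: sqr_ge0.
have k30 : 0 <= \int[Q]_y (`|eta y| ^+ 3) by apply: Rint_ge0 => y; rewrite exprn_ge0.
rewrite ve; set x := (Num.sqrt m)^-1.
have x0 : 0 <= x by rewrite invr_ge0 ltW.
have x1 : x <= 1 by rewrite invf_le1.
have mx : m * x ^+ 2 = 1 by rewrite -sm2 /x exprVn mulfV// expf_neq0// gt_eqF.
rewrite (ger0_norm x0).
rewrite (_ : m * _ = x ^+ 2 * \int[Q]_y (eta y ^+ 4) + x ^+ 2 * (v ^+ 2 / 4) + x * \int[Q]_y (`|eta y| ^+ 3)); last first.
  transitivity ((m * x ^+ 2) * (x ^+ 2 * \int[Q]_y (eta y ^+ 4) + x ^+ 2 * (v ^+ 2 / 4) + x * \int[Q]_y (`|eta y| ^+ 3))); first by field.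
  by rewrite mx mul1r.
have xx : x ^+ 2 <= x by rewrite expr2 ler_piMl.
have v2 : v ^+ 2 / 4 <= (1 + K) ^+ 2.
  have : v ^+ 2 <= (1 + K) ^+ 2 by apply: lerXn2r; rewrite ?nnegrE// (le_trans v0).
  by have := sqr_ge0 (1 + K); lra.
have v4 : 0 <= v ^+ 2 / 4 by rewrite divr_ge0// sqr_ge0.
rewrite mulrDl mulrDl ![_ * x]mulrC lerD//; last by rewrite ler_wpM2l.
rewrite lerD//; by apply: ler_pM => //; exact: sqr_ge0.
Qed.

Lemma score_martingale s t B : 0 <= s -> s <= t -> t <= 1 -> natural_filtration score s B ->
  \int[mu]_z (\1_B z * (score t z - score s z)) = 0.
Proof.
apply: (test_sum_martingale res mtr tJ hF (w := fun t p => sint N lam G t p.1)).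
- exact: mW.
- move=> u u01; exact: (L1_new (sint_L1 u01)).1.
- by move=> x; exact: (adapted_sint hF hN aN blam bG).
- by move=> x s' t' A' s0 st t1 FA; exact: martS bG s0 st t1 FA.
Qed.

Lemma int_ds_right (f : R -> R) (k : R) t : mfunT f -> (forall x, `|f x| <= k) ->
  t \in `[0, 1[ -> int_ds f s @[s --> t^'+] --> int_ds f t.
Proof.
move=> mf fk; rewrite in_itv/= => /andP[t0 t1].
have k0 : 0 <= k by exact: le_trans (fk 0).
apply/cvgrPdist_le => e e0.
have r0 : 0 < e / (k + 1) by rewrite divr_gt0// ltr_wpDl.
near=> s.
have ts : t < s by near: s; exact: nbhs_right_gt.
have s1 : s <= 1 by near: s; apply: nbhs_right_le.
rewrite distrC (le_trans (int_dsB_le mf fk t0 (ltW ts) s1))//.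
apply: (@le_trans _ _ ((k + 1) * (s - t))); first by apply: ler_wpM2r; [rewrite subr_ge0 ltW|rewrite lerDl].
rewrite mulrC -ler_pdivlMr ?ltr_wpDl// lerBlDl.
by near: s; apply: nbhs_right_le; rewrite ltrDl.
Unshelve. all: by end_near. Qed.

Lemma sint_right (H : R -> S -> R) c y t : bpred F c H -> t \in `[0, 1[ ->
  sint N lam H s y @[s --> t^'+] --> sint N lam H t y.
Proof.
move=> bH t01; apply: cvgB.
  by have [h _] := jsum_cadlag (N y) (H ^~ y); exact: h.
have bHl := bpredM bH blam; have [_ _ hb] := bHl.
by apply: (@int_ds_right _ (c * C)) => //; exact: bpred_measurable1 bHl.
Qed.

Lemma score_cadlag z t : t \in `[0, 1[ -> score s z @[s --> t^'+] --> score t z.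
Proof.
move=> t01; have sE s : score s z = \sum_(j <- enum J) sint N lam G s (tnth z j).
  by rewrite coord_score.
rewrite (_ : (fun s => score s z) = (fun s => \sum_(j <- enum J) sint N lam G s (tnth z j))); last exact/funext.
rewrite sE; apply: cvg_sumr => j; exact: sint_right bG t01.
Qed.

Let CL := C' ^+ 2 * C.

Lemma score_incr_moment4 s t : 0 <= s -> s <= t -> t <= 1 -> C * (t - s) <= 2^-1 ->
  L1 mu (fun z => (score t z - score s z) ^+ 4) /\
  \int[mu]_z ((score t z - score s z) ^+ 4) <=
    m * (8 * C' ^+ 4 * (2593 * (C * (t - s)))) + 3 * m ^+ 2 * (CL * (t - s)) ^+ 2.
Proof.
move=> s0 st t1 Cts; have s01 := t01E s0 (le_trans st t1); have t01 := t01E (le_trans s0 st) t1.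
pose eta y := sint N lam G t y - sint N lam G s y.
have [i4 e4] := sint_incr_moment4 hF hN aN iN blam comp bG s0 st t1 Cts.
have meta : mfunT eta by apply: measurable_funB; exact: sint_meas.
have eta0 : \int[Q]_y eta y = 0.
  by rewrite RintB ?sint_mean0 ?subrr//; exact: sint_L1.
have [i4' _ _ h] := coord_sum_moments res meta i4 eta0 (enum_uniq (mem J)).
have E z : coord_sum eta (enum J) z = score t z - score s z.
  by rewrite !coord_score /coord_sum -sumrB.
have E4 : (fun z => coord_sum eta (enum J) z ^+ 4) = (fun z => (score t z - score s z) ^+ 4).
  by apply/funext => z; rewrite E.
rewrite E4 -cardE in h; rewrite E4 in i4'; split=> //; apply: (le_trans h).
have e2 : \int[Q]_y (eta y ^+ 2) = mean_qv t - mean_qv s.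
  have [sF Fm _] := hF.
  rewrite -(sint_variance t01) -(sint_variance s01).
  apply: (mart_sqr_incr sF Fm (adapted_sint hF hN aN blam bG)) => //.
    by move=> u u01; exact: (L1_sint_sqr hF hN aN iN blam comp bG u01).
  by move=> s' u A' s'0 su u1 FA; exact: martS bG s'0 su u1 FA.
have /andP[v0 v1] := mean_qv_incr s0 st t1.
rewrite lerD//; first by rewrite ler_wpM2l// ltW.
rewrite ler_wpM2l ?mulr_ge0 ?sqr_ge0// e2.
by apply: lerXn2r (v1); rewrite nnegrE// (le_trans v0 v1).
Qed.

Let sm0 : 0 < Num.sqrt m. Proof. by rewrite sqrtr_gt0. Qed.

Let smE : Num.sqrt m ^+ 2 = m. Proof. by rewrite sqr_sqrtr// ltW. Qed.

Let score_meas t : t \in `[0, 1] -> mfunT (score t).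
Proof. exact: measurable_score. Qed.

Let score_L4 t : t \in `[0, 1] -> L1 mu (fun z => score t z ^+ 4).
Proof.
move=> t01; have [i4 _ _ _] := coord_sum_moments res (sint_meas t01) (sint_L4 t01) (sint_mean0 t01) (enum_uniq (mem J)).
by under eq_fun do rewrite coord_score.
Qed.

(** Doob's inequality with fourth powers on each of [q] blocks, then a union bound. After
    normalization, the part of the fourth moment that is linear in the block length adds up to order
    1 / m and the quadratic part to order 1 / q; the former is the trace of the jumps. *)
Lemma score_modulus (q : nat) (e : R) : (0 < q)%N -> C / q%:R <= 2^-1 -> 0 < e ->
  exists A, [/\ measurable A, fine (mu A) <= (e ^+ 4)^-1 * (8 * C' ^+ 4 * 2593 * C / m + 3 * CL ^+ 2 / q%:R) &
   forall z, ~ A z -> forall i, (i < q)%N -> forall t, t \in `[i%:R / q%:R, i.+1%:R / q%:R] ->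
     `|(Num.sqrt m)^-1 * score t z - (Num.sqrt m)^-1 * score (i%:R / q%:R) z| <= e].
Proof.
move=> q0 Cq e0; have q0' : (0 : R) < q%:R by rewrite ltr0n.
pose b := ((e * Num.sqrt m) ^+ 4)^-1 * (m * (8 * C' ^+ 4 * (2593 * (C * q%:R^-1))) + 3 * m ^+ 2 * (CL * q%:R^-1) ^+ 2).
have -> : (e ^+ 4)^-1 * (8 * C' ^+ 4 * 2593 * C / m + 3 * CL ^+ 2 / q%:R) = q%:R * b.
  have s4 : Num.sqrt m ^+ 4 = m ^+ 2 by rewrite -[4%N]/(2 * 2)%N exprM smE.
  rewrite /b [(e * _) ^+ 4]exprMn s4.
  by field; rewrite !gt_eqF.
have em0 : 0 < e * Num.sqrt m by rewrite mulr_gt0.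
apply: prob_cover => i iq.
pose s : R := i%:R / q%:R; pose t : R := i.+1%:R / q%:R.
have ts : t - s = q%:R^-1 by rewrite /t /s -natr1 mulrDl mul1r addrAC subrr add0r.
have s0 : 0 <= s by rewrite divr_ge0// ltW.
have st : s <= t by rewrite ler_pM2r ?invr_gt0// ler_nat.
have t1 : t <= 1 by rewrite ler_pdivrMr// mul1r ler_nat.
have [A [mA PA HA]] := doob_path (or_intror (erefl 2)) em0 s0 st t1 score_meas score_L4 score_martingale score_cadlag.
exists A; split=> //.
  apply: (le_trans PA); rewrite /b; apply: ler_wpM2l; first by rewrite invr_ge0 exprn_ge0// ltW.
  by have [_] := score_incr_moment4 s0 st t1 (ltac:(by rewrite ts)); rewrite ts.
move=> z nA u us; rewrite -mulrBr normrM gtr0_norm ?invr_gt0// mulrC ler_pdivrMr//.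
exact: HA.
Qed.

Lemma score_sup (B : R) : 0 < B ->
  exists A, [/\ measurable A, fine (mu A) <= (B ^+ 2)^-1 * CL &
   forall z, ~ A z -> forall t, t \in `[0, 1] -> `|(Num.sqrt m)^-1 * score t z| <= B].
Proof.
move=> B0; have Bm0 : 0 < B * Num.sqrt m by rewrite mulr_gt0.
have iS2 t : t \in `[0, 1] -> L1 mu (fun z => score t z ^+ 1.*2).
  by move=> t01; apply: (@L1_pow_le _ _ _ mu 2 2) => //; [exact: score_meas|exact: score_L4].
have [A [mA PA HA]] := doob_path (or_introl (erefl 1%N)) Bm0 (lexx 0) ler01 (lexx 1) score_meas iS2 score_martingale score_cadlag.
have h11 : (1 : R) \in `[0, 1] by apply: t01E.
have sc0 z : score 0 z = 0.
  by rewrite coord_score /coord_sum big1// => j _; exact: (sint0 hN blam _ bG).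
exists A; split=> //.
  apply: (le_trans PA).
  have -> : (fun z => (score 1 z - score 0 z) ^+ 1.*2) = (fun z => coord_sum (sint N lam G 1) (enum J) z ^+ 2).
    by apply/funext => z; rewrite sc0 subr0 coord_score.
  have [_ _ -> _] := coord_sum_moments res (sint_meas h11) (sint_L4 h11) (sint_mean0 h11) (enum_uniq (mem J)).
  rewrite -cardE sint_variance// exprMn smE invfM -mulrA ler_wpM2l ?invr_ge0 ?sqr_ge0//.
  rewrite mulrA mulVf ?gt_eqF// mul1r.
  by have /andP[_] := mean_qv_incr (lexx 0) ler01 (lexx 1); rewrite mean_qv0 !subr0 mulr1.
move=> z nA t t01; rewrite normrM gtr0_norm ?invr_gt0// mulrC ler_pdivrMr//.
by have := HA z nA t t01; rewrite sc0 subr0.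
Qed.

End limit_process.

Section estimation.
Variables Gh lh : X -> R -> S -> R.
Hypothesis pGh : param_bpred F C' Gh.
Hypothesis plh0 : param_bpred F0 C lh.

Let plh : param_bpred F C lh := param_sub plh0.

Let pG : param_bpred F C' (fun=> G) := param_cst bG.

Let pl : param_bpred F C (fun=> lam) := param_cst blam.

Definition g2 := param_mean (fun x t y => (Gh x t y - G t y) ^+ 2).
Definition h2 := param_mean (fun x t y => (lam t y - lh x t y) ^+ 2).

Let dG : X -> R -> S -> R := fun x t y => Gh x t y - G t y.
Let dl : X -> R -> S -> R := fun x t y => lam t y - lh x t y.

Let pdG : param_bpred F (C' + C') dG := paramB pGh pG.
Let pdl : param_bpred F (C + C) dl := paramB pl plh.

Definition est_point t (p : S * X) :=
  jsum (N p.1) (Gh p.2 ^~ p.1) t - int_ds (fun s => Gh p.2 s p.1 * lh p.2 s p.1) t.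

Definition est_score t (z : n.-tuple S) := test_sum tr J (est_point t) z.

Let pK A c K (pK : param_bpred A c K) x y : mfunT (K x ^~ y) /\ (forall s, `|K x s y| <= c).
Proof. by have [h _] := pK; split; [exact: bpred_measurable1 (h x)|move=> s; have [_ _] := h x; exact]. Qed.

Lemma int_ds_lin (f g : R -> R) (c c' t : R) : mfunT f -> mfunT g ->
  (forall s, `|f s| <= c) -> (forall s, `|g s| <= c') -> t \in `[0, 1] ->
  int_ds (fun s => f s + g s) t = int_ds f t + int_ds g t /\ int_ds (fun s => f s - g s) t = int_ds f t - int_ds g t.
Proof.
move=> mf mg fc gc t01; have jf := L1_bounded (@leb01 R) mf fc; have jg := L1_bounded (@leb01 R) mg gc.
rewrite !int_ds_leb01//; [|exact: measurable_funB|exact: measurable_funD].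
rewrite -RintD; [|exact: L1_indic|exact: L1_indic].
rewrite -RintB; [|exact: L1_indic|exact: L1_indic].
by split; apply: eq_Rintegral => s _; ring.
Qed.

Let sint_point K t (p : S * X) := sint N lam (K p.2) t p.1.

(** With hats for estimates, Ghat dMhat - G dM = (Ghat - G) dM + G (lambda - lambdahat) ds + (Ghat -
    G) (lambda - lambdahat) ds. The three terms are estimated separately. *)
Lemma est_point_decomposition t p : t \in `[0, 1] ->
  est_point t p - sint N lam G t p.1 = sint_point dG t p +
    (int_ds (fun s => G s p.1 * dl p.2 s p.1) t + int_ds (fun s => dG p.2 s p.1 * dl p.2 s p.1) t).
Proof.
move=> t01; case: p => y x /=.
have [m1 b1] := pK (paramM pGh plh) x y; have [m2 b2] := pK (paramM pG pl) x y.
have [m3 b3] := pK (paramM pdG pl) x y; have [m4 b4] := pK (paramM pG pdl) x y.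
have [m5 b5] := pK (paramM pdG pdl) x y.
have e1 := (int_ds_lin m4 m5 b4 b5 t01).1.
have e2 := (int_ds_lin m2 m3 b2 b3 t01).1.
have m6 := measurable_funD m2 m3.
have b6 s : `|G s y * lam s y + dG x s y * lam s y| <= C' * C + (C' + C') * C.
  by rewrite (le_trans (ler_normD _ _))// lerD.
have e3 := (int_ds_lin m6 m1 b6 b1 t01).2.
rewrite -e1 /est_point /sint_point /sint /=.
have -> : int_ds (fun s => G s y * dl x s y + dG x s y * dl x s y) t =
    int_ds (fun s => (G s y * lam s y + dG x s y * lam s y) - Gh x s y * lh x s y) t.
  by apply: int_ds_ext => // s _; rewrite /dG /dl; ring.
rewrite e3 e2.
have -> : jsum (N y) (dG x ^~ y) t = jsum (N y) (Gh x ^~ y) t - jsum (N y) (G ^~ y) t.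
  by rewrite /jsum -sumrB; apply: eq_bigr => k _; rewrite /dG mulrBl.
by ring.
Qed.

Let h01 : (0 : R) \in `[0, 1]. Proof. exact: t01E. Qed.
Let h11 : (1 : R) \in `[0, 1]. Proof. exact: t01E. Qed.

Let sm0 : 0 < Num.sqrt m. Proof. by rewrite sqrtr_gt0. Qed.

Let smE : Num.sqrt m ^+ 2 = m. Proof. by rewrite sqr_sqrtr// ltW. Qed.

Let dGw t := sint_point dG t.

Let mdGw t : t \in `[0, 1] -> mfunT (dGw t).
Proof. exact: measurable_param_sint pdG. Qed.

Let NC2 : L1 Q (fun y => ((C' + C') * (N y 1 + C)) ^+ 2).
Proof.
rewrite (_ : (fun y => _) = fun y => (C' + C') ^+ 2 * (N y 1 ^+ 2 + (2 * C * N y 1 + C ^+ 2))); last by apply/funext => y; ring.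
apply: L1Z; apply: L1D; last by apply: L1D; [exact: L1Z|exact: L1_cst].
by apply: (@L1_pow_le _ _ _ Q 2 2) => //; [exact: mN|exact: (L1_counting_pow4 hF hN aN iN blam comp h11)].
Qed.

Let dGw_le t p : t \in `[0, 1] -> `|dGw t p| <= (C' + C') * (N p.1 1 + C).
Proof. by move=> t01; have [h _] := pdG; exact: (sint_le hN blam p.1 (h p.2) t01). Qed.

Let dGw2 t : t \in `[0, 1] -> L1 M (fun z => new_eval tr (dGw t) z ^+ 2).
Proof.
move=> t01; have [i2 _] := L1_new NC2.
apply: (L1_le _ i2).
  by apply: measurable_funX; apply: measurable_new_eval => //; exact: mdGw.
move=> z; rewrite normrX lerXn2r ?nnegrE// ?(le_trans _ (dGw_le (z.2, tr z.1) t01))//.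
Qed.

Let dGw_L1 t : t \in `[0, 1] -> L1 M (new_eval tr (dGw t)).
Proof.
by move=> t01; apply: L1_sqr_abs; [apply: measurable_new_eval => //; exact: mdGw|exact: dGw2].
Qed.

(** Given the training data the integrand is a fixed predictable process. Doob's inequality with
    squares, orthogonality of the test observations and the isometry bound the second moment by m C
    [g2], and the normalization removes m. *)
Lemma error_martingale (e : R) : 0 < e ->
  exists A, [/\ measurable A, fine (mu A) <= (e ^+ 2)^-1 * (C * g2) &
   forall z, ~ A z -> forall t, t \in `[0, 1] -> `|(Num.sqrt m)^-1 * test_sum tr J (dGw t) z| <= e].
Proof.
move=> e0; have em0 : 0 < e * Num.sqrt m by rewrite mulr_gt0.
have bd x : bpred F (C' + C') (dG x) by have [h _] := pdG; exact: h.
have mean0 z t : t \in `[0, 1] -> L1 Q (fun y => new_eval tr (dGw t) (z, y)) /\ \int[Q]_y new_eval tr (dGw t) (z, y) = 0.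
  move=> t01; have b := bd (tr z); split; first exact: (L1_sint hF hN aN iN blam b t01).
  move: (t01); rewrite in_itv/= => /andP[t0 t1].
  have FT : F 0 setT by apply: sigma_algebra_setT; have [sF _ _] := hF; exact: sF.
  have := martS b (lexx 0) t0 t1 FT; apply: etrans.
  by apply: eq_Rintegral => y _; rewrite indicT mul1r (sint0 hN blam y b) subr0.
have sq t : t \in `[0, 1] -> L1 mu (fun z => test_sum tr J (dGw t) z ^+ 2) /\
   \int[mu]_z (test_sum tr J (dGw t) z ^+ 2) = m * \int[M]_z (new_eval tr (dGw t) z ^+ 2).
  move=> t01; apply: (test_sum_sqr res mtr tJ (mdGw t01) (dGw2 t01)) => z; by have [] := mean0 z t t01.
have mart := test_sum_martingale res mtr tJ hF mdGw dGw_L1 (fun x => adapted_sint hF hN aN blam (bd x))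
  (fun x s t A s0 st t1 FA => martS (bd x) s0 st t1 FA).
have cad z t : t \in `[0, 1[ -> test_sum tr J (dGw s) z @[s --> t^'+] --> test_sum tr J (dGw t) z.
  move=> t01; have sE s : test_sum tr J (dGw s) z = \sum_(j <- enum J) sint N lam (dG (tr z)) s (tnth z j).
    by rewrite big_enum.
  rewrite (_ : (fun s => test_sum tr J (dGw s) z) = (fun s => \sum_(j <- enum J) sint N lam (dG (tr z)) s (tnth z j))); last exact/funext.
  rewrite sE; apply: cvg_sumr => j; exact: sint_right (bd (tr z)) t01.
have [A [mA PA HA]] := doob_path (Z := fun t => test_sum tr J (dGw t)) (or_introl (erefl 1%N)) em0 (lexx 0) ler01 (lexx 1)
  (fun t t01 => measurable_test_sum mtr J (mdGw t01)) (fun t t01 => (sq t t01).1) mart cad.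
have s0 z : test_sum tr J (dGw 0) z = 0.
  by rewrite /test_sum big1// => j _; exact: (sint0 hN blam _ (bd _)).
have Ew : \int[M]_z (new_eval tr (dGw 1) z ^+ 2) <= C * g2.
  have b2 : param_bpred F ((C' + C') * (C' + C')) (fun x t y => dG x t y * dG x t y) := paramM pdG pdG.
  have b2' : param_bpred F ((C' + C') * (C' + C')) (fun x t y => dG x t y ^+ 2).
    exact: param_sqr.
  have [iJJ EJ] := param_mean_jsum b2' (fun x t y => sqr_ge0 _).
  apply: le_trans EJ; have [_ <-] := Rint_prod12 (dGw2 h11); have [_ <-] := Rint_prod12 iJJ.
  apply: le_of_eq; apply: eq_Rintegral => z _.
  exact: (sint_isometry hF hN aN iN blam comp (bd (tr z)) h11).
exists A; split=> //.
  apply: (le_trans PA).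
  have -> : (fun z => (test_sum tr J (dGw 1) z - test_sum tr J (dGw 0) z) ^+ 1.*2) = (fun z => test_sum tr J (dGw 1) z ^+ 2).
    by apply/funext => z; rewrite s0 subr0.
  rewrite (sq 1 h11).2 exprMn smE invfM -mulrA; apply: ler_wpM2l; first by rewrite invr_ge0 sqr_ge0.
  by rewrite mulrA mulVf ?gt_eqF// mul1r.
move=> z nA t t01; rewrite normrM gtr0_norm ?invr_gt0// mulrC ler_pdivrMr//.
by have := HA z nA t t01; rewrite s0 subr0.
Qed.

Let joint K A c (pKK : param_bpred A c K) j :
  mfunT (fun w : R * n.-tuple S => K (tr w.2) w.1 (tnth w.2 j)).
Proof.
suff mp : mfunT (fun w : R * n.-tuple S => (w.1, (tnth w.2 j, tr w.2))).
  exact: (measurableT_comp (measurable_param pKK) mp).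
apply: measurable_fun_pair; first exact: measurable_fst.
apply: measurable_fun_pair; first exact: (measurableT_comp (measurable_tnth j) measurable_snd).
exact: (measurableT_comp mtr measurable_snd).
Qed.

Let Rint_sqr_le {d0 : measure_display} {T0 : measurableType d0} (P0 : probability T0 R) (f : T0 -> R) : mfunT f ->
  L1 P0 (fun x => f x ^+ 2) -> \int[P0]_x `|f x| <= Num.sqrt (\int[P0]_x (f x ^+ 2)).
Proof.
move=> mf i2; have E : (fun x : T0 => (cst (1 : R) x) ^+ 2) = fun=> 1 by apply/funext => x; rewrite expr1n.
have := Rint_CS mf (measurable_cst (1 : R)) i2.
rewrite E => /(_ (L1_cst P0 1)); rewrite Rint_cst sqrtr1 mulr1.
by rewrite (_ : (fun x => `|f x * cst 1 x|) = fun x => `|f x|)//; apply/funext => x; rewrite mulr1.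
Qed.

(** The indicator discards times outside [0, 1], about which the orthogonality of the residual says
    nothing. *)
Let drift1 : X -> R -> S -> R := fun x s y => \1_`[0, 1] s * (G s y * dl x s y).

Let drift1_bound x s y : `|drift1 x s y| <= C' * (C + C).
Proof.
have [_ b] := pK (paramM pG pdl) x y; rewrite /drift1 normrM norm_indic.
by rewrite (le_trans _ (b s))// ler_piMl// indicE; case: (_ \in _).
Qed.

Let measurable_drift1 : mfunT (fun z : X * (R * S) => drift1 z.1 z.2.1 z.2.2).
Proof.
have [_ mm] := paramM pG pdl; apply: measurable_funM => //.
apply: (measurableT_comp (f := \1_`[0, 1] : R -> R)); first exact: measurable_indic.
exact: (measurableT_comp measurable_fst measurable_snd).
Qed.

(** The supremum over [t] is bounded by the integral over time of the absolute value of the sum. At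
    each fixed time the summands are centred given the training data and uncorrelated, so the second
    moment is of order m and the normalized sum of order sqrt [h2]. *)
Lemma error_drift (e : R) : 0 < e ->
  exists A, [/\ measurable A, fine (mu A) <= e^-1 * (C' * Num.sqrt h2) &
   forall z, ~ A z -> forall t, t \in `[0, 1] ->
     `|(Num.sqrt m)^-1 * test_sum tr J (fun p => int_ds (fun s => G s p.1 * dl p.2 s p.1) t) z| <= e].
Proof.
move=> e0; have em0 : 0 < e * Num.sqrt m by rewrite mulr_gt0.
pose f (w : R * n.-tuple S) : R := test_sum tr J (fun p => drift1 p.2 w.1 p.1) w.2.
have mf : mfunT f.
  rewrite (_ : f = fun w => \sum_(j < n) (if j \in J then drift1 (tr w.2) w.1 (tnth w.2 j) else 0)); last first.
    by apply/funext => w; rewrite /f /test_sum big_mkcond.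
  apply: measurable_sum => j; case: (j \in J) => //.
  apply: measurable_funM; last exact: (joint (paramM pG pdl)).
  by apply: (measurableT_comp (f := \1_`[0, 1] : R -> R)); [exact: measurable_indic|exact: measurable_fst].
have fb w : `|f w| <= \sum_(j < n) (C' * (C + C)).
  rewrite /f /test_sum big_mkcond/= (le_trans (ler_norm_sum _ _ _))// ler_sum// => j _.
  have b0 : 0 <= C' * (C + C) by rewrite mulr_ge0// addr_ge0.
  by case: (j \in J); [exact: drift1_bound|rewrite normr0].
have if1 := L1_bounded (leb01 \x mu)%E mf fb.
have f2b w : `|f w ^+ 2| <= (\sum_(j < n) (C' * (C + C))) ^+ 2.
  by rewrite normrX lerXn2r ?nnegrE// (le_trans _ (fb w)).
have if2 := L1_bounded (leb01 \x mu)%E (measurable_funX 2 mf) f2b.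
pose r1 z := \int[leb01]_s `|f (s, z)|.
have [ir1 Er1] := Rint_prod21 (L1_abs if1).
have md s : mfunT (fun p : S * X => drift1 p.2 s p.1).
  apply: (measurableT_comp measurable_drift1 (g := fun p : S * X => (p.2, (s, p.1)))).
  apply: measurable_fun_pair; first exact: measurable_snd.
  by apply: measurable_fun_pair => //; exact: measurable_fst.
have d2 s z : `|new_eval tr (fun p : S * X => drift1 p.2 s p.1) z ^+ 2| <= (C' * (C + C)) ^+ 2.
  by rewrite normrX lerXn2r ?nnegrE// ?(le_trans _ (drift1_bound (tr z.1) s z.2))//; exact: drift1_bound.
have Es s : \int[mu]_z (f (s, z) ^+ 2) = m * \int[M]_z (drift1 (tr z.1) s z.2 ^+ 2).
  have i2 : L1 M (fun z => new_eval tr (fun p : S * X => drift1 p.2 s p.1) z ^+ 2).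
    apply: (L1_bounded _ _ (d2 s)); apply: measurable_funX; exact: measurable_new_eval (md s).
  have msec z : mfunT (fun y => drift1 (tr z) s y).
    suff mp : mfunT (fun y : S => (y, tr z)) by exact: (measurableT_comp (md s) mp).
    by apply: measurable_fun_pair => //; exact: measurable_id.
  have [|z|_ //] := test_sum_sqr res mtr tJ (md s) i2.
    by move=> z; apply: (L1_bounded _ (msec z)) => y; exact: drift1_bound.
  rewrite /new_eval/=; have [s01|ns] := boolP (s \in `[0, 1]); last first.
    rewrite (_ : (fun y => _) = fun=> 0) ?Rint_cst//; apply/funext => y.
    by rewrite /drift1 indicE memNset ?mul0r//=; apply/negP.
  have [_ _ bd] : bpred F0 (C + C) (dl (tr z)) by apply: bpredB => //; have [h _] := plh0; exact: h.
  (* The intensity error is predictable for the smaller filtration, hence known strictly before [s]: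
     this is what makes it an admissible weight for [resG]. *)
  have mw : measurable_wrt (left_sigma F0 s) (dl (tr z) s).
    apply: (predictable_left hF0 s01); have [p _ _] : bpred F0 (C + C) (dl (tr z)) by apply: bpredB => //; have [h _] := plh0; exact: h.
    exact: p.
  rewrite -[RHS](resG s01 mw (bd s)); apply: eq_Rintegral => y _.
  by rewrite /drift1 indicE mem_set// mul1r mulrC.
have E2 : \int[(leb01 \x mu)%E]_w (f w ^+ 2) <= m * (C' ^+ 2 * h2).
  have [_ <-] := Rint_prod12 if2.
  under eq_Rintegral do rewrite Es.
  pose k (w : R * (n.-tuple S * S)) := drift1 (tr w.2.1) w.1 w.2.2 ^+ 2.
  have mk : mfunT k.
    apply: measurable_funX; apply: (measurableT_comp measurable_drift1 (g := fun w : R * (n.-tuple S * S) => (tr w.2.1, (w.1, w.2.2)))).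
    apply: measurable_fun_pair.
      exact: (measurableT_comp mtr (measurableT_comp measurable_fst measurable_snd)).
    apply: measurable_fun_pair; first exact: measurable_fst.
    exact: (measurableT_comp measurable_snd measurable_snd).
  have ik : L1 (leb01 \x M)%E k by apply: (L1_bounded _ mk) => w; exact: (d2 w.1 w.2).
  have [ik1 ek] := Rint_prod12 ik.
  rewrite RintZ// ek; apply: ler_wpM2l; first exact: ltW.
  have p2 : param_bpred F ((C + C) * (C + C)) (fun x t y => dl x t y ^+ 2).
    exact: param_sqr.
  have i2 := L1_param_new p2.
  rewrite /h2 /param_mean -RintZ//; apply: Rint_le => //; first exact: L1Z.
  move=> w; rewrite /k /drift1 !exprMn mulrA; apply: ler_wpM2r; first exact: sqr_ge0.
  have [_ _ hG] := bG; have g1 := hG w.1 w.2.2.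
  have l1 : (\1_`[0, 1] w.1 : R) ^+ 2 <= 1 by rewrite indicE; case: (_ \in _); rewrite ?expr1n ?expr0n.
  have l2 : G w.1 w.2.2 ^+ 2 <= C' ^+ 2 by rewrite -[leLHS]real_normK ?num_real//; apply: lerXn2r; rewrite ?nnegrE.
  by apply: le_trans (_ : 1 * G w.1 w.2.2 ^+ 2 <= _); [exact: ler_wpM2r (sqr_ge0 _) _ _ l1|rewrite mul1r].
have h20 : 0 <= h2 by apply: Rint_ge0 => w; exact: sqr_ge0.
have E1 : \int[mu]_z r1 z <= Num.sqrt m * (C' * Num.sqrt h2).
  rewrite Er1; apply: (le_trans (Rint_sqr_le mf if2)).
  rewrite -[leRHS](ger0_norm (x := Num.sqrt m * (C' * Num.sqrt h2))); last by rewrite !mulr_ge0// sqrtr_ge0.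
  rewrite -sqrtr_sqr; apply: ler_wsqrtr; apply: (le_trans E2).
  by rewrite !exprMn smE sqr_sqrtr.
have r10 z : 0 <= r1 z by apply: Rint_ge0.
have [|A [mA PA HA]] := markov_event (b := e^-1 * (C' * Num.sqrt h2)) (L1_measurable ir1) ir1 em0 r10.
  by apply: (le_trans E1); apply: le_of_eq; field; rewrite gt_eqF.
exists A; split=> // z nA t t01; rewrite normrM gtr0_norm ?invr_gt0// mulrC ler_pdivrMr//.
apply: le_trans (HA z nA).
have mfz : mfunT (fun s => f (s, z)) := measurable_fun_pair1 z mf.
have ifz : L1 (@leb01 R) (fun s => f (s, z)) := L1_bounded _ mfz (fun s => fb (s, z)).
have -> : test_sum tr J (fun p => int_ds (fun s => G s p.1 * dl p.2 s p.1) t) z = \int[leb01]_s (\1_`[0, t] s * f (s, z)).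
  pose v j s : R := if j \in J then \1_`[0, t] s * (G s (tnth z j) * dl (tr z) s (tnth z j)) else 0.
  have iv j : L1 (@leb01 R) (v j).
    rewrite /v; case: (j \in J); last exact: L1_cst.
    have [mm bb] := pK (paramM pG pdl) (tr z) (tnth z j).
    by apply: L1_indic => //; exact: L1_bounded bb.
  transitivity (\int[leb01]_s \sum_(j < n) v j s).
    rewrite Rint_sum// /test_sum big_mkcond/=; apply: eq_bigr => j _; rewrite /v.
    case: (j \in J); last by rewrite Rint_cst.
    have [mm bb] := pK (paramM pG pdl) (tr z) (tnth z j).
    by rewrite /test_eval/= int_ds_leb01.
  apply: eq_Rintegral => s _; rewrite /f /test_sum [in RHS]big_mkcond mulr_sumr; apply: eq_bigr => j _.
  rewrite /v; case: (j \in J); last by rewrite mulr0.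
  rewrite /test_eval /drift1/= mulrA; congr (_ * _).
  rewrite !indicE -natrM mulnb; congr (nat_of_bool _)%:R.
  move: t01; rewrite in_itv/= => /andP[t0 t1]; rewrite !mem_setE !in_itv/=.
  by apply/idP/andP => [/andP[h1 h2']|[]//]; split; rewrite ?h1 ?h2'//= (le_trans h2').
apply: (le_trans (Rint_abs (L1_indic _ ifz))) => //.
apply: Rint_le; [by apply: L1_abs; exact: L1_indic|exact: L1_abs|] => s.
by rewrite normrM norm_indic ler_piMl// indicE; case: (_ \in _).
Qed.

(** There is no cancellation in this term: a sum of m absolute values has mean at most m sqrt ([g2]
    [h2]), and the normalization leaves sqrt m. This accounts for the rate imposed on the product of
    the errors. *)
Lemma error_product (e : R) : 0 < e ->
  exists A, [/\ measurable A, fine (mu A) <= e^-1 * (Num.sqrt m * Num.sqrt g2 * Num.sqrt h2) &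
   forall z, ~ A z -> forall t, t \in `[0, 1] ->
     `|(Num.sqrt m)^-1 * test_sum tr J (fun p => int_ds (fun s => dG p.2 s p.1 * dl p.2 s p.1) t) z| <= e].
Proof.
move=> e0; have em0 : 0 < e * Num.sqrt m by rewrite mulr_gt0.
have pp := param_abs (paramM pdG pdl).
pose b (p : S * X) := \int[leb01]_s `|dG p.2 s p.1 * dl p.2 s p.1|.
have mb : mfunT b := @measurable_Rint1 _ _ _ _ _ leb01 _ (measurable_param pp).
have b0 p : 0 <= b p by apply: Rint_ge0.
have ipp := L1_param_new pp.
have [ib eb] := Rint_prod21 ipp.
have [iS ES] := test_sum_abs res mtr tJ mb ib.
have Eb : \int[M]_z new_eval tr b z <= Num.sqrt g2 * Num.sqrt h2.
  have pg2 : param_bpred F ((C' + C') * (C' + C')) (fun x t y => dG x t y ^+ 2).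
    exact: param_sqr.
  have p2 : param_bpred F ((C + C) * (C + C)) (fun x t y => dl x t y ^+ 2).
    exact: param_sqr.
  apply: le_trans (Rint_CS (measurable_param_new pdG) (measurable_param_new pdl) (L1_param_new pg2) (L1_param_new p2)).
  by rewrite le_eqVlt -eb eqxx.
pose r3 := test_sum tr J b.
have r30 z : 0 <= r3 z by apply: sumr_ge0 => j _; exact: b0.
have mr3 : mfunT r3 := measurable_test_sum mtr J mb.
have E3 : \int[mu]_z r3 z <= m * (Num.sqrt g2 * Num.sqrt h2).
  have eab : \int[mu]_z r3 z = \int[mu]_z `|r3 z| by apply: eq_Rintegral => z _; rewrite ger0_norm.
  rewrite eab; apply: (le_trans ES); apply: ler_wpM2l; first exact: ltW.
  apply: le_trans Eb; apply: le_of_eq.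
  by apply: eq_Rintegral => z _; rewrite ger0_norm//; exact: b0.
have [|A [mA PA HA]] := markov_event (b := e^-1 * (Num.sqrt m * Num.sqrt g2 * Num.sqrt h2)) mr3 iS em0 r30.
  rewrite (le_trans E3)// -[X in X * (_ * _) <= _]smE expr2; apply: le_of_eq.
  by field; rewrite gt_eqF.
exists A; split=> // z nA t t01; rewrite normrM gtr0_norm ?invr_gt0// mulrC ler_pdivrMr//.
apply: le_trans (HA z nA); rewrite (le_trans (ler_norm_sum _ _ _))// ler_sum// => j _.
rewrite /test_eval/=; have [mm bb] := pK (paramM pdG pdl) (tr z) (tnth z j).
have im := L1_bounded (@leb01 R) mm bb.
rewrite int_ds_leb01//; apply: (le_trans (Rint_abs (L1_indic _ im))) => //.
apply: Rint_le; [by apply: L1_abs; exact: L1_indic|exact: L1_abs|] => s.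
by rewrite normrM norm_indic ler_piMl// indicE; case: (_ \in _).
Qed.

Lemma est_score_approx (e : R) : 0 < e ->
  exists A, [/\ measurable A,
   fine (mu A) <= (e ^+ 2)^-1 * (C * g2) + e^-1 * (C' * Num.sqrt h2) + e^-1 * (Num.sqrt m * Num.sqrt g2 * Num.sqrt h2) &
   forall z, ~ A z -> forall t, t \in `[0, 1] ->
     `|(Num.sqrt m)^-1 * est_score t z - (Num.sqrt m)^-1 * score t z| <= 3 * e].
Proof.
move=> e0; have [A1 [mA1 P1 H1]] := error_martingale e0.
have [A2 [mA2 P2 H2]] := error_drift e0.
have [A3 [mA3 P3 H3]] := error_product e0.
have mA12 := measurableU _ _ mA1 mA2.
exists ((A1 `|` A2) `|` A3); split; first exact: measurableU.
  apply: (le_trans (prob_setU _ mA12 mA3)); apply: lerD P3.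
  by apply: (le_trans (prob_setU _ mA1 mA2)); exact: lerD.
move=> z nz t t01.
have h1 := H1 z (fun h => nz (or_introl (or_introl h))) t t01.
have h2' := H2 z (fun h => nz (or_introl (or_intror h))) t t01.
have h3 := H3 z (fun h => nz (or_intror h)) t t01.
have -> : (Num.sqrt m)^-1 * est_score t z - (Num.sqrt m)^-1 * score t z =
  (Num.sqrt m)^-1 * test_sum tr J (dGw t) z +
  (Num.sqrt m)^-1 * test_sum tr J (fun p => int_ds (fun s => G s p.1 * dl p.2 s p.1) t) z +
  (Num.sqrt m)^-1 * test_sum tr J (fun p => int_ds (fun s => dG p.2 s p.1 * dl p.2 s p.1) t) z.
  rewrite -mulrBr -!mulrDr; congr (_ * _); rewrite /est_score /score /test_sum -sumrB -!big_split/=.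
  by apply: eq_bigr => j _; rewrite /test_eval est_point_decomposition// addrA.
rewrite (_ : 3 * e = e + e + e); last by ring.
by rewrite (le_trans (ler_normD _ _))// lerD// (le_trans (ler_normD _ _))// lerD.
Qed.

Definition est_var t (z : n.-tuple S) :=
  m^-1 * test_sum tr J (fun p : S * X => jsum (N p.1) (fun s => Gh p.2 s p.1 ^+ 2) t) z.

Let ref_var t (z : n.-tuple S) :=
  m^-1 * test_sum tr J (fun p : S * X => jsum (N p.1) (fun s => G s p.1 ^+ 2) t) z.

Let jsum_mono (h : R -> R) y s t : (forall s, 0 <= h s) -> s <= t -> jsum (N y) h s <= jsum (N y) h t.
Proof.
move=> h0 st; apply: ler_sum => i _; rewrite ler_wpM2l//.
by have [h1|//] := leP (jump (N y) i) s; rewrite (le_trans h1 st).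
Qed.

Let ref_var_mono z s t : s <= t -> ref_var s z <= ref_var t z.
Proof.
move=> st; rewrite /ref_var; apply: ler_wpM2l; first by rewrite invr_ge0 ltW.
apply: ler_sum => j _; by apply: jsum_mono => // r; exact: sqr_ge0.
Qed.

(** The difference of squares is at most 2 C' |Ghat - G|; its jump integral over [0, 1] dominates
    all times and has mean bounded by compensation and Cauchy-Schwarz. *)
Let error_variance (e : R) : 0 < e ->
  exists A, [/\ measurable A, fine (mu A) <= e^-1 * (2 * C' * C * Num.sqrt g2) &
   forall z, ~ A z -> forall t, t \in `[0, 1] -> `|est_var t z - ref_var t z| <= e].
Proof.
move=> e0; have pS := paramB (paramM pGh pGh) (paramM pG pG).
have pA := param_abs pS.
pose b (p : S * X) := jsum (N p.1) (fun s => `|Gh p.2 s p.1 * Gh p.2 s p.1 - G s p.1 * G s p.1|) 1.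
have mb : mfunT b := measurable_param_jsum pA h11.
have b0 p : 0 <= b p by apply: sumr_ge0 => k _; rewrite mulr_ge0.
have [ib eb] := param_mean_jsum pA (fun x t y => normr_ge0 _).
have [iS ES] := test_sum_abs res mtr tJ mb ib.
have pg2 : param_bpred F ((C' + C') * (C' + C')) (fun x t y => dG x t y ^+ 2).
  exact: param_sqr.
have pd := param_abs pdG.
have Eb : \int[M]_z new_eval tr b z <= C * (2 * C' * Num.sqrt g2).
  apply: (le_trans eb); rewrite ler_wpM2l//.
  have h1 : param_mean (fun x t y => `|dG x t y|) <= Num.sqrt g2.
    apply: (Rint_sqr_le (measurable_param_new pdG)); exact: (L1_param_new pg2).
  apply: le_trans (_ : 2 * C' * param_mean (fun x t y => `|dG x t y|) <= _); last by rewrite ler_wpM2l// mulr_ge0.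
  rewrite /param_mean -RintZ; last exact: (L1_param_new pd).
  apply: Rint_le; [exact: (L1_param_new pA)|by apply: L1Z; exact: (L1_param_new pd)|].
  move=> w; rewrite -!expr2 subr_sqr normrM [leRHS]mulrC ler_wpM2l// (le_trans (ler_normD _ _))//.
  have [h _] := pGh; have [_ _ g1] := h (tr w.2.1); have [_ _ gg] := bG.
  by rewrite mulr_natl mulr2n; apply: lerD.
pose r4 := test_sum tr J b.
have r40 z : 0 <= r4 z by apply: sumr_ge0 => j _; exact: b0.
have mr4 : mfunT r4 := measurable_test_sum mtr J mb.
have em0 : 0 < e * m by rewrite mulr_gt0.
have E4 : \int[mu]_z r4 z <= m * (C * (2 * C' * Num.sqrt g2)).
  have eab : \int[mu]_z r4 z = \int[mu]_z `|r4 z| by apply: eq_Rintegral => z _; rewrite ger0_norm.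
  rewrite eab; apply: (le_trans ES); apply: ler_wpM2l; first exact: ltW.
  apply: le_trans Eb; apply: le_of_eq.
  by apply: eq_Rintegral => z _; rewrite ger0_norm//; exact: b0.
have [|A [mA PA HA]] := markov_event (b := e^-1 * (2 * C' * C * Num.sqrt g2)) mr4 iS em0 r40.
  by rewrite (le_trans E4)//; apply: le_of_eq; field; rewrite gt_eqF.
exists A; split=> // z nA t t01; rewrite /est_var /ref_var -mulrBr normrM gtr0_norm ?invr_gt0// mulrC ler_pdivrMr//.
apply: le_trans (HA z nA); rewrite /test_sum -sumrB (le_trans (ler_norm_sum _ _ _))// ler_sum// => j _.
rewrite /test_eval/= /jsum -sumrB (le_trans (ler_norm_sum _ _ _))//.
apply: le_trans (_ : jsum (N (tnth z j)) (fun s => `|Gh (tr z) s (tnth z j) * Gh (tr z) s (tnth z j) - G s (tnth z j) * G s (tnth z j)|) t <= _).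
  by apply: ler_sum => k _; rewrite -mulrBl normrM -!expr2 (ger0_norm (ler0n _ _)).
by apply: jsum_mono => //; move: t01; rewrite in_itv/= => /andP[].
Qed.

(** Chebyshev's inequality at a single time; the fourth moment of N(1) bounds the variance of one
    summand. *)
Let law_large (e t : R) : 0 < e -> t \in `[0, 1] ->
  exists A, [/\ measurable A, fine (mu A) <= (m * e ^+ 2)^-1 * (C' ^+ 4 * (1 + counting_moment_bound C)) &
   forall z, ~ A z -> `|ref_var t z - mean_qv t| <= e].
Proof.
move=> e0 t01; move: (t01); rewrite in_itv/= => /andP[t0 t1].
pose a0 y := jsum (N y) (fun s => G s y ^+ 2) t.
pose a (p : S * X) := a0 p.1 - mean_qv t.
have i1 : L1 Q a0 := iJ t01.
have ma : mfunT a.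
  apply: measurable_funB; last exact: measurable_cst.
  exact: (measurableT_comp (L1_measurable i1) measurable_fst).
have [i4 e4] := counting_total_moment4 hF hN aN iN blam comp.
have N0 y : N y 0 = 0 by case: (hN y).
have a0b y : `|a0 y| <= C' ^+ 2 * N y 1.
  have [_ _ gg] := bG.
  have := @le_jsumB _ (N y) (hN y) (fun s => G s y ^+ 2) (C' ^+ 2) 0 t _ h01 t01 t0.
  rewrite jsum0// subr0 N0 subr0 => h; apply: (le_trans (h _)); first by move=> x; rewrite normrX lerXn2r// nnegrE.
  by rewrite ler_wpM2l ?sqr_ge0// (counting_path_homo (N y) t1).
have sqb y : a0 y ^+ 2 <= C' ^+ 4 * (1 + N y 1 ^+ 4).
  have h : a0 y ^+ 2 <= (C' ^+ 2 * N y 1) ^+ 2.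
    by rewrite -[leLHS]real_normK ?num_real//; apply: lerXn2r (a0b y); rewrite nnegrE// (le_trans _ (a0b y)).
  apply: (le_trans h); rewrite exprMn -exprM ler_wpM2l ?exprn_ge0//.
  have := sqr_ge0 (N y 1 ^+ 2 - 1); have -> : N y 1 ^+ 4 = (N y 1 ^+ 2) ^+ 2 by rewrite -exprM.
  move: (N y 1 ^+ 2) => x h1; have h2 := sqr_ge0 x; rewrite sqrrB1 in h1; lra.
have iB : L1 Q (fun y => C' ^+ 4 * (1 + N y 1 ^+ 4)) by apply: L1Z; apply: L1D => //; exact: L1_cst.
have i2 : L1 Q (fun y => a0 y ^+ 2).
  apply: (L1_le _ iB); first exact: measurable_funX (L1_measurable i1).
  by move=> y; rewrite ger0_norm ?sqr_ge0.
have E2 : \int[Q]_y (a0 y ^+ 2) <= C' ^+ 4 * (1 + counting_moment_bound C).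
  apply: (le_trans (Rint_le i2 iB sqb)); rewrite RintZ; last by apply: L1D => //; exact: L1_cst.
  by rewrite RintD//; [rewrite Rint_cst ler_wpM2l ?exprn_ge0// lerD2l|exact: L1_cst].
have ED : (fun y => (a0 y - mean_qv t) ^+ 2) = (fun y => a0 y ^+ 2 + (- (2 * mean_qv t) * a0 y + mean_qv t ^+ 2)).
  by apply/funext => y; ring.
have ic2 : L1 Q (fun y => (a0 y - mean_qv t) ^+ 2).
  by rewrite ED; apply: L1D => //; apply: L1D; [exact: L1Z|exact: L1_cst].
have Ec2 : \int[Q]_y ((a0 y - mean_qv t) ^+ 2) <= C' ^+ 4 * (1 + counting_moment_bound C).
  rewrite ED RintD//; last by apply: L1D; [exact: L1Z|exact: L1_cst].
  rewrite RintD; [|exact: L1Z|exact: L1_cst].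
  rewrite RintZ// Rint_cst -/(mean_qv t) (_ : - (2 * mean_qv t) * mean_qv t + mean_qv t ^+ 2 = - mean_qv t ^+ 2); last by ring.
  by rewrite (le_trans _ E2)// gerDl oppr_le0 sqr_ge0.
have [iM EM] := L1_new ic2.
have [|z|z|iS ES] := test_sum_sqr res mtr tJ ma.
- exact: iM.
- by apply: L1B => //; exact: L1_cst.
- by rewrite /new_eval/a/= RintB ?Rint_cst ?subrr//; exact: L1_cst.
have em0 : 0 < (e * m) ^+ 2 by rewrite exprn_gt0// mulr_gt0.
pose r z := test_sum tr J a z ^+ 2.
have r0 z : 0 <= r z := sqr_ge0 _.
have [|A [mA PA HA]] := markov_event (b := (m * e ^+ 2)^-1 * (C' ^+ 4 * (1 + counting_moment_bound C))) (L1_measurable iS) iS em0 r0.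
  rewrite ES (_ : (e * m) ^+ 2 * _ = m * (C' ^+ 4 * (1 + counting_moment_bound C))); last by field; rewrite !gt_eqF.
  by rewrite ler_pM2l//; apply: le_trans Ec2; rewrite -EM.
exists A; split=> // z nA.
have -> : ref_var t z - mean_qv t = m^-1 * test_sum tr J a z.
  rewrite /ref_var /test_sum /a /test_eval/= sumrB sumr_const -[mean_qv t *+ _]mulr_natl mulrBr mulrA mulVf ?mul1r// gt_eqF//.
rewrite normrM gtr0_norm ?invr_gt0// mulrC ler_pdivrMr//.
have em : 0 <= e * m by rewrite mulr_ge0// ltW.
rewrite -(ger0_norm em) -ler_sqr ?nnegrE// !real_normK ?num_real//; exact: HA.
Qed.

(** [ref_var] is nondecreasing in time and its mean is Lipschitz: closeness at the q + 1 grid points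
    extends to all times at the cost of C'^2 C / q. *)
Lemma est_variance (q : nat) (e : R) : (0 < q)%N -> 0 < e ->
  exists A, [/\ measurable A,
   fine (mu A) <= e^-1 * (2 * C' * C * Num.sqrt g2) + q.+1%:R * ((m * e ^+ 2)^-1 * (C' ^+ 4 * (1 + counting_moment_bound C))) &
   forall z, ~ A z -> forall t, t \in `[0, 1] -> `|est_var t z - mean_qv t| <= 2 * e + C' ^+ 2 * C / q%:R].
Proof.
move=> q0 e0; have q0' : (0 : R) < q%:R by rewrite ltr0n.
have [A1 [mA1 P1 H1]] := error_variance e0.
have grid01 i : (i < q.+1)%N -> (i%:R / q%:R : R) \in `[0, 1].
  by move=> iq; apply: t01E; [rewrite divr_ge0// ltW|rewrite ler_pdivrMr// mul1r ler_nat].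
have [A2 [mA2 P2 H2]] := prob_cover (fun i iq => law_large e0 (grid01 i iq)).
exists (A1 `|` A2); split; first exact: measurableU.
  by apply: (le_trans (prob_setU mu mA1 mA2)); exact: lerD.
move=> z nz t t01; have h1 := H1 z (fun h => nz (or_introl h)) t t01.
have h2' := H2 z (fun h => nz (or_intror h)).
move: (t01); rewrite in_itv/= => /andP[t0 t1].
have [i [iq lo hi]] := unit_grid_cell q0 t0 t1.
have gi := grid01 _ (ltnW iq : (i < q.+1)%N); have gi1 := grid01 _ (iq : (i.+1 < q.+1)%N).
have := h2' _ (ltnW iq : (i < q.+1)%N); have := h2' _ (iq : (i.+1 < q.+1)%N).
have := ref_var_mono z lo; have := ref_var_mono z hi.
move: gi gi1; rewrite !in_itv/= => /andP[gi0 gi1] /andP[gj0 gj1].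
have /andP[v1 v2] := mean_qv_incr gi0 lo t1; have /andP[v3 v4] := mean_qv_incr t0 hi gj1.
have d1 : i.+1%:R / q%:R - i%:R / q%:R = q%:R^-1 :> R by rewrite -natr1 mulrDl mul1r addrAC subrr add0r.
have CL0 : 0 <= C' ^+ 2 * C by rewrite mulr_ge0// sqr_ge0.
have v2' : C' ^+ 2 * C * (t - i%:R / q%:R) <= C' ^+ 2 * C / q%:R by apply: ler_wpM2l => //; rewrite -[leRHS]d1; apply: lerB.
have v4' : C' ^+ 2 * C * (i.+1%:R / q%:R - t) <= C' ^+ 2 * C / q%:R by apply: ler_wpM2l => //; rewrite -[leRHS]d1; apply: lerB.
move: h1; rewrite !ler_norml => /andP[a1 a2] b1 b2 /andP[c1 c2] /andP[f1 f2].
by apply/andP; split; lra.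
Qed.

End estimation.

End sample.

(** * Reduction to bounded integrands and conclusion *)

Section observation.
Context {R : realType} {d : measure_display} {S : measurableType d}.
Variable Q : probability S R.
Implicit Types (F : R -> set (set S)) (H : R -> S -> R).

Lemma usual_filtrationW F : usual_filtration Q F -> filtration F.
Proof. by case=> s1 s2 s3 _ _; split. Qed.

Section join.
Variable F : R -> set (set S).
Hypothesis hF : filtration F.
Variable X : R -> S -> R.
Hypothesis mX : forall t, t \in `[0, 1] -> mfunT (X t).

Lemma join_filtrationP : filtration (join_filtration F X).
Proof.
have [sF Fm Fmono] := hF; split.
- move=> t _; apply: sigma_algebra_bigcap => s _; exact: smallest_sigma_algebra.
- move=> t; rewrite in_itv/= => /andP[t0 t1] A FA.
  have : join_raw F X 1 A by apply: FA; rewrite /= t1 lexx; split=> //; right.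
  apply: smallest_sub; first exact: sigma_algebra_measurable.
  move=> B [FB|[s]]; first by apply: (Fm 1) => //; exact: t01E.
  by move=> /= s01 [D mD <-]; rewrite setTI -[X in measurable X]setTI; exact: mX.
- move=> s t s0 st t1 A FA r [/andP[tr r1] tr1]; apply: FA; split; first by rewrite (le_trans st tr).
  by case: tr1 => [h|]; [left; exact: le_lt_trans h|right].
Qed.

Lemma join_filtration_sub t : t \in `[0, 1] -> F t `<=` join_filtration F X t.
Proof.
rewrite in_itv/= => /andP[t0 t1]; have [_ _ Fmono] := hF.
move=> A FA s [/andP[ts s1] _]; apply: sub_gen_smallest; left.
exact: Fmono FA.
Qed.

End join.

(** Bounded and defined by zero outside [0, 1], it is jointly measurable for all times, and it
    equals the process at every time of [0, 1] where the bound holds. *)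
Definition clamped (c : R) H : R -> S -> R := fun t y => clamp (- c) c (restr_proc 1 H (t, y)).

Lemma clampedE c H t y : t \in `[0, 1] -> clamped c H t y = clamp (- c) c (H t y).
Proof. by move=> t01; rewrite /clamped /restr_proc patchT// inE; split. Qed.

Lemma clamped_id c H t y : t \in `[0, 1] -> `|H t y| <= c -> clamped c H t y = H t y.
Proof. by move=> t01; rewrite ler_norml => /andP[h1 h2]; rewrite clampedE// clamp_id. Qed.

(** Clamping both a process and its estimate cannot increase their distance, so the rates are
    preserved. *)
Lemma clamp_contraction (c x y : R) : `|clamp (- c) c x - clamp (- c) c y| <= `|x - y|.
Proof.
have mono a b : a <= b -> clamp (- c) c a <= clamp (- c) c b.
  move=> ab; rewrite /clamp ge_max; apply/andP; split; rewrite le_max; apply/orP; [left; exact: lexx|right].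
  by rewrite le_min !ge_min; apply/andP; split; apply/orP; [left|right].
have H a b : a <= b -> `|clamp (- c) c a - clamp (- c) c b| <= `|a - b|.
  move=> ab; rewrite distrC ger0_norm ?subr_ge0 ?mono// distrC ger0_norm ?subr_ge0// lerBlDr {1}/clamp ge_max.
  have ca := clamp_ge (- c) c a; apply/andP; split; first by lra.
  have : Num.min c a <= clamp (- c) c a by rewrite le_max lexx orbT.
  have : Num.min c b <= b - a + Num.min c a; last by lra.
  by rewrite ge_min; have [h|h] := leP c a; apply/orP; [left|right]; lra.
by have [h|/ltW h] := leP x y; [exact: H|rewrite distrC [leRHS]distrC; exact: H].
Qed.

Lemma bpred_clamped F c H : filtration F -> 0 <= c -> predictable F H -> bpred F c (clamped c H).
Proof.
move=> hF c0 pH; split.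
- apply: (@predictable_ext _ _ _ _ (fun t y => clamp (- c) c (H t y))); first by move=> t y t01; rewrite clampedE.
  exact: (predictable_comp (measurable_clamp _ _)).
- suff mp : mfunT (restr_proc 1 H).
    by apply: (measurableT_comp (measurable_clamp _ _)); rewrite (_ : (fun x => _) = restr_proc 1 H)//; apply/funext => -[].
  exact: (measurable_predictable hF).
- by move=> t y; exact: clamp_norm.
Qed.

Lemma Rint_ae_eq (f g : S -> R) : mfunT f -> mfunT g ->
  {ae Q, forall y, f y = g y} -> \int[Q]_y f y = \int[Q]_y g y.
Proof.
move=> mf mg fg; congr fine; apply: ae_eq_integral => //; [exact/measurable_EFinP|exact/measurable_EFinP|].
by apply: filterS fg => y -> _.
Qed.

Variables (F : R -> set (set S)) (N : S -> cumulative R R) (X lam blam G : R -> S -> R) (C C' : R).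
Hypothesis hO : observable Q F N X.
Hypothesis hlam : intensity Q F N lam.
Hypothesis hblam : intensity Q (join_filtration F X) N blam.
Hypothesis hG : residual_process Q F X G.
Hypothesis C0 : 0 < C.
Hypothesis C'0 : 0 < C'.
Hypothesis blamC : {ae Q, forall y, forall t, t \in `[0, 1] -> blam t y <= C}.
Hypothesis GC : sup_bounded Q C' G.

Local Notation GF := (join_filtration F X).

Lemma observable_filtration : filtration F.
Proof. by have [h _ _ _ _] := hO; exact: usual_filtrationW. Qed.

Let hF := observable_filtration.

Lemma observable_join_filtration : filtration GF.
Proof. by have [_ _ _ _ mX] := hO; exact: join_filtrationP. Qed.

Let hGF := observable_join_filtration.

Lemma observable_sub t : t \in `[0, 1] -> F t `<=` GF t.
Proof. exact: join_filtration_sub. Qed.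

Lemma observable_counting y : counting_path (N y).
Proof. by have [_ h _ _ _] := hO. Qed.

Let hN := observable_counting.

Lemma observable_adapted : adapted GF (fun t y => N y t).
Proof. by have [_ _ aN _ _] := hO => t t01 B mB; apply: observable_sub => //; exact: aN. Qed.

Let aN := observable_adapted.

Lemma intensity_bound : L1 Q (fun y => N y 1) /\ L1 (leb01 \x Q)%E (restr_proc 1 blam).
Proof.
have [pb ib lmb] := hblam.
exact: (intensity_bounded_above hGF hN aN pb (ltW C0) lmb ib blamC).
Qed.

Lemma residual_predictable : predictable GF G.
Proof. by have [cG aG _] := hG; exact: predictable_caglad. Qed.

Lemma bpred_residual : bpred GF C' (clamped C' G).
Proof. by apply: bpred_clamped (ltW C'0) residual_predictable. Qed.

Lemma bpred_intensity : bpred F C (clamped C lam).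
Proof. by have [pl _ _] := hlam; exact: bpred_clamped (ltW C0) pl. Qed.

Let left_sigma_algebra t : t \in `[0, 1] -> sigma_algebra setT (left_sigma F t) /\ left_sigma F t `<=` measurable.
Proof.
move=> t01; have [sF Fm Fmono] := hF; move: t01; rewrite in_itv/= => /andP[t0 t1].
rewrite /left_sigma; case: eqP => [_|_]; first by split; [apply: sF|apply: Fm]; exact: t01E.
split; first exact: smallest_sigma_algebra.
apply: smallest_sub; first exact: sigma_algebra_measurable.
move=> B [s]; rewrite /= in_itv/= => /andP[s0 st]; apply: Fm; apply: t01E => //.
exact: le_trans (ltW st) t1.
Qed.

Let mG t : mfunT (fun y => restr_proc 1 G (t, y)).
Proof. exact: (measurable_fun_pair2 t (measurable_predictable hGF residual_predictable)). Qed.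

Lemma residual_orthogonal t Z (c : R) : t \in `[0, 1] -> measurable_wrt (left_sigma F t) Z ->
  (forall y, `|Z y| <= c) -> \int[Q]_y (Z y * clamped C' G t y) = 0.
Proof.
move=> t01 mZ Zc; have [cG aG cond] := hG; have [sL Lm] := left_sigma_algebra t01.
have GE y : restr_proc 1 G (t, y) = G t y by rewrite /restr_proc patchT// inE.
have mGt : mfunT (G t) by rewrite (_ : G t = fun y => restr_proc 1 G (t, y))//; apply/funext => y; rewrite GE.
have [iG _ _ _] := cond t t01.
have mZ' := measurable_wrt_sub Lm mZ.
transitivity (\int[Q]_y (Z y * G t y)).
  apply: Rint_ae_eq; [apply: measurable_funM => //|exact: measurable_funM|].
    by apply: (measurableT_comp (measurable_clamp _ _)); exact: mG.
  by apply: filterS GC => y h; rewrite clamped_id// h.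
apply: (pull_out_bounded sL Lm iG _ mZ Zc) => B LB.
have := condexp_increment Lm (cond t t01) LB; apply: etrans.
by apply: eq_Rintegral => y _; rewrite /= subr0.
Qed.

Lemma variance_functionE t : t \in `[0, 1] ->
  variance_function Q N G t = mean_qv Q N (clamped C' G) t.
Proof.
move=> t01; have mR := measurable_predictable hGF residual_predictable.
have mGy y : mfunT (fun s => restr_proc 1 G (s, y)) := measurable_fun_pair1 y mR.
have E y : int_dN (N y) (fun s => G s y ^+ 2) t = jsum (N y) (fun s => restr_proc 1 G (s, y) ^+ 2) t.
  rewrite int_dN_jsum//; last first.
    apply: (@eq_measurable_fun _ _ _ _ _ (fun s => restr_proc 1 G (s, y) ^+ 2)).
      move=> s; rewrite inE/= in_itv/= => /andP[s0 s1]; rewrite /restr_proc patchT// inE/=; split=> //.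
      by rewrite /= in_itv/= ltW.
    by apply: measurable_funTS; exact: measurable_funX.
  apply: jsum_ext => // s; rewrite in_itv/= => /andP[s0 s1]; rewrite /restr_proc patchT// inE/=; split=> //.
  by rewrite /= in_itv/= ltW.
have mj (H : R -> S -> R) : mfunT (fun z : R * S => H z.1 z.2) -> mfunT (fun y => jsum (N y) (H ^~ y) t).
  move=> mH; apply: (@measurable_jsum _ _ _ N hN t t01 _ (fun z => H z.1 z.2)) => // u u0t; have [_ GFm _] := hGF.
  have u01 : u \in `[0, 1] by move: u0t t01; rewrite !in_itv/= => /andP[-> h] /andP[_ h']; rewrite (le_trans h h').
  exact: (measurable_wrt_sub (GFm u u01) (aN u01)).
rewrite /variance_function -/(Rintegral _ _ _); under eq_Rintegral do rewrite E.
apply: Rint_ae_eq.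
- apply: (mj (fun s y => restr_proc 1 G (s, y) ^+ 2)); apply: measurable_funX.
  by rewrite (_ : (fun z => _) = restr_proc 1 G)//; apply/funext => -[].
- apply: (mj (fun s y => clamped C' G s y ^+ 2)); apply: measurable_funX.
  by have [_ h _] := bpred_residual.
apply: filterS GC => y h; apply: jsum_ext => // s; rewrite in_itv/= => /andP[s0 s1].
have s01 : s \in `[0, 1] by apply: t01E => //; exact: ltW.
by rewrite clamped_id ?h//; congr (_ ^+ 2); rewrite /restr_proc patchT// inE.
Qed.

Hypothesis hH0 : H0 Q F N X lam.
Hypothesis ilam : L1 (leb01 \x Q)%E (restr_proc 1 lam).

(** H_0 enters here: it makes [lam] an intensity for the enlarged filtration, equal almost
    everywhere to the bounded one, so the compensation formula holds for that filtration with an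
    intensity predictable for the smaller one. *)
Lemma compensation_clamped c H : bpred GF c H ->
  \int[Q]_y jsum (N y) (H ^~ y) 1 = \int[(leb01 \x Q)%E]_z (H z.1 z.2 * clamped C lam z.1 z.2).
Proof.
move=> bH; have [pl _ _] := hlam; have [pb _ lmb] := hblam; have [iN ib] := intensity_bound.
have pl' : predictable GF lam by apply: (predictable_sub observable_sub).
have [_ _ h] := intensity_unique hGF hN aN (ltW C0) pl' pb iN ilam ib hH0 lmb blamC.
exact: h bH.
Qed.

End observation.

(** * Uniform convergence in law from finite-dimensional estimates *)

Section cell_distance.
Context {R : realType} {N r : nat}.
Variables (B e : R).
Hypothesis B0 : 0 < B.

Lemma near_cell_dist (k : @cell_index N r) (x x' : 'I_N -> R) i : `|x i| <= B -> `|x' i| <= B ->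
  near_cell B e k x -> near_cell B e k x' -> `|x i - x' i| <= 8 * B * e.
Proof.
move=> xB x'B /forallP/(_ i) h /forallP/(_ i) h'.
apply: (le_trans (squash_dist B0 xB x'B)).
rewrite (_ : 8 * B * e = 4 * B * (e + e)); last by ring.
apply: ler_wpM2l; first by rewrite mulr_ge0// ltW.
by rewrite (le_trans (ler_distD ((k i)%:R / r%:R) _ _))// lerD// distrC.
Qed.

End cell_distance.

Section uniform_weak_convergence.
Context {R : realType}.
Variables (Theta : Type) (Theta0 : set Theta).
Variables (d d' : Theta -> measure_display).
Variable Om : forall th, measurableType (d th).
Variable Om' : forall th, measurableType (d' th).
Variable P : forall th, probability (Om th) R.
Variable P' : forall th, probability (Om' th) R.
Variable S : forall th, nat -> R -> Om th -> R.
Variable U : forall th, R -> Om' th -> R.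
Hypothesis mS : forall n th t, Theta0 th -> t \in `[0, 1] -> mfunT (@S th n t).
Hypothesis mU : forall th t, Theta0 th -> t \in `[0, 1] -> mfunT (@U th t).
(** Cosines with a phase are the terms of trigonometric polynomials, so this covers the mean weights
    of all cells. *)
Hypothesis fidi : forall (N : nat) (a t : 'I_N -> R) (c e : R), (forall i, t i \in `[0, 1]) -> 0 < e ->
  \forall n \near \oo, forall th, Theta0 th ->
    `|\int[P th]_w cos (\sum_(i < N) a i * S n (t i) w + c) -
      \int[P' th]_w cos (\sum_(i < N) a i * @U th (t i) w + c)| <= e.

Lemma measurable_trig_poly {dX} {X : measurableType dX} (N : nat) (g : ('I_N -> R) -> R) (x : 'I_N -> X -> R) :
  trig_poly g -> (forall i, mfunT (x i)) -> mfunT (fun w => g (x ^~ w)) /\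
  exists c, forall w, `|g (x ^~ w)| <= c.
Proof.
move=> tg mx; elim: tg => [|b a c g' _ [mg [k gk]]].
  by split; [exact: measurable_cst|exists 0 => w; rewrite normr0].
split.
  apply: measurable_funD => //; apply: measurable_funM => //.
  apply: (measurableT_comp (continuous_measurable_fun (@continuous_cos R))); apply: measurable_funD => //.
  by apply: measurable_sum => i; apply: measurable_funM.
exists (`|b| + k) => w; rewrite (le_trans (ler_normD _ _))// lerD//.
by rewrite normrM ler_piMr// ler_norml cos_geN1 cos_le1.
Qed.

Lemma Rint_trig_term {dX} {X : measurableType dX} (N : nat) (g : ('I_N -> R) -> R) (x : 'I_N -> X -> R)
    (b : R) (a : 'I_N -> R) (c : R) (p : probability X R) :
  trig_poly g -> (forall i, mfunT (x i)) ->
  \int[p]_w (b * cos (\sum_(i < N) a i * x i w + c) + g (x ^~ w)) =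
  b * \int[p]_w cos (\sum_(i < N) a i * x i w + c) + \int[p]_w g (x ^~ w).
Proof.
move=> tg mx; have [mg [k gk]] := measurable_trig_poly tg mx.
have ic : L1 p (fun w => cos (\sum_(i < N) a i * x i w + c)).
  apply: (@L1_bounded _ _ _ _ _ 1); last by move=> w; rewrite ler_norml cos_geN1 cos_le1.
  apply: (measurableT_comp (continuous_measurable_fun (@continuous_cos R))); apply: measurable_funD => //.
  by apply: measurable_sum => i; apply: measurable_funM.
by rewrite RintD ?RintZ//; [exact: L1Z|exact: L1_bounded gk].
Qed.

Lemma fidi_trig_poly (N : nat) (g : ('I_N -> R) -> R) (t : 'I_N -> R) (e : R) :
  trig_poly g -> (forall i, t i \in `[0, 1]) -> 0 < e ->
  \forall n \near \oo, forall th, Theta0 th ->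
    `|\int[P th]_w g (fun i => S n (t i) w) - \int[P' th]_w g (fun i => @U th (t i) w)| <= e.
Proof.
move=> + t01; move=> tg; elim: tg e => [|b a c g' tg' ih] e e0.
  by near=> n => th _; rewrite !Rint_cst subrr normr0 ltW.
have eb : 0 < e / 2 / (`|b| + 1) by rewrite !divr_gt0// ltr_wpDl.
have e2 : 0 < e / 2 by rewrite divr_gt0.
near=> n => th hth.
rewrite (Rint_trig_term (x := fun i => S n (t i)) b a c (P th) tg'); last by move=> i; exact: mS.
rewrite (Rint_trig_term (x := fun i => @U th (t i)) b a c (P' th) tg'); last by move=> i; exact: mU.
rewrite opprD addrACA -mulrBr (le_trans (ler_normD _ _))// (splitr e) lerD//; last first.
  by move: th hth; near: n; exact: ih.
rewrite normrM; apply: (@le_trans _ _ ((`|b| + 1) * (e / 2 / (`|b| + 1)))); last by rewrite mulrCA divff ?mulr1// gt_eqF// ltr_wpDl.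
apply: ler_pM => //; first by rewrite lerDl.
by move: th hth; near: n; exact: fidi.
Unshelve. all: by end_near. Qed.

Variable V : Theta -> R -> R.
Variable L : R.
Hypothesis L0 : 0 < L.
Hypothesis VL : forall th, Theta0 th -> forall s t, s \in `[0, 1] -> t \in `[0, 1] -> `|V th s - V th t| <= L * `|s - t|.
Hypothesis V0 : forall th, Theta0 th -> V th 0 = 0.
Variable T : {uniform (@unitI R) -> R} -> {uniform (@unitI R) -> R} -> R.
Hypothesis hT : forall p, (@C01 R `*` closure [set res01 (V th) | th in Theta0]) p ->
  jointly_continuous_at T p.
Variables x v : forall th, nat -> Om th -> R -> R.
(** [n] becomes large after [q] is fixed: prelimit paths jump, and no mesh makes their modulus small
    for every [n]. *)
Hypothesis modS : forall e tau : R, 0 < e -> 0 < tau -> exists q0, forall q, (q0 <= q)%N ->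
  \forall n \near \oo, forall th, Theta0 th -> exists A : set (Om th), [/\ measurable A, fine (P th A) <= tau &
    forall w, ~ A w -> forall i, (i < q)%N -> forall t, t \in `[i%:R / q%:R, i.+1%:R / q%:R] ->
      `|S n t w - S n (i%:R / q%:R) w| <= e].
Hypothesis supS : forall tau : R, 0 < tau -> exists2 B, 0 < B &
  \forall n \near \oo, forall th, Theta0 th -> exists A : set (Om th), [/\ measurable A, fine (P th A) <= tau &
    forall w, ~ A w -> forall t, t \in `[0, 1] -> `|S n t w| <= B].
Hypothesis approx : forall e tau : R, 0 < e -> 0 < tau ->
  \forall n \near \oo, forall th, Theta0 th -> exists A : set (Om th), [/\ measurable A, fine (P th A) <= tau &
    forall w, ~ A w -> [/\ cadlag (x n w), cadlag (v n w) & forall t, t \in `[0, 1] ->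
      `|x n w t - S n t w| <= e /\ `|v n w t - V th t| <= e]].
Hypothesis tightU : forall tau : R, 0 < tau -> exists B q, [/\ 0 < B, forall j, 0 < q j &
  forall th, Theta0 th -> exists A : set (Om' th), [/\ measurable A, fine (P' th A) <= tau &
    forall w, ~ A w -> modulus_class B q (@U th ^~ w)]].
Hypothesis mD : forall n th, Theta0 th -> mfunT (fun w : Om th => T (res01 (x n w)) (res01 (v n w))).
Hypothesis mD' : forall th, Theta0 th -> mfunT (fun w : Om' th => T (res01 (@U th ^~ w)) (res01 (V th))).

Let BL_bounded {dX} {X : measurableType dX} (p : probability X R) (f : R -> R) (D : X -> R) : @BL1 R f -> mfunT D ->
  L1 p (f \o D) /\ 'E_p[f \o D]%E = (\int[p]_w f (D w))%:E.
Proof.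
move=> [f1 fL] mD0; have cf : continuous f.
  move=> z; apply/cvgrPdist_le => e e0; near=> y.
  have := fL (z, y) (conj Logic.I Logic.I); rewrite /= mul1r => /le_trans; apply.
  by near: y; exists e => //= y; rewrite /ball_/=; exact: ltW.
have iD : L1 p (f \o D).
  apply: (@L1_bounded _ _ _ _ _ 1); last by move=> w; exact: f1.
  exact: (measurableT_comp (continuous_measurable_fun cf) mD0).
by split=> //; rewrite unlock -EFin_Rint.
Unshelve. all: by end_near. Qed.

(** [comparison] is used with 3 e for the exceptional probabilities and the tolerance, [e] for the
    far cells and e / ([#|K|] + 1) for the cell probabilities: 28 is 7 times 3, plus 5, plus 2. The
    radius [r] is spent in quarters: approximation of the path, its oscillation in a block, the size
    of a cell, the oscillation of the representative. *)
Lemma uniform_weak_convergence_le (e : R) : 0 < e ->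
  \forall n \near \oo, forall th, Theta0 th -> forall f : R -> R, @BL1 R f ->
   `|\int[P th]_w f (T (res01 (x n w)) (res01 (v n w))) -
     \int[P' th]_w f (T (res01 (@U th ^~ w)) (res01 (V th)))| <= 28 * e.
Proof.
move=> e0.
have [BU [qs [BU0 qs0 hU]]] := tightU e0.
have [r r0 hr] := uniform_nearness L0 VL V0 hT BU qs0 e0.
have [BS BS0 hS] := supS e0.
pose B := BS + BU; have B0 : 0 < B by rewrite addr_gt0.
have r4 : 0 < r / 4 by rewrite divr_gt0.
have [q1 hq1] := modS r4 e0.
pose j := Num.truncn (4 / r).
have jr : j.+1%:R^-1 <= r / 4.
  by rewrite -[leRHS]invrK lef_pV2 ?posrE ?invr_gt0 ?ltr0n// invf_div ltW// truncnS_gt.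
(* Fine enough both for the prelimit paths and for the modulus of the compact class at precision r /
   4. *)
pose q := (q1 + (Num.truncn (qs j)^-1).+1)%N.
have q0 : (0 < q)%N by rewrite /q addnS.
have q0' : (0 : R) < q%:R by rewrite ltr0n.
have qj : q%:R^-1 <= qs j.
  rewrite -[leRHS]invrK lef_pV2 ?posrE ?invr_gt0// ltW// (lt_le_trans (truncnS_gt _))//.
  by rewrite ler_nat leq_addl.
(* Two paths near a common cell then differ by at most 8 B eta = r / 4 at the grid points. *)
pose eta := r / (32 * B); have eta0 : 0 < eta by rewrite divr_gt0// mulr_gt0.
(* Bernstein degree for which cells that are not near carry a total weight of at most [e]. *)
pose b := (Num.truncn (q%:R / (4 * eta ^+ 2) / e)).+1.
have b0 : (0 < b)%N by [].
have be : q%:R * (4 * b%:R * eta ^+ 2)^-1 <= e.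
  have h := ltW (truncnS_gt (q%:R / (4 * eta ^+ 2) / e)).
  have e40 : 0 < 4 * eta ^+ 2 by rewrite mulr_gt0// exprn_gt0.
  move: h; rewrite -/b ler_pdivrMr// ler_pdivrMr// => h.
  rewrite ler_pdivrMr; last by rewrite mulrAC mulr_gt0// ltr0n.
  by rewrite (le_trans h)//; apply: le_of_eq; ring.
pose K : finType := @cell_index q b.
pose ti (i : 'I_q) : R := i%:R / q%:R.
have ti01 i : ti i \in `[0, 1].
  by rewrite in_itv/= divr_ge0 ?(ltW q0')//= ler_pdivrMr// mul1r ler_nat ltnW.
have K0 : 0 < #|K|%:R + 1 :> R by rewrite ltr_wpDl.
have tau0 : 0 < e / (#|K|%:R + 1) by rewrite divr_gt0.
(* A cell is good when it is near some path of the compact class; one such path represents it, and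
   the functional is evaluated there. Representatives depend neither on the parameter nor on [n]. *)
pose pgood (k : K) (f : R -> R) := modulus_class BU qs f /\ near_cell B eta k (fun i => f (ti i)).
pose p (k : K) : R -> R := if pselect (exists f, pgood k f) is left h then sval (cid h) else fun=> 0.
have hp k : (exists f, pgood k f) -> pgood k (p k).
  by rewrite /p; case: pselect => // h _; exact: svalP (cid h).
pose good (k : K) : bool := `[< exists f, pgood k f >].
have weights : \forall n \near \oo, forall k : K, forall th, Theta0 th ->
    `|\int[P th]_w cell_weight B k (fun i => S n (ti i) w) - \int[P' th]_w cell_weight B k (fun i => @U th (ti i) w)| <= e / (#|K|%:R + 1).
  apply: filter_forall => k; apply: fidi_trig_poly => //; exact: trig_poly_cell_weight.
near=> n => th hth f hf.
have [A1 [mA1 PA1 H1]] : exists A : set (Om th), [/\ measurable A, fine (P th A) <= e &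
    forall w, ~ A w -> forall t, t \in `[0, 1] -> `|S n t w| <= BS].
  by move: th hth; near: n; exact: hS.
have [A2 [mA2 PA2 H2]] : exists A : set (Om th), [/\ measurable A, fine (P th A) <= e &
    forall w, ~ A w -> forall i, (i < q)%N -> forall t, t \in `[i%:R / q%:R, i.+1%:R / q%:R] ->
      `|S n t w - S n (i%:R / q%:R) w| <= r / 4].
  by move: th hth {hf A1 mA1 PA1 H1}; near: n; apply: hq1; rewrite leq_addr.
have [A3 [mA3 PA3 H3]] : exists A : set (Om th), [/\ measurable A, fine (P th A) <= e &
    forall w, ~ A w -> [/\ cadlag (x n w), cadlag (v n w) & forall t, t \in `[0, 1] ->
      `|x n w t - S n t w| <= r / 4 /\ `|v n w t - V th t| <= r / 4]].
  by move: th hth {hf A1 mA1 PA1 H1 A2 mA2 PA2 H2}; near: n; exact: approx.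
have [A' [mA' PA' HA']] := hU th hth.
have mA12 := measurableU _ _ mA1 mA2.
(* Through the grid point to the left of [t]: oscillation of [h], distance inside the cell,
   oscillation of the representative. *)
have close (k : K) (g h : R -> R) : pgood k g -> near_cell B eta k (fun i => h (ti i)) ->
    (forall i, `|h (ti i)| <= B) ->
    (forall i, (i < q)%N -> forall t, t \in `[i%:R / q%:R, i.+1%:R / q%:R] -> `|h t - h (i%:R / q%:R)| <= r / 4) ->
    forall t, t \in `[0, 1] -> `|h t - g t| <= 3 * (r / 4).
  move=> [[cg gB gm] gn] hn hB hh t t01.
  have [i [iq lo hi]] : exists i, [/\ (i < q)%N, i%:R / q%:R <= t & t <= i.+1%:R / q%:R].
    by move: t01; rewrite in_itv/= => /andP[t0 t1]; exact: unit_grid_cell.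
  have h1 : `|h t - h (i%:R / q%:R)| <= r / 4 by apply: hh => //; rewrite in_itv/= lo.
  have h2 : `|h (i%:R / q%:R) - g (i%:R / q%:R)| <= r / 4.
    have gB' i0 : `|g (ti i0)| <= B by rewrite (le_trans (gB _ (ti01 i0)))// /B lerDr ltW.
    have := near_cell_dist B0 (hB (Ordinal iq)) (gB' (Ordinal iq)) hn gn.
    by rewrite (_ : 8 * B * eta = r / 4)// /eta; field; rewrite gt_eqF.
  have h3 : `|g (i%:R / q%:R) - g t| <= r / 4.
    apply: le_trans jr; apply: gm => //; first exact: (ti01 (Ordinal iq)).
    apply: le_trans qj; rewrite distrC ger0_norm ?subr_ge0// lerBlDl.
    by rewrite (le_trans hi)// -natr1 mulrDl mul1r.
  rewrite (_ : h t - g t = (h t - h (i%:R / q%:R)) + (h (i%:R / q%:R) - g (i%:R / q%:R)) + (g (i%:R / q%:R) - g t)); last by ring.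
  rewrite (_ : 3 * (r / 4) = r / 4 + r / 4 + r / 4); last by ring.
  by rewrite (le_trans (ler_normD _ _))// lerD// (le_trans (ler_normD _ _))// lerD.
have e3 : 0 <= 3 * e by rewrite mulr_ge0// ltW.
have f_lip a b' : `|a - b'| <= e -> `|f a - f b'| <= 3 * e.
  move=> ab; have [_ fL] := hf; have := fL (a, b') (conj Logic.I Logic.I); rewrite /= mul1r => /le_trans; apply.
  by apply: (le_trans ab); have := e0; lra.
have r_le : 3 * (r / 4) <= r by have := r0; lra.
pose a k := if good k then f (T (res01 (p k)) (res01 (V th))) else 0.
have cdV : cadlag (V th) := lipschitz_cadlag L0 (VL hth).
have [f1 fL] := hf.
have mg k := measurable_trig_poly (x := fun i => @S th n (ti i)) (@trig_poly_cell_weight _ q b B k) (fun i => mS n hth (ti01 i)).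
have mg' k := measurable_trig_poly (x := fun i => @U th (ti i)) (@trig_poly_cell_weight _ q b B k) (fun i => mU hth (ti01 i)).
have [iD _] := BL_bounded (P th) hf (mD n hth).
have [iD' _] := BL_bounded (P' th) hf (mD' hth).
have := @comparison _ _ _ _ _ (P th) (P' th) K _ _
  (fun k w => cell_weight B k (fun i => S n (ti i) w)) (fun k w => cell_weight B k (fun i => @U th (ti i) w))
  (fun k w => near_cell B eta k (fun i => S n (ti i) w)) (fun k w => near_cell B eta k (fun i => @U th (ti i) w))
  good a ((A1 `|` A2) `|` A3) A' (3 * e) e (e / (#|K|%:R + 1)) (L1_measurable iD) (L1_measurable iD').
move=> h; apply: (le_trans (h _ _ _ _ _ _ _ _ _ _ _ _ _ _ _ _ _ _ _ _ _)) => {h} //.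
- by move=> w; exact: f1.
- by move=> w; exact: f1.
- by move=> k; exact: (mg k).1.
- by move=> k; exact: (mg' k).1.
- by move=> k w; exact: cell_weight_ge0.
- by move=> k w; exact: cell_weight_ge0.
- by move=> w; exact: cell_weight_sum.
- by move=> w; exact: cell_weight_sum.
- exact: measurableU.
- rewrite (_ : 3 * e = e + e + e); last by ring.
  by apply: (le_trans (prob_setU _ mA12 mA3)); apply: lerD PA3; apply: (le_trans (prob_setU _ mA1 mA2)); exact: lerD.
- by apply: (le_trans PA'); have := e0; lra.
- by move=> k; rewrite /a; case: ifP => _; rewrite ?normr0//; exact: f1.
- by move=> k /negbTE; rewrite /a => ->.
- exact: ltW.
- move=> w k nA gk nk; rewrite /a gk; apply: f_lip.
  have pk := hp k (asboolW gk); have [mk _] := pk.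
  have [cx cv xv] := H3 w (fun h => nA (or_intror h)).
  apply: hr => // t t01; last by rewrite (le_trans (xv t t01).2)//; have := r0; lra.
  have hc : `|S n t w - p k t| <= 3 * (r / 4).
    apply: (close k _ (fun t => S n t w) pk nk) => //; last exact: (H2 w (fun h => nA (or_introl (or_intror h)))).
    by move=> i; rewrite (le_trans (H1 w (fun h => nA (or_introl (or_introl h))) _ (ti01 i)))// /B lerDl ltW.
  rewrite (le_trans (ler_distD (S n t w) _ _))// (_ : r = r / 4 + 3 * (r / 4)); last by field.
  by rewrite lerD//; exact: (xv t t01).1.
- move=> w k nA' nk; have mk := HA' w nA'.
  have gk : good k by apply/asboolP; exists (@U th ^~ w).
  split=> //; rewrite /a gk; apply: f_lip.
  have pk := hp k (asboolW gk); have [mk' _] := pk; have [cU UB Um] := mk.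
  apply: hr => //; first exact: within_continuous_cadlag.
    move=> t t01; apply: le_trans r_le; apply: (close k _ (fun t => @U th t w) pk nk) => //.
      by move=> i; rewrite (le_trans (UB _ (ti01 i)))// /B lerDr ltW.
    move=> i iq t' t'i; apply: le_trans jr; apply: Um.
    + move: t'i; rewrite !in_itv/= => /andP[lo hi]; apply/andP; split; first by apply: le_trans lo; rewrite divr_ge0.
      by rewrite (le_trans hi)// ler_pdivrMr// mul1r ler_nat.
    + exact: (ti01 (Ordinal iq)).
    + move: t'i; rewrite !in_itv/= => /andP[lo hi]; apply: le_trans qj; rewrite ger0_norm ?subr_ge0// lerBlDl.
      by rewrite (le_trans hi)// -natr1 mulrDl mul1r.
  by move=> t t01; rewrite subrr normr0 ltW.
- by move=> w; apply: le_trans be; exact: cell_weight_far.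
- by move=> w; apply: le_trans be; exact: cell_weight_far.
- by move=> k; move: k th hth {hf A1 mA1 PA1 H1 A2 mA2 PA2 H2 A3 mA3 PA3 H3 A' mA' PA' HA' mA12 close a cdV mg mg' iD iD'}; near: n.
have : 2 * #|K|%:R * (e / (#|K|%:R + 1)) <= 2 * e.
  rewrite -mulrA ler_pM2l// mulrA ler_pdivrMr// mulrC.
  by apply: ler_wpM2l; [exact: ltW|rewrite lerDl].
by lra.
Unshelve. all: by end_near. Qed.

Lemma uniform_weak_convergence :
  sup_nneg Theta0 (fun th => bl_dist (P th) (fun w => T (res01 (x n w)) (res01 (v n w))) (P' th)
     (fun w => T (res01 (@U th ^~ w)) (res01 (V th)))) @[n --> \oo] --> 0%E.
Proof.
have sup_le (n : nat) (e : R) : 0 < e -> (forall th, Theta0 th -> forall f : R -> R, @BL1 R f ->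
   `|\int[P th]_w f (T (res01 (x n w)) (res01 (v n w))) -
     \int[P' th]_w f (T (res01 (@U th ^~ w)) (res01 (V th)))| <= e) ->
  (0 <= sup_nneg Theta0 (fun th => bl_dist (P th) (fun w => T (res01 (x n w)) (res01 (v n w))) (P' th)
     (fun w => T (res01 (@U th ^~ w)) (res01 (V th)))) <= e%:E)%E.
  move=> e0 H; apply/andP; split; first by apply: ereal_sup_ubound; left.
  apply: ge_ereal_sup => _ [->|[th hth <-]]; first by rewrite lee_fin ltW.
  apply: ge_ereal_sup => _ [f hf <-].
  have [_ ->] := BL_bounded (P th) hf (mD n hth); have [_ ->] := BL_bounded (P' th) hf (mD' hth).
  by rewrite lee_fin; exact: H.
apply/fine_cvgP; split.
  have := uniform_weak_convergence_le ltr01; apply: filterS => n h.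
  have /andP[h1 h2] := sup_le n 28 (ltr0n _ _) (fun th hth f hf => ltac:(by have := h th hth f hf; rewrite mulr1)).
  by rewrite ge0_fin_numE// (le_lt_trans h2)// ltry.
apply/cvgrPdist_le => e e0; have e28 : 0 < e / 28 by rewrite divr_gt0.
have := uniform_weak_convergence_le e28; apply: filterS => n h.
have /andP[h1 h2] := sup_le n e e0 (fun th hth f hf => ltac:(by have := h th hth f hf; rewrite mulrC divfK)).
rewrite sub0r normrN ger0_norm ?fine_ge0// -lee_fin fineK// ge0_fin_numE// (le_lt_trans h2)// ltry//.
Qed.

End uniform_weak_convergence.

(** * From the data to sample tuples, and replacement of the estimators *)

Section cadlag_algebra.
Context {R : realType}.
Implicit Types f g : R -> R.

Lemma cadlagD f g : cadlag f -> cadlag g -> cadlag (fun t => f t + g t).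
Proof.
move=> [f1 f2] [g1 g2]; split=> t t01; first by apply: cvgD; [exact: f1|exact: g1].
by apply: is_cvgD; [exact: f2|exact: g2].
Qed.

Lemma cadlagZ (k : R) f : cadlag f -> cadlag (fun t => k * f t).
Proof.
move=> [f1 f2]; split=> t t01; first by apply: cvgM; [exact: cvg_cst|exact: f1].
by apply: is_cvgM; [exact: is_cvg_cst|exact: f2].
Qed.

Lemma cadlag_sum (I : Type) (s : seq I) (P : pred I) (f : I -> R -> R) :
  (forall i, cadlag (f i)) -> cadlag (fun t => \sum_(i <- s | P i) f i t).
Proof.
move=> cf; elim: s => [|i s ih].
  under eq_fun do rewrite big_nil.
  by split=> t _; [exact: cvg_cst|exact: is_cvg_cst].
under eq_fun do rewrite big_cons.
by case: (P i) => //; exact: cadlagD.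
Qed.

Lemma cadlag_ext f g : (forall t, t \in `[0, 1] -> f t = g t) -> cadlag f -> cadlag g.
Proof.
move=> fg [f1 f2]; split=> t; rewrite in_itv/= => /andP[t0 t1].
  rewrite -fg ?in_itv/= ?t0 ?ltW//; apply: cvg_trans (f1 t _); last by rewrite in_itv/= t0.
  apply: near_eq_cvg; near=> s; rewrite fg// in_itv/=; apply/andP; split; last by near: s; exact: nbhs_right_le.
  by apply: le_trans t0 _; near: s; exact: nbhs_right_ge.
have /cvg_ex[l fl] : cvg (f s @[s --> t^'-]) by apply: f2; rewrite in_itv/= t0.
apply: (cvgP l); apply: cvg_trans fl; apply: near_eq_cvg.
near=> s; rewrite fg// in_itv/=; apply/andP; split; first by near: s; exact: nbhs_left_ge.
apply: le_trans _ t1; near: s; exact: nbhs_left_le.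
Unshelve. all: by end_near. Qed.

Lemma cadlag_int_ds (f : R -> R) (k : R) : mfunT f -> (forall s, `|f s| <= k) -> cadlag (int_ds f).
Proof.
move=> mf fk; have k0 : 0 <= k := le_trans (normr_ge0 _) (fk 0).
apply: (@lipschitz_cadlag _ (k + 1)); first by rewrite ltr_wpDl.
have H s t : s \in `[0, 1] -> t \in `[0, 1] -> s <= t -> `|int_ds f s - int_ds f t| <= (k + 1) * `|s - t|.
  rewrite !in_itv/= => /andP[s0 s1] /andP[t0 t1] st; rewrite distrC [`|s - t|]distrC [`|t - s|]ger0_norm ?subr_ge0//.
  by rewrite (le_trans (int_dsB_le mf fk s0 st t1))// ler_wpM2r ?subr_ge0// lerDl.
move=> s t s01 t01; have [st|/ltW st] := leP s t; first exact: H.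
by rewrite distrC [`|s - t|]distrC; exact: H.
Qed.

End cadlag_algebra.

Section data.
Context {R : realType} {d d' : measure_display}.
Context {S : measurableType d} {Om : measurableType d'}.
Variables (Q : probability S R) (P : probability Om R).
Variables (Y : nat -> Om -> S) (Ynew : Om -> S).
Hypothesis hiid : iid Q P (oapp Y Ynew).
Variables (n : nat) (J : {set 'I_n}).

Local Notation X := (#|~: J|.-tuple S).

(** The additional copy becomes the last coordinate of an (n + 1)-tuple, so a single resamplable law
    describes the data and the copy. *)
Definition sample_index (i : 'I_n.+1) : option nat := if (i < n)%N then Some (i : nat) else None.

Definition sample (w : Om) : n.+1.-tuple S := [tuple oapp Y Ynew (sample_index i) w | i < n.+1].

Let mY (o : option nat) : mfunT (oapp Y Ynew o). Proof. by have [h _ _] := hiid. Qed.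

Lemma measurable_sample : mfunT sample.
Proof.
apply/measurable_fun_tnthP => i.
by rewrite (_ : _ \o _ = oapp Y Ynew (sample_index i))//; apply/funext => w; rewrite /= tnth_mktuple.
Qed.

Definition sample_rv : {mfun Om >-> n.+1.-tuple S} := mfun_Sub (mem_set measurable_sample).

Definition sample_law : probability (n.+1.-tuple S) R := distribution P sample_rv.

Definition old (j : 'I_n) : 'I_n.+1 := widen_ord (leqnSn n) j.

Lemma sample_old w j : tnth (sample w) (old j) = Y j w.
Proof. by rewrite tnth_mktuple /sample_index/= ltn_ord. Qed.

Lemma sample_max w : tnth (sample w) ord_max = Ynew w.
Proof. by rewrite tnth_mktuple /sample_index/= ltnn. Qed.

Lemma sample_index_inj : injective sample_index.
Proof.
move=> i j; rewrite /sample_index; case: (ltnP i n) => hi; case: (ltnP j n) => hj //; first by case=> /val_inj.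
move=> _; apply/val_inj/eqP; rewrite eqn_leq; apply/andP; split.
  exact: leq_trans (ltn_ord i : (i <= n)%N) hj.
exact: leq_trans (ltn_ord j : (j <= n)%N) hi.
Qed.

Lemma sample_law_resamplable : resamplable sample_law Q.
Proof.
apply: resamplableP => A mA; have [_ hQ hP] := hiid.
(* Independence is stated for sets indexed by all of [option nat]; indices outside the sample get an
   arbitrary set of the family. *)
pose A' (o : option nat) := A (odflt ord_max [pick i | sample_index i == o]).
have A'E i : A' (sample_index i) = A i.
  rewrite /A'; case: pickP => [k /eqP/sample_index_inj ->//|/(_ i)]; by rewrite eqxx.
have mA' o : measurable (A' o) by exact: mA.
pose r := [seq sample_index i | i <- enum 'I_n.+1].
have ur : uniq r by rewrite map_inj_uniq ?enum_uniq//; exact: sample_index_inj.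
have := hP r A' ur mA'.
rewrite big_map big_enum /= => h; transitivity (\prod_(i < n.+1) P (oapp Y Ynew (sample_index i) @^-1` A' (sample_index i)))%E.
  rewrite -h /sample_law /= /distribution /pushforward; congr (P _); apply/seteqP; split=> w /=.
    move=> hw _ /= /mapP[i _ ->]; rewrite /= A'E; have := hw i; by rewrite tnth_mktuple.
  move=> hw i; rewrite tnth_mktuple; have := hw (sample_index i); rewrite A'E; apply.
  by rewrite /= map_f// mem_enum.
by apply: eq_bigr => i _; rewrite hQ ?A'E.
Qed.

Definition trained (z : n.+1.-tuple S) : X := [tuple tnth z (old (enum_val i)) | i < #|~: J|].

Lemma measurable_trained : mfunT trained.
Proof.
apply/measurable_fun_tnthP => i.
rewrite (_ : _ \o _ = (@tnth n.+1 S)^~ (old (enum_val i))); first exact: measurable_tnth.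
by apply/funext => z; rewrite /= tnth_mktuple.
Qed.

Lemma trained_sample w : trained (sample w) = training J Y w.
Proof. by apply: eq_from_tnth => i; rewrite !tnth_mktuple /sample_index/= ltn_ord. Qed.

Lemma old_inj : injective old.
Proof. by move=> i j /(congr1 val)/= /val_inj. Qed.

Definition test_set : {set 'I_n.+1} := [set old j | j in J].

Lemma card_test_set : #|test_set| = #|J|.
Proof. by rewrite card_imset//; exact: old_inj. Qed.

Lemma test_set_index j : j \in test_set -> test_index trained j.
Proof.
move=> /imsetP[k kJ ->] z y; apply: eq_from_tnth => i; rewrite [LHS]tnth_mktuple tnth_set_tnth [RHS]tnth_mktuple.
case: eqP => // /old_inj ik; have := enum_valP i; by rewrite inE ik kJ.
Qed.

Lemma new_index : test_index trained ord_max.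
Proof.
move=> z y; apply: eq_from_tnth => i; rewrite [LHS]tnth_mktuple tnth_set_tnth [RHS]tnth_mktuple; case: eqP => // /(congr1 val)/= h.
by have := ltn_ord (enum_val i); rewrite h ltnn.
Qed.

Let M := [the probability (n.+1.-tuple S * S)%type R of (sample_law \x Q)%E].

Lemma ge0_integral_eval (k : S * X -> \bar R) i : test_index trained i -> mfunT k -> (forall p, 0 <= k p)%E ->
  (\int[P]_w k (tnth (sample w) i, training J Y w) = \int[M]_z k (z.2, trained z.1))%E.
Proof.
move=> ti mk k0; rewrite -(test_law_ge0 sample_law_resamplable measurable_trained ti mk k0).
rewrite ge0_integral_distribution//=.
  by apply: eq_integral => w _; rewrite /= trained_sample.
apply: (measurableT_comp mk); apply: measurable_fun_pair; [exact: measurable_tnth|exact: measurable_trained].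
Qed.

Lemma measurable_new : mfunT (fun w => (Ynew w, training J Y w)).
Proof.
apply: measurable_fun_pair; first exact: (mY None).
rewrite (_ : training J Y = trained \o sample); first exact: (measurableT_comp measurable_trained measurable_sample).
by apply/funext => w; rewrite /= trained_sample.
Qed.

(** Jointly with the training data, a test observation has the law of the additional copy, and the
    estimators are assumed bounded on the latter. The null event is encoded as a nonnegative
    function, whose integral is what is compared. *)
Lemma null_transfer (b : S * X -> R) : mfunT b -> (forall p, 0 <= b p) ->
  {ae P, forall w, b (Ynew w, training J Y w) = 0} ->
  {ae P, forall w, forall j, j \in J -> b (Y j w, training J Y w) = 0}.
Proof.
move=> mb b0 h.
have mbE : mfunT (fun p => (b p)%:E) by exact/measurable_EFinP.
have b0E p : (0 <= (b p)%:E)%E by rewrite lee_fin.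
have E0 : (\int[M]_z (b (z.2, trained z.1))%:E = 0)%E.
  rewrite -(ge0_integral_eval new_index mbE b0E); apply/eqP; rewrite eq_le integral_ge0 ?andbT//.
  rewrite (@ae_eq_integral _ _ _ P setT (cst 0%E))//; first by rewrite integral0.
    have E : (fun w => (b (tnth (sample w) ord_max, training J Y w))%:E) = (fun w => (b (Ynew w, training J Y w))%:E).
      by apply/funext => w; rewrite sample_max.
    by rewrite E; exact: (measurableT_comp mbE measurable_new).
  by apply: filterS h => w hw _; rewrite sample_max hw.
have hj (j : 'I_n) : {ae P, forall w, j \in J -> b (Y j w, training J Y w) = 0}.
  have [jJ|/negP nJ] := boolP (j \in J); last by apply: nearW => w.
  have ti : test_index trained (old j) by apply: test_set_index; exact: imset_f.
  have mk : mfunT (fun w => (b (tnth (sample w) (old j), training J Y w))%:E).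
    apply: (measurableT_comp mbE (g := fun w => (tnth (sample w) (old j), training J Y w))).
    apply: measurable_fun_pair; first exact: (measurableT_comp (measurable_tnth _) measurable_sample).
    exact: (measurableT_comp measurable_snd measurable_new).
  have := ge0_integral_eval ti mbE b0E; rewrite E0 => Ej.
  have := (@ae_eq_integral_abs _ _ _ P setT measurableT _ mk).1.
  rewrite (_ : (\int[P]_w `|_| = 0)%E); last first.
    by rewrite -[RHS]Ej; apply: eq_integral => w _; rewrite gee0_abs.
  by move=> /(_ erefl); apply: filterS => w /(_ Logic.I) [+ _]; rewrite sample_old.
exact: filter_forall hj.
Qed.

End data.

Section truncated_distance.
Context {R : realType}.

(** Truncation at 1 makes discrepancies of an unclamped estimator integrable, while distance zero
    still means equality. *)
Definition tdist (x y : R) : R := Num.min 1 `|x - y|.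

Lemma tdist_ge0 x y : 0 <= tdist x y.
Proof. by rewrite le_min ler01 normr_ge0. Qed.

Lemma tdist_le1 x y : tdist x y <= 1.
Proof. by rewrite ge_min lexx. Qed.

Lemma tdist_eq0 x y : tdist x y = 0 -> x = y.
Proof.
rewrite /tdist; have [_ /eqP|_ /normr0_eq0/eqP] := leP 1 `|x - y|; first by rewrite oner_eq0.
by rewrite subr_eq0 => /eqP.
Qed.

Lemma tdistxx x : tdist x x = 0.
Proof. by rewrite /tdist subrr normr0 min_r. Qed.

Lemma measurable_tdist {d} {T : measurableType d} (f g : T -> R) : mfunT f -> mfunT g ->
  mfunT (fun x => tdist (f x) (g x)).
Proof.
by move=> mf mg; apply: measurable_minr => //; apply: measurableT_comp => //; exact: measurable_funB.
Qed.

End truncated_distance.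

Section estimators.
Context {R : realType} {d d' : measure_display}.
Context {S : measurableType d} {Om : measurableType d'}.
Variables (Q : probability S R) (P : probability Om R).
Variables (Y : nat -> Om -> S) (Ynew : Om -> S).
Hypothesis hiid : iid Q P (oapp Y Ynew).
Variables (n : nat) (J : {set 'I_n}).

Local Notation X := (#|~: J|.-tuple S).
Local Notation mu := (sample_law hiid n).
Local Notation tr := (@trained _ S n J).
Local Notation M := [the probability (n.+1.-tuple S * S)%type R of (mu \x Q)%E].

Implicit Types (e : estimator (R := R) (S := S) J).

Definition clamped_estimator (c : R) e : X -> R -> S -> R := fun x => clamped c (e x).

Section one_estimator.
Variable F : R -> set (set S).
Hypothesis hF : filtration F.
Variable e : estimator (R := R) (S := S) J.
Hypothesis pe : predictable_estimator F e.

Lemma measurable_restr_estimator : mfunT (fun z : X * (R * S) => restr_proc 1 (e z.1) z.2).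
Proof.
have [_ me] := pe.
pose D : set (X * (R * S)) := [set z | z.2.1 \in `[0, 1]].
rewrite (_ : (fun z => _) = (fun z : X * (R * S) => e z.1 z.2.1 z.2.2) \_ D); last first.
  apply/funext => -[x [t y]]; rewrite /restr_proc /patch /=.
  congr (if _ then _ else _); apply/idP/idP; rewrite !inE/=; [by case|by move=> h; split].
apply/(measurable_restrictT _ _).1 => //.
rewrite (_ : D = (fun z : X * (R * S) => z.2.1) @^-1` `[0, 1]%classic)//.
rewrite -[X in measurable X]setTI; apply: (measurableT_comp measurable_fst measurable_snd) => //.
Qed.

Lemma param_bpred_estimator c : 0 <= c -> param_bpred F c (clamped_estimator c e).
Proof.
move=> c0; have [pp _] := pe; split; first by move=> x; exact: bpred_clamped.
apply: (measurableT_comp (measurable_clamp _ _)).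
suff E : (fun z : X * (R * S) => restr_proc 1 (e z.1) (z.2.1, z.2.2)) = fun z => restr_proc 1 (e z.1) z.2.
  by rewrite E; exact: measurable_restr_estimator.
by apply/funext => -[x [t y]].
Qed.

Lemma measurable_restr_eval : mfunT (fun z : R * (S * X) => restr_proc 1 (e z.2.2) (z.1, z.2.1)).
Proof.
suff mp : mfunT (fun z : R * (S * X) => (z.2.2, (z.1, z.2.1))) by exact: (measurableT_comp measurable_restr_estimator mp).
apply: measurable_fun_pair; first exact: (measurableT_comp measurable_snd measurable_snd).
apply: measurable_fun_pair; first exact: measurable_fst.
exact: (measurableT_comp measurable_fst measurable_snd).
Qed.

Lemma restr_estimator_in x t y : t \in `[0, 1] -> restr_proc 1 (e x) (t, y) = e x t y.
Proof. by move=> t01; rewrite /restr_proc patchT// inE. Qed.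

Lemma measurable_restr_estimator_path x y : mfunT (fun s => restr_proc 1 (e x) (s, y)).
Proof. exact: (measurable_fun_pair1 (y, x) measurable_restr_eval). Qed.

Lemma restr_estimator_bounded c w : (forall t, t \in `[0, 1] -> `|evaluate e Y Ynew t w| <= c) -> 0 <= c ->
  forall s, restr_proc 1 (e (training J Y w)) (s, Ynew w) = clamped_estimator c e (training J Y w) s (Ynew w).
Proof.
move=> h c0 s; rewrite /clamped_estimator /clamped clamp_id//.
  have [s01|ns] := boolP (s \in `[0, 1]); last by rewrite /restr_proc patchN ?oppr_le0//; apply/negP; rewrite inE/= => -[]; rewrite (negbTE ns).
  by rewrite restr_estimator_in//; have := h s s01; rewrite ler_norml => /andP[].
have [s01|ns] := boolP (s \in `[0, 1]); last by rewrite /restr_proc patchN//; apply/negP; rewrite inE/= => -[]; rewrite (negbTE ns).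
by rewrite restr_estimator_in//; have := h s s01; rewrite ler_norml => /andP[].
Qed.

Lemma measurable_excess c : 0 <= c ->
  mfunT (fun z : R * (S * X) => tdist (restr_proc 1 (e z.2.2) (z.1, z.2.1)) (clamped_estimator c e z.2.2 z.1 z.2.1)).
Proof.
move=> c0; apply: measurable_tdist; first exact: measurable_restr_eval.
exact: (measurable_param (param_bpred_estimator c0)).
Qed.

Variable H : R -> S -> R.
Hypothesis pH : predictable F H.

Let dist2 (z : R * (S * X)) : R := (restr_proc 1 H (z.1, z.2.1) - restr_proc 1 (e z.2.2) (z.1, z.2.1)) ^+ 2.

Let mrH : mfunT (fun z : R * (S * X) => restr_proc 1 H (z.1, z.2.1)).
Proof.
suff mp : mfunT (fun z : R * (S * X) => (z.1, z.2.1)) by exact: (measurableT_comp (measurable_predictable hF pH) mp).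
by apply: measurable_fun_pair; [exact: measurable_fst|exact: (measurableT_comp measurable_fst measurable_snd)].
Qed.

Let mdist2 : mfunT dist2.
Proof. by apply: measurable_funX; apply: measurable_funB; [exact: mrH|exact: measurable_restr_eval]. Qed.

Let dist2_ge0 z : (0 <= (dist2 z)%:E)%E. Proof. by rewrite lee_fin sqr_ge0. Qed.

Let norm_new := norm2 P (fun t w => H t (Ynew w) - evaluate e Y Ynew t w).

Let sq_int := (\int[P]_w \int[leb01]_s (dist2 (s, (Ynew w, training J Y w)))%:E)%E.

Let restr_in (K : R -> S -> R) t y : t \in `[0, 1] -> restr_proc 1 K (t, y) = K t y.
Proof. by move=> t01; rewrite /restr_proc patchT// inE. Qed.

Lemma norm2_leb01 : norm_new = sqrte sq_int.
Proof.
rewrite /norm_new /norm2 poweR12_sqrt; last by apply: integral_ge0 => w _; apply: integral_ge0 => t _; rewrite lee_fin sqr_ge0.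
congr sqrte; apply: eq_integral => w _; rewrite ge0_integral_leb01//; last first.
  by apply/measurable_EFinP; exact: (measurable_fun_pair1 _ mdist2).
by apply: eq_integral => t; rewrite inE/= => t01; rewrite /dist2/= !restr_in.
Qed.

Let inner (p : S * X) : \bar R := (\int[leb01]_s (dist2 (s, p))%:E)%E.

Let measurable_inner : mfunT inner.
Proof.
have mdE : mfunT (fun z => (dist2 z)%:E) by exact/measurable_EFinP.
exact: (@measurable_fun_fubini_tonelli_G _ _ R _ _ leb01 (fun z : R * (S * X) => (dist2 z)%:E)).
Qed.

Lemma sq_int_new : sq_int = (\int[M]_z inner (z.2, tr z.1))%E.
Proof.
rewrite -(ge0_integral_eval hiid (@new_index _ S n J) measurable_inner); last first.
  by move=> p; apply: integral_ge0.
by apply: eq_integral => w _; rewrite sample_max.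
Qed.

(** Combines the contraction property with the identification of the copy and the training data as a
    new observation and a sample under the product law. *)
Lemma clamped_le_norm2 c : 0 <= c ->
  ((Num.sqrt (param_mean Q mu tr (fun x t y => (clamped_estimator c e x t y - clamped c H t y) ^+ 2)))%:E <= norm_new)%E.
Proof.
move=> c0; rewrite norm2_leb01.
have pK : param_bpred F ((c + c) * (c + c)) (fun x t y => (clamped_estimator c e x t y - clamped c H t y) ^+ 2).
  have p1 := param_bpred_estimator c0; have p2 := param_cst (X := X) (bpred_clamped hF c0 pH).
  exact: param_sqr (paramB p1 p2).
have iK := L1_param_new Q mu (@measurable_trained _ S n J) pK.
set k := (fun z : R * (n.+1.-tuple S * S) => _) in iK.
have k0 z : 0 <= k z by exact: sqr_ge0.
have -> : (Num.sqrt (param_mean Q mu tr (fun x t y => (clamped_estimator c e x t y - clamped c H t y) ^+ 2)))%:E =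
    sqrte ((param_mean Q mu tr (fun x t y => (clamped_estimator c e x t y - clamped c H t y) ^+ 2))%:E) by [].
rewrite lee_sqrt; last by apply: integral_ge0 => w _; apply: integral_ge0.
rewrite /param_mean -(EFin_Rint iK).
have mk : mfunT (fun z => (k z)%:E) by apply/measurable_EFinP; exact: L1_measurable iK.
rewrite (@fubini_tonelli2 _ _ R _ _ leb01 M (fun z => (k z)%:E))//.
rewrite sq_int_new; apply: ge0_le_integral => //.
- by move=> z _; apply: integral_ge0 => s _; rewrite lee_fin.
- apply: (@measurable_fun_fubini_tonelli_G _ _ R _ _ leb01 (fun z : R * (n.+1.-tuple S * S) => (k z)%:E)) => //.
- by apply: (measurableT_comp measurable_inner); apply: measurable_fun_pair; [exact: measurable_snd|exact: (measurableT_comp (@measurable_trained _ S n J) measurable_fst)].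
move=> z _; rewrite /fubini_G/= /inner; apply: ge0_le_integral => //.
- by move=> s _; rewrite lee_fin.
- by apply/measurable_EFinP; exact: (measurable_fun_pair1 z (L1_measurable iK)).
- by apply/measurable_EFinP; exact: (measurable_fun_pair1 _ mdist2).
move=> s _; rewrite lee_fin /k /dist2/= /clamped_estimator /clamped.
rewrite -[leLHS]real_normK ?num_real// -[leRHS]real_normK ?num_real//.
by apply: lerXn2r; rewrite ?nnegrE// [leRHS]distrC clamp_contraction.
Qed.

(** A finite L2 distance to a bounded estimate makes the target integrable, through |a| <= |a - b| +
    |b| and |x| <= x^2 + 1. *)
Lemma L1_norm2 c : (norm_new < +oo)%E -> sup_bounded P c (evaluate e Y Ynew) ->
  L1 (leb01 \x Q)%E (restr_proc 1 H).
Proof.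
move=> fin bc; have mH := measurable_predictable hF pH.
have sfin : (sq_int < +oo)%E.
  move: fin; rewrite norm2_leb01; by move: sq_int => [r||]// _; rewrite ltry.
apply/integrableP; split; first exact/measurable_EFinP.
have mHa : mfunT (fun z => `|(restr_proc 1 H z)%:E|%E) by apply/measurable_EFinP; exact: measurableT_comp.
rewrite (@fubini_tonelli2 _ _ R _ _ leb01 Q (fun z => `|(restr_proc 1 H z)%:E|%E))//.
pose k (p : S * X) := (\int[leb01]_s `|(restr_proc 1 H (s, p.1))%:E|)%E.
have mk1 : mfunT (fun y => \int[leb01]_s `|(restr_proc 1 H (s, y))%:E|)%E.
  exact: (@measurable_fun_fubini_tonelli_G _ _ R _ _ leb01 (fun z : R * S => `|(restr_proc 1 H z)%:E|%E)).
have mk : mfunT k := measurableT_comp mk1 measurable_fst.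
have k0 p : (0 <= k p)%E by apply: integral_ge0.
have -> : (\int[Q]_y fubini_G leb01 (fun z => `|(restr_proc 1 H z)%:E|) y = \int[M]_z k (z.2, tr z.1))%E.
  rewrite (@fubini_tonelli1 _ _ _ _ _ mu Q (fun z => k (z.2, tr z.1)))//; last first.
    by apply: (measurableT_comp mk1); exact: measurable_snd.
  rewrite (_ : fubini_F Q _ = fun=> (\int[Q]_y fubini_G leb01 (fun z => `|(restr_proc 1 H z)%:E|) y)%E)//.
  by rewrite integral_cst// [X in (_ * X)%E](_ : _ = 1%E) ?mule1//; exact: probability_setT.
rewrite -(ge0_integral_eval hiid (@new_index _ S n J) mk k0).
pose u w := (inner (Ynew w, training J Y w) + (1 + `|c|)%:E)%E.
have mnew : mfunT (fun w => (Ynew w, training J Y w)) := measurable_new hiid (J := J).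
have iu : (\int[P]_w u w < +oo)%E.
  rewrite ge0_integralD//; last 2 first.
  - by move=> w _; apply: integral_ge0.
  - exact: (measurableT_comp measurable_inner mnew).
  rewrite integral_cst// [X in (_ + _ * X)%E](_ : _ = 1%E); last exact: probability_setT.
  by rewrite mule1 lte_add_pinfty// ltry.
apply: le_lt_trans iu; apply: ae_ge0_le_integral => //.
- have E : (fun w => k (tnth (sample Y Ynew n w) ord_max, training J Y w)) = (fun w => k (Ynew w, training J Y w)).
    by apply/funext => w; rewrite sample_max.
  by rewrite E; exact: (measurableT_comp mk mnew).
- by move=> w _; apply: adde_ge0; [exact: integral_ge0|rewrite lee_fin addr_ge0].
- by apply: emeasurable_funD => //; exact: (measurableT_comp measurable_inner mnew).
apply: filterS bc => w bw _; rewrite sample_max /u /k /inner /=.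
rewrite [(1 + `|c|)%:E](_ : _ = (\int[leb01]_s (1 + `|c|)%:E)%E); last first.
  by rewrite integral_cst// [X in (_ * X)%E](_ : _ = 1%E) ?mule1//; exact: probability_setT.
have md w' : mfunT (fun s => (dist2 (s, w'))%:E) by apply/measurable_EFinP; exact: (measurable_fun_pair1 _ mdist2).
rewrite -ge0_integralD//.
apply: ge0_le_integral => //.
- by apply/measurable_EFinP; apply: measurableT_comp => //; exact: (measurable_fun_pair1 _ mH).
- by apply: emeasurable_funD.
move=> s _; rewrite -EFinD lee_fin /dist2/=.
have [s01|ns] := boolP (s \in `[0, 1]); last first.
  rewrite /restr_proc patchN ?normr0 ?addr_ge0 ?sqr_ge0//.
  by apply/negP; rewrite inE/= => -[]; rewrite (negbTE ns).
rewrite !restr_in//; have b := bw s s01; rewrite /evaluate in b.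
move: (H s (Ynew w)) (e (training J Y w) s (Ynew w)) b => a b' hb.
apply: (@le_trans _ _ (`|a - b'| + `|b'|)); first by rewrite -{1}(subrK b' a) ler_normD.
have h1 : `|a - b'| <= (a - b') ^+ 2 + 1.
  by rewrite -[(a - b') ^+ 2]real_normK ?num_real//; have := sqr_ge0 (`|a - b'| - 2^-1); lra.
by have := ler_norm c; lra.
Qed.

End one_estimator.

Section replacement.
Variables (F GF : R -> set (set S)) (N : S -> cumulative R R) (lamhat Ghat : estimator (R := R) (S := S) J) (C C' : R).
Hypothesis hF : filtration F.
Hypothesis hGF : filtration GF.
Hypothesis hN : forall y, counting_path (N y).
Hypothesis aN : adapted GF (fun t y => N y t).
Hypothesis pl : predictable_estimator F lamhat.
Hypothesis pG : predictable_estimator GF Ghat.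
Hypothesis C0 : 0 <= C.
Hypothesis C'0 : 0 <= C'.
Hypothesis lC : sup_bounded P C (evaluate lamhat Y Ynew).
Hypothesis GC : sup_bounded P C' (evaluate Ghat Y Ynew).

Local Notation Gh := (clamped_estimator C' Ghat).
Local Notation lh := (clamped_estimator C lamhat).

Let exG (z : R * (S * X)) := tdist (restr_proc 1 (Ghat z.2.2) (z.1, z.2.1)) (Gh z.2.2 z.1 z.2.1).
Let exl (z : R * (S * X)) := tdist (restr_proc 1 (lamhat z.2.2) (z.1, z.2.1)) (lh z.2.2 z.1 z.2.1).
Let mexG : mfunT exG := measurable_excess hGF pG C'0.
Let mexl : mfunT exl := measurable_excess hF pl C0.

(** A jump part stands beside the Lebesgue part because two processes may agree at almost every time
    and differ at a jump. The vanishing of this one variable is the event carried from the copy to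
    the test observations. *)
Let excess (p : S * X) : R :=
  jsum (N p.1) (fun s => exG (s, p)) 1 + \int[leb01]_s (exG (s, p) + exl (s, p)).

Let mN u : u \in `[0, 1] -> mfunT (fun y => N y u).
Proof. exact: (measurable_counting hGF aN). Qed.

Let measurable_sum_excess : mfunT (fun z => exG z + exl z).
Proof. exact: measurable_funD. Qed.

Let measurable_excess_total : mfunT excess.
Proof.
have h11 : (1 : R) \in `[0, 1] by rewrite in_itv/= ler01 lexx.
apply: measurable_funD; last exact: (@measurable_Rint1 _ _ _ _ _ leb01 _ measurable_sum_excess).
apply: (@measurable_jsum R _ _ (fun p : S * X => N p.1) (fun p => hN p.1) 1 h11 _ exG) => // u u01.
by apply: (measurableT_comp (mN _) measurable_fst).
Qed.

Let excess_ge0 p : 0 <= excess p.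
Proof.
apply: addr_ge0; last by apply: Rint_ge0 => s; rewrite addr_ge0 ?tdist_ge0.
by apply: sumr_ge0 => k _; rewrite mulr_ge0 ?tdist_ge0.
Qed.

Let excess_eq0 p t : excess p = 0 -> t \in `[0, 1] ->
  [/\ int_dM (N p.1) (fun s => lamhat p.2 s p.1) (fun s => Ghat p.2 s p.1) t = est_point N Gh lh t p &
   int_dN (N p.1) (fun s => Ghat p.2 s p.1 ^+ 2) t = jsum (N p.1) (fun s => Gh p.2 s p.1 ^+ 2) t].
Proof.
case: p => y x /= /eqP; rewrite paddr_eq0; last 2 first.
- by apply: sumr_ge0 => k _; rewrite mulr_ge0 ?tdist_ge0.
- by apply: Rint_ge0 => s; rewrite addr_ge0 ?tdist_ge0.
move=> /andP[j0 /eqP i0] t01.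
have jE (k : 'I_(njumps (N y))) : Ghat x (jump (N y) k) y = Gh x (jump (N y) k) y.
  have jk01 : jump (N y) k \in `[0, 1] by rewrite in_itv/= ltW ?jump_gt0//= jump_le1.
  have hk : exG (jump (N y) k, (y, x)) * (jump (N y) k <= 1)%R%:R = 0.
    apply/eqP; rewrite eq_le mulr_ge0 ?tdist_ge0// andbT -(eqP j0) /jsum (bigD1 k)//= lerDl.
    by apply: sumr_ge0 => i _; rewrite mulr_ge0 ?tdist_ge0.
  rewrite -(restr_estimator_in Ghat x y jk01); apply: tdist_eq0.
  have j1 : (jump (N y) k <= 1)%R%:R = 1 :> R by rewrite jump_le1// ltn_ord.
  rewrite j1 mulr1 in hk; exact: hk.
have sub01 s : s \in `]0, 1] -> s \in `[0, 1] by rewrite !in_itv/= => /andP[/ltW-> ->].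
have mGp : measurable_fun (`]0, 1]%classic : set R) (fun s => Ghat x s y).
  apply: (@eq_measurable_fun _ _ _ _ _ (fun s => restr_proc 1 (Ghat x) (s, y))).
    by move=> s; rewrite inE => /sub01; exact: restr_estimator_in.
  by apply: measurable_funTS; exact: (measurable_restr_estimator_path pG).
have iE : L1 (@leb01 R) (fun s => exG (s, (y, x)) + exl (s, (y, x))).
  apply: (@L1_bounded _ _ _ _ _ 2); first exact: (measurable_fun_pair1 _ measurable_sum_excess).
  by move=> s; rewrite ger0_norm ?addr_ge0 ?tdist_ge0// -[2]/(1 + 1); apply: lerD; exact: tdist_le1.
have ae0 := Rint_eq0_ae iE (fun s => addr_ge0 (tdist_ge0 _ _) (tdist_ge0 _ _)) i0.
have [mGx _] := pG; have bG x' : bpred GF C' (Gh x') by have [h _] := param_bpred_estimator hGF pG C'0.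
have bl x' : bpred F C (lh x') by have [h _] := param_bpred_estimator hF pl C0.
split; last first.
  rewrite int_dN_jsum//; last by apply: measurable_funX.
  by apply: eq_bigr => k _; rewrite jE.
rewrite /int_dM /est_point int_dN_jsum//=; congr (_ - _); first by apply: eq_bigr => k _; rewrite jE.
rewrite (@int_ds_ext _ _ (fun s => restr_proc 1 (Ghat x) (s, y) * restr_proc 1 (lamhat x) (s, y)))//; last first.
  by move=> s s01; rewrite !restr_estimator_in.
have m1 := measurable_funM (measurable_restr_estimator_path pG x y) (measurable_restr_estimator_path pl x y).
have m2 := measurable_funM (bpred_measurable1 y (bG x)) (bpred_measurable1 y (bl x)).
rewrite !int_ds_leb01//; apply: Rint_ae_eq.
- by apply: measurable_funM => //; exact: measurable_indic.
- by apply: measurable_funM => //; exact: measurable_indic.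
apply: filterS ae0 => s /eqP; rewrite paddr_eq0 ?tdist_ge0// => /andP[/eqP/tdist_eq0/= -> /eqP/tdist_eq0/= ->]//.
Qed.

(** On the copy the assumed bounds make [excess] vanish; [null_transfer] does the rest, with one
    null set for all times. *)
Lemma estimators_clamped : {ae P, forall w, forall t, t \in `[0, 1] ->
  gamma_hat N lamhat Ghat Y w t = #|J|%:R^-1 * est_score N tr (test_set J) Gh lh t (sample Y Ynew n w) /\
  V_hat N Ghat Y w t = est_var N tr (test_set J) Gh t (sample Y Ynew n w)}.
Proof.
have h0 : {ae P, forall w, excess (Ynew w, training J Y w) = 0}.
  apply: filterS2 lC GC => w hl hG; have el := restr_estimator_bounded hl C0; have eG := restr_estimator_bounded hG C'0.
  rewrite /excess /jsum big1 ?add0r; last by move=> k _; rewrite /exG/= eG tdistxx mul0r.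
  by under eq_Rintegral do rewrite /exG /exl/= el eG !tdistxx addr0; rewrite Rint_cst.
have := null_transfer hiid measurable_excess_total excess_ge0 h0; apply: filterS => w hw t t01.
have E (f : S * X -> R) : test_sum tr (test_set J) f (sample Y Ynew n w) = \sum_(j in J) f (Y j w, training J Y w).
  rewrite /test_sum big_imset/=; last by move=> i j _ _; exact: old_inj.
  by apply: eq_bigr => j _; rewrite /test_eval sample_old trained_sample.
split; rewrite /gamma_hat /V_hat /est_score /est_var ?card_test_set E; congr (_ * _); apply: eq_bigr => j jJ.
  by have [-> _] := excess_eq0 (hw j jJ) t01.
by have [_ ->] := excess_eq0 (hw j jJ) t01.
Qed.

Lemma est_score_cadlag z : cadlag (fun t => est_score N tr (test_set J) Gh lh t z).
Proof.
apply: cadlag_sum => j; have bG x' : bpred GF C' (Gh x') by have [h _] := param_bpred_estimator hGF pG C'0.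
have bl x' : bpred F C (lh x') by have [h _] := param_bpred_estimator hF pl C0.
have := cadlagD (jsum_cadlag (N (tnth z j)) (Gh (tr z) ^~ (tnth z j))) (cadlagZ (-1) (@cadlag_int_ds _ (fun s => Gh (tr z) s (tnth z j) * lh (tr z) s (tnth z j)) (C' * C) _ _)).
rewrite /test_eval /est_point/= => h; under eq_fun do rewrite -mulN1r; apply: h.
  by apply: measurable_funM; [exact: bpred_measurable1 (bG _)|exact: bpred_measurable1 (bl _)].
by move=> s; rewrite normrM; have [_ _ h1] := bG (tr z); have [_ _ h2] := bl (tr z); exact: ler_pM.
Qed.

Lemma est_var_cadlag z : cadlag (fun t => est_var N tr (test_set J) Gh t z).
Proof.
by apply: cadlagZ; apply: cadlag_sum => j; exact: (jsum_cadlag (N (tnth z j))).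
Qed.

End replacement.
End estimators.

(** * Uniform tightness of the Gaussian limits *)

Section tightness.
Context {R : realType}.

(** Points at most one cell length apart lie in the same cell or in adjacent ones, so three block
    oscillations suffice. *)
Lemma grid_modulus (u : R -> R) (p : nat) (e : R) : (0 < p)%N ->
  (forall i, (i < p)%N -> forall t, t \in `[i%:R / p%:R, i.+1%:R / p%:R] -> `|u t - u (i%:R / p%:R)| <= e) ->
  forall s t, s \in `[0, 1] -> t \in `[0, 1] -> `|s - t| <= p%:R^-1 -> `|u s - u t| <= 3 * e.
Proof.
move=> p0 H; have p0' : (0 : R) < p%:R by rewrite ltr0n.
have H' s t : s \in `[0, 1] -> t \in `[0, 1] -> s <= t -> t - s <= p%:R^-1 -> `|u s - u t| <= 3 * e.
  rewrite !in_itv/= => /andP[s0 s1] /andP[t0 t1] st sp.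
  have [i [ip lo hi]] := unit_grid_cell p0 s0 s1.
  have hs := H i ip s (ltac:(by rewrite in_itv/= lo)).
  have d1 (k : nat) : k.+1%:R / p%:R - k%:R / p%:R = p%:R^-1 :> R by rewrite -natr1 mulrDl mul1r addrAC subrr add0r.
  have [h|h] := leP t (i.+1%:R / p%:R).
    have ht := H i ip t (ltac:(by rewrite in_itv/= h (le_trans lo st))).
    by move: hs ht; rewrite !ler_norml => /andP[h1 h2] /andP[h3 h4]; apply/andP; split; lra.
  have ip1 : (i.+1 < p)%N.
    by rewrite -(ltr_nat R); have := lt_le_trans h t1; rewrite ltr_pdivrMr// mul1r.
  have ht := H i.+1 ip1 t (ltac:(by rewrite in_itv/= ltW//=; have := d1 i; have := d1 i.+1; lra)).
  have hi' := H i ip (i.+1%:R / p%:R) (ltac:(by rewrite in_itv/= lexx andbT ler_pM2r ?invr_gt0// ler_nat)).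
  by move: hs ht hi'; rewrite !ler_norml => /andP[h1 h2] /andP[h3 h4] /andP[h5 h6]; apply/andP; split; lra.
move=> s t s01 t01; have [st|/ltW st] := leP s t.
  by rewrite [`|s - t|]distrC ger0_norm ?subr_ge0//; exact: H'.
by rewrite ger0_norm ?subr_ge0// distrC; exact: H'.
Qed.

Lemma prob_bigcup {d} {T : measurableType d} (mu : probability T R) (A : nat -> set T) (e : R) : 0 <= e ->
  (forall j, measurable (A j)) -> (forall j, fine (mu (A j)) <= e / (2 ^ j.+1)%:R) ->
  fine (mu (\bigcup_j A j)) <= e.
Proof.
move=> e0 mA hA; rewrite -lee_fin fineK ?fin_num_measure//; last exact: bigcupT_measurable.
apply: (le_trans (measure_sigma_subadditive mu mA (bigcupT_measurable _ mA) (fun x h => h))).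
apply: le_trans (epsilon_trick0 predT e0); apply: lee_nneseries => // j _.
by have := hA j; rewrite -lee_fin fineK ?fin_num_measure.
Qed.

Section one_martingale.
Context {d : measure_display} {T : measurableType d}.
Variable P : probability T R.
Variables (V : R -> R) (U : R -> T -> R) (L : R).
Hypothesis hU : continuous_gaussian_martingale P V U.
Hypothesis L0 : 0 < L.
Hypothesis VL : forall s t, s \in `[0, 1] -> t \in `[0, 1] -> `|V s - V t| <= L * `|s - t|.
Hypothesis V0 : V 0 = 0.

Let h01 : (0 : R) \in `[0, 1]. Proof. exact: t01E. Qed.
Let h11 : (1 : R) \in `[0, 1]. Proof. exact: t01E. Qed.

Let rcU y t : t \in `[0, 1[ -> U s y @[s --> t^'+] --> U t y.
Proof. by move=> t01; have [cU _ _ _] := hU; have [h _] := within_continuous_cadlag (cU y); exact: h. Qed.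

Lemma gaussian_block (p : nat) (e : R) : (0 < p)%N -> 0 < e ->
  exists A, [/\ measurable A, fine (P A) <= (e ^+ 4)^-1 * (3 * L ^+ 2 / p%:R) &
    forall y, ~ A y -> forall s t, s \in `[0, 1] -> t \in `[0, 1] -> `|s - t| <= p%:R^-1 -> `|U s y - U t y| <= 3 * e].
Proof.
move=> p0 e0; have p0' : (0 : R) < p%:R by rewrite ltr0n.
have [|A [mA PA HA]] := @prob_cover R _ _ P p ((e ^+ 4)^-1 * (3 * (L * p%:R^-1) ^+ 2))
   (fun i y => forall t, t \in `[i%:R / p%:R, i.+1%:R / p%:R] -> `|U t y - U (i%:R / p%:R) y| <= e).
  move=> i ip; pose s : R := i%:R / p%:R; pose t : R := i.+1%:R / p%:R.
  have ts : t - s = p%:R^-1 by rewrite /t /s -natr1 mulrDl mul1r addrAC subrr add0r.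
  have s0 : 0 <= s by rewrite divr_ge0// ltW.
  have st : s <= t by rewrite ler_pM2r ?invr_gt0// ler_nat.
  have t1 : t <= 1 by rewrite ler_pdivrMr// mul1r ler_nat.
  have [A [mA PA HA]] := doob_path (or_intror (erefl 2)) e0 s0 st t1 (gaussian_path_measurable hU)
    (fun t t01 => let: And3 h _ _ := gaussian_path_moments hU t01 in h) (gaussian_path_martingale hU) rcU.
  exists A; split=> //; apply: (le_trans PA); apply: ler_wpM2l; first by rewrite invr_ge0 exprn_ge0// ltW.
  have [_ ->] := gaussian_incr_moment4 hU s0 st t1; apply: ler_wpM2l => //.
  rewrite -[leLHS]real_normK ?num_real//; apply: lerXn2r; rewrite ?nnegrE//.
    by rewrite divr_ge0// ltW.
  apply: le_trans (VL _ _) _; rewrite ?in_itv/= ?t1 ?(le_trans st t1) ?s0 ?(le_trans s0 st)//.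
  by rewrite ger0_norm ?subr_ge0// ts.
exists A; split=> //.
  apply: (le_trans PA); apply: le_of_eq; field.
  by rewrite !gt_eqF.
by move=> y nA; exact: (grid_modulus p0 (HA y nA)).
Qed.

Lemma gaussian_sup (B : R) : 0 < B ->
  exists A, [/\ measurable A, fine (P A) <= (B ^+ 2)^-1 * L &
    forall y, ~ A y -> forall t, t \in `[0, 1] -> `|U t y| <= B].
Proof.
move=> B0.
have iU2 t : t \in `[0, 1] -> L1 P (fun y => U t y ^+ 1.*2).
  move=> t01; have [i4 _ _] := gaussian_path_moments hU t01.
  by apply: (@L1_pow_le _ _ _ P 2 2) => //; exact: (gaussian_path_measurable hU t01).
have [A [mA PA HA]] := doob_path (or_introl (erefl 1%N)) B0 (lexx 0) ler01 (lexx 1) (gaussian_path_measurable hU)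
  iU2 (gaussian_path_martingale hU) rcU.
have [_ e0 _] := gaussian_path_moments hU h01; rewrite V0 in e0.
have [_ e1 _] := gaussian_path_moments hU h11.
have z0 : {ae P, forall y, U 0 y ^+ 2 = 0} by apply: Rint_eq0_ae => //; [exact: iU2|move=> y; exact: sqr_ge0].
have z0' : {ae P, forall y, U 0 y = 0} by apply: filterS z0 => y /eqP; rewrite expf_eq0/= => /eqP.
have mU0 := gaussian_path_measurable hU h01.
(* The martingale starts at 0 almost surely, its variance at time 0 being zero; the null set where
   it does not joins the exceptional set, Doob's bound being on increments. *)
pose Z := [set y | U 0 y != 0].
have mZ : measurable Z.
  rewrite (_ : Z = U 0 @^-1` (~` [set 0])); last by apply/seteqP; split=> y /= /eqP.
  by rewrite -[X in measurable X]setTI; apply: mU0 => //; exact: measurableC.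
have PZ : P Z = 0%E.
  have [Z' [mZ' PZ' sub]] := z0'; apply/eqP; rewrite eq_le measure_ge0 andbT -PZ' le_measure ?inE//.
  by move=> y /= /eqP ny; apply: sub => /=.
exists (A `|` Z); split; first exact: measurableU.
  apply: (le_trans (prob_setU _ mA mZ)); rewrite PZ addr0; apply: (le_trans PA); apply: ler_wpM2l.
    by rewrite invr_ge0 exprn_ge0// ltW.
  rewrite (@Rint_ae_eq _ _ _ P _ (fun y => U 1 y ^+ 2)).
  - by rewrite e1; have := VL h11 h01; rewrite V0 !subr0 normr1 mulr1; apply: le_trans; exact: ler_norm.
  - by apply: measurable_funX; apply: measurable_funB => //; exact: (gaussian_path_measurable hU h11).
  - by apply: measurable_funX; exact: (gaussian_path_measurable hU h11).
  - by apply: filterS z0' => y ->; rewrite subr0.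
move=> y nA t t01; have := HA y (fun h => nA (or_introl h)) t t01.
by have [->|nz] := eqVneq (U 0 y) 0; [rewrite subr0|move=> _; exfalso; apply: nA; right].
Qed.

End one_martingale.

(** The bound and the modulus are fixed before the probability space and the martingale: they depend
    on the Lipschitz constant and on [tau], which makes tightness uniform over the parameter. *)
Lemma gaussian_tightness (L tau : R) : 0 < L -> 0 < tau -> exists B q, [/\ 0 < B, forall j, 0 < q j &
  forall d (T : measurableType d) (P : probability T R) (V : R -> R) (U : R -> T -> R),
    continuous_gaussian_martingale P V U ->
    (forall s t, s \in `[0, 1] -> t \in `[0, 1] -> `|V s - V t| <= L * `|s - t|) -> V 0 = 0 ->
    exists A : set T, [/\ measurable A, fine (P A) <= tau & forall y, ~ A y -> modulus_class B q (U ^~ y)]].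
Proof.
(* The factor 3 is the loss of [gaussian_block], so that precision [j] is exactly 1 / (j + 1). *)
move=> L0 tau0; pose e (j : nat) : R := (3 * j.+1%:R)^-1.
have e0 j : 0 < e j by rewrite invr_gt0 mulr_gt0// ltr0n.
(* More than [b j] blocks bring the exceptional probability of precision [j] below tau / 2^(j + 2),
   and the sum over [j] below tau / 2. *)
pose b j : R := (e j ^+ 4)^-1 * (3 * L ^+ 2) / (tau / 2 / (2 ^ j.+1)%:R).
pose p j := (Num.truncn (b j)).+1.
have t2 : 0 < tau / 2 by rewrite divr_gt0.
have t2j j : 0 < tau / 2 / (2 ^ j.+1)%:R by rewrite divr_gt0// ltr0n expn_gt0.
(* As B >= 1, its square is at least 2 L / tau, and the supremum bound costs at most tau / 2. *)
pose B : R := 1 + 2 * L / tau; have B0 : 0 < B by rewrite ltr_pwDl// divr_ge0 ?mulr_ge0// ltW.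
exists B, (fun j => (p j)%:R^-1); split=> // [j|d T P V U hU VL V0]; first by rewrite invr_gt0 ltr0n.
have [A0 [mA0 PA0 H0]] := gaussian_sup hU VL V0 B0.
have /choice[A HA] j := gaussian_block hU L0 VL (ltn0Sn (Num.truncn (b j))) (e0 j).
have mA j : measurable (A j) by have [h _ _] := HA j.
have PA : fine (P (\bigcup_j A j)) <= tau / 2.
  apply: prob_bigcup => // [|j]; first exact: ltW.
  have [_ h _] := HA j; apply: (le_trans h); rewrite -/(p j) mulrA ler_pdivrMr ?ltr0n// -ler_pdivrMl// mulrC.
  exact: ltW (truncnS_gt _).
exists (A0 `|` \bigcup_j A j); split; first by apply: measurableU => //; exact: bigcupT_measurable.
  apply: (le_trans (prob_setU _ mA0 (bigcupT_measurable _ mA))); rewrite (splitr tau); apply: lerD => //.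
  apply: (le_trans PA0); rewrite mulrC ler_pdivrMr ?exprn_gt0//.
  have : 2 * L / tau <= B ^+ 2.
    have B1 : 1 <= B by rewrite lerDl divr_ge0 ?mulr_ge0// ltW.
    apply: (@le_trans _ _ B); first by rewrite /B lerDr.
    by rewrite expr2 ler_peMr// ltW.
  by rewrite ler_pdivrMr// => h; lra.
move=> y nA; have [cU _ _ _] := hU; split; first exact: cU.
  exact: H0 y (fun h => nA (or_introl h)).
move=> j s t s01 t01 st; have [_ _ h] := HA j.
have := h y (fun hA => nA (or_intror (ex_intro2 _ _ j Logic.I hA))) s t s01 t01 st.
by rewrite (_ : 3 * e j = j.+1%:R^-1)// /e; field; rewrite nat1r pnatr_eq0.
Qed.

End tightness.

(** * Assembly at one parameter, then uniformly *)

Section one_sample.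
Context {R : realType} {d d' : measure_display}.
Context {S : measurableType d} {Om : measurableType d'}.
Variables (Q : probability S R) (P : probability Om R).
Variables (F : R -> set (set S)) (N : S -> cumulative R R) (X lam blam G : R -> S -> R) (C C' : R).
Hypothesis hO : observable Q F N X.
Hypothesis hlam : intensity Q F N lam.
Hypothesis hblam : intensity Q (join_filtration F X) N blam.
Hypothesis hG : residual_process Q F X G.
Hypothesis C0 : 0 < C.
Hypothesis C'0 : 0 < C'.
Hypothesis blamC : {ae Q, forall y, forall t, t \in `[0, 1] -> blam t y <= C}.
Hypothesis GC : sup_bounded Q C' G.
Hypothesis hH0 : H0 Q F N X lam.
Hypothesis ilam : L1 (leb01 \x Q)%E (restr_proc 1 lam).

Let hF := observable_filtration hO.
Let hGF := observable_join_filtration hO.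
Let F0F := observable_sub hO.
Let hN := observable_counting hO.
Let aN := observable_adapted hO.
Let iN : L1 Q (fun y => N y 1) := (intensity_bound hO hblam C0 blamC).1.
Let bl := bpred_intensity hO hlam C0.
Let bG := bpred_residual hO hG C'0.
Let comp := compensation_clamped hO hlam hblam C0 blamC hH0 ilam.
Let resG := residual_orthogonal hO hG GC.

Lemma variance_function_incr s t : 0 <= s -> s <= t -> t <= 1 ->
  0 <= variance_function Q N G t - variance_function Q N G s <= C' ^+ 2 * C * (t - s).
Proof.
move=> s0 st t1; have s01 : s \in `[0, 1] by rewrite in_itv/= s0 (le_trans st).
have t01 : t \in `[0, 1] by rewrite in_itv/= t1 (le_trans s0).
rewrite !(variance_functionE hO hG C'0 GC)//.
exact: (mean_qv_incr hGF F0F hN aN iN bl comp bG).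
Qed.

Lemma variance_function0 : variance_function Q N G 0 = 0.
Proof. by rewrite (variance_functionE hO hG C'0 GC) ?in_itv/= ?lexx ?ler01// mean_qv0. Qed.

Lemma variance_function_lipschitz s t : s \in `[0, 1] -> t \in `[0, 1] ->
  `|variance_function Q N G s - variance_function Q N G t| <= C' ^+ 2 * C * `|s - t|.
Proof.
have H u v : u \in `[0, 1] -> v \in `[0, 1] -> u <= v ->
    `|variance_function Q N G u - variance_function Q N G v| <= C' ^+ 2 * C * `|u - v|.
  rewrite !in_itv/= => /andP[u0 _] /andP[_ v1] uv; have /andP[h1 h2] := variance_function_incr u0 uv v1.
  by rewrite distrC ger0_norm// distrC ger0_norm// subr_ge0.
move=> s01 t01; have [st|/ltW ts] := leP s t; first exact: H.
by rewrite distrC [`|s - t|]distrC; exact: H.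
Qed.

Variables (Y : nat -> Om -> S) (Ynew : Om -> S).
Hypothesis hiid : iid Q P (oapp Y Ynew).
Variables (n : nat) (J : {set 'I_n}).

Local Notation Z := (sample Y Ynew n).
Local Notation mu := (sample_law hiid n).
Local Notation tr := (@trained _ S n J).
Local Notation m := (#|J|%:R : R).

Let res : resamplable mu Q := sample_law_resamplable hiid (n := n).
Let mZ : mfunT Z := measurable_sample hiid (n := n).
Let mtr : mfunT tr := @measurable_trained _ S n J.
Let tJ j : j \in test_set J -> test_index tr j := @test_set_index _ S n J j.

Definition limit_path t w := (Num.sqrt m)^-1 * score N (clamped C lam) (clamped C' G) tr (test_set J) t (Z w).

Let on_sample (b : R) (good : n.+1.-tuple S -> Prop) :
  (exists A, [/\ measurable A, fine (mu A) <= b & forall z, ~ A z -> good z]) ->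
  exists A, [/\ measurable A, fine (P A) <= b & forall w, ~ A w -> good (Z w)].
Proof.
move=> [A [mA PA HA]]; exists (Z @^-1` A); split=> //; last by move=> w; exact: HA.
by rewrite -[X in measurable X]setTI; exact: mZ.
Qed.

Lemma measurable_limit_path t : t \in `[0, 1] -> mfunT (limit_path t).
Proof.
move=> t01; apply: measurable_funM => //.
exact: (measurableT_comp (measurable_score hGF F0F hN aN bl bG mtr (test_set J) t01) mZ).
Qed.

Hypothesis J0 : (0 < #|J|)%N.

Let J0' : (0 < #|test_set J|)%N. Proof. by rewrite card_test_set. Qed.

Lemma limit_path_cos (k : nat) (a t : 'I_k -> R) (c v K : R) : (forall i, t i \in `[0, 1]) ->
  v = \sum_(i < k) \sum_(j < k) a i * a j * variance_function Q N G (Num.min (t i) (t j)) ->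
  K = k%:R ^+ 3 * \sum_(i < k) a i ^+ 4 * pow4_bound C C' ->
  `|\int[P]_w cos (\sum_(i < k) a i * limit_path (t i) w + c) - expR (- v / 2) * cos c|
    <= (K + (1 + K) ^+ 2 + (1 + K)) / Num.sqrt m.
Proof.
move=> t01 vE KE.
have vE' : v = \sum_(i < k) \sum_(j < k) a i * a j * mean_qv Q N (clamped C' G) (Num.min (t i) (t j)).
  rewrite vE; apply: eq_bigr => i _; apply: eq_bigr => j _; rewrite (variance_functionE hO hG C'0 GC)//.
  by rewrite /Num.min; case: ifP.
have := score_cos hGF F0F hN aN iN bl comp bG res tr J0' c t01 vE' KE.
rewrite card_test_set; congr (`|_ - _| <= _).
have ms : mfunT (fun z => cos (\sum_(i < k) a i * ((Num.sqrt m)^-1 * score N (clamped C lam) (clamped C' G) tr (test_set J) (t i) z) + c)).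
  apply: (measurableT_comp (continuous_measurable_fun (@continuous_cos R))); apply: measurable_funD => //.
  apply: measurable_sum => i; apply: measurable_funM => //; apply: measurable_funM => //.
  exact: (measurable_score hGF F0F hN aN bl bG mtr (test_set J) (t01 i)).
rewrite /Rintegral integral_distribution//; first exact/measurable_EFinP.
apply: (@L1_bounded _ _ _ P (fun w => cos (\sum_(i < k) a i * limit_path (t i) w + c)) 1); first exact: (measurableT_comp ms mZ).
by move=> w; rewrite ler_norml cos_geN1 cos_le1.
Qed.

Lemma limit_path_modulus (q : nat) (e : R) : (0 < q)%N -> C / q%:R <= 2^-1 -> 0 < e ->
  exists A, [/\ measurable A, fine (P A) <= (e ^+ 4)^-1 * (8 * C' ^+ 4 * 2593 * C / m + 3 * (C' ^+ 2 * C) ^+ 2 / q%:R) &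
   forall w, ~ A w -> forall i, (i < q)%N -> forall t, t \in `[i%:R / q%:R, i.+1%:R / q%:R] ->
     `|limit_path t w - limit_path (i%:R / q%:R) w| <= e].
Proof.
move=> q0 Cq e0; have := score_modulus hGF F0F hN aN iN bl comp bG res mtr tJ J0' q0 Cq e0.
by rewrite card_test_set => h; exact: on_sample h.
Qed.

Lemma limit_path_sup (B : R) : 0 < B ->
  exists A, [/\ measurable A, fine (P A) <= (B ^+ 2)^-1 * (C' ^+ 2 * C) &
   forall w, ~ A w -> forall t, t \in `[0, 1] -> `|limit_path t w| <= B].
Proof.
move=> B0; have := score_sup hGF F0F hN aN iN bl comp bG res mtr tJ J0' B0.
by rewrite card_test_set => h; exact: on_sample h.
Qed.

Variables (lamhat Ghat : estimator (R := R) (S := S) J).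
Hypothesis pl : predictable_estimator F lamhat.
Hypothesis pG : predictable_estimator (join_filtration F X) Ghat.
Hypothesis lhC : sup_bounded P C (evaluate lamhat Y Ynew).
Hypothesis GhC : sup_bounded P C' (evaluate Ghat Y Ynew).

(** The null set where the estimators differ from their clamped versions joins the exceptional set;
    outside it the path estimates for the sample tuple apply, and clamping has not increased the
    errors. *)
Lemma estimator_approx (g h e : R) (q : nat) : (0 < q)%N -> 0 < e ->
  (norm2 P (fun t w => G t (Ynew w) - evaluate Ghat Y Ynew t w)%R <= g%:E)%E ->
  (norm2 P (fun t w => lam t (Ynew w) - evaluate lamhat Y Ynew t w)%R <= h%:E)%E ->
  exists A, [/\ measurable A,
    fine (P A) <= (e ^+ 2)^-1 * (C * g ^+ 2) + e^-1 * (C' * h) + e^-1 * (Num.sqrt m * g * h) +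
      (e^-1 * (2 * C' * C * g) + q.+1%:R * ((m * e ^+ 2)^-1 * (C' ^+ 4 * (1 + counting_moment_bound C)))) &
    forall w, ~ A w ->
     [/\ cadlag (fun t => Num.sqrt m * gamma_hat N lamhat Ghat Y w t), cadlag (V_hat N Ghat Y w) &
      forall t, t \in `[0, 1] ->
       `|Num.sqrt m * gamma_hat N lamhat Ghat Y w t - limit_path t w| <= 3 * e /\
       `|V_hat N Ghat Y w t - variance_function Q N G t| <= 2 * e + C' ^+ 2 * C / q%:R]].
Proof.
move=> q0 e0 hg hh.
have [plam _ _] := hlam; have pres := residual_predictable hO hG.
have pGh := param_bpred_estimator hGF pG (ltW C'0); have plh := param_bpred_estimator hF pl (ltW C0).
pose Gh := clamped_estimator C' Ghat; pose lh := clamped_estimator C lamhat.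
have sg : Num.sqrt (g2 Q (clamped C' G) mu tr Gh) <= g.
  by rewrite -lee_fin; apply: le_trans hg; exact: (clamped_le_norm2 hiid hGF pG pres (ltW C'0)).
have sh : Num.sqrt (h2 Q (clamped C lam) mu tr lh) <= h.
  rewrite -lee_fin; apply: le_trans hh; rewrite /h2.
  under [X in param_mean _ _ _ X]eq_fun do under eq_fun do under eq_fun do rewrite -sqrrN opprB.
  exact: (clamped_le_norm2 hiid hF pl plam (ltW C0)).
have g20 : 0 <= g2 Q (clamped C' G) mu tr Gh by apply: Rint_ge0 => w; exact: sqr_ge0.
have gE : g2 Q (clamped C' G) mu tr Gh <= g ^+ 2.
  rewrite -[leLHS]sqr_sqrtr//; apply: lerXn2r (sg); rewrite nnegrE ?sqrtr_ge0// (le_trans _ sg)// sqrtr_ge0//.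
have g0 : 0 <= g := le_trans (sqrtr_ge0 _) sg.
have h0 : 0 <= h := le_trans (sqrtr_ge0 _) sh.
have m0 : 0 < m by rewrite ltr0n.
have := est_score_approx hGF hF F0F hN aN iN bl comp bG resG res mtr tJ J0' pGh plh e0.
rewrite card_test_set => /on_sample[A1 [mA1 PA1 H1]].
have := est_variance hGF F0F hN aN iN bl comp bG res mtr tJ J0' pGh q0 e0.
rewrite card_test_set => /on_sample[A2 [mA2 PA2 H2]].
have [A3 [mA3 PA3 sub3]] := estimators_clamped hiid hF hGF hN aN pl pG (ltW C0) (ltW C'0) lhC GhC.
have mA12 := measurableU _ _ mA1 mA2.
exists ((A1 `|` A2) `|` A3); split; first exact: measurableU.
  apply: (le_trans (prob_setU _ mA12 mA3)); rewrite PA3 addr0; apply: (le_trans (prob_setU _ mA1 mA2)).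
  have e1 : 0 <= e^-1 by rewrite invr_ge0 ltW.
  apply: lerD; first apply: (le_trans PA1); last apply: (le_trans PA2).
    apply: lerD; first apply: lerD.
    - by apply: ler_wpM2l; [rewrite invr_ge0 sqr_ge0|apply: ler_wpM2l gE; exact: ltW].
    - by apply: ler_wpM2l => //; apply: ler_wpM2l sh; exact: ltW.
    - apply: ler_wpM2l => //; apply: ler_pM => //; rewrite ?mulr_ge0 ?sqrtr_ge0//.
      by apply: ler_wpM2l sg; exact: sqrtr_ge0.
  by rewrite lerD2r; apply: ler_wpM2l => //; apply: ler_wpM2l sg; rewrite !mulr_ge0// ltW.
move=> w nA.
have n3 t : t \in `[0, 1] -> Num.sqrt m * gamma_hat N lamhat Ghat Y w t = (Num.sqrt m)^-1 * est_score N tr (test_set J) Gh lh t (Z w) /\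
    V_hat N Ghat Y w t = est_var N tr (test_set J) Gh t (Z w).
  move=> t01; have w3 : forall t, t \in `[0, 1] ->
    gamma_hat N lamhat Ghat Y w t = m^-1 * est_score N tr (test_set J) Gh lh t (Z w) /\
    V_hat N Ghat Y w t = est_var N tr (test_set J) Gh t (Z w).
    by apply: contrapT => nw; apply: nA; right; apply: sub3.
  have [-> ->] := w3 t t01; split=> //; rewrite mulrA; congr (_ * _).
  have sm : Num.sqrt m != 0 by rewrite gt_eqF// sqrtr_gt0.
  by rewrite -{2}(sqr_sqrtr (ltW m0)) expr2 invfM mulrA mulfV// mul1r.
split.
- apply: (cadlag_ext (fun t t01 => esym (n3 t t01).1)); apply: cadlagZ.
  exact: (est_score_cadlag N hF hGF pl pG (ltW C0) (ltW C'0) (Z w)).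
- apply: (cadlag_ext (fun t t01 => esym (n3 t t01).2)); exact: est_var_cadlag.
move=> t t01; have [-> ->] := n3 t t01; split.
  exact: H1 w (fun h => nA (or_introl (or_introl h))) t t01.
rewrite (variance_functionE hO hG C'0 GC)//.
exact: H2 w (fun h => nA (or_introl (or_intror h))) t t01.
Qed.

End one_sample.

Lemma ler_div_truncn {R : realType} (a b : R) (k : nat) : 0 < b -> (Num.truncn (a / b) < k)%N -> a / k%:R <= b.
Proof.
move=> b0 hk; have k0 : (0 : R) < k%:R by rewrite ltr0n (leq_trans _ hk).
rewrite ler_pdivrMr// mulrC -ler_pdivrMr//; apply: le_trans (ltW (truncnS_gt _)) _.
by rewrite ler_nat.
Qed.

(** The L2 errors are extended reals; a finite bound on their maximum yields real numbers that can
    enter the estimates. *)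
Lemma maxe_rates {R : realType} (x y : \bar R) (s e : R) : (0 <= x)%E -> (0 <= y)%E ->
  (maxe (maxe x y) (s%:E * x * y) <= e%:E)%E ->
  exists a b : R, [/\ (x <= a%:E)%E, (y <= b%:E)%E, 0 <= a <= e, 0 <= b <= e & s * a * b <= e].
Proof.
rewrite ge_max => x0 y0 /andP[]; rewrite ge_max => /andP[].
case: x x0 => [a||]// a0; case: y y0 => [b||]// b0; rewrite -?EFinM !lee_fin in a0 b0 * => ae be abe.
by exists a, b; split=> //; apply/andP.
Qed.

Theorem corollary4p8 (R : realType) (Theta : Type)
  (* the observable and its law, for each theta *)
  (d : Theta -> measure_display)
  (S : forall th, measurableType (d th))
  (Q : forall th, probability (S th) R)
  (F : forall th, R -> set (set (S th)))
  (N : forall th, S th -> cumulative R R)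
  (X : forall th, R -> S th -> R)
  (lam blam G : forall th, R -> S th -> R)
  (* the data Y 0, Y 1, ... and one additional copy Ynew *)
  (d' : Theta -> measure_display)
  (Om : forall th, measurableType (d' th))
  (P : forall th, probability (Om th) R)
  (Y : forall th, nat -> Om th -> S th)
  (Ynew : forall th, Om th -> S th)
  (* sample splits and estimators *)
  (J : forall n : nat, {set 'I_n})
  (lamhat Ghat : forall th n, estimator (S := S th) (J n))
  (* the functional and the limit *)
  (T : {uniform (@unitI R) -> R} -> {uniform (@unitI R) -> R} -> R)
  (d'' : Theta -> measure_display)
  (Om' : forall th, measurableType (d'' th))
  (P' : forall th, probability (Om' th) R)
  (U : forall th, R -> Om' th -> R)
  (C C' : R) :
  let Gfilt th := join_filtration (F th) (X th) in
  let V th := variance_function (Q th) (N th) (G th) in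
  let Theta0 := [set th | H0 (Q th) (F th) (N th) (X th) (lam th)] in
  let lamhat_new th n := evaluate (lamhat th n) (Y th) (Ynew th) in
  let Ghat_new th n := evaluate (Ghat th n) (Y th) (Ynew th) in
  let g th n :=
    norm2 (P th) (fun t w => G th t (Ynew th w) - Ghat_new th n t w) in
  let h th n :=
    norm2 (P th) (fun t w => lam th t (Ynew th w) - lamhat_new th n t w) in
  let D th n :=
    test_statistic (N th) (lamhat th n) (Ghat th n) (Y th) T in
  (forall th, observable (Q th) (F th) (N th) (X th)) ->
  (forall th, intensity (Q th) (F th) (N th) (lam th)) ->
  (forall th, intensity (Q th) (Gfilt th) (N th) (blam th)) ->
  (forall th, residual_process (Q th) (F th) (X th) (G th)) ->
  (forall th, iid (Q th) (P th) (oapp (Y th) (Ynew th))) ->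
  (forall th n, predictable_estimator (F th) (lamhat th n)) ->
  (forall th n, predictable_estimator (Gfilt th) (Ghat th n)) ->
  (* boundedness *)
  0 < C -> 0 < C' ->
  (forall th y, caglad (blam th ^~ y)) ->
  (forall th, {ae Q th, forall y,
     forall t, t \in `[0, 1] -> blam th t y <= C}) ->
  (forall th, sup_bounded (Q th) C' (G th)) ->
  (forall th n, sup_bounded (P th) C (lamhat_new th n)) ->
  (forall th n, sup_bounded (P th) C' (Ghat_new th n)) ->
  (* rates *)
  #|J n| @[n --> \oo] --> \oo ->
  (sup_nneg [set: Theta] (fun th => maxe (maxe (g th n) (h th n))
      ((Num.sqrt #|J n|%:R)%:E * g th n * h th n))%E @[n --> \oo] --> 0%E) ->
  (* the functional *)
  (forall p, (C01 `*` closure [set res01 (V th) | th in Theta0]) p ->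
     jointly_continuous_at T p) ->
  (* the limit *)
  (forall th, Theta0 th ->
     continuous_gaussian_martingale (P' th) (V th) (U th)) ->
  (forall th n, Theta0 th -> measurable_fun setT (D th n)) ->
  (forall th, Theta0 th -> measurable_fun setT
     (fun w => T (res01 ((U th) ^~ w)) (res01 (V th)))) ->
  (sup_nneg Theta0 (fun th => bl_dist (P th) (D th n) (P' th)
     (fun w => T (res01 ((U th) ^~ w)) (res01 (V th)))) @[n --> \oo] --> 0%E).
Proof.
move=> Gfilt V Theta0 lamhat_new Ghat_new g h D hO hlam hblam hG hiid pl pG C0 C'0 cb bC GC lC GhC hJ rates hT hU mD mD'.
pose L := C' ^+ 2 * C; have L0 : 0 < L by rewrite mulr_gt0// exprn_gt0.
have card (k : nat) : \forall n \near \oo, (k <= #|J n|)%N := hJ _ (nbhs_infty_ge k).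
have rate (e : R) : 0 < e -> \forall n \near \oo, forall th, exists a b : R,
    [/\ (g th n <= a%:E)%E, (h th n <= b%:E)%E, 0 <= a <= e, 0 <= b <= e & Num.sqrt #|J n|%:R * a * b <= e].
  move=> e0; move/fine_cvgP: rates => [fin /cvgrPdist_le/(_ e e0) lim].
  apply: filterS2 fin lim => n finn limn th.
  apply: maxe_rates; [exact: poweR_ge0|exact: poweR_ge0|].
  apply: (@le_trans _ _ (sup_nneg [set: Theta] (fun th => maxe (maxe (g th n) (h th n)) ((Num.sqrt #|J n|%:R)%:E * g th n * h th n)%E))).
    by apply: ereal_sup_ubound; right; exists th.
  by rewrite -(fineK finn) lee_fin; apply: le_trans limn; rewrite sub0r normrN ler_norm.
(* One [n] with a finite error is enough, the estimate being bounded. *)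
have ilam th : L1 (leb01 \x Q th)%E (restr_proc 1 (lam th)).
  have [n hn] := filter_ex (rate 1 ltr01); have [a [b [_ hh _ _ _]]] := hn th; have [plam _ _] := hlam th.
  exact: (L1_norm2 (hiid th) (observable_filtration (hO th)) (pl th n) plam (le_lt_trans hh (ltry _)) (lC th n)).
have VL th : Theta0 th -> forall s t, s \in `[0, 1] -> t \in `[0, 1] -> `|V th s - V th t| <= L * `|s - t|.
  move=> hth; exact: (variance_function_lipschitz (hO th) (hlam th) (hblam th) (hG th) C0 C'0 (bC th) (GC th) hth (ilam th)).
have V0 th : Theta0 th -> V th 0 = 0 by move=> _; exact: (variance_function0 (hO th) (hG th) C'0 (GC th)).
pose W th n := limit_path (N th) (lam th) (G th) C C' (Y th) (Ynew th) (J n).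
have mW n th t : Theta0 th -> t \in `[0, 1] -> mfunT (W th n t).
  by move=> hth t01; exact: (measurable_limit_path (hO th) (hlam th) (hG th) C0 C'0 (hiid th) (J n) t01).
apply: (@uniform_weak_convergence R Theta Theta0 _ _ Om Om' P P' W U mW _ _ V L L0 VL V0 T hT
  (fun th n w t => Num.sqrt #|J n|%:R * gamma_hat (N th) (lamhat th n) (Ghat th n) (Y th) w t)
  (fun th n w => V_hat (N th) (Ghat th n) (Y th) w)) => //.
- by move=> th t hth t01; exact: (gaussian_path_measurable (hU th hth) t01).
- move=> k a t c e t01 e0.
  pose K := k%:R ^+ 3 * \sum_(i < k) a i ^+ 4 * pow4_bound C C'.
  pose r := K + (1 + K) ^+ 2 + (1 + K).
  (* With at least (r / e)^2 test observations, r / sqrt m is at most [e]. *)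
  have big : \forall n \near \oo, ((Num.truncn ((r / e) ^+ 2)).+1 <= #|J n|)%N := card _.
  apply: filterS big => n hn th hth.
  have J0 : (0 < #|J n|)%N by exact: leq_trans hn.
  have := limit_path_cos (hO th) (hlam th) (hblam th) (hG th) C0 C'0 (bC th) (GC th) hth (ilam th) (hiid th) J0 c t01 erefl erefl.
  have [_ _ _ ->] := gaussian_lincomb_moments (hU th hth) a t01.
  move=> /(_ a)/le_trans; apply; rewrite -/K -/r.
  have m0 : 0 < #|J n|%:R :> R by rewrite ltr0n.
  have sm : 0 < Num.sqrt #|J n|%:R :> R by rewrite sqrtr_gt0.
  rewrite ler_pdivrMr// mulrC -ler_pdivrMr//; apply: le_trans (ler_norm _) _.
  rewrite -sqrtr_sqr ler_sqrt//; apply: le_trans (ltW (truncnS_gt _)) _.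
  by rewrite ler_nat.
- move=> e tau e0 tau0; have t2 : 0 < tau / 2 by rewrite divr_gt0.
  (* The first summand gives C / q <= 1 / 2, as the fourth moments on a block require; the second
     brings the 1 / q part of the modulus below tau / 2. The part in 1 / m is left to [n]. *)
  exists ((Num.truncn (2 * C)).+1 + (Num.truncn ((e ^+ 4)^-1 * (3 * L ^+ 2) / (tau / 2))).+1)%N => q hq.
  have q1 : ((Num.truncn (2 * C)).+1 <= q)%N by apply: leq_trans hq; rewrite leq_addr.
  have q2 : (Num.truncn ((e ^+ 4)^-1 * (3 * L ^+ 2) / (tau / 2)) < q)%N by apply: leq_trans hq; rewrite leq_addl.
  have q0 : (0 < q)%N by exact: leq_trans q1.
  have Cq : C / q%:R <= 2^-1.
    rewrite ler_pdivrMr ?ltr0n// -ler_pdivrMl ?invr_gt0// invrK; apply: le_trans (ltW (truncnS_gt _)) _.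
    by rewrite ler_nat.
  have big : \forall n \near \oo, ((Num.truncn ((e ^+ 4)^-1 * (8 * C' ^+ 4 * 2593 * C) / (tau / 2))).+1 <= #|J n|)%N := card _.
  apply: filterS big => n hn th hth; have J0 : (0 < #|J n|)%N by exact: leq_trans hn.
  have [A [mA PA HA]] := limit_path_modulus (hO th) (hlam th) (hblam th) (hG th) C0 C'0 (bC th) hth (ilam th) (hiid th) J0 q0 Cq e0.
  exists A; split=> //; apply: (le_trans PA); rewrite mulrDr !mulrA (splitr tau); apply: lerD.
    by have := ler_div_truncn t2 hn; rewrite !mulrA.
  by have := ler_div_truncn t2 q2; rewrite /L !mulrA.
- move=> tau tau0; pose B := 1 + L / tau.
  have B1 : 1 <= B by rewrite lerDl divr_ge0// ltW.
  have B0 : 0 < B by exact: lt_le_trans ltr01 B1.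
  exists B => //; apply: filterS (card 1) => n J0 th hth.
  have [A [mA PA HA]] := limit_path_sup (hO th) (hlam th) (hblam th) (hG th) C0 C'0 (bC th) hth (ilam th) (hiid th) J0 B0.
  exists A; split=> //; apply: (le_trans PA); rewrite mulrC ler_pdivrMr ?exprn_gt0// -ler_pdivrMl// mulrC.
  apply: (@le_trans _ _ B); first by rewrite /B lerDr.
  by rewrite expr2 ler_peMr// ltW.
- move=> e tau e0 tau0; have t2 : 0 < tau / 2 by rewrite divr_gt0.
  (* The path then costs 3 e1 <= e, and the variance 2 e1 + e / 2 = e. *)
  pose e1 := e / 4; have e10 : 0 < e1 by rewrite divr_gt0.
  have ie1 : 0 < e1^-1 by rewrite invr_gt0.
  have ie2 : 0 < (e1 ^+ 2)^-1 by rewrite invr_gt0 exprn_gt0.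
  pose q := (Num.truncn (L / (e / 2))).+1.
  have Lq : L / q%:R <= e / 2 by apply: ler_div_truncn; rewrite ?divr_gt0.
  pose a1 := (e1 ^+ 2)^-1 * C; pose a2 := e1^-1 * C'; pose a4 := e1^-1 * (2 * C' * C).
  have a10 : 0 < a1 by rewrite mulr_gt0.
  have a20 : 0 < a2 by rewrite mulr_gt0.
  have a40 : 0 < a4 by rewrite !mulr_gt0.
  pose A := a1 + a2 + e1^-1 + a4; have A0 : 0 < A by rewrite !addr_gt0.
  pose a5 := q.+1%:R * ((e1 ^+ 2)^-1 * (C' ^+ 4 * (1 + counting_moment_bound C))).
  (* With dl <= 1 the square of the error on G is also at most dl, so the four terms driven by the
     rates are linear in dl with total coefficient [A]; the remaining term, [a5] divided by m, is
     made small by the size of the test set. *)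
  pose dl := Num.min 1 (tau / 2 / A).
  have dl0 : 0 < dl by rewrite lt_min ltr01 divr_gt0.
  have dl1 : dl <= 1 by rewrite ge_min lexx.
  have dlA : A * dl <= tau / 2 by rewrite mulrC -ler_pdivlMr// ge_min lexx orbT.
  have big : \forall n \near \oo, ((Num.truncn (a5 / (tau / 2))).+1 <= #|J n|)%N := card _.
  apply: filterS2 (rate dl dl0) big => n rn hn th hth; have J0 : (0 < #|J n|)%N by exact: leq_trans hn.
  have [gr [hr [gE hE /andP[gr0 grd] /andP[hr0 hrd] ghd]]] := rn th.
  have [B [mB PB HB]] := estimator_approx (hO th) (hlam th) (hblam th) (hG th) C0 C'0 (bC th) (GC th) hth (ilam th) (hiid th) J0
    (pl th n) (pG th n) (lC th n) (GhC th n) (isT : (0 < q)%N) e10 gE hE.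
  exists B; split=> //; last first.
    move=> w nB; have [c1 c2 c3] := HB w nB; split=> // t t01; have [h1 h2] := c3 t t01; split.
      by apply: (le_trans h1); rewrite /e1; clear -e0; lra.
    by apply: (le_trans h2); rewrite /e1; move: Lq; rewrite /L; clear; lra.
  apply: (le_trans PB).
  have g2d : gr ^+ 2 <= dl by apply: le_trans (grd); rewrite expr2 ler_piMl//; exact: le_trans grd dl1.
  have b1 : (e1 ^+ 2)^-1 * (C * gr ^+ 2) <= a1 * dl by rewrite mulrA ler_pM2l.
  have b2 : e1^-1 * (C' * hr) <= a2 * dl by rewrite mulrA ler_pM2l.
  have b3 : e1^-1 * (Num.sqrt #|J n|%:R * gr * hr) <= e1^-1 * dl by rewrite ler_pM2l.
  have b4 : e1^-1 * (2 * C' * C * gr) <= a4 * dl by rewrite mulrA ler_pM2l.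
  have b5 : q.+1%:R * ((#|J n|%:R * e1 ^+ 2)^-1 * (C' ^+ 4 * (1 + counting_moment_bound C))) <= tau / 2.
    apply: le_trans (ler_div_truncn t2 hn); apply: le_of_eq.
    by rewrite /a5 invfM; ring.
  by move: dlA b1 b2 b3 b4 b5; rewrite /A; clear; lra.
- move=> tau tau0; have [B [q [B0 q0 H]]] := gaussian_tightness L0 tau0.
  exists B, q; split=> // th hth; apply: (H _ _ _ _ _ (hU th hth)); [exact: VL|exact: V0].
- by move=> n th hth; exact: mD.
Qed.
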